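(* Let $\Lambda\in\{\Lambda_0,\Lambda_1,\Lambda_2\}$ and let $\mathcal F(\Lambda)=\bigoplus_{Y\in\mathcal Z(\Lambda)}\mathbb Q(q)Y$ be the Fock space representation of $U_q(C_2^{(1)})$. Let $\mathcal L(\Lambda)=\bigoplus_{Y\in\mathcal Z(\Lambda)}\mathbb A_0Y$. Then the pair $(\mathcal L(\Lambda),\mathcal Z(\Lambda))$ is a crystal basis of $\mathcal F(\Lambda)$ (where $\mathcal Z(\Lambda)$ is identified with its image in $\mathcal L(\Lambda)/q\mathcal L(\Lambda)$), and the crystal of $\mathcal F(\Lambda)$ is isomorphic to the affine crystal $\mathcal Z(\Lambda)$ with the abstract maps $\mathrm{wt},\varepsilon_i,\varphi_i,\tilde E_i,\tilde F_i$ ($i\in I$) defined by $i$-signatures.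
   Context: QUANTUM AFFINE ALGEBRA. $I=\{0,1,2\}$; the Cartan matrix $A=(a_{ij})_{i,j\in I}$ has rows $(2,-1,0)$, $(-2,2,-2)$, $(0,-1,2)$. $P^\vee=\mathbb Zh_0\oplus\mathbb Zh_1\oplus\mathbb Zh_2\oplus\mathbb Zd$, $\mathfrak h=\mathbb Q\otimes_{\mathbb Z} P^\vee$; $\alpha_i,\Lambda_i\in\mathfrak h^*$ are defined by $\alpha_i(h_j)=a_{ji}$, $\alpha_i(d)=\delta_{0,i}$, $\Lambda_i(h_j)=\delta_{ij}$, $\Lambda_i(d)=0$. $\delta=\alpha_0+2\alpha_1+\alpha_2$ and $P=\mathbb Z\Lambda_0\oplus\mathbb Z\Lambda_1\oplus\mathbb Z\Lambda_2\oplus\mathbb Z\delta$. $q$ is an indeterminate, $q_0=q_2=q^2$, $q_1=q$, $K_i=q_i^{h_i}$ (so $K_0=q^{2h_0}$, $K_1=q^{h_1}$, $K_2=q^{2h_2}$), $[k]_i=(q_i^k-q_i^{-k})/(q_i-q_i^{-1})$, $[n]_i!=\prod_{k=1}^n[k]_i$, $e_i^{(n)}=e_i^n/[n]_i!$, $f_i^{(n)}=f_i^n/[n]_i!$. $U_q(C_2^{(1)})$ is the unital associative $\mathbb Q(q)$-algebra generated by $e_i,f_i$ ($i\in I$), $q^h$ ($h\in P^\vee$) with relations $q^0=1$, $q^hq^{h'}=q^{h+h'}$, $q^he_iq^{-h}=q^{\alpha_i(h)}e_i$, $q^hf_iq^{-h}=q^{-\alpha_i(h)}f_i$, $e_if_j-f_je_i=\delta_{ij}(K_i-K_i^{-1})/(q_i-q_i^{-1})$,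 and the $q$-Serre relations $\sum_{k=0}^{1-a_{ij}}(-1)^k e_i^{(1-a_{ij}-k)}e_je_i^{(k)}=0=\sum_{k=0}^{1-a_{ij}}(-1)^k f_i^{(1-a_{ij}-k)}f_jf_i^{(k)}$ for $i\ne j$. CRYSTAL BASES. Let $M$ be an integrable module: $M=\bigoplus_{\lambda\in P}M_\lambda$ with $M_\lambda=\{v:q^hv=q^{\lambda(h)}v\ \forall h\in P^\vee\}$, and for each $i$, $M$ is a direct sum of finite-dimensional irreducible modules over the subalgebra generated by $e_i,f_i,K_i^{\pm1}$. Any $v\in M_\lambda$ is uniquely $v=\sum_{k\ge0}f_i^{(k)}v_k$ with $v_k\in\ker e_i\cap M_{\lambda+k\alpha_i}$; the Kashiwara operators are $\tilde e_iv=\sum_{k\ge1}f_i^{(k-1)}v_k$, $\tilde f_iv=\sum_{k\ge0}f_i^{(k+1)}v_k$. $\mathbb A_0=\{f/g\in\mathbb Q(q): f,g\in\mathbb Q[q],\ g(0)\ne0\}$. A crystal basis of $M$ is a pair $(L,B)$ where: (i) $L$ is a free $\mathbb A_0$-submodule of $M$ with $M\cong\mathbb Q(q)\otimes_{\mathbb A_0}L$; (ii) $B$ is a $\mathbb Q$-basis of $L/qL$; (iii) $L=\bigoplus_\lambda L_\lambda$, $L_\lambda=L\cap M_\lambda$; (iv) $B=\bigsqcup_\lambda B_\lambda$, $B_\lambda=B\cap(L_\lambda/qL_\lambda)$; (v) $\tilde e_iL\subset L$, $\tilde f_iL\subset L$; (vi) $\tilde e_iB\subset B\cup\{0\}$,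 $\tilde f_iB\subset B\cup\{0\}$; (vii) for $b,b'\in B$, $\tilde f_ib=b'$ iff $b=\tilde e_ib'$. The crystal of $M$ is $B$ with the weight map, the induced operators $\tilde e_i,\tilde f_i$, and $\varepsilon_i(b)=\max\{k\ge0:\tilde e_i^kb\in B\}$, $\varphi_i(b)=\max\{k\ge0:\tilde f_i^kb\in B\}$. An affine crystal is a set $B$ with maps $\mathrm{wt}:B\to P$, $\varepsilon_i,\varphi_i:B\to\mathbb Z\cup\{-\infty\}$, $\tilde e_i,\tilde f_i:B\to B\cup\{0\}$ satisfying the usual axioms ($\varphi_i(b)=\varepsilon_i(b)+\langle h_i,\mathrm{wt}(b)\rangle$; $\tilde e_i$ and $\tilde f_i$ change $\mathrm{wt}$ by $+\alpha_i$, $-\alpha_i$, change $\varepsilon_i$ by $-1$, $+1$ and $\varphi_i$ by $+1$, $-1$ when nonzero; $\tilde f_ib=b'$ iff $\tilde e_ib'=b$; $\tilde e_ib=\tilde f_ib=0$ if $\varepsilon_i(b)=-\infty$). An isomorphism of crystals is a bijection compatible with all these maps. YOUNG WALLS. Fix $\Lambda\in\{\Lambda_0,\Lambda_1,\Lambda_2\}$. Columns are indexed by $k=0,1,2,\dots$ from right to left (column $k+1$ is immediately to the left of column $k$). Each column is a stack of unit cubes at levels $l=0,1,2,\dots$. A cube is either of type I: cut into a lower and an upper half, each a block of color $1$; or of type II: cut into a back and a front half, one a block of color $0$ and the other a block of color $2$. Every block has volume $1/2$. Pattern: for $\Lambda=\Lambda_0,\Lambda_2$ cubes at even levels are of type II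 and at odd levels of type I; for $\Lambda=\Lambda_1$ cubes at even levels are of type I and at odd levels of type II. For $\Lambda=\Lambda_0,\Lambda_1$ the type II cubes in column $k$ have back color $2$ and front color $0$ if $k$ is even, and back color $0$ and front color $2$ if $k$ is odd; for $\Lambda=\Lambda_2$ the colors $0$ and $2$ are interchanged. The ground state wall $Y_\Lambda$ consists, in every column, of the back block of the level-$0$ cube if $\Lambda=\Lambda_0,\Lambda_2$, and of the lower $1$-block of the level-$0$ cube if $\Lambda=\Lambda_1$. A Young wall on $Y_\Lambda$ is obtained by adding finitely many blocks to $Y_\Lambda$ so that: (1) an upper $1$-block is present only if the lower $1$-block of the same cube is, and a block of the cube at level $l+1$ is present only if both blocks of the cube at level $l$ in the same column are; (2) if a position (level and half) is occupied in column $k+1$, the same position is occupied in column $k$. A column is full if its volume is an integer. A Young wall is proper if no two full columns have the same height. $\mathcal Z(\Lambda)$ is the set of proper Young walls on $Y_\Lambda$. Write $Y=(y_k)_{k\ge0}=(\dots,y_2,y_1,y_0)$ by columns; $|y_k|$ is the number of blocks of $y_k$ added to $Y_\Lambda$. $\mathrm{wt}(Y)=\Lambda-\sum_i k_i\alpha_i$, $k_i$ the number of $i$-colored blocks added to $Y_\Lambda$. SIGNATURES AND ABSTRACT CRYSTAL. An $i$-block (not in $Y_\Lambda$) of $Y$ is a removable $i$-block if removing it gives a proper Young wall; an admissible $i$-slot is a place where adding an $i$-block gives a proper Young wall. A column is $i$-removable (resp. $i$-admissible) if it has a removable $i$-block (resp. an admissible $i$-slot); it is twice $i$-removable (resp.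 twice $i$-admissible) if one can remove (resp. add) an $i$-block in this column twice in succession, obtaining proper Young walls at each step. To column $y_k$ assign its $i$-signature: $--$ if twice $i$-removable; $-$ if once $i$-removable but not $i$-admissible; $-+$ if once $i$-removable and once $i$-admissible; $+$ if once $i$-admissible but not $i$-removable; $++$ if twice $i$-admissible; $\cdot$ otherwise. Reading columns from left to right and cancelling every $(+,-)$ pair gives the $i$-signature of $Y$, a finite sequence of $-$'s followed by $+$'s; $\varepsilon_i(Y)$ and $\varphi_i(Y)$ are its numbers of $-$'s and $+$'s. $\tilde E_iY$ is obtained by removing the $i$-block corresponding to the right-most $-$ of the $i$-signature ($0$ if there is no $-$); $\tilde F_iY$ is obtained by adding an $i$-block to the column corresponding to the left-most $+$ ($0$ if there is no $+$). With $\mathrm{wt},\varepsilon_i,\varphi_i,\tilde E_i,\tilde F_i$, $\mathcal Z(\Lambda)$ is an affine crystal (a known fact). A part of $Y$ is $Y'=(y_k)_{s\le k<t}$, $0\le s<t\le\infty$. The notions of removable blocks, admissible slots, signature, $\varepsilon_i$, $\varphi_i$ are extended to parts by considering the columns $y_k$, $s\le k<t$, in isolation (only blocks of these columns are added or removed, ground state blocks stay, and the Young wall and properness conditions are imposed only among these columns). ACTION ON $\mathcal F(\Lambda)$ (Fock space representation; an integrable module). $q^hY=q^{\langle h,\mathrm{wt}(Y)\rangle}Y$. Case $i=1$. $e_1Y=\sum_b q^{-R_1(b;Y)}\,(Y\nearrow b)$ over removable $1$-blocks $b$ of $Y$. If $b$ is in $y_k$ and $Z$ is $Y$ with $b$ removed: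 $Y\nearrow b=Z$ if the $1$-signature of $y_k$ is $--$, or is $-$ and there is another $1$-block directly beneath $b$; $Y\nearrow b=q^{-1}(1-(-q^2)^{l(b)+1})Z$ if the $1$-signature of $y_k$ is $-+$, or is $-$ and there is no $1$-block directly beneath $b$, where $l(b)=\#\{l<k:|y_l|=|y_k|\}$. $R_1(b;Y)=\varphi_1(Y_R(b))-\varepsilon_1(Y_R(b))$, where $Y_R(b)=(y_l,\dots,y_0)$ with $|y_k|=|y_{k-1}|=\dots=|y_{l+1}|<|y_l|$; $R_1(b;Y)=0$ if $k=0$ or no such $l$ exists. $f_1Y=\sum_b q^{L_1(b;Y)}\,(Y\swarrow b)$ over admissible $1$-slots $b$ of $Y$. If $b$ is in $y_k$ and $Z$ is $Y$ with a $1$-block added at $b$: $Y\swarrow b=Z$ if the $1$-signature of $y_k$ is $++$, or is $+$ and there is no $1$-block directly beneath $b$; $Y\swarrow b=q^{-1}(1-(-q^2)^{l(b)+1})Z$ if the $1$-signature of $y_k$ is $-+$, or is $+$ and there is a $1$-block directly beneath $b$, where $l(b)=\#\{l>k:|y_l|=|y_k|\}$. $L_1(b;Y)=\varphi_1(Y_L(b))-\varepsilon_1(Y_L(b))$, where $Y_L(b)=(\dots,y_{l+2},y_{l+1})$ with $|y_{l+1}|<|y_l|=|y_{l-1}|=\dots=|y_k|$. Convention: if $\Lambda=\Lambda_1$ and $|y_k|=0$ (so that $l(b)=\infty$ and no such $l$ exists), put $(-q^2)^{\infty}=0$ and $L_1(b;Y)=1$, so that the term of $b$ is $Z$ with coefficient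 $1$. Case $i=0,2$. $e_iY=\sum_b q^{-2R_i(b;Y)}(Y\nearrow b)$ over removable and virtually removable $i$-blocks $b$. For $b$ removable, $Y\nearrow b$ is $Y$ with $b$ removed. Virtually removable: let $y_{k+m},\dots,y_k$, $m\ge1$, be a maximal set of consecutive columns with the same $|y_\cdot|>0$ whose top cube is of type II and contains exactly one block (all back, or all front), such that the top block $b$ of the right-most column $y_k$ has color $i$; put $l(b)=m$. Let $Z$ be obtained from $Y$ by deleting the top block of the left-most column $y_{k+m}$ and, in each of $y_{k+m-1},\dots,y_k$, replacing the top block by the other half of the same cube (back by front, or front by back). If $Z$ is a proper Young wall, $b$ is virtually removable and $Y\nearrow b=(-q^2)^{l(b)}Z$. In either case ($b$ in $y_k$) $Y_R(b)=(y_{k-1},\dots,y_0)$, $R_i(b;Y)=\varphi_i(Y_R(b))-\varepsilon_i(Y_R(b))$ if $k\ge1$, and $R_i(b;Y)=0$ if $k=0$. $f_iY=\sum_b q^{2L_i(b;Y)}(Y\swarrow b)$ over admissible and virtually admissible $i$-slots $b$. For $b$ admissible, $Y\swarrow b$ is $Y$ with an $i$-block added at $b$. Virtually admissible: let $y_k,y_{k-1},\dots,y_{k-m}$, $m\ge1$, be a maximal set of consecutive columns with the same $|y_\cdot|>0$ whose top cube is of type II and contains exactly one block (all back, or all front), such that the empty half $b$ of the top cube of the left-most column $y_k$ has color $i$; put $l(b)=m$. Let $Z$ be obtained from $Y$ by replacing the top block by the other half of the same cube in each of $y_k,\dots,y_{k-m+1}$, and by filling the top cube of the right-most column $y_{k-m}$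 completely. If $Z$ is a proper Young wall, $b$ is virtually admissible and $Y\swarrow b=(-q^2)^{l(b)}Z$. In either case ($b$ in $y_k$) $Y_L(b)=(\dots,y_{k+2},y_{k+1})$ and $L_i(b;Y)=\varphi_i(Y_L(b))-\varepsilon_i(Y_L(b))$. *)

(* Defs.v *)
From HB Require Import structures.
From mathcomp Require Import all_boot all_order all_algebra fraction.
From mathcomp Require Import finmap monalg.
From mathcomp Require Import boolp classical_sets.
Set Implicit Arguments.
Unset Strict Implicit.
Unset Printing Implicit Defensive.
Import GRing.Theory.
Local Open Scope ring_scope.

Definition Kq : fieldType := {fraction {poly rat}}.
Definition q : Kq := tofrac ('X : {poly rat}).

Definition A0 : set Kq :=
  [set x | exists f g : {poly rat}, g.[0] != 0 /\ x = tofrac f / tofrac g].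

Notation I := 'I_3.
Definition i0 : I := @Ordinal 3 0 isT.
Definition i1 : I := @Ordinal 3 1 isT.
Definition i2 : I := @Ordinal 3 2 isT.

Definition cartan (i j : I) : int :=
  nth 0 (nth [::] [:: [::  2; -1;  0];
                      [:: -2;  2; -2];
                      [::  0; -1;  2]] i) j.

(* q_i = q ^ (di i) *)
Definition di (i : I) : int := if i == i1 then 1 else 2.
Definition qi (i : I) : Kq := q ^ di i.

(* Elements of P^vee are given by their coordinates on h_0, h_1, h_2 and d,
   elements of P by their coordinates on Lambda_0, Lambda_1, Lambda_2 and
   delta; these are dual bases, since delta(h_j) = 0 and delta(d) = 1. *)
Definition coweight : zmodType := ({ffun I -> int} * int)%type.
Definition weight : zmodType := ({ffun I -> int} * int)%type.

Definition pairing (h : coweight) (la : weight) : int :=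
  \sum_(j : I) h.1 j * la.1 j + h.2 * la.2.

Definition hcheck (i : I) : coweight := ([ffun j => (j == i)%:R], 0).
Definition Lambda (i : I) : weight := ([ffun j => (j == i)%:R], 0).
(* alpha_i(h_j) = a_ji and alpha_i(d) = [i = 0] *)
Definition alpha (i : I) : weight := ([ffun j => cartan j i], (i == i0)%:R).

Definition qint (i : I) (k : nat) : Kq :=
  (qi i ^ k%:Z - qi i ^ (- k%:Z)) / (qi i - (qi i)^-1).
Definition qfact (i : I) (n : nat) : Kq := \prod_(1 <= k < n.+1) qint i k.

Section LinearAlgebra.
Variables (R : nzRingType) (V : lmodType R).

Definition direct_sum (J : eqType) (S : set V) (F : J -> set V) : Prop :=
  [/\ forall j v, F j v -> S v,
      forall v, S v -> exists (s : seq J) (x : J -> V),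
        [/\ uniq s, forall j, j \in s -> F j (x j) & v = \sum_(j <- s) x j]
    & forall (s : seq J) (x : J -> V), uniq s ->
        (forall j, j \in s -> F j (x j)) -> \sum_(j <- s) x j = 0 ->
        forall j, j \in s -> x j = 0].

Definition is_basis (C : set R) (S : set V) (J : eqType) (b : J -> V) : Prop :=
  [/\ forall j, S (b j),
      forall v, S v -> exists (s : seq J) (c : J -> R),
        [/\ uniq s, forall j, j \in s -> C (c j)
          & v = \sum_(j <- s) c j *: b j]
    & forall (s : seq J) (c : J -> R), uniq s ->
        (forall j, j \in s -> C (c j)) -> \sum_(j <- s) c j *: b j = 0 ->
        forall j, j \in s -> c j = 0].

Definition submodule_over (C : set R) (S : set V) : Prop :=
  [/\ S 0, forall u v, S u -> S v -> S (u + v)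
    & forall c v, C c -> S v -> S (c *: v)].

Definition findim (S : set V) : Prop :=
  exists s : seq V, forall v, S v ->
    exists c : nat -> R, v = \sum_(k < size s) c k *: s`_k.

End LinearAlgebra.

Definition divpow (V : lmodType Kq) (T : V -> V) (i : I) (n : nat) (v : V) : V :=
  (qfact i n)^-1 *: iter n T v.

Definition serre_exp (i j : I) : nat := `|1 - cartan i j|%N.

Record Uq_rep (V : lmodType Kq) := UqRep {
  rep_e : I -> {linear V -> V};
  rep_f : I -> {linear V -> V};
  rep_q : coweight -> {linear V -> V};
  rep_q0 : forall v, rep_q 0 v = v;
  rep_qD : forall h h' v, rep_q h (rep_q h' v) = rep_q (h + h') v;
  rep_qe : forall h i v,
    rep_q h (rep_e i (rep_q (- h) v)) = q ^ pairing h (alpha i) *: rep_e i v;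
  rep_qf : forall h i v,
    rep_q h (rep_f i (rep_q (- h) v)) = q ^ (- pairing h (alpha i)) *: rep_f i v;
  (* K_i = q^{di i h_i} *)
  rep_ef : forall i j v,
    rep_e i (rep_f j v) - rep_f j (rep_e i v) =
      if i == j then (qi i - (qi i)^-1)^-1 *:
        (rep_q (hcheck i *~ di i) v - rep_q (- (hcheck i *~ di i)) v)
      else 0;
  rep_serre_e : forall i j, i != j -> forall v,
    \sum_(k < (serre_exp i j).+1) (-1) ^+ k *:
       divpow (rep_e i) i (serre_exp i j - k)
         (rep_e j (divpow (rep_e i) i k v)) = 0;
  rep_serre_f : forall i j, i != j -> forall v,
    \sum_(k < (serre_exp i j).+1) (-1) ^+ k *:
       divpow (rep_f i) i (serre_exp i j - k)
         (rep_f j (divpow (rep_f i) i k v)) = 0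
}.

Section CrystalBases.
Variables (M : lmodType Kq) (rho : Uq_rep M).

Local Notation e := (rep_e rho).
Local Notation f := (rep_f rho).
Local Notation qh := (rep_q rho).

Definition wspace (la : weight) : set M :=
  [set v | forall h, qh h v = q ^ pairing h la *: v].

Definition sub_i_module (i : I) (S : set M) : Prop :=
  submodule_over setT S /\
  forall v, S v -> [/\ S (e i v), S (f i v),
    S (qh (hcheck i *~ di i) v) & S (qh (- (hcheck i *~ di i)) v)].

Definition irreducible_i (i : I) (S : set M) : Prop :=
  [/\ sub_i_module i S, exists2 v, S v & v <> 0
    & forall T : set M, sub_i_module i T -> (forall v, T v -> S v) ->
        (forall v, T v -> v = 0) \/ (forall v, S v -> T v)].

Definition integrable : Prop :=
  direct_sum setT wspace /\
  forall i, exists (J : eqType) (S : J -> set M),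
    (forall j, irreducible_i i (S j) /\ findim (S j)) /\ direct_sum setT S.

(* v = sum_(k < n) f_i^(k) x_k is the decomposition defining the Kashiwara
   operators on M_la. Some x_k <> 0 in ker e_i may have f_i^(k) x_k = 0; the
   decomposition is unique only if such terms are excluded, which is the
   usual restriction k <= <h_i, la + k alpha_i>. *)
Definition string_decomp (i : I) (la : weight) (v : M) (n : nat)
    (x : nat -> M) : Prop :=
  (forall k, (k < n)%N ->
     [/\ e i (x k) = 0, wspace (la + alpha i *+ k) (x k)
       & divpow (f i) i k (x k) = 0 -> x k = 0]) /\
  v = \sum_(0 <= k < n) divpow (f i) i k (x k).

(* Graphs of the Kashiwara operators, extended linearly from the weight spaces
   to M. They are graphs of linear maps when M is integrable. *)
Definition kash_e_graph (i : I) (v w : M) : Prop :=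
  exists (s : seq weight) (n : weight -> nat) (y : weight -> M)
         (x : weight -> nat -> M),
    [/\ uniq s,
        forall la, la \in s -> wspace la (y la) /\
          string_decomp i la (y la) (n la) (x la),
        v = \sum_(la <- s) y la
      & w = \sum_(la <- s) \sum_(1 <= k < n la) divpow (f i) i k.-1 (x la k)].

Definition kash_f_graph (i : I) (v w : M) : Prop :=
  exists (s : seq weight) (n : weight -> nat) (y : weight -> M)
         (x : weight -> nat -> M),
    [/\ uniq s,
        forall la, la \in s -> wspace la (y la) /\
          string_decomp i la (y la) (n la) (x la),
        v = \sum_(la <- s) y la
      & w = \sum_(la <- s) \sum_(0 <= k < n la) divpow (f i) i k.+1 (x la k)].

Definition kash_e (i : I) (v : M) : M := xget 0 (kash_e_graph i v).
Definition kash_f (i : I) (v : M) : M := xget 0 (kash_f_graph i v).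

(* Elements of L / qL are represented by the cosets v + qL (v in L), as sets;
   coset L 0 is the zero of L / qL. *)
Definition coset (L : set M) (v : M) : set M :=
  [set w | exists2 u, L u & w = v + q *: u].

(* the operator induced on L / qL by an operator T preserving L and qL *)
Definition induced (L : set M) (T : M -> M) (b : set M) : set M :=
  [set w | exists2 v, b v & coset L (T v) w].

Definition rat_basis_mod_q (L : set M) (B : set (set M)) : Prop :=
  [/\ forall b, B b -> exists2 v, L v & b = coset L v,
      forall v, L v -> exists (n : nat) (u : 'I_n -> M) (c : 'I_n -> rat),
        (forall j, L (u j) /\ B (coset L (u j))) /\
        coset L v = coset L (\sum_(j < n) ratr (c j) *: u j)
    & forall (n : nat) (u : 'I_n -> M) (c : 'I_n -> rat),
        (forall j, L (u j) /\ B (coset L (u j))) ->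
        injective (fun j => coset L (u j)) ->
        coset L (\sum_(j < n) ratr (c j) *: u j) = coset L 0 ->
        forall j, c j = 0].

(* b lies in L_la / q L_la, where L_la is the intersection of L and M_la *)
Definition coset_weight (L : set M) (la : weight) (b : set M) : Prop :=
  exists v, [/\ L v, wspace la v & b = coset L v].

Record crystal_basis (L : set M) (B : set (set M)) : Prop := CrystalBasis {
  (* an A0-basis of L which is also a Kq-basis of M: this says that L is free
     and that the canonical map from Kq (x)_A0 L to M is bijective *)
  cb_lattice : submodule_over A0 L /\
    exists (J : eqType) (b : J -> M), is_basis A0 L b /\ is_basis setT setT b;
  cb_basis : rat_basis_mod_q L B;
  cb_lattice_weight : direct_sum L (fun la : weight => L `&` wspace la)%classic;
  cb_basis_weight : forall b, B b -> exists! la, coset_weight L la b;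
  cb_lattice_e : forall i v, L v -> L (kash_e i v);
  cb_lattice_f : forall i v, L v -> L (kash_f i v);
  cb_basis_e : forall i b, B b ->
    B (induced L (kash_e i) b) \/ induced L (kash_e i) b = coset L 0;
  cb_basis_f : forall i b, B b ->
    B (induced L (kash_f i) b) \/ induced L (kash_f i) b = coset L 0;
  cb_inverse : forall i b b', B b -> B b' ->
    (induced L (kash_f i) b = b' <-> b = induced L (kash_e i) b')
}.

End CrystalBases.

(* The value None stands for -oo in ceps, cphi and for 0 in ce, cf. *)
Record crystal := Crystal {
  csort :> Type;
  cwt : csort -> weight;
  ceps : I -> csort -> option int;
  cphi : I -> csort -> option int;
  ce : I -> csort -> option csort;
  cf : I -> csort -> option csort
}.

Record affine_crystal (C : crystal) : Prop := AffineCrystal {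
  ac_phi : forall i (b : C),
    cphi i b = omap (fun n => n + pairing (hcheck i) (cwt b)) (ceps i b);
  ac_e : forall i (b b' : C), ce i b = Some b' ->
    [/\ cwt b' = cwt b + alpha i, ceps i b' = omap (fun n => n - 1) (ceps i b)
      & cphi i b' = omap (fun n => n + 1) (cphi i b)];
  ac_f : forall i (b b' : C), cf i b = Some b' ->
    [/\ cwt b' = cwt b - alpha i, ceps i b' = omap (fun n => n + 1) (ceps i b)
      & cphi i b' = omap (fun n => n - 1) (cphi i b)];
  ac_inverse : forall i (b b' : C), cf i b = Some b' <-> ce i b' = Some b;
  ac_infty : forall i (b : C), ceps i b = None ->
    ce i b = None /\ cf i b = None
}.

Definition crystal_isomorphic (C D : crystal) : Prop :=
  exists theta : C -> D, bijective theta /\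
    forall b : C, cwt (theta b) = cwt b /\ forall i,
      [/\ ceps i (theta b) = ceps i b, cphi i (theta b) = cphi i b,
          ce i (theta b) = omap theta (ce i b)
        & cf i (theta b) = omap theta (cf i b)].

Section CrystalOf.
Variables (M : lmodType Kq) (rho : Uq_rep M) (L : set M) (B : set (set M)).

Definition cosets_in : Type := {b : set M | B b}.

Definition to_cosets_in (b : set M) : option cosets_in :=
  if pselect (B b) is left Bb then Some (exist _ b Bb) else None.

Definition is_max (P : nat -> Prop) : set nat :=
  [set k | P k /\ forall l, P l -> (l <= k)%N].

Definition string_length (T : set M -> set M) (b : cosets_in) : nat :=
  xget 0%N (is_max (fun k => B (iter k T (sval b)))).

Definition crystal_of : crystal := {|
  csort := cosets_in;
  cwt b := xget 0 [set la | coset_weight rho L la (sval b)];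
  ceps i b := Some (string_length (induced L (kash_e rho i)) b)%:Z;
  cphi i b := Some (string_length (induced L (kash_f rho i)) b)%:Z;
  ce i b := to_cosets_in (induced L (kash_e rho i) (sval b));
  cf i b := to_cosets_in (induced L (kash_f rho i) (sval b))
|}.

End CrystalOf.

(* A block is (column, level, half); half = false is the lower half of a cube
   of type I or the back half of a cube of type II. *)
Definition block : Type := (nat * nat * bool)%type.
Definition col (b : block) : nat := b.1.1.
Definition level (b : block) : nat := b.1.2.
Definition half (b : block) : bool := b.2.

(* For each Lambda, the ground state wall consists of the blocks (k, 0, false);
   a wall is given by the set of the blocks added to it. *)
Definition ground (b : block) : bool := (level b == 0%N) && ~~ half b.

Definition occupied (A : {fset block}) (b : block) : bool :=
  ground b || (b \in A).

(* |y_k| *)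
Definition added (A : {fset block}) (k : nat) : nat :=
  count (fun b => col b == k) A.

(* The number of blocks of a column is twice its volume. A full column has no
   half-filled cube, so that its height is its volume. *)
Definition full (A : {fset block}) (k : nat) : bool := ~~ odd (added A k).+1.

(* all columns with index >= ncols A are ground state columns *)
Definition ncols (A : {fset block}) : nat := \max_(b <- A) (col b).+1.

(* (s, Some t) is the range of columns s <= k < t, (s, None) is s <= k < oo *)
Definition col_range : Type := (nat * option nat)%type.
Definition whole : col_range := (0%N, None).
Definition in_range (p : col_range) (k : nat) : bool :=
  (p.1 <= k)%N && (if p.2 is Some t then (k < t)%N else true).

Definition part (p : col_range) (A : {fset block}) : {fset block} :=
  [fset b in A | in_range p (col b)]%fset.

Section YoungWalls.
(* the ground state wall is that of Lambda_lam *)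
Variable lam : I.

Definition typeI (l : nat) : bool := odd l (+) (lam == i1).

Definition color (b : block) : I :=
  if typeI (level b) then i1
  else if odd (col b) (+) half b (+) (lam == i2) then i0 else i2.

(* The conditions are imposed on and among the columns of the range p only. *)
Definition young_wall (p : col_range) (A : {fset block}) : bool :=
  all (fun b : block => let: (k, l, h) := b in
    [&& in_range p k, ~~ ground b,
        typeI l && h ==> occupied A (k, l, false),
        (0 < l)%N ==> occupied A (k, l.-1, false) && occupied A (k, l.-1, true)
      & (p.1 < k)%N ==> occupied A (k.-1, l, h)]) A.

Definition proper (p : col_range) (A : {fset block}) : bool :=
  young_wall p A &&
  all (fun b => all (fun b' =>
    [&& col b != col b', full A (col b) & full A (col b')]
      ==> (added A (col b) != added A (col b'))) A) A.

Section Signature.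
Variables (i : I) (p : col_range).

Definition removable (A : {fset block}) (k : nat) : seq block :=
  [seq b <- A | [&& col b == k, color b == i & proper p (A `\ b)%fset]].

(* a slot satisfying (1) has level at most |y_k| + 1 *)
Definition admissible (A : {fset block}) (k : nat) : seq block :=
  [seq b <- [seq (k, l, h) | l <- iota 0 (added A k).+2, h <- [:: false; true]]
     | [&& ~~ occupied A b, color b == i & proper p (b |` A)%fset]].

Definition is_removable (A : {fset block}) (k : nat) : bool :=
  removable A k != [::].
Definition is_admissible (A : {fset block}) (k : nat) : bool :=
  admissible A k != [::].
Definition twice_removable (A : {fset block}) (k : nat) : bool :=
  has (fun b => is_removable (A `\ b)%fset k) (removable A k).
Definition twice_admissible (A : {fset block}) (k : nat) : bool :=
  has (fun b => is_admissible (b |` A)%fset k) (admissible A k).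

(* signs are booleans: true is +, false is - *)
Definition column_signature (A : {fset block}) (k : nat) : seq bool :=
  if twice_removable A k then [:: false; false]
  else if twice_admissible A k then [:: true; true]
  else if is_removable A k && is_admissible A k then [:: false; true]
  else if is_removable A k then [:: false]
  else if is_admissible A k then [:: true]
  else [::].

(* Column indices from left to right. Columns further to the left are ground
   state columns with a ground state column to their right in the range: their
   signature is empty. *)
Definition columns (A : {fset block}) : seq nat :=
  let n := (maxn p.1 (ncols A)).+1 in
  rev (iota p.1 ((if p.2 is Some t then minn t n else n) - p.1)).

Definition signs (A : {fset block}) : seq (bool * nat) :=
  [seq (s, k) | k <- columns A, s <- column_signature A k].

(* Cancellation of the pairs (+,-), reading from left to right: ms are the
   columns of the - seen so far, the last one first, and ps the columns of the
   uncancelled + seen so far, the last one first. *)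
Fixpoint cancel_signs (w : seq (bool * nat)) (ms ps : seq nat)
    : seq nat * seq nat :=
  match w with
  | [::] => (rev ms, rev ps)
  | (true, k) :: w' => cancel_signs w' ms (k :: ps)
  | (false, k) :: w' =>
      if ps is _ :: ps' then cancel_signs w' ms ps'
      else cancel_signs w' (k :: ms) ps
  end.

(* columns of the - and of the + of the i-signature, from left to right *)
Definition signature (A : {fset block}) : seq nat * seq nat :=
  cancel_signs (signs (part p A)) [::] [::].

Definition eps (A : {fset block}) : nat := size (signature A).1.
Definition phi (A : {fset block}) : nat := size (signature A).2.
Definition phi_eps (A : {fset block}) : int := (phi A)%:Z - (eps A)%:Z.

End Signature.

Definition walls : choiceType := {A : {fset block} | proper whole A}.

Definition wall_wt (A : {fset block}) : weight :=
  Lambda lam - \sum_(i : I) alpha i *+ count (fun b => color b == i) A.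

Definition Etilde (i : I) (Y : walls) : option walls :=
  let A := val Y in
  obind (fun k => obind (fun b => insub (A `\ b)%fset)
                        (ohead (removable i whole A k)))
        (ohead (rev (signature i whole A).1)).

Definition Ftilde (i : I) (Y : walls) : option walls :=
  let A := val Y in
  obind (fun k => obind (fun b => insub (b |` A)%fset)
                        (ohead (admissible i whole A k)))
        (ohead (signature i whole A).2).

Definition wall_crystal : crystal := {|
  csort := walls;
  cwt Y := wall_wt (val Y);
  ceps i Y := Some (eps i whole (val Y))%:Z;
  cphi i Y := Some (phi i whole (val Y))%:Z;
  ce := Etilde;
  cf := Ftilde
|}.

Definition fock : lmodType Kq := {malg Kq[walls]}.

Definition vec (Y : walls) : fock := << Y >>%R.

(* the wall Z as a vector, 0 if Z is not a proper Young wall *)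
Definition vec_of (Z : {fset block}) : fock := oapp vec 0 (insub Z).

(* By (2), |y_k| is a nonincreasing function of k, so the columns with the same
   |y| as y_k are consecutive. These are their numbers to the right and to the
   left of y_k; the second one is used for |y_k| > 0 only. *)
Definition nright (A : {fset block}) (k : nat) : nat :=
  count (fun l => added A l == added A k) (iota 0 k).
Definition nleft (A : {fset block}) (k : nat) : nat :=
  count (fun l => added A l == added A k) (iota k.+1 (ncols A - k.+1)).

Definition coef1 (l : nat) : Kq := q^-1 * (1 - (- q ^+ 2) ^+ l.+1).

(* For i = 1 there is a 1-block directly beneath b iff b is an upper half. *)
Definition fock_e1 (A : {fset block}) : fock :=
  \sum_(0 <= k < ncols A) \sum_(b <- removable i1 whole A k)
    let sg := column_signature i1 whole A k in
    let c := if (sg == [:: false; false]) || ((sg == [:: false]) && half b)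
             then 1 else coef1 (nright A k) in
    let R1 := phi_eps i1 (0%N, Some (k - nright A k)%N) A in
    (q ^ (- R1) * c) *: vec_of (A `\ b)%fset.

Definition fock_f1 (A : {fset block}) : fock :=
  \sum_(0 <= k < (ncols A).+1) \sum_(b <- admissible i1 whole A k)
    let sg := column_signature i1 whole A k in
    let c := if (sg == [:: true; true]) || ((sg == [:: true]) && ~~ half b)
             then 1 else coef1 (nleft A k) in
    let L1 := phi_eps i1 ((k + nleft A k)%N.+1, None) A in
    (* for |y_k| = 0 this is the convention for l(b) = oo *)
    (if added A k == 0%N then 1 else q ^ L1 * c) *: vec_of (b |` A)%fset.

(* If the top cube of column k is of type II and contains exactly one block,
   its level and the half which is present. *)
Definition half_top (A : {fset block}) (k : nat) : option (nat * bool) :=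
  let n := (added A k).+1 in
  if odd n && ~~ typeI n./2 then Some (n./2, occupied A (k, n./2, true))
  else None.

(* The numbers l(b) = m and the walls Z of the virtually removable i-blocks and
   of the virtually admissible i-slots b in column k (at most one), whether or
   not Z is proper. By (2), the top blocks in a maximal set of consecutive
   columns as in half_top, with the same |y|, are all back or all front. *)
Definition virtual_e (i : I) (A : {fset block}) (k : nat)
    : option (nat * {fset block}) :=
  if half_top A k is Some (l, h) then
    let m := nleft A k in
    if [&& (0 < added A k)%N, nright A k == 0%N, (0 < m)%N
         & color (k, l, h) == i]
    then Some (m,
      (A `\` [fset ((j, l, h) : block) | j in iota k m.+1])
        `|` [fset ((j, l, ~~ h) : block) | j in iota k m])%fset
    else None
  else None.

Definition virtual_f (i : I) (A : {fset block}) (k : nat)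
    : option (nat * {fset block}) :=
  if half_top A k is Some (l, h) then
    let m := nright A k in
    if [&& (0 < added A k)%N, nleft A k == 0%N, (0 < m)%N
         & color (k, l, ~~ h) == i]
    then Some (m,
      (A `\` [fset ((j, l, h) : block) | j in iota (k - m).+1 m])
        `|` [fset ((j, l, ~~ h) : block) | j in iota (k - m) m.+1])%fset
    else None
  else None.

(* the term of the virtual block or slot; it is 0 if Z is not proper *)
Definition virtual_term (o : option (nat * {fset block})) : fock :=
  if o is Some (m, Z) then (- q ^+ 2) ^+ m *: vec_of Z else 0.

Definition fock_e02 (i : I) (A : {fset block}) : fock :=
  \sum_(0 <= k < ncols A)
    q ^ (- 2 * phi_eps i (0%N, Some k) A) *:
      (\sum_(b <- removable i whole A k) vec_of (A `\ b)%fset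
       + virtual_term (virtual_e i A k)).

Definition fock_f02 (i : I) (A : {fset block}) : fock :=
  \sum_(0 <= k < (ncols A).+1)
    q ^ (2 * phi_eps i (k.+1, None) A) *:
      (\sum_(b <- admissible i whole A k) vec_of (b |` A)%fset
       + virtual_term (virtual_f i A k)).

Definition fock_e (i : I) (Y : walls) : fock :=
  if i == i1 then fock_e1 (val Y) else fock_e02 i (val Y).
Definition fock_f (i : I) (Y : walls) : fock :=
  if i == i1 then fock_f1 (val Y) else fock_f02 i (val Y).

Definition is_fock_rep (rho : Uq_rep fock) : Prop :=
  forall Y : walls,
    [/\ forall h, rep_q rho h (vec Y) = q ^ pairing h (wall_wt (val Y)) *: vec Y,
        forall i, rep_e rho i (vec Y) = fock_e i Y
      & forall i, rep_f rho i (vec Y) = fock_f i Y].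

Definition fock_lattice : set fock := [set v | forall Y : walls, A0 (mcoeff Y v)].

Definition fock_basis : set (set fock) :=
  [set b | exists Y : walls, b = coset fock_lattice (vec Y)].

End YoungWalls.

Arguments fock_lattice : clear implicits.
Arguments fock_basis : clear implicits.

(* Main.v *)
Require Import Defs.
From HB Require Import structures.
From mathcomp Require Import all_boot all_order all_algebra perm fraction.
From mathcomp Require Import finmap monalg boolp classical_sets.
From mathcomp Require Import zify ring.
Import Defs.
Set Implicit Arguments.
Unset Strict Implicit.
Unset Printing Implicit Defensive.
Import Order.TTheory GRing.Theory Num.Theory.
Local Open Scope ring_scope.

(** Fix a color i. The f_i-string structure of the Fock space can be read off
    from the rows of the walls. At each level the blocks form two rows, one for
    each half, and a wall is determined by the lengths of its rows. The levels
    that carry blocks of color i are separated by levels that do not, and once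
    the rows of the latter are fixed, the condition that a wall be proper
    becomes independent conditions on the pairs of rows at the former. Each
    of these pairs has at most eight values. They span a representation of the
    quantum sl2 attached to i that splits into trivial modules, copies of the
    two-dimensional module V and copies of V tensor V; in one degenerate case
    only the three-dimensional summand of V tensor V occurs. The signs in the
    i-signature are the letters of the corresponding pure tensors, so the span
    of all walls with prescribed rows at the other levels is a sum of tensor
    powers of V (up to the degenerate case), and Kashiwara's tensor product
    rule is the cancellation of signs.

    The walls themselves are not the pure tensors: the virtual slots and the
    coefficients that depend on equal columns are the effect of a change of
    basis. It is made explicit at one level by [pure_vector], it is congruent
    to the identity modulo q, and [equiv_all] says that it turns the action of
    f at a level into the coproduct action on words. The tensor product over
    the levels is [tensor], where [tensor_act] collects the local statements,
    and [action_1] and [action_02] compare the two cases of the definition of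
    f_i with this tensor product; the powers of q in that definition are the
    weights of the levels to the left of the slot ([phi_eps_prefix]).

    In a tensor power of V the exact strings of f are constructed by adding one
    letter at a time ([strv], [f_strv]), by the decomposition of V(m) tensor V
    into V(m+1) and V(m-1). The string vector of a word is congruent modulo q
    to its pure tensor, and f multiplies it by a quantum integer and moves it
    as the signature rule prescribes ([add_spec], [Ftilde_some]). This gives
    for every wall Y a vector congruent to Y modulo q, on which f_i acts as on
    an exact string.

    The rest holds in general. The action of e_i is not needed in explicit
    form: it is determined by that of f_i, because a vector of weight n that is
    killed by the (n+1)-st power of f is a highest weight vector
    ([killed_by_e], [e_sv]). As the weight spaces of the Fock space are finite
    dimensional ([finite_weight]), the string vectors form a basis of the
    lattice, and the Kashiwara operators move them along the strings
    ([kashiwara_operators]). Modulo q the string vectors are the walls, so the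
    lattice with the walls is a crystal basis whose crystal is given by the
    signature rule ([string_crystal_basis], [string_crystal_isomorphic]). *)

(** * The local ring of rational functions regular at zero *)

Section FieldIdentities.
Variable F : fieldType.
Implicit Types x y a b : F.

Lemma frac_sub a b x y : b != 0 -> y != 0 -> a / b - x / y = (a * y - x * b) / (b * y).
Proof. by move=> b0 y0; field; rewrite b0 y0. Qed.

Lemma frac_neq0 a b : a != 0 -> b != 0 -> a / b != 0.
Proof. by move=> a0 b0; rewrite mulf_neq0 ?invr_eq0. Qed.

Lemma mul_sub1 x y : x * y - 1 = (x - 1) * y + (y - 1).
Proof. by ring. Qed.

Lemma inv_sub1 x a b h : b != 0 -> h != 0 -> b = h - x * a -> (h / b)^-1 - 1 = x * - (a / h).
Proof. by move=> b0 h0 e; rewrite invf_div e; field. Qed.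

Lemma add1_frac x a b : b != 0 -> x * (a / b) + 1 = (b + x * a) / b.
Proof. by move=> b0; field. Qed.

Lemma frac_subr a b c : b != 0 -> a / b - c = (a - c * b) / b.
Proof. by move=> b0; field. Qed.

Lemma subr_frac_mul a b c x : b != 0 -> c * b - x * a = (c - x * (a / b)) * b.
Proof. by move=> b0; field. Qed.

End FieldIdentities.

(** The fractions with a denominator that does not vanish at 0, in any field F
    with an embedding t of the polynomials. *)
Section Local.
Variables (F : fieldType) (t : {rmorphism {poly rat} -> F}).
Hypothesis t_inj : injective t.

Let t_eq0 f : (t f == 0) = (f == 0).
Proof. by rewrite -(inj_eq t_inj) rmorph0. Qed.

Let v : F := t 'X.

Let O (x : F) : Prop := exists f g : {poly rat}, g.[0] != 0 /\ x = t f / t g.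

Let nz (g : {poly rat}) : g.[0] != 0 -> t g != 0.
Proof. by move=> g0; rewrite t_eq0; apply: contraNneq g0 => ->; rewrite horner0. Qed.

Lemma O_subring : [/\ O 1, forall x y, O x -> O y -> O (x - y)
  & forall x y, O x -> O y -> O (x * y)].
Proof.
split.
- by exists 1, 1; rewrite hornerC oner_eq0 divff // rmorph1 oner_eq0.
- move=> x y [f [g [g0 ->]]] [f' [g' [g'0 ->]]].
  exists (f * g' - f' * g), (g * g'); split; first by rewrite hornerM mulf_neq0.
  by rewrite rmorphB !rmorphM frac_sub // nz.
- move=> x y [f [g [g0 ->]]] [f' [g' [g'0 ->]]].
  exists (f * f'), (g * g'); split; first by rewrite hornerM mulf_neq0.
  by rewrite !rmorphM mulf_div.
Qed.

Lemma O_poly f : O (t f).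
Proof. by exists f, 1; rewrite hornerC oner_eq0 rmorph1 divr1. Qed.

Lemma O_inv x a : O a -> x - 1 = v * a -> x != 0 /\ exists2 b, O b & x^-1 - 1 = v * b.
Proof.
case=> f [g [g0 ->]] ex; have ng := nz g0.
pose h := g + 'X * f.
have h0 : h.[0] != 0 by rewrite hornerD hornerM hornerX mul0r addr0.
have nh := nz h0.
have eh : t h = t g + v * t f by rewrite /h rmorphD rmorphM.
have {}ex : x = t h / t g by rewrite eh -[LHS](subrK 1 x) ex (add1_frac _ _ ng).
split; first by rewrite ex frac_neq0.
exists (- (t f / t h)); last by rewrite ex; apply: (inv_sub1 ng nh); rewrite eh addrK.
by exists (- f), h; rewrite rmorphN mulNr.
Qed.

Lemma O_ratr (c : rat) : ratr c = t c%:P.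
Proof. by rewrite -(fmorph_eq_rat (t \o polyC)). Qed.

Lemma O_residue x : O x -> exists (c : rat), exists2 b, O b & x - ratr c = v * b.
Proof.
move=> [f [g [g0 ->]]]; exists (f.[0] / g.[0]); have ng := nz g0.
pose d := f - (f.[0] / g.[0])%:P * g.
have : root d 0 by rewrite /root hornerD hornerN hornerM hornerC divfK // subrr.
case/factor_theorem=> h; rewrite subr0 => eh.
exists (t h / t g); first by exists h, g.
have ed : t d = v * t h by rewrite eh mulrC rmorphM.
rewrite O_ratr mulrA -ed /d; move: (_%:P) => c.
by rewrite rmorphB rmorphM (frac_subr _ _ ng).
Qed.

Lemma O_ratr0 (c : rat) a : O a -> ratr c = v * a -> c = 0.
Proof.
case=> f [g [g0 ->]]; rewrite O_ratr => /eqP; have ng := nz g0.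
rewrite -subr_eq0 => e.
have : t (c%:P * g - 'X * f) == 0.
  by rewrite rmorphB !rmorphM (subr_frac_mul _ _ _ ng) (eqP e) mul0r.
rewrite t_eq0 => /eqP /(congr1 (horner^~ 0)).
rewrite hornerD hornerN !hornerM hornerX hornerC mul0r subr0 horner0 => /eqP.
by rewrite mulf_eq0 (negPf g0) orbF => /eqP.
Qed.

End Local.

Fact tofracq_inj : injective (@tofrac {poly rat}).
Proof. by move=> x y /eqP; rewrite tofrac_eq => /eqP. Qed.

Lemma q_neq0 : q != 0.
Proof. by rewrite /q tofrac_eq0 polyX_eq0. Qed.

Definition A0p : {pred Kq} := [pred x | `[<A0 x>]].

Lemma A0pP x : reflect (A0 x) (x \in A0p).
Proof. exact: asboolP. Qed.

Fact A0_subring : subring_closed A0p.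
Proof.
have [h1 hB hM] := O_subring tofracq_inj.
split=> [|x y /A0pP Hx /A0pP Hy|x y /A0pP Hx /A0pP Hy]; apply/A0pP.
- exact: h1.
- exact: hB.
- exact: hM.
Qed.
(** The last two axioms replace the residue field: the units congruent to 1
    are invertible in the ring, and the uniformizer is not invertible. *)
Record local_ring (F : fieldType) := LocalRing {
  lr_A : {pred F};
  lr_q : F;
  lr_sub : subring_closed lr_A;
  lr_qA : lr_q \in lr_A;
  lr_q0 : lr_q != 0;
  lr_inv : forall x a, a \in lr_A -> x - 1 = lr_q * a ->
    x != 0 /\ exists2 b, b \in lr_A & x^-1 - 1 = lr_q * b;
  lr_1 : forall a, a \in lr_A -> 1 <> lr_q * a
}.
HB.instance Definition _ F (R : local_ring F) :=
  GRing.isSubringClosed.Build F (lr_A R) (lr_sub R).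

Fact A0_q : q \in A0p.
Proof. by apply/A0pP; exact: (O_poly (@tofrac {poly rat}) 'X). Qed.

Fact A0_inv x a : a \in A0p -> x - 1 = q * a ->
  x != 0 /\ exists2 b, b \in A0p & x^-1 - 1 = q * b.
Proof.
move=> /A0pP Aa e; have [nx [b Ob eb]] := O_inv tofracq_inj Aa e.
by split=> //; exists b => //; apply/A0pP.
Qed.

Lemma A0_ratr (c : rat) : (ratr c : Kq) \in A0p.
Proof. by apply/A0pP; rewrite (O_ratr (@tofrac {poly rat})); exact: O_poly. Qed.

Lemma A0_res x : x \in A0p -> exists (c : rat), exists2 b, b \in A0p & x - ratr c = q * b.
Proof.
move=> /A0pP Ax; have [c [b Ob eb]] := O_residue tofracq_inj Ax.
by exists c, b => //; apply/A0pP.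
Qed.

Lemma A0_ratr0 (c : rat) a : a \in A0p -> ratr c = q * a -> c = 0.
Proof. by move=> /A0pP Aa; exact: (O_ratr0 tofracq_inj Aa). Qed.

Fact A0_1 a : a \in A0p -> 1 <> q * a.
Proof.
move=> Aa e; have /eqP := @A0_ratr0 1 a Aa (etrans (ratr_nat Kq 1) e).
by rewrite oner_eq0.
Qed.

Definition Rq : local_ring Kq := LocalRing A0_subring A0_q q_neq0 A0_inv A0_1.

Lemma RqP x : A0 x <-> x \in lr_A Rq.
Proof. exact: (rwP (A0pP x)). Qed.

Lemma Rq_q : lr_q Rq = q. Proof. by []. Qed.

#[global] Opaque Kq q A0 Rq.

(** * Quantum integers *)

Section QuantumIntegers.
Variables (F : fieldType) (p : F) (p0 : p != 0) (p2 : 1 - p ^+ 2 != 0).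

(** The quantum integer of n at p. It is needed for negative n too, where n is
    a weight. *)
Definition br (n : int) : F := (p ^ n - p ^ (- n)) / (p - p^-1).

Lemma br0 : br 0 = 0.
Proof. by rewrite /br oppr0 subrr mul0r. Qed.

Lemma brN n : br (- n) = - br n.
Proof. by rewrite /br opprK -opprB mulNr. Qed.

Let h2 : p * p - 1 != 0.
Proof. by rewrite -oppr_eq0 opprB -expr2. Qed.

Let h2' : 1 - p * p != 0.
Proof. by rewrite -expr2. Qed.

(** Positive quantum integers as a pole times a unit of the local ring. *)
Lemma br_nat (n : nat) : br n.+1 = p ^ (- n%:Z) * ((1 - p ^+ (2 * n.+1)) / (1 - p ^+ 2)).
Proof.
rewrite /br -!exprnN -!exprnP mul2n -addnn exprD expr2 !exprS.
have pn : p ^+ n != 0 by rewrite expf_neq0.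
by field; rewrite pn p0 h2 h2'.
Qed.

(** The two identities that govern the commutation of e with powers of f. *)
Lemma br_step (m : int) (a : int) :
  br (m + a + a) + br a * br (m + a - 1) = br (a + 1) * br (m + a).
Proof.
rewrite /br !opprD opprK !expfzDr // !expr1z -!invr_expz.
have pm : p ^ m != 0 by rewrite expfz_neq0.
have pa : p ^ a != 0 by rewrite expfz_neq0.
move: (p ^ m) (p ^ a) pm pa => x y x0 y0.
by field; rewrite x0 y0 p0 h2.
Qed.

Lemma br_string (m k : int) : br (m + 1) * br k + br (m - k) = br m * br (k + 1).
Proof.
rewrite /br !opprD opprK !expfzDr // !expr1z -!invr_expz.
have pm : p ^ m != 0 by rewrite expfz_neq0.
have pa : p ^ k != 0 by rewrite expfz_neq0.
move: (p ^ m) (p ^ k) pm pa => x y x0 y0.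
by field; rewrite x0 y0 p0 h2.
Qed.

Lemma br_neq0 (n : int) :
  (forall k, (0 < k)%N -> 1 - p ^+ k != 0) -> n != 0 -> br n != 0.
Proof.
move=> p1; have pos (m : nat) : br m.+1 != 0.
  by rewrite br_nat mulf_neq0 ?expfz_neq0 // frac_neq0 // p1.
by case: n => [[|m]|m] // _; rewrite ?NegzE ?brN ?oppr_eq0; exact: pos.
Qed.

End QuantumIntegers.

(** * Units congruent to one *)

Section LocalRing.
Variables (F : fieldType) (R : local_ring F).
Local Notation A := (lr_A R).
Local Notation q := (lr_q R).

(** The maximal ideal of the local ring. *)
Definition qA (x : F) : Prop := exists2 a, a \in A & x = q * a.

Lemma qA_A x : qA x -> x \in A.
Proof. by case=> a Aa ->; rewrite rpredM ?lr_qA. Qed.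
Lemma qA0 : qA 0.
Proof. by exists 0; rewrite ?rpred0 ?mulr0. Qed.
Lemma qAD x y : qA x -> qA y -> qA (x + y).
Proof. by case=> a Aa -> [b Ab ->]; exists (a + b); rewrite ?rpredD ?mulrDr. Qed.
Lemma qAN x : qA x -> qA (- x).
Proof. by case=> a Aa ->; exists (- a); rewrite ?rpredN ?mulrN. Qed.
Lemma qAMl x y : x \in A -> qA y -> qA (x * y).
Proof. by move=> Ax [b Ab ->]; exists (x * b); rewrite ?rpredM // mulrCA. Qed.
Lemma qAMr x y : qA x -> y \in A -> qA (x * y).
Proof. by move=> ? ?; rewrite mulrC; apply: qAMl. Qed.
Lemma qA_sum (J : Type) (r : seq J) (P : pred J) (G : J -> F) :
  (forall j, P j -> qA (G j)) -> qA (\sum_(j <- r | P j) G j).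
Proof. by move=> H; elim/big_ind: _ => //; [exact: qA0 | exact: qAD]. Qed.
Lemma qA_X n : (0 < n)%N -> qA (q ^+ n).
Proof. by case: n => // n _; exists (q ^+ n); rewrite ?rpredX ?lr_qA // exprS. Qed.
Lemma qA_1 : ~ qA 1.
Proof. by case=> a Aa; exact: lr_1. Qed.

(** The units congruent to 1 modulo the maximal ideal. *)
Definition unit1 (x : F) : Prop := qA (x - 1).

Lemma unit1_A x : unit1 x -> x \in A.
Proof. by move=> /qA_A H; rewrite -(subrK 1 x) rpredD ?rpred1. Qed.
Lemma unit1_1 : unit1 1.
Proof. by rewrite /unit1 subrr; exact: qA0. Qed.
Lemma unit1M x y : unit1 x -> unit1 y -> unit1 (x * y).
Proof.
move=> Hx Hy; rewrite /unit1 mul_sub1.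
by apply: qAD => //; apply: qAMr => //; apply: unit1_A.
Qed.
Lemma unit1_inv x : unit1 x -> x != 0 /\ unit1 x^-1.
Proof. by case=> a Aa e; have [nx [b Ab eb]] := lr_inv Aa e; split=> //; exists b. Qed.
Lemma unit1_1D x : qA x -> unit1 (1 + x).
Proof. by rewrite /unit1 addrC addKr. Qed.
Lemma unit1_1B x : qA x -> unit1 (1 - x).
Proof. by move=> H; apply: unit1_1D; apply: qAN. Qed.

Lemma qX_eq1 n : q ^+ n = 1 -> n = 0%N.
Proof. by case: n => // n e; case: qA_1; rewrite -e; apply: qA_X. Qed.

Lemma qexpz_inj (m n : int) : q ^ m = q ^ n -> m = n.
Proof.
wlog le_mn : m n / (m <= n)%R.
  by move=> H; case: (lerP m n) => [/H //|/ltW /H {}H /esym/H].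
move=> e; have : q ^ (n - m) = 1.
  by rewrite expfzDr ?lr_q0 // -e -expfzDr ?lr_q0 // subrr expr0z.
have: (0 <= n - m)%R by rewrite subr_ge0.
case ek : (n - m) => [k|//] _; rewrite -exprnP => /qX_eq1 ek0.
by apply/esym/eqP; rewrite -subr_eq0 ek ek0.
Qed.

(** An invertible base: one of the parameters attached to the simple roots. *)
Definition base (p : F) : Prop := exists2 d, (0 < d)%N & p = q ^+ d.

Section Base.
Variables (p : F) (bp : base p).

Lemma base_neq0 : p != 0.
Proof. by case: bp => d _ ->; rewrite expf_neq0 ?lr_q0. Qed.
Lemma base_qA n : (0 < n)%N -> qA (p ^+ n).
Proof. by case: bp => d d0 -> n0; rewrite -exprM; apply: qA_X; rewrite muln_gt0 d0. Qed.
Lemma base_A : p \in A.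
Proof. by apply: qA_A; rewrite -(expr1 p); apply: base_qA. Qed.
Lemma base_unit1 n : (0 < n)%N -> unit1 (1 - p ^+ n).
Proof. by move=> n0; apply/unit1_1B/base_qA. Qed.
Lemma base_1B n : (0 < n)%N -> 1 - p ^+ n != 0.
Proof. by move=> /base_unit1/unit1_inv[]. Qed.
Lemma base_1D n : (0 < n)%N -> 1 + p ^+ n != 0.
Proof. by move=> n0; apply: (unit1_inv _).1; apply/unit1_1D/base_qA. Qed.

Lemma br_base_neq0 (n : int) : n != 0 -> br p n != 0.
Proof. exact: (br_neq0 base_neq0 (base_1B (ltn0Sn 1)) base_1B). Qed.

End Base.

End LocalRing.

Lemma qi_base i : base Rq (qi i).
Proof. by rewrite /qi /di; case: eqP => _; [exists 1%N | exists 2%N]. Qed.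

Lemma ratr_A (c : rat) : (ratr c : Kq) \in lr_A Rq.
Proof. exact: A0_ratr. Qed.

Lemma A_residue x : x \in lr_A Rq -> exists c : rat, qA Rq (x - ratr c).
Proof. by move=> /A0_res[c [b Ab eb]]; exists c, b. Qed.

Lemma ratr_qA (c : rat) : qA Rq (ratr c) -> c = 0.
Proof. by case=> a; exact: A0_ratr0. Qed.

(** * Words of signs *)

(** Words are stored with the last letter first, because the cancellation rule
    is computed from left to right.  The two stacks hold the positions of the
    uncancelled minus and plus signs, the last position first. *)
Fixpoint stacks (r : seq bool) : seq nat * seq nat :=
  if r is b :: r' then
    let st := stacks r' in
    if b then (st.1, size r' :: st.2)
    else if st.2 is _ :: ps then (st.1, ps) else (size r' :: st.1, [::])
  else ([::], [::]).

Definition weps r := size (stacks r).1.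
Definition wphi r := size (stacks r).2.

Lemma weps_true r : weps (true :: r) = weps r. Proof. by []. Qed.
Lemma wphi_true r : wphi (true :: r) = (wphi r).+1. Proof. by []. Qed.
Lemma weps_false r : weps (false :: r) = (weps r + (wphi r == 0))%N.
Proof. by rewrite /weps /wphi /=; case: (stacks r) => ms [|x ps] /=; rewrite ?addn1 ?addn0. Qed.
Lemma wphi_false r : wphi (false :: r) = (wphi r).-1.
Proof. by rewrite /wphi /=; case: (stacks r) => ms [|x ps]. Qed.

(** The tensor product rule, computed on the last letter first: a plus sign is
    changed at the end of the word only if no plus sign is left uncancelled
    before it. *)
Fixpoint wft (r : seq bool) : option (seq bool) :=
  if r is b :: r' then
    if b then if wphi r' == 0%N then Some (false :: r') else omap (cons true) (wft r')
    else if (1 < wphi r')%N then omap (cons false) (wft r') else None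
  else None.

Fixpoint wet (r : seq bool) : option (seq bool) :=
  if r is b :: r' then
    if b then omap (cons true) (wet r')
    else if wphi r' == 0%N then Some (true :: r') else omap (cons false) (wet r')
  else None.

Lemma wft_none r : (wft r == None) = (wphi r == 0%N).
Proof.
elim: r => [|[] r IH] //=.
  by rewrite wphi_true; case: ifP => // n0; case: (wft r) IH => [r'|] //=; rewrite n0.
rewrite wphi_false; case: ltnP => h; last by rewrite eqxx; apply/esym; lia.
have -> : (omap (cons false) (wft r) == None) = (wft r == None) by case: (wft r).
by rewrite IH; lia.
Qed.

Lemma wet_none r : (wet r == None) = (weps r == 0%N).
Proof.
elim: r => [|[] r IH] //=; first by rewrite weps_true -IH; case: (wet r).
rewrite weps_false; case: ifP => h; first by apply/esym; rewrite addn1.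
by rewrite addn0 -IH; case: (wet r).
Qed.

Lemma wft_some r r' : wft r = Some r' ->
  [/\ weps r' = (weps r).+1, wphi r = (wphi r').+1, wet r' = Some r & size r' = size r].
Proof.
elim: r r' => [|[] r IH] //= r'.
- case: eqP => [p0 [<-]|n0].
    by rewrite weps_false wphi_false wphi_true weps_true /= p0 eqxx addn1.
  case E: (wft r) => [r1|] //= [<-]; have [h1 h2 h3 h4] := IH _ E.
  by rewrite !weps_true !wphi_true /= h3 h1 h2 h4.
- case: ltnP => // h; case E: (wft r) => [r1|] //= [<-]; have [h1 h2 h3 h4] := IH _ E.
  rewrite !weps_false !wphi_false /= h3 h1 h4 /=.
  by case: eqP => [e|_]; [lia|split=> //; lia].
Qed.

Lemma wet_some r r' : wet r = Some r' -> wft r' = Some r /\ size r' = size r.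
Proof.
elim: r r' => [|[] r IH] //= r'.
- case E: (wet r) => [r1|] //= [<-]; have [h1 h2] := IH _ E.
  have [_ e _ _] := wft_some h1; rewrite /= h1 h2; split=> //.
  by case: eqP => // ?; lia.
- case: eqP => [p0 [<-]|n0]; first by rewrite /= p0 eqxx.
  case E: (wet r) => [r1|] //= [<-]; have [h1 h2] := IH _ E.
  have [_ e _ _] := wft_some h1; rewrite /= h1 h2; split=> //.
  by case: ltnP => // ?; lia.
Qed.

(** * Exact strings in a tensor product of two-dimensional modules *)

Definition sgn (b : bool) : int := if b then 1 else -1.

Definition wwt (w : seq bool) : int := \sum_(b <- w) sgn b.

Section Strings.
Variables (F : fieldType) (p : F).
Hypothesis p0 : p != 0.
Hypothesis p1 : forall n, (0 < n)%N -> 1 - p ^+ n != 0.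

(** The action of f on the pure tensor of a word: a plus sign becomes a minus
    sign, with the weight of the letters to its left as exponent. *)
Fixpoint fw (w : seq bool) : seq (F * seq bool) :=
  if w is b :: w' then
    (if b then [:: (1, false :: w')] else [::]) ++
    [seq (p ^ sgn b * x.1, b :: x.2) | x <- fw w']
  else [::].

Lemma fw_cat w1 w2 : fw (w1 ++ w2) =
  [seq (x.1, x.2 ++ w2) | x <- fw w1] ++
  [seq (p ^ wwt w1 * x.1, w1 ++ x.2) | x <- fw w2].
Proof.
elim: w1 => [|b w1 IH] /=.
  rewrite -[LHS]map_id; apply: eq_map => -[k w] /=.
  by rewrite /wwt big_nil expr0z mul1r.
rewrite IH !map_cat catA -!map_comp; congr (_ ++ _); first by case: b.
apply: eq_map => -[k w] /=.
by rewrite /wwt big_cons mulrA -expfzDr.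
Qed.

Lemma size_fw w x : x \in fw w -> size x.2 = size w.
Proof.
elim: w x => [|b w IH] x //=; rewrite mem_cat => /orP[].
  by case: b => //; rewrite inE => /eqP ->.
by case/mapP=> y /IH e ->; rewrite /= e.
Qed.

Variables (M : lmodType F) (f : {linear M -> M}) (N : nat) (Th : seq bool -> M).
Hypothesis f_Th : forall w, size w = N -> f (Th w) = \sum_(x <- fw w) x.1 *: Th x.2.

(** The two coefficients of the component V(m-1) in V(m) tensor V(1). Modulo q
    they are 1 and 0. *)
Definition alph (r : seq bool) : F :=
  (1 - p ^+ (2 * wphi r)) / (1 - p ^+ (2 * (wphi r + weps r))).
Definition beta (r : seq bool) : F :=
  p ^+ wphi r * ((1 - p ^+ (2 * (weps r).+1)) / (1 - p ^+ (2 * (wphi r + weps r)))).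

(** The string vector attached to the prefix r, followed by the pure word w.
    Adding one letter to the prefix is the decomposition of V(m) (x) V(1) into
    V(m+1) and V(m-1), where V(m) is the string through the prefix. *)
Fixpoint strv (n : nat) (r w : seq bool) : M :=
  match n, r with
  | n'.+1, true :: r' => strv n' r' (true :: w)
      + p ^+ (wphi r').+1 *: oapp (fun r1 => strv n' r1 (false :: w)) 0 (wet r')
  | n'.+1, false :: r' =>
      if wphi r' == 0%N then strv n' r' (false :: w) else
      alph r' *: strv n' r' (false :: w)
      - beta r' *: oapp (fun r1 => strv n' r1 (true :: w)) 0 (wft r')
  | _, _ => Th w
  end.

Let p2 : 1 - p ^+ 2 != 0.
Proof. exact: p1. Qed.

Lemma brS (n : nat) : br p n.+1 = p ^ (- n%:Z) + p * br p n.
Proof.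
case: n => [|n]; first by rewrite br0 mulr0 addr0 (br_nat p0 p2) muln1 expr0z mul1r divff.
rewrite !(br_nat p0 p2) -[in RHS](divfK p2 (p ^ (- n.+1%:Z))).
rewrite mulrCA [in RHS]mulrA -!exprnN exprS [in (2 * n.+2)%N]mulnS exprD.
have pn : p ^+ n != 0 by rewrite expf_neq0.
by field; rewrite pn p0 p2.
Qed.

Lemma alph_step (a e : nat) :
  (1 - p ^+ (2 * a.+1)) / (1 - p ^+ (2 * (a.+1 + e))) * br p e.+1
   - p ^+ a.+1 * ((1 - p ^+ (2 * e.+1)) / (1 - p ^+ (2 * (a.+1 + e)))) * p ^ (a%:Z - 1 - e%:Z)
  = br p e.+1 * ((1 - p ^+ (2 * a)) / (1 - p ^+ (2 * (a + e.+1)))).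
Proof.
rewrite -addSnnS (br_nat p0 p2).
have d0 : 1 - p ^+ (2 * (a.+1 + e)) != 0 by apply: p1; lia.
have -> : p ^ (a%:Z - 1 - e%:Z) = p ^+ a / p / p ^+ e.
  by rewrite !expfzDr // -[p ^ (- 1)]/(p ^- 1) expr1 -exprnN.
rewrite -exprnN.
have pe : p ^+ e != 0 by rewrite expf_neq0.
have -> : p ^+ (2 * a.+1) = p ^+ a * p ^+ a * (p * p).
  by rewrite -!exprD -expr2 -exprD; congr (_ ^+ _); lia.
have -> : p ^+ (2 * a) = p ^+ a * p ^+ a by rewrite -exprD; congr (_ ^+ _); lia.
move: p2 d0 pe; rewrite expr2.
move: (p ^+ (2 * (a.+1 + e))) (p ^+ (2 * e.+1)) => x y.
rewrite exprS; move: (p ^+ e) (p ^+ a) => z t h d0 z0.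
by field; rewrite p0 h d0 z0.
Qed.

Lemma beta_step (a e : nat) :
  p ^+ a.+1 * ((1 - p ^+ (2 * e.+1)) / (1 - p ^+ (2 * (a.+1 + e)))) * br p e.+2
  = br p e.+1 * (p ^+ a * ((1 - p ^+ (2 * e.+2)) / (1 - p ^+ (2 * (a + e.+1))))).
Proof.
rewrite -addSnnS !(br_nat p0 p2).
have d0 : 1 - p ^+ (2 * (a.+1 + e)) != 0 by apply: p1; lia.
have pe : p ^+ e != 0 by rewrite expf_neq0.
rewrite -!exprnN; move: p2 d0.
move: (p ^+ (2 * (a.+1 + e))) (p ^+ (2 * e.+1)) (p ^+ (2 * e.+2)) => x y u.
rewrite expr2 !exprS; move: (p ^+ e) (p ^+ a) pe.
by move=> z t z0 h d0; field; rewrite p0 h d0 z0.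
Qed.

Lemma lin_rearrange (a b e1 e2 t u : F) (Y Z S1 S2 : M) :
  a *: (e1 *: Y + t *: S1) - b *: (e2 *: Z + (u *: Y + t *: S2)) =
  (a * e1 - b * u) *: Y - (b * e2) *: Z + t *: (a *: S1 - b *: S2).
Proof.
rewrite !scalerDr !scalerA scalerBl scalerN scalerA ![t * _]mulrC !opprD !addrA.
by rewrite (ACl (1*4*3*2*5))%AC.
Qed.

Let wt (r : seq bool) : int := (wphi r)%:Z - (weps r)%:Z.

Lemma sum_oapp n (o : option (seq bool)) (b : bool) (c : F) (w : seq (F * seq bool)) :
  \sum_(x <- w) x.1 *: (c *: oapp (fun r1 => strv n r1 (b :: x.2)) 0 o) =
  c *: oapp (fun r1 => \sum_(x <- w) x.1 *: strv n r1 (b :: x.2)) 0 o.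
Proof.
case: o => [r1|] /=; last by rewrite scaler0 big1 // => x _; rewrite scaler0.
by rewrite scaler_sumr; apply: eq_bigr => x _ /=; rewrite !scalerA mulrC.
Qed.

Lemma sum_cons n r (b : bool) (c : F) (w : seq (F * seq bool)) :
  \sum_(x <- w) (c * x.1) *: strv n r (b :: x.2) =
  c *: \sum_(x <- w) x.1 *: strv n r (b :: x.2).
Proof. by rewrite scaler_sumr; apply: eq_bigr => x _; rewrite scalerA. Qed.

(** By induction on the prefix: the prefix spans an irreducible module with
    vectors indexed by its string, and [alph_step] and [beta_step] are the
    identities between quantum integers that make the next letter compatible
    with it. The last term is the coproduct: f acts on the remaining pure
    tensor with the weight of the prefix as exponent. *)
Lemma f_strv n r w : size r = n -> (n + size w)%N = N ->
  f (strv n r w) = br p (weps r).+1 *: oapp (fun r1 => strv n r1 w) 0 (wft r)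
    + p ^ wt r *: \sum_(x <- fw w) x.1 *: strv n r x.2.
Proof.
elim: n r w => [|n IH] [|b r] w //= => [_ sw|[sr] sw].
  by rewrite scaler0 add0r expr0z scale1r f_Th.
have Em r1 : size r1 = n -> f (strv n r1 (false :: w)) =
    br p (weps r1).+1 *: oapp (fun r2 => strv n r2 (false :: w)) 0 (wft r1)
    + p ^ (wt r1 - 1) *: \sum_(x <- fw w) x.1 *: strv n r1 (false :: x.2).
  move=> s1; rewrite (IH _ (false :: w)) //=; last by lia.
  by rewrite big_map sum_cons scalerA -expfzDr.
have Ep r1 : size r1 = n -> f (strv n r1 (true :: w)) =
    br p (weps r1).+1 *: oapp (fun r2 => strv n r2 (true :: w)) 0 (wft r1)
    + (p ^ wt r1 *: strv n r1 (false :: w)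
    + p ^ (wt r1 + 1) *: \sum_(x <- fw w) x.1 *: strv n r1 (true :: x.2)).
  move=> s1; rewrite (IH _ (true :: w)) //=; last by lia.
  by rewrite big_cons big_map sum_cons /= scale1r scalerDr scalerA -expfzDr.
rewrite -/(strv n.+1 (b :: r) w) -/(wft (b :: r)).
rewrite -[oapp _ _ _]/(oapp (fun r1 => strv n.+1 r1 w) 0 (wft (b :: r))).
(* the first term of the right-hand side is kept folded while the left-hand side is
   expanded, and is compared with it in each case at the end *)
have [Q eQ] : exists Q, Q = br p (weps (b :: r)).+1 *:
    oapp (fun r1 => strv n.+1 r1 w) 0 (wft (b :: r)) by eexists.
rewrite -eQ; case: b eQ => eQ /=.
- rewrite linearD linearZ /= Ep //; set P := p ^+ _.
  under [in RHS]eq_bigr => x _ do rewrite scalerDr.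
  rewrite big_split sum_oapp /=; set S := \sum_(x <- fw w) _; set T := oapp (fun r1 => \sum_(x <- fw w) _) _ (wet r).
  have ewt : wt (true :: r) = wt r + 1 by rewrite /wt weps_true wphi_true; lia.
  have -> : P *: f (oapp (fun r1 => strv n r1 (false :: w)) 0 (wet r)) =
     (P * br p (weps r)) *: strv n r (false :: w) + p ^ (wt r + 1) *: (P *: T).
    rewrite /T; case E: (wet r) => [r1|] /=; last first.
      have /eqP -> : weps r == 0%N by rewrite -wet_none E.
      by rewrite linear0 br0 !scaler0 mulr0 scale0r addr0.
    have [h1 h2] := wet_some E; have [h3 h4 h5 h6] := wft_some h1.
    rewrite Em ?h2 // h1 /= -h3 scalerDr !scalerA; congr (_ + _ *: _).
    by rewrite mulrC; congr (_ ^ _ * _); rewrite /wt; lia.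
  have -> : Q = br p (weps r).+1 *: oapp (fun r1 => strv n r1 (true :: w)) 0 (wft r) +
     (p ^ wt r + P * br p (weps r)) *: strv n r (false :: w).
    rewrite eQ weps_true /=; case E: (wft r) => [r1|].
      have [h3 h4 h5 h6] := wft_some E.
      rewrite h4 /= h5 /= scalerDr scalerA; congr (_ + _ *: _).
      rewrite brS mulrDl; congr (_ + _); last by rewrite /P h4 !exprS; ring.
      by rewrite exprnP -expfzDr // /wt h4 addrC.
    have e : wphi r == 0%N by rewrite -wft_none E.
    rewrite e /= e scaler0 add0r brS; congr ((_ + _ * _) *: _).
      by rewrite /wt (eqP e) sub0r.
    by rewrite /P (eqP e) expr1.
  rewrite ewt scalerDl [p ^ (wt r + 1) *: (S + _)]scalerDr.
  by rewrite !addrA (ACl (1*2*4*3*5))%AC.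
- case: ifP => [/eqP e|ne].
    have /eqP Ew : wft r == None by rewrite wft_none e.
    rewrite eQ Em // Ew /= e /= !scaler0; congr (_ + p ^ _ *: _).
    by rewrite /wt weps_false wphi_false e; lia.
  case E: (wft r) => [r1|]; last by move: ne; rewrite -wft_none E.
  have [h3 h4 h5 h6] := wft_some E.
  have ewt : wt (false :: r) = wt r - 1.
    by rewrite /wt weps_false wphi_false ne addn0 h4; lia.
  have ewt1 : wt r1 = wt r - 2 by rewrite /wt h3 h4; lia.
  rewrite linearB !linearZ /= Em // Ep ?h6 // E /= ewt1 ewt.
  under [in RHS]eq_bigr => x _ do rewrite scalerBr.
  rewrite sumrB (sum_oapp n (Some r1)) /=.
  have -> : \sum_(x <- fw w) x.1 *: (alph r *: strv n r (false :: x.2)) =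
     alph r *: \sum_(x <- fw w) x.1 *: strv n r (false :: x.2).
    by rewrite scaler_sumr; apply: eq_bigr => x _; rewrite !scalerA mulrC.
  set Y := strv n r1 _; set Z := oapp _ _ (wft r1).
  set S1 := \sum_(x <- fw w) _; set S2 := \sum_(x <- fw w) _.
  have -> : Q = (alph r * br p (weps r).+1 - beta r * p ^ (wt r - 2)) *: Y
     - (beta r * br p (weps r).+2) *: Z.
    rewrite eQ weps_false ne addn0 /= h4 ltnS /alph /beta h4.
    rewrite [wt r - 2](_ : _ = (wphi r1)%:Z - 1 - (weps r)%:Z); last by rewrite /wt h4; lia.
    rewrite alph_step beta_step; case: ltnP => h.
      by rewrite E /= [wphi r1 == 0%N]gtn_eqF // h3 scalerBr !scalerA.
    have e0 : wphi r1 = 0%N by lia.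
    have /eqP Ew : wft r1 == None by rewrite wft_none e0.
    by rewrite /Z Ew e0 /= !scaler0 muln0 expr0 subrr mul0r mulr0 scale0r subr0.
  rewrite h3 scalerN (_ : wt r - 2 + 1 = wt r - 1); last by lia.
  exact: lin_rearrange.
Qed.

End Strings.

(** * Submodules over the local ring *)

Section Lattice.
Variables (F : fieldType) (R : local_ring F) (M : lmodType F) (L : set M).
Local Notation A := (lr_A R).
Local Notation q := (lr_q R).
Hypothesis HL : submodule_over [set x | x \in A]%classic L.

(** The submodule q L; two vectors are congruent when their difference lies in
    it. *)
Definition qlat : set M := [set v | exists2 u, L u & v = q *: u].

Lemma lat0 : L 0. Proof. by case: HL. Qed.
Lemma latD u v : L u -> L v -> L (u + v). Proof. by case: HL => _ h _; exact: h. Qed.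
Lemma latZ c v : c \in A -> L v -> L (c *: v).
Proof. by case: HL => _ _ h; exact: h. Qed.
Lemma latN v : L v -> L (- v).
Proof. by move=> Lv; rewrite -scaleN1r; apply: latZ => //; rewrite rpredN rpred1. Qed.
Lemma lat_sum (J : eqType) (r : seq J) (P : pred J) (G : J -> M) :
  (forall j, j \in r -> P j -> L (G j)) -> L (\sum_(j <- r | P j) G j).
Proof.
move=> H; rewrite big_seq_cond; elim/big_ind: _ => [|u v|j /andP[]].
- exact: lat0.
- exact: latD.
- exact: H.
Qed.

Lemma qlat0 : qlat 0. Proof. by exists 0; [exact: lat0 | rewrite scaler0]. Qed.
Lemma qlatD u v : qlat u -> qlat v -> qlat (u + v).
Proof. by case=> a La -> [b Lb ->]; exists (a + b); [exact: latD | rewrite scalerDr]. Qed.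
Lemma qlatZ c v : c \in A -> qlat v -> qlat (c *: v).
Proof.
move=> Ac [a La ->]; exists (c *: a); first exact: latZ.
by rewrite !scalerA mulrC.
Qed.
Lemma qlatN v : qlat v -> qlat (- v).
Proof. by case=> a La ->; exists (- a); [exact: latN | rewrite scalerN]. Qed.
Lemma qlatB u v : qlat u -> qlat v -> qlat (u - v).
Proof. by move=> Lu Lv; apply: qlatD => //; apply: qlatN. Qed.
Lemma qlatqZ c v : qA R c -> L v -> qlat (c *: v).
Proof. by case=> a Aa -> Lv; exists (a *: v); [exact: latZ | rewrite scalerA]. Qed.
Lemma qlat_lat v : qlat v -> L v.
Proof. by case=> a La ->; apply: latZ => //; exact: lr_qA. Qed.
Lemma qlat_sum (J : eqType) (r : seq J) (P : pred J) (G : J -> M) :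
  (forall j, j \in r -> P j -> qlat (G j)) -> qlat (\sum_(j <- r | P j) G j).
Proof.
move=> H; rewrite big_seq_cond; elim/big_ind: _ => [|u v|j /andP[]].
- exact: qlat0.
- exact: qlatD.
- exact: H.
Qed.

Lemma qlat_trans u v w : qlat (u - v) -> qlat (v - w) -> qlat (u - w).
Proof. by move=> h1 h2; rewrite -(subrK v u) -addrA; apply: qlatD. Qed.

Variables (p : F) (bp : base R p) (N : nat) (Th : seq bool -> M).
Hypothesis L_Th : forall w, size w = N -> L (Th w).

Lemma alph_unit1 r : wphi r != 0%N -> unit1 R (alph p r).
Proof.
move=> h; apply: unit1M; first by apply: base_unit1 => //; lia.
by apply: (unit1_inv _).2; apply: base_unit1 => //; lia.
Qed.

Lemma beta_qA r : wphi r != 0%N -> qA R (beta p r).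
Proof.
move=> h; apply: qAMr; first by apply: base_qA => //; lia.
apply/unit1_A/unit1M; first by apply: base_unit1 => //; lia.
by apply: (unit1_inv _).2; apply: base_unit1 => //; lia.
Qed.

(** Every correction term in the definition of the string vectors has a
    coefficient divisible by q, and [alph] is congruent to 1. *)
Lemma strv_cong n r w : size r = n -> (n + size w)%N = N ->
  qlat (strv p Th n r w - Th (catrev r w)).
Proof.
have catL r1 w1 : (size r1 + size w1)%N = N -> L (Th (catrev r1 w1)).
  by move=> e; apply: L_Th; rewrite -e catrevE size_cat size_rev.
elim: n r w => [|n IH] [|b r] w //= => [_ sw|[sr] sw].
  by rewrite subrr; exact: qlat0.
have Lp b1 r1 : size r1 = n -> L (strv p Th n r1 (b1 :: w)).
  move=> s1; rewrite -[X in L X](subrK (Th (catrev r1 (b1 :: w)))).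
  apply: latD; last by apply: catL => /=; lia.
  by apply: qlat_lat; apply: IH => //=; lia.
case: b.
  rewrite addrAC; apply: qlatD; first by apply: IH => //=; lia.
  case E: (wet r) => [r1|] /=; last by rewrite scaler0; exact: qlat0.
  apply: qlatqZ; first exact: base_qA.
  by apply: Lp; have [_ ->] := wet_some E.
case: ifP => [_|/negbT ne]; first by apply: IH => //=; lia.
rewrite addrAC; apply: qlatB.
  apply: qlat_trans (IH _ _ sr _); last by rewrite /=; lia.
  rewrite -[X in _ - X]scale1r -scalerBl; apply: qlatqZ; first exact: alph_unit1.
  exact: Lp.
case E: (wft r) => [r1|] /=; last by rewrite scaler0; exact: qlat0.
apply: qlatqZ; first exact: beta_qA.
by apply: Lp; have [_ _ _ ->] := wft_some E.
Qed.

End Lattice.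

(** * Linear maps on a free module *)

Section LinearExtension.
Variables (F : fieldType) (T : choiceType).
Implicit Types (u v : {malg F[T]}).

Lemma malgU_scale (c : F) (x : T) : << c *g x >> = c *: << x >> :> {malg F[T]}.
Proof. by apply/malgP => y; rewrite mcoeffZ !mcoeffU mulr_natr. Qed.

Lemma malg_sum v : v = \sum_(x <- msupp v) v@_x *: << x >>.
Proof. by rewrite {1}[v]monalgE; apply: eq_bigr => x _; rewrite malgU_scale. Qed.

Variable M : lmodType F.

Definition lext (h : T -> M) v : M := \sum_(x <- msupp v) v@_x *: h x.

Lemma lextEw (h : T -> M) v (d : {fset T}) : (msupp v `<=` d)%fset ->
  lext h v = \sum_(x <- d) v@_x *: h x.
Proof.
move=> sd; apply: big_fset_incl => // x _ nx.
by rewrite mcoeff_outdom // scale0r.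
Qed.

Fact lext_linear h : linear (lext h).
Proof.
move=> c u v; pose d := (msupp u `|` msupp v)%fset.
rewrite (@lextEw _ (c *: u + v) d); last first.
  apply/fsubset_trans/fsetSU/msuppZ_le; exact: msuppD_le.
rewrite (@lextEw _ u d) ?fsubsetUl // (@lextEw _ v d) ?fsubsetUr //.
rewrite scaler_sumr -big_split; apply: eq_bigr => x _ /=.
by rewrite mcoeffD mcoeffZ scalerDl scalerA.
Qed.
HB.instance Definition _ h := GRing.isLinear.Build F {malg F[T]} M _ (lext h) (lext_linear h).

Lemma lextU h x : lext h << x >> = h x.
Proof. by rewrite /lext msuppU oner_eq0 big_seq_fset1 mcoeffUU scale1r. Qed.

Lemma lext_uniq (g : {linear {malg F[T]} -> M}) (h : T -> M) v :
  (forall x, v@_x != 0 -> g << x >> = h x) -> g v = lext h v.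
Proof.
move=> e; rewrite {1}[v]malg_sum linear_sum /lext big_seq [RHS]big_seq.
by apply: eq_bigr => x; rewrite -mcoeff_neq0 => nx; rewrite linearZ /= e.
Qed.

Lemma eq_lext (g h : T -> M) v : (forall x, v@_x != 0 -> g x = h x) -> lext g v = lext h v.
Proof. by move=> e; apply: lext_uniq => x nx; rewrite /= lextU e. Qed.

End LinearExtension.

Lemma lext_coef (F : fieldType) (T : choiceType) (h : T -> {malg F[T]}) v y :
  (lext h v)@_y = \sum_(x <- msupp v) v@_x * (h x)@_y.
Proof. by rewrite /lext raddf_sum; apply: eq_bigr => x _ /=; rewrite mcoeffZ. Qed.

Lemma lext_diag (F : fieldType) (T : choiceType) (c : T -> F) (v : {malg F[T]}) y :
  (lext (fun x => c x *: << x >>) v)@_y = c y * v@_y.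
Proof.
rewrite lext_coef; case: (msuppP v y) => [|ny].
  move=> ys; rewrite (bigD1_seq y) //= mcoeffZ mcoeffUU mulr1 big1 ?addr0 1?mulrC //.
  by move=> x /negPf nxy; rewrite mcoeffZ mcoeffU nxy mulr0n !mulr0.
rewrite mulr0 big_seq big1 // => x xs; rewrite mcoeffZ mcoeffU.
by case: eqP => [exy|_]; [rewrite exy (negPf ny) in xs | rewrite mulr0n !mulr0].
Qed.

Lemma lext_comp (F : fieldType) (T : choiceType) (M : lmodType F)
  (g : T -> M) (h : T -> {malg F[T]}) v : lext g (lext h v) = lext (fun x => lext g (h x)) v.
Proof. by rewrite [X in lext g X]/lext linear_sum; apply: eq_bigr => x _; rewrite linearZ. Qed.

Lemma lext_id (F : fieldType) (T : choiceType) (v : {malg F[T]}) : lext (fun x => << x >>) v = v.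
Proof. exact/esym/malg_sum. Qed.

(** * Highest weight vectors of sl2-modules *)

Section Sl2.
Variables (F : fieldType) (p : F) (M : lmodType F) (e f : {linear M -> M}).
Variable Wt : int -> M -> Prop.
Hypothesis p0 : p != 0.
Hypothesis p1 : forall k, (0 < k)%N -> 1 - p ^+ k != 0.
Hypothesis Wt_e : forall n v, Wt n v -> Wt (n + 2) (e v).
Hypothesis Wt_f : forall n v, Wt n v -> Wt (n - 2) (f v).
Hypothesis ef : forall n v, Wt n v -> e (f v) - f (e v) = br p n *: v.

Let p2 : 1 - p ^+ 2 != 0.
Proof. exact: p1. Qed.

Lemma Wt_iter_e n v a : Wt n v -> Wt (n + (2 * a)%:Z) (iter a e v).
Proof.
move=> Wv; elim: a => [|a IH] /=; first by rewrite muln0 addr0.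
by have := Wt_e IH; rewrite -addrA -PoszD -mulnSr.
Qed.

Lemma Wt_iter_f n v a : Wt n v -> Wt (n - (2 * a)%:Z) (iter a f v).
Proof.
move=> Wv; elim: a => [|a IH] /=; first by rewrite muln0 subr0.
by have := Wt_f IH; rewrite -addrA -opprD -PoszD -mulnSr.
Qed.

(** The commutation relation, summed along the powers of e. *)
Lemma iter_e_f n v a : Wt n v -> iter a.+1 e (f v) =
  f (iter a.+1 e v) + (br p a.+1 * br p (n + a%:Z)) *: iter a e v.
Proof.
move=> Wv; elim: a => [|a IH].
  rewrite /= addr0 (br_nat p0 p2) muln1 expr0z mul1r divff // mul1r.
  by rewrite -(ef Wv) addrCA subrr addr0.
rewrite iterS IH linearD linearZ /=.
have := ef (Wt_e (Wt_iter_e a Wv)) => /eqP; rewrite subr_eq => /eqP ->.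
rewrite addrAC -scalerDl addrC; congr (_ + _ *: _).
have := br_step p0 p2 n a.+1.
rewrite (_ : n + a.+1%:Z - 1 = n + a%:Z); last by lia.
rewrite (_ : a.+1%:Z + 1 = a.+2%:Z); last by lia.
by move=> <-; congr (_ + _); congr (br p _); lia.
Qed.

(** A vector of weight n >= 0 killed by the (n+1)-st power of f is a highest
    weight vector: if w were its last nonzero image under a power of e, then
    applying powers of e to the vanishing vector would give a nonzero multiple
    of w. *)
Lemma killed_by_e (n : nat) v : Wt n v -> iter n.+1 f v = 0 ->
  (exists j, iter j e v = 0) -> e v = 0.
Proof.
move=> Wv fv [j0 ej0].
case: (eqVneq (e v) 0) => // ev0.
(* w = e^j v is the last nonzero vector; e^(j+b) f^b v is a nonzero multiple of w
   for all b up to n+1, which is absurd for b = n+1 *)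
have [j [j1 ej ej1]] : exists j, [/\ (0 < j)%N, iter j e v != 0 & iter j.+1 e v = 0].
  elim: j0 ej0 => [|j IH] ej.
    by move: ev0; rewrite (_ : v = 0) ?linear0 ?eqxx.
  case: (eqVneq (iter j e v) 0) => [/IH //|ej'].
  by exists j; split=> //; case: j ej ej' {IH} => //= ej _; move: ev0; rewrite ej eqxx.
have key b : (b <= n.+1)%N -> (forall a, (j + b < a)%N -> iter a e (iter b f v) = 0) /\
    exists2 c, c != 0 & iter (j + b) e (iter b f v) = c *: iter j e v.
  elim: b => [|b IH] hb.
    rewrite addn0; split; last by exists 1; rewrite ?oner_eq0 ?scale1r.
    by move=> a ja; rewrite -(subnK ja) iterD ej1; elim: (a - _)%N => //= k ->; rewrite linear0.
  have [h1 [c c0 h2]] := IH (ltnW hb).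
  have Wb := Wt_iter_f b Wv.
  split=> [[//|a] ja|].
    by rewrite (iter_e_f a Wb) h1 ?linear0 ?add0r ?h1 ?scaler0 //; lia.
  rewrite addnS (iter_e_f _ Wb) h1 ?linear0 ?add0r // h2 scalerA.
  exists (br p (j + b).+1 * br p (n%:Z - (2 * b)%:Z + (j + b)%:Z) * c) => //.
  by apply: mulf_neq0 => //; apply: mulf_neq0; apply: br_neq0 => //; lia.
have [_ [c c0]] := key _ (leqnn _).
rewrite fv (_ : iter _ e 0 = 0); last by elim: (j + n.+1)%N => //= k ->; rewrite linear0.
by move/esym/eqP; rewrite scaler_eq0 (negPf c0) (negPf ej).
Qed.

End Sl2.

(** * Matrices congruent to the identity modulo q *)

Section MatrixCong.
Variables (F : fieldType) (R : local_ring F).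
Local Notation A := (lr_A R).

Lemma A_det n (B : 'M[F]_n) : (forall i j, B i j \in A) -> \det B \in A.
Proof.
move=> HB'; rewrite /determinant rpred_sum // => s _.
by rewrite rpredM ?rpredX ?rpredN ?rpred1 // rpred_prod.
Qed.

Lemma unit1_det n (B : 'M[F]_n) :
  (forall i j, qA R (B i j - (i == j)%:R)) -> unit1 R (\det B).
Proof.
move=> HB'; rewrite /determinant (bigD1 (1%g : 'S_n)) //= odd_perm1 expr0 mul1r /unit1 addrAC.
have HBA i j : B i j \in A.
  rewrite -(subrK (i == j)%:R (B i j)) rpredD ?rpred_nat //; exact: qA_A.
apply: qAD.
  rewrite -/(unit1 R _); elim/big_ind: _ => [||i _]; [exact: unit1_1 | exact: unit1M |].
  by have := HB' i i; rewrite eqxx perm1.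
apply: qA_sum => s ns; apply: qAMl; first by rewrite rpredX ?rpredN ?rpred1.
have [i si] : exists i, s i != i.
  apply/existsP; apply: contraNT ns; rewrite negb_exists => /forallP h.
  by apply/eqP/permP => i; rewrite perm1; apply/eqP; have := h i; rewrite negbK.
rewrite (bigD1 i) //=; apply: qAMr; last by rewrite rpred_prod.
by have := HB' i (s i); rewrite eq_sym (negPf si) subr0.
Qed.

(** The determinant is a unit congruent to 1, and the adjugate matrix has
    entries in the local ring, so the inverse is integral; then it is
    congruent to the identity because its product with the given matrix is. *)
Lemma invmx_cong n (B : 'M[F]_n) : (forall i j, qA R (B i j - (i == j)%:R)) ->
  B \in unitmx /\ forall i j, qA R (invmx B i j - (i == j)%:R).
Proof.
move=> HB'; have [d0 d1] := unit1_inv (unit1_det HB').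
have uB : B \in unitmx by rewrite unitmxE unitfE.
have HBA i j : B i j \in A.
  rewrite -(subrK (i == j)%:R (B i j)) rpredD ?rpred_nat //; exact: qA_A.
have HW i j : invmx B i j \in A.
  rewrite /invmx uB mxE rpredM ?(unit1_A d1) // mxE /cofactor.
  by rewrite rpredM ?rpredX ?rpredN ?rpred1 // A_det // => k l; rewrite !mxE.
split=> // i j.
have -> : invmx B i j - (i == j)%:R = - \sum_k invmx B i k * (B k j - (k == j)%:R).
  have := congr1 (fun C : 'M_n => C i j) (mulVmx uB); rewrite !mxE => <-.
  under [in RHS]eq_bigr => k _ do rewrite mulrBr.
  rewrite sumrB opprB; congr (_ - _).
  rewrite (bigD1 j) //= eqxx mulr1 big1 ?addr0 // => k /negPf ->; exact: mulr0.
apply/qAN/qA_sum => k _; exact: qAMl.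
Qed.

End MatrixCong.

Local Open Scope classical_set_scope.

(** * From families of exact strings to crystal bases *)

Lemma pairing_sep (la mu : weight) : (forall h, pairing h la = pairing h mu) -> la = mu.
Proof.
move=> H; rewrite [la]surjective_pairing [mu]surjective_pairing; congr (_, _).
  apply/ffunP => j; have := H (hcheck j); rewrite /pairing /= !mul0r !addr0.
  have E (la1 : weight) : \sum_j0 [ffun j1 => (j1 == j)%:R] j0 * la1.1 j0 = la1.1 j.
    rewrite (bigD1 j) //= ffunE eqxx mul1r big1 ?addr0 // => k /negPf nk.
    by rewrite ffunE nk mul0r.
  by rewrite !E.
have := H ([ffun => 0], 1); rewrite /pairing /= !mul1r.
by rewrite !big1 ?add0r // => j _; rewrite ffunE mul0r.
Qed.

Lemma pairingD h la mu : pairing h (la + mu) = pairing h la + pairing h mu.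
Proof.
rewrite /pairing addrACA -big_split -mulrDr; congr (_ + _).
by apply: eq_bigr => j _; rewrite ffunE mulrDr.
Qed.

Lemma pairingN h la : pairing h (- la) = - pairing h la.
Proof.
rewrite /pairing opprD -sumrN -mulrN; congr (_ + _).
by apply: eq_bigr => j _; rewrite ffunE mulrN.
Qed.

Lemma pairing_hcheck i la : pairing (hcheck i) la = la.1 i.
Proof.
rewrite /pairing mul0r addr0 (bigD1 i) //= ffunE eqxx mul1r big1 ?addr0 // => k /negPf nk.
by rewrite ffunE nk mul0r.
Qed.

Lemma pairing_hcheckM i n la : pairing (hcheck i *~ n) la = n * la.1 i.
Proof.
have E m : pairing (hcheck i *+ m) la = m%:Z * la.1 i.
  elim: m => [|m IH]; rewrite /pairing.
    by rewrite mulr0n big1 ?mul0r ?addr0 // => j _; rewrite ffunE mul0r.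
  have PD (h h' : coweight) : \sum_j (h + h').1 j * la.1 j + (h + h').2 * la.2 =
      pairing h la + pairing h' la.
    rewrite /pairing addrACA -big_split -mulrDl; congr (_ + _).
    by apply: eq_bigr => j _; rewrite ffunE mulrDl.
  by rewrite mulrSr PD IH pairing_hcheck -[X in _ + X]mul1r -mulrDl -PoszD addn1.
case: n => m; first exact: E.
rewrite NegzE mulNr -E /pairing opprD -sumrN -mulNr; congr (_ + _).
by apply: eq_bigr => j _; rewrite ffunE mulNr.
Qed.

Lemma pairing_hcheckMN i n la : pairing (- (hcheck i *~ n)) la = - (n * la.1 i).
Proof. by rewrite -mulrNz pairing_hcheckM mulNr. Qed.

Lemma cartan_diag i : (alpha i).1 i = 2.
Proof. by rewrite /alpha ffunE; case: i => -[|[|[|]]]. Qed.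

Section FreeLattice.
Variables (F : fieldType) (R : local_ring F) (T : choiceType).
Local Notation A := (lr_A R).
Local Notation q := (lr_q R).
Local Notation M := {malg F[T]}.

Definition lattice : set M := [set v | forall x, v@_x \in A].
Local Notation L := lattice.
Local Notation qlat := (qlat R).
Implicit Types (u v : M) (x y : T).

Lemma coefU x y : (<< x >> : M)@_y = (x == y)%:R.
Proof. exact: mcoeffU. Qed.

Lemma lattice_sub : submodule_over [set x | x \in A] L.
Proof.
split=> [x|u v Lu Lv x|c v Ac Lv x].
- by rewrite mcoeff0 rpred0.
- by rewrite mcoeffD rpredD.
- by rewrite mcoeffZ rpredM.
Qed.

Lemma lattice_U x : L << x >>.
Proof. by move=> y; rewrite coefU rpred_nat. Qed.

Lemma qlatticeP v : qlat L v <-> forall x, qA R v@_x.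
Proof.
split=> [[u Lu ->] x|h]; first by exists u@_x => //; rewrite mcoeffZ.
exists (q^-1 *: v); last by rewrite scalerA divff ?lr_q0 // scale1r.
move=> x; have [a Aa e] := h x.
by rewrite mcoeffZ e mulKf ?lr_q0.
Qed.

Lemma lext_lattice (h : T -> M) v : (forall x, L (h x)) -> L v -> L (lext h v).
Proof.
move=> Lh Lv; apply: (lat_sum lattice_sub) => x _ _.
by apply: (latZ lattice_sub).
Qed.

Lemma lext_qlattice (h : T -> M) v : (forall x, L (h x)) -> qlat L v -> qlat L (lext h v).
Proof.
by move=> Lh [u Lu ->]; exists (lext h u); [exact: lext_lattice | rewrite linearZ].
Qed.

Lemma lext_cong (h : T -> M) v :
  (forall x, qlat L (h x - << x >>)) -> L v -> qlat L (lext h v - v).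
Proof.
move=> Lh Lv; rewrite {2}[v]malg_sum -sumrB.
apply: (qlat_sum lattice_sub) => x _ _; rewrite -scalerBr.
exact: (qlatZ lattice_sub).
Qed.

Lemma lattice_cong u v : qlat L (u - v) -> L v -> L u.
Proof.
by move=> h Lv; rewrite -(subrK v u); apply: (latD lattice_sub) => //; apply: (qlat_lat lattice_sub).
Qed.

(** Two unitriangular modulo q families are inverse to each other as soon as
    the indices fall in finite classes preserved by the first one. *)
Lemma inverse_family (W : eqType) (wt : T -> W) (v : T -> M) :
  (forall la, exists s : seq T, forall x, wt x = la -> x \in s) ->
  (forall x, qlat L (v x - << x >>)) ->
  (forall x y, (v x)@_y != 0 -> wt y = wt x) ->
  exists d : T -> M, [/\ forall x, qlat L (d x - << x >>),
    forall x y, (d x)@_y != 0 -> wt y = wt x,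
    forall x, lext v (d x) = << x >> & forall x, lext d (v x) = << x >>].
Proof.
move=> Hfin vc vw.
have key la : exists d : T -> M, forall x, wt x = la ->
   [/\ qlat L (d x - << x >>), forall y, (d x)@_y != 0 -> wt y = la,
     lext v (d x) = << x >> & lext d (v x) = << x >>].
  have [s0 hs0] := Hfin la.
  pose s := undup [seq x <- s0 | wt x == la].
  have us : uniq s by exact: undup_uniq.
  have sP x : (x \in s) = (wt x == la).
    rewrite mem_undup mem_filter; case: eqP => // e; exact: hs0.
  pose n := size s.
  case: (pselect (exists x, x \in s)) => [[x0 x0s]|ne]; last first.
    by exists (fun x => << x >>) => x e; case: ne; exists x; rewrite sP e eqxx.
  (* the matrix of the family in one weight space *)
  pose B := \matrix_(j < n, k < n) (v (nth x0 s j))@_(nth x0 s k).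
  have [uB hW] : B \in unitmx /\ forall i j, qA R (invmx B i j - (i == j)%:R).
    apply: invmx_cong => i j; rewrite mxE.
    have /qlatticeP/(_ (nth x0 s j)) := vc (nth x0 s i).
    by rewrite mcoeffB coefU nth_uniq.
  have idx x : wt x = la -> exists k : 'I_n, nth x0 s k = x.
    move=> /eqP; rewrite -sP => xs; have h : (index x s < n)%N by rewrite index_mem.
    by exists (Ordinal h); rewrite nth_index.
  have vE (j : 'I_n) : v (nth x0 s j) = \sum_(k < n) B j k *: << nth x0 s k >>.
    apply/malgP => y; rewrite raddf_sum /=.
    case: (boolP (y \in s)) => ys; last first.
      rewrite big1 => [|k _].
        apply/eqP; apply: contraNT ys => /vw; rewrite sP => ->.
        by rewrite -sP mem_nth.
      rewrite mcoeffZ coefU; case: eqP => [e|]; last by rewrite mulr0.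
      by rewrite -e mem_nth in ys.
    have /idx[k <-] : wt y = la by apply/eqP; rewrite -sP.
    rewrite (bigD1 k) //= mcoeffZ coefU eqxx mulr1 mxE big1 ?addr0 // => l nl.
    by rewrite mcoeffZ coefU nth_uniq // (inj_eq val_inj) (negPf nl) mulr0.
  pose dm (k : 'I_n) : M := \sum_(j < n) invmx B k j *: << nth x0 s j >>.
  pose d x : M := if insub (index x s) is Some k then dm k else 0.
  have dE (k : 'I_n) : d (nth x0 s k) = dm k.
    rewrite /d; case: insubP => [k' _ e|]; last by rewrite index_uniq ?ltn_ord.
    by congr (dm _); apply/val_inj; rewrite /= e index_uniq.
  have sumE (C : 'M[F]_n) (g h : T -> M) (i : 'I_n) : C \in unitmx ->
      (forall j : 'I_n, g (nth x0 s j) = \sum_(k < n) invmx C j k *: h (nth x0 s k)) ->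
      \sum_(j < n) C i j *: g (nth x0 s j) = h (nth x0 s i).
    move=> uC hg; under eq_bigr => j _ do rewrite hg scaler_sumr.
    rewrite exchange_big /=.
    transitivity (\sum_(k < n) (i == k)%:R *: h (nth x0 s k)); last first.
      rewrite (bigD1 i) //= eqxx scale1r big1 ?addr0 // => k.
      by rewrite eq_sym => /negPf ->; rewrite scale0r.
    apply: eq_bigr => k _; have := congr1 (fun C1 : 'M_n => C1 i k) (mulmxV uC).
    rewrite !mxE => <-; rewrite scaler_suml; apply: eq_bigr => j _.
    by rewrite scalerA.
  exists d => x e; have [k <-] := idx x e; rewrite dE; split.
  - apply/qlatticeP => y; rewrite mcoeffB raddf_sum coefU /=.
    case: (boolP (y \in s)) => ys; last first.
      rewrite big1 => [|j _].
        case: eqP => [e1|_]; last by rewrite subr0; exact: qA0.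
        by rewrite -e1 mem_nth in ys.
      rewrite mcoeffZ coefU; case: eqP => [e1|]; last by rewrite mulr0.
      by rewrite -e1 mem_nth in ys.
    have /idx[l <-] : wt y = la by apply/eqP; rewrite -sP.
    rewrite (bigD1 l) //= mcoeffZ coefU eqxx mulr1 big1 => [|j nl].
      by rewrite addr0 nth_uniq // (inj_eq val_inj).
    by rewrite mcoeffZ coefU nth_uniq // (inj_eq val_inj) (negPf nl) mulr0.
  - move=> y; apply: contraNeq => ny; rewrite raddf_sum big1 // => j _ /=.
    rewrite mcoeffZ coefU; case: eqP => [e1|]; last by rewrite mulr0.
    by move: ny; rewrite -e1 -sP mem_nth.
  - rewrite /dm linear_sum /=; under eq_bigr => j _ do rewrite linearZ /= lextU.
    apply: (sumE (invmx B) v (fun x => << x >>)) => [|j]; first by rewrite unitmx_inv.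
    by rewrite invmxK.
  - rewrite vE linear_sum /=; under eq_bigr => j _ do rewrite linearZ /= lextU.
    by apply: (sumE B d (fun x => << x >>)) => // j; rewrite dE.
have [D HD] := choice key.
exists (fun x => D (wt x) x); split=> x.
- by have [] := HD _ x erefl.
- by have [] := HD _ x erefl.
- by have [] := HD _ x erefl.
- have [_ _ _ <-] := HD _ x erefl; apply: eq_lext => y /vw -> //.
Qed.

End FreeLattice.
Arguments lattice {F} R T.

Section StringFamily.
Variables (F : fieldType) (R : local_ring F) (T : choiceType).
Local Notation A := (lr_A R).
Local Notation q := (lr_q R).
Local Notation M := {malg F[T]}.
Local Notation L := (lattice R T).
Local Notation qlat := (qlat R).
Implicit Types (u v w z : M) (x y : T).

Variables (p : F) (bp : base R p) (e f : {linear M -> M}).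
Variables (W : zmodType) (wt : T -> W) (al : W) (nW : W -> int).

(** The weight space, described by the support of its vectors. *)
Definition inW (la : W) : set M := [set v | forall y, v@_y != 0 -> wt y = la].

Hypothesis e_wt : forall x, inW (wt x + al) (e << x >>).
Hypothesis f_wt : forall x, inW (wt x - al) (f << x >>).
Hypothesis nW_al : forall la, nW (la + al) = nW la + 2.
Hypothesis ef : forall x, e (f << x >>) - f (e << x >>) = br p (nW (wt x)) *: << x >>.
Hypothesis wt_fin : forall la, exists s : seq T, forall x, wt x = la -> x \in s.
Hypothesis wt_nil : forall x, exists n, forall y, wt y <> wt x + al *+ n.

Variables (eps phi : T -> nat) (et ft : T -> option T) (sv : T -> M).
Hypothesis wt_phi : forall x, nW (wt x) = (phi x)%:Z - (eps x)%:Z.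
Hypothesis ft_et : forall x y, ft x = Some y <-> et y = Some x.
Hypothesis ft_some : forall x y, ft x = Some y ->
  [/\ eps y = (eps x).+1, phi x = (phi y).+1 & wt y = wt x - al].
Hypothesis ft_none : forall x, ft x = None -> phi x = 0%N.
Hypothesis et_none : forall x, et x = None -> eps x = 0%N.
Hypothesis sv_cong : forall x, qlat L (sv x - << x >>).
Hypothesis sv_wt : forall x, inW (wt x) (sv x).
Hypothesis f_sv : forall x, f (sv x) = br p (eps x).+1 *: oapp sv 0 (ft x).

Let p0 : p != 0 := base_neq0 bp.
Let p1 : forall k, (0 < k)%N -> 1 - p ^+ k != 0 := base_1B bp.
Let brn0 (n : nat) : br p n.+1 != 0.
Proof. exact: (br_base_neq0 bp (isT : n.+1%:Z != 0)). Qed.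

Lemma inW_lin la (g : {linear M -> M}) mu v :
  (forall x, wt x = la -> inW mu (g << x >>)) -> inW la v -> inW mu (g v).
Proof.
move=> hg hv y; rewrite [v]malg_sum linear_sum raddf_sum /= => ny.
have [x xs nx] : exists2 x, x \in msupp v & (g (v@_x *: << x >>))@_y != 0.
  apply: contrapT => h; case/negP: ny; rewrite big_seq big1 // => x xs.
  by apply/eqP; apply: contrapT => /negP nx; apply: h; exists x.
move: nx; rewrite linearZ mcoeffZ mulf_eq0 negb_or => /andP[vx gx].
exact: (hg x (hv x vx)).
Qed.

Lemma e_inW la v : inW la v -> inW (la + al) (e v).
Proof. by apply: inW_lin => x <-. Qed.

Lemma f_inW la v : inW la v -> inW (la - al) (f v).
Proof. by apply: inW_lin => x <-. Qed.

Lemma ef_inW la v : inW la v -> e (f v) - f (e v) = br p (nW la) *: v.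
Proof.
move=> hv.
have E (g h : {linear M -> M}) : g (h v) = \sum_(x <- msupp v) v@_x *: g (h << x >>).
  by rewrite {1}[v]malg_sum !linear_sum; apply: eq_bigr => x _; rewrite !linearZ.
rewrite !E [in RHS](malg_sum v) scaler_sumr -sumrB big_seq [RHS]big_seq.
apply: eq_bigr => x; rewrite -mcoeff_neq0 => /hv <-.
by rewrite -scalerBr ef !scalerA mulrC.
Qed.

Lemma nW_alN la : nW (la - al) = nW la - 2.
Proof. by rewrite -[in RHS](subrK al la) nW_al addrK. Qed.

Lemma e_nil v : exists n, iter n e v = 0.
Proof.
have key x : exists n, iter n e << x >> = 0.
  have [n hn] := wt_nil x; exists n; apply/malgP => y; rewrite mcoeff0; apply/eqP.
  have h : inW (wt x + al *+ n) (iter n e << x >>).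
    elim: n {hn} => [|n IH] /=; last by rewrite mulrSr addrA; apply: e_inW.
    move=> z; rewrite mulr0n addr0 coefU; case: (eqVneq x z) => [->//|_].
    by rewrite eqxx.
  by apply: contrapT => /negP /h /hn.
have iter_mono m n u : iter n e u = 0 -> iter (m + n) e u = 0.
  by rewrite iterD => ->; elim: m => //= m ->; rewrite linear0.
have [N hN] : exists N, forall x, x \in (msupp v : seq T) -> iter N e << x >> = 0.
  elim: (msupp v : seq T) => [|x s [N hN]]; first by exists 0%N.
  have [n hn] := key x; exists (n + N)%N => y; rewrite inE => /orP[/eqP ->|/hN].
    by rewrite addnC; apply: iter_mono.
  exact: iter_mono.
exists N; have iter_lin n u : iter n e u = \sum_(x <- msupp u) u@_x *: iter n e << x >>.
  elim: n => [|n IH] /=; first exact: malg_sum.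
  by rewrite IH linear_sum; apply: eq_bigr => x _; rewrite linearZ.
by rewrite iter_lin big_seq big1 // => x /hN ->; rewrite scaler0.
Qed.

Lemma iter_f_sv n x : (n <= phi x)%N -> exists2 y, iter n (obind ft) (Some x) = Some y &
  iter n f (sv x) = (\prod_(k < n) br p (eps x + k).+1) *: sv y /\
  [/\ eps y = (eps x + n)%N, phi x = (phi y + n)%N & wt y = wt x - al *+ n].
Proof.
elim: n => [_|n IH hn].
  by exists x => //; rewrite big_ord0 scale1r addn0 addn0 mulr0n subr0.
have [y ey [fy [h1 h2 h3]]] := IH (ltnW hn).
case E: (ft y) => [y'|]; last by have := ft_none E; move: h2 hn => ->; lia.
have [h4 h5 h6] := ft_some E.
exists y'; first by rewrite /= ey.
rewrite /= fy linearZ /= f_sv E /= scalerA big_ord_recr /= h1; split=> //.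
by rewrite h4 h1 h2 h5 h6 h3 mulrSr opprD addrA; split=> //; lia.
Qed.

(** By induction along the string. At its top, the power of f that kills the
    string vector is determined by its weight, so [killed_by_e] applies; one
    step further down, the value follows from the commutation relation and the
    identity [br_string]. *)
Lemma e_sv x : e (sv x) = br p (phi x).+1 *: oapp sv 0 (et x).
Proof.
move En : (eps x) => n; elim: n x En => [|n IH] x En.
  case E: (et x) => [y|].
    by have [] := ft_some ((ft_et _ _).2 E); rewrite En.
  rewrite /= scaler0; apply: (@killed_by_e _ p M e f (fun n v => exists2 la, inW la v & nW la = n) p0 p1 _ _ _ (phi x)).
  - by move=> n v [la h <-]; exists (la + al); [exact: e_inW | rewrite nW_al].
  - by move=> n v [la h <-]; exists (la - al); [exact: f_inW | rewrite nW_alN].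
  - by move=> n v [la h <-]; exact: ef_inW.
  (* at the top of the string the weight is phi x *)
  - by exists (wt x) => //; rewrite wt_phi En subr0.
  - have [y ey [fy [h1 h2 h3]]] := iter_f_sv (leqnn (phi x)).
    rewrite /= fy linearZ /= f_sv; case E1: (ft y) => [y'|]; last by rewrite !scaler0.
    by have [_ h5 _] := ft_some E1; lia.
  - exact: e_nil.
case E: (et x) => [y|]; last by have := et_none E; rewrite En.
have E' := (ft_et _ _).2 E; have [h1 h2 h3] := ft_some E'.
have hx : sv x = (br p (eps y).+1)^-1 *: f (sv y).
  by rewrite f_sv E' scalerA mulVf ?brn0 // scale1r.
have hy := ef_inW (@sv_wt y); move/eqP: hy; rewrite subr_eq => /eqP hy.
have ey : eps y = n by lia.
have hfe : f (e (sv y)) = (br p (phi y).+1 * br p (eps y)) *: sv y.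
  rewrite (IH y ey) linearZ /=; case E1: (et y) => [z|].
    have Ez := (ft_et _ _).2 E1; have [h4 _ _] := ft_some Ez.
    by rewrite /= f_sv Ez /= h4 scalerA.
  by rewrite /= linear0 scaler0 (et_none E1) br0 mulr0 scale0r.
rewrite {1}hx linearZ /= hy hfe -scalerDl scalerA; congr (_ *: _).
have hs := br_string p0 (p1 (ltn0Sn 1)) (phi y) (eps y).
rewrite wt_phi [X in _ * X]addrC (_ : (phi y).+1%:Z = (phi y)%:Z + 1); last by lia.
rewrite hs -h2 (_ : (eps y).+1%:Z = (eps y)%:Z + 1); last by lia.
rewrite mulrCA mulVf ?mulr1 //; have := brn0 (eps y).
by rewrite (_ : (eps y).+1%:Z = (eps y)%:Z + 1); last by lia.
Qed.

(** * Divided powers and Kashiwara operators *)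

Definition qf (n : nat) : F := \prod_(1 <= k < n.+1) br p k.
Definition divp (n : nat) (v : M) : M := (qf n)^-1 *: iter n f v.

Lemma qf_neq0 n : qf n != 0.
Proof.
rewrite /qf big_nat prodf_seq_neq0; apply/allP => k _.
by apply/implyP => /andP[k1 _]; move: k1; case: (k : nat) => // k' _; exact: brn0.
Qed.

Fact divp_linear n : linear (divp n).
Proof.
have h : linear (iter n f).
  by move=> c u v; elim: n => //= n ->; rewrite linearP.
by move=> c u v; rewrite /divp h scalerDr !scalerA mulrC.
Qed.
HB.instance Definition _ n := GRing.isLinear.Build F M M _ (divp n) (divp_linear n).

(** The divided powers move a vector at the top of a string down without
    coefficient. *)
Lemma divp_sv n x : eps x = 0%N -> divp n (sv x) = oapp sv 0 (iter n (obind ft) (Some x)).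
Proof.
move=> e0; case: (leqP n (phi x)) => hn.
  have [y ey [fy _]] := iter_f_sv hn.
  rewrite /divp fy ey scalerA e0 [X in X *: _](_ : _ = 1) ?scale1r //.
  rewrite /qf big_add1 big_mkord; under [X in _ * X]eq_bigr => k _ do rewrite add0n.
  by rewrite mulVf //; have := qf_neq0 n; rewrite /qf big_add1 big_mkord.
have [y ey [fy [h1 h2 h3]]] := iter_f_sv (leqnn (phi x)).
have ny : ft y = None by case E: (ft y) => [z|] //; have [_ h4 _] := ft_some E; lia.
have hN : iter n (obind ft) (Some x) = None.
  rewrite -(subnK hn) iterD /= ey /= ny.
  by elim: (n - _)%N => //= k ->.
rewrite hN /divp -{2}(subnK hn) iterD /= fy linearZ /= f_sv ny !scaler0.
by rewrite (_ : iter _ f 0 = 0) ?scaler0 //; elim: (n - _)%N => //= k ->; rewrite linear0.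
Qed.

(** The string vectors are unitriangular modulo q in each finite weight space,
    so that the coordinates of the basis vectors with respect to them are
    integral. *)
Lemma inv_exists : exists d : T -> M, [/\ forall x, qlat L (d x - << x >>),
    forall x y, (d x)@_y != 0 -> wt y = wt x,
    forall x, lext sv (d x) = << x >> & forall x, lext d (sv x) = << x >>].
Proof. exact: inverse_family. Qed.

Definition invf : T -> M := sval (cid inv_exists).

Let d_cong x : qlat L (invf x - << x >>).
Proof. by rewrite /invf; case: cid => d []. Qed.
Let d_wt x : inW (wt x) (invf x).
Proof. by rewrite /invf; case: cid => d [_ h] /= _ _ y /h. Qed.
Let svK u : lext sv (lext invf u) = u.
Proof.
rewrite lext_comp -[RHS]lext_id; apply: eq_lext => x _.
by rewrite /invf; case: cid => d [].
Qed.
Let dK u : lext invf (lext sv u) = u.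
Proof.
rewrite lext_comp -[RHS]lext_id; apply: eq_lext => x _.
by rewrite /invf; case: cid => d [].
Qed.

Definition U0 (o : option T) : M := oapp (fun x => << x >>) 0 o.
(** The operators that move the string vectors along the strings; they are
    shown below to be the Kashiwara operators. *)
Definition kE (u : M) : M := lext sv (lext (fun x => U0 (et x)) (lext invf u)).
Definition kF (u : M) : M := lext sv (lext (fun x => U0 (ft x)) (lext invf u)).
Fact kE_linear : linear kE. Proof. by move=> c u v; rewrite /kE !linearP. Qed.
Fact kF_linear : linear kF. Proof. by move=> c u v; rewrite /kF !linearP. Qed.
HB.instance Definition _ := GRing.isLinear.Build F M M _ kE kE_linear.
HB.instance Definition _ := GRing.isLinear.Build F M M _ kF kF_linear.

Lemma lext_U0 o : lext sv (U0 o) = oapp sv 0 o.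
Proof. by case: o => [x|]; rewrite /U0 /= ?lextU ?linear0. Qed.

Lemma kE_sv x : kE (sv x) = oapp sv 0 (et x).
Proof. by rewrite /kE -[sv x]lextU dK lextU lext_U0. Qed.

Lemma kF_sv x : kF (sv x) = oapp sv 0 (ft x).
Proof. by rewrite /kF -[sv x]lextU dK lextU lext_U0. Qed.

Lemma sv_sum u : u = \sum_(x <- msupp (lext invf u)) (lext invf u)@_x *: sv x.
Proof. by rewrite -[LHS]svK. Qed.

Lemma lin_sv (g : {linear M -> M}) u :
  g u = \sum_(x <- msupp (lext invf u)) (lext invf u)@_x *: g (sv x).
Proof. by rewrite {1}(sv_sum u) linear_sum; apply: eq_bigr => x _; rewrite linearZ. Qed.

(** Since e shifts the string vectors with nonzero coefficients, a vector
    killed by e is a combination of string vectors at the top of their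
    strings. *)
Lemma ker_e z x : e z = 0 -> (lext invf z)@_x != 0 -> et x = None.
Proof.
move=> ez ax; case E: (et x) => [y|] //; case/eqP: ax.
pose a := lext invf z.
have h1 : lext (fun x => U0 (ft x)) (lext (fun x => br p (phi x).+1 *: U0 (et x)) a) = 0.
  have -> : lext (fun x => br p (phi x).+1 *: U0 (et x)) a = lext invf (e z).
    rewrite -[RHS]/((lext invf \o e) z) [RHS]lin_sv; apply: eq_bigr => x' _.
    congr (_ *: _); rewrite /= e_sv linearZ /=; congr (_ *: _).
    by rewrite -lext_U0 dK.
  by rewrite ez !linear0.
have := congr1 (mcoeff x) h1; rewrite lext_comp mcoeff0.
rewrite (@eq_lext _ _ _ _ (fun x => (br p (phi x).+1 *+ (et x != None)) *: << x >>)); last first.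
  move=> x' _; rewrite linearZ /= /U0; case E': (et x') => [y'|] /=.
    by rewrite lextU ((ft_et _ _).2 E').
  by rewrite linear0 scaler0 scale0r.
by rewrite lext_diag E mulr1n => /eqP; rewrite mulf_eq0 (negPf (brn0 _)) => /eqP.
Qed.

Lemma invf_inW la z x : inW la z -> (lext invf z)@_x != 0 -> wt x = la.
Proof.
move=> hz; have: inW la (lext invf z); last by apply.
by apply: (inW_lin (la := la)) => // y <- x'; rewrite /= lextU => /d_wt.
Qed.

(** By [ker_e] a vector killed by e is a combination of tops of strings, which
    all have the same length if the vector is a weight vector. The last
    hypothesis says that k does not exceed this length; otherwise the divided
    power would vanish. *)
Lemma kE_divp k la z : e z = 0 -> inW la z -> (divp k z = 0 -> z = 0) ->
  kE (divp k z) = if k is k'.+1 then divp k' z else 0.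
Proof.
move=> ez hz nz; case: (eqVneq z 0) => [->|z0]; first by case: k {nz} => *; rewrite !linear0.
have E0 x : (lext invf z)@_x != 0 -> et x = None /\ eps x = 0%N.
  by move=> /(ker_e ez) h; split=> //; apply: et_none.
have Ek x : (lext invf z)@_x != 0 -> iter k (obind ft) (Some x) != None.
  move=> ax; have [_ ex] := E0 x ax; case: (leqP k (phi x)) => hk.
    by have [y -> _] := iter_f_sv hk.
  case/negP: z0; apply/eqP/nz; rewrite (lin_sv (divp k)) big_seq big1 //= => y.
  rewrite -mcoeff_neq0 => ay; have [_ ey] := E0 y ay; rewrite divp_sv //.
  have hyx : phi y = phi x.
    have := wt_phi y; have := wt_phi x.
    by rewrite ex ey (invf_inW hz ax) (invf_inW hz ay) !subr0 => -> [].
  have [y1 ey1 [_ [_ h2 _]]] := iter_f_sv (leqnn (phi y)).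
  have ny : ft y1 = None by case E: (ft y1) => [z1|] //; have [_ h4 _] := ft_some E; lia.
  have hk' : (phi y < k)%N by rewrite hyx.
  rewrite -(subnK hk') iterD /= ey1 /= ny.
  by rewrite (_ : iter _ _ None = None) ?scaler0 //; elim: (k - _)%N => //= j ->.
rewrite -[LHS]/((kE \o divp k) z) (lin_sv _ z).
transitivity (\sum_(x <- msupp (lext invf z)) (lext invf z)@_x *:
   (if k is k'.+1 then divp k' (sv x) else 0)); last first.
  case: {nz Ek} k => [|k]; first by rewrite big1 // => x _; rewrite scaler0.
  exact/esym/(lin_sv (divp k)).
rewrite big_seq [RHS]big_seq; apply: eq_bigr => x; rewrite -mcoeff_neq0 => ax.
congr (_ *: _); rewrite /=.
have [ex ex0] := E0 x ax; have := Ek x ax; rewrite divp_sv //.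
case: {nz Ek} k => [|k] /=; first by rewrite kE_sv ex.
rewrite divp_sv //; case: (iter k _ _) => [y|] //=.
by case E: (ft y) => [y'|] //= _; rewrite kE_sv ((ft_et _ _).1 E).
Qed.

Lemma kF_divp k z : e z = 0 -> kF (divp k z) = divp k.+1 z.
Proof.
move=> ez; rewrite -[LHS]/((kF \o divp k) z) [LHS]lin_sv [RHS](lin_sv (divp k.+1)).
rewrite big_seq [RHS]big_seq.
apply: eq_bigr => x; rewrite -mcoeff_neq0 => ax; congr (_ *: _); rewrite /=.
have ex := et_none (ker_e ez ax); rewrite !divp_sv //=.
by case: (iter k _ _) => [y|] /=; rewrite ?kF_sv ?linear0.
Qed.

Definition topv x := odflt x (iter (eps x) (obind et) (Some x)).

Lemma topvP x : [/\ eps (topv x) = 0%N, iter (eps x) (obind ft) (Some (topv x)) = Some x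
  & wt (topv x) = wt x + al *+ eps x].
Proof.
have key n y : eps y = n -> exists2 t, iter n (obind et) (Some y) = Some t &
    [/\ eps t = 0%N, iter n (obind ft) (Some t) = Some y & wt t = wt y + al *+ n].
  elim: n y => [|n IH] y hy; first by exists y => //; rewrite mulr0n addr0.
  case E: (et y) => [z|]; last by have := et_none E; rewrite hy.
  have E' := (ft_et _ _).2 E; have [h1 h2 h3] := ft_some E'.
  have [|t et1 [h4 h5 h6]] := IH z; first by lia.
  exists t; first by rewrite iterSr /= E.
  by rewrite /= h5 /= E' h6 h3 mulrS addrA subrK.
by have [t et1 h] := key _ x erefl; rewrite /topv et1.
Qed.

(** A string vector is a divided power of the string vector at the top of its
    string. *)
Lemma string_exists u : exists (s : seq W) (n : W -> nat) (y : W -> M) (x : W -> nat -> M),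
  [/\ uniq s,
    forall la, la \in s -> [/\ inW la (y la),
      forall k, (k < n la)%N -> [/\ e (x la k) = 0, inW (la + al *+ k) (x la k)
        & divp k (x la k) = 0 -> x la k = 0]
      & y la = \sum_(0 <= k < n la) divp k (x la k)]
   & u = \sum_(la <- s) y la].
Proof.
pose a := lext invf u; pose S := (msupp a : seq T).
pose N := (\max_(x <- S) eps x).+1.
pose x la k := \sum_(t <- S | (wt t == la) && (eps t == k)) a@_t *: sv (topv t).
pose y la := \sum_(t <- S | wt t == la) a@_t *: sv t.
have topS t : divp (eps t) (sv (topv t)) = sv t.
  by have [h1 h2 h3] := topvP t; rewrite divp_sv // h2.
have dx la k : divp k (x la k) = \sum_(t <- S | (wt t == la) && (eps t == k)) a@_t *: sv t.
  rewrite linear_sum; apply: eq_bigr => t /andP[_ /eqP <-] /=.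
  by rewrite linearZ /= topS.
have inW_sum la (P : pred T) (G : T -> M) : (forall t, P t -> inW la (G t)) ->
    inW la (\sum_(t <- S | P t) a@_t *: G t).
  move=> h z; rewrite raddf_sum /= => nz; apply: contrapT => nla; case/eqP: nz.
  apply: big1 => t Pt; rewrite mcoeffZ.
  by case: (eqVneq ((G t)@_z) 0) => [->|/(h t Pt)//]; rewrite mulr0.
exists (undup [seq wt t | t <- S]), (fun=> N), y, x; split; first exact: undup_uniq.
  move=> la _; split; first by apply: inW_sum => t /eqP <-.
    move=> k _; split.
    - rewrite linear_sum big1 // => t /andP[_ /eqP ek]; rewrite linearZ /= e_sv.
      have [h1 h2 h3] := topvP t; case E: (et (topv t)) => [z|]; last by rewrite !scaler0.
      by have [] := ft_some ((ft_et _ _).2 E); rewrite h1.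
    - apply: inW_sum => t /andP[/eqP <- /eqP <-].
      by have [_ _ <-] := topvP t.
    - rewrite dx => h0; rewrite /x big_seq_cond big1 // => t /andP[tS ht].
      have := congr1 (mcoeff t) (congr1 (lext invf) h0).
      rewrite linear0 linear_sum raddf_sum mcoeff0 /=.
      rewrite big_mkcond /= (bigD1_seq t tS) ?fset_uniq //=.
      rewrite ht.
      rewrite linearZ /= mcoeffZ -[sv t]lextU dK coefU eqxx mulr1 big1 ?addr0.
        by move=> ->; rewrite scale0r.
      move=> t' ntt'; case: ifP => // _; rewrite linearZ /= mcoeffZ -[sv t']lextU dK coefU.
      by rewrite (negPf ntt') mulr0.
  under eq_bigr => k _ do rewrite dx.
  rewrite big_mkord (exchange_big_dep (fun t => wt t == la)) /=; last by move=> k t _ /andP[].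
  rewrite /y big_seq_cond [RHS]big_seq_cond; apply: eq_bigr => t /andP[tS wl].
  have ht : (eps t < N)%N by rewrite ltnS; apply: (leq_bigmax_seq t).
  rewrite (bigD1 (Ordinal ht)) /=; last by rewrite wl eqxx.
  rewrite big1 ?addr0 // => k /andP[/andP[_ /eqP ek] nk].
  by case/negP: nk; apply/eqP/val_inj; rewrite /= ek.
rewrite {1}(sv_sum u) -/a -/S /y (exchange_big_dep predT) //=.
rewrite big_seq [RHS]big_seq; apply: eq_bigr => t tS.
rewrite big_mkcond (bigD1_seq (wt t)) /= ?undup_uniq ?mem_undup ?map_f //.
by rewrite eqxx big1 ?addr0 // => la; rewrite eq_sym => /negPf ->.
Qed.

Lemma kE_lat u : L u -> L (kE u).
Proof.
have svL x : L (sv x) by apply: lattice_cong (sv_cong x) (lattice_U R x).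
have dL x : L (invf x) by apply: lattice_cong (d_cong x) (lattice_U R x).
move=> Lu; apply: lext_lattice => //; apply: lext_lattice; last exact: lext_lattice.
by move=> x; case: (et x) => [y|]; [exact: lattice_U | exact: (lat0 (lattice_sub R T))].
Qed.

Lemma kF_lat u : L u -> L (kF u).
Proof.
have svL x : L (sv x) by apply: lattice_cong (sv_cong x) (lattice_U R x).
have dL x : L (invf x) by apply: lattice_cong (d_cong x) (lattice_U R x).
move=> Lu; apply: lext_lattice => //; apply: lext_lattice; last exact: lext_lattice.
by move=> x; case: (ft x) => [y|]; [exact: lattice_U | exact: (lat0 (lattice_sub R T))].
Qed.

Lemma kE_cong x : qlat L (kE << x >> - U0 (et x)).
Proof.
have svL y : L (sv y) by apply: lattice_cong (sv_cong y) (lattice_U R y).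
have U0L o : L (U0 o) by case: o => [y|]; [exact: lattice_U | exact: (lat0 (lattice_sub R T))].
rewrite /kE lextU; apply: (qlat_trans (lattice_sub R T)); last first.
  have := @lext_qlattice _ R _ (fun x => U0 (et x)) _ (fun y => U0L (et y)) (d_cong x).
  by rewrite linearB /= lextU; exact.
apply: lext_cong => //; apply: lext_lattice => //.
exact: lattice_cong (d_cong x) (lattice_U R x).
Qed.

Lemma kF_cong x : qlat L (kF << x >> - U0 (ft x)).
Proof.
have svL y : L (sv y) by apply: lattice_cong (sv_cong y) (lattice_U R y).
have U0L o : L (U0 o) by case: o => [y|]; [exact: lattice_U | exact: (lat0 (lattice_sub R T))].
rewrite /kF lextU; apply: (qlat_trans (lattice_sub R T)); last first.
  have := @lext_qlattice _ R _ (fun x => U0 (ft x)) _ (fun y => U0L (ft y)) (d_cong x).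
  by rewrite linearB /= lextU; exact.
apply: lext_cong => //; apply: lext_lattice => //.
exact: lattice_cong (d_cong x) (lattice_U R x).
Qed.

(** The Kashiwara operators exist as linear maps, are computed by any
    string decomposition, and act on the lattice as the shifts of the strings. *)
Theorem kashiwara_operators : exists kE kF : {linear M -> M},
  [/\ forall k la z, e z = 0 -> inW la z -> (divp k z = 0 -> z = 0) ->
        kE (divp k z) = (if k is k'.+1 then divp k' z else 0) /\ kF (divp k z) = divp k.+1 z,
      forall u, exists (s : seq W) (n : W -> nat) (y : W -> M) (x : W -> nat -> M),
        [/\ uniq s,
        forall la, la \in s -> [/\ inW la (y la),
          forall k, (k < n la)%N -> [/\ e (x la k) = 0, inW (la + al *+ k) (x la k)
            & divp k (x la k) = 0 -> x la k = 0]
          & y la = \sum_(0 <= k < n la) divp k (x la k)]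
        & u = \sum_(la <- s) y la],
      forall u, L u -> L (kE u) /\ L (kF u)
    & forall x, qlat L (kE << x >> - U0 (et x)) /\ qlat L (kF << x >> - U0 (ft x))].
Proof.
exists kE, kF; split.
- by move=> k la z ez hz nz; split; [exact: (kE_divp ez hz nz) | exact: (kF_divp k ez)].
- exact: string_exists.
- by move=> u Lu; split; [exact: kE_lat | exact: kF_lat].
- by move=> x; split; [exact: kE_cong | exact: kF_cong].
Qed.

End StringFamily.

Local Close Scope classical_set_scope.

(** * Crystal bases from families of exact strings *)
Local Open Scope classical_set_scope.

Lemma A0_set : A0 = [set x | x \in lr_A Rq].
Proof. by apply/seteqP; split=> x /RqP. Qed.

Lemma qi_pairing (i : I) (la : weight) : q ^ pairing (hcheck i *~ di i) la = qi i ^ la.1 i.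
Proof. by rewrite pairing_hcheckM /qi exprz_exp. Qed.

Lemma qi_pairingN (i : I) (la : weight) :
  q ^ pairing (- (hcheck i *~ di i)) la = qi i ^ (- la.1 i).
Proof. by rewrite pairing_hcheckMN /qi exprz_exp mulrN. Qed.

Lemma q_inj (m n : int) : q ^ m = q ^ n -> m = n.
Proof. by rewrite -Rq_q => /qexpz_inj. Qed.

Lemma qX_neq0 (m : int) : q ^ m != 0.
Proof. by rewrite -Rq_q expfz_neq0 // lr_q0. Qed.

Lemma scale_shift (F : fieldType) (V : lmodType F) (x : F) (m n : int) (u w : V) :
  x != 0 -> x ^ (- m) *: u = x ^ n *: w -> u = x ^ (m + n) *: w.
Proof.
by move=> x0 e; rewrite expfzDr // -scalerA -e scalerA -expfzDr // subrr expr0z scale1r.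
Qed.

Lemma sum_pred (V : zmodType) (m : nat) (G : nat -> V) (D : nat -> nat -> V) :
  (forall k, (k < m)%N -> G k = if k is k'.+1 then D k' k else 0) ->
  \sum_(1 <= k < m) D k.-1 k = \sum_(0 <= k < m) G k.
Proof.
case: m => [|m] h; first by rewrite !big_geq.
rewrite [RHS]big_ltn // h // add0r; apply: eq_big_nat => k /andP[k1 km].
by rewrite h //; case: k k1 {km}.
Qed.

Lemma sum_coef (F : fieldType) (T : choiceType) (s : seq T) (c : T -> F) x :
  uniq s -> x \in s -> (\sum_(j <- s) c j *: << j >> : {malg F[T]})@_x = c x.
Proof.
move=> us xs; rewrite raddf_sum (bigD1_seq x) //= mcoeffZ coefU.
rewrite eqxx mulr1 big1 ?addr0 // => y /negPf nyx.
by rewrite mcoeffZ coefU nyx mulr0.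
Qed.

Lemma sum_coef_ord (F : fieldType) (T : choiceType) n (g : 'I_n -> T) (c : 'I_n -> F) j :
  injective g -> (\sum_(k < n) c k *: << g k >> : {malg F[T]})@_(g j) = c j.
Proof.
move=> gi; rewrite raddf_sum (bigD1 j) //= mcoeffZ coefU eqxx mulr1.
rewrite big1 ?addr0 // => k nkj; rewrite mcoeffZ coefU (inj_eq gi) (negPf nkj).
exact: mulr0.
Qed.

Section Cosets.
Variables (M : lmodType Kq) (L : set M).
Hypothesis HL : submodule_over [set x | x \in lr_A Rq] L.

Lemma in_coset u w : coset L u w <-> qlat Rq L (w - u).
Proof.
rewrite /qlat /= Rq_q; split=> [[a La ->]|[a La e]].
  by exists a; rewrite // addrC addKr.
by exists a; rewrite // -e addrCA subrr addr0.
Qed.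

Lemma coset_eq u v : coset L u = coset L v <-> qlat Rq L (u - v).
Proof.
split=> [e|h]; first by apply/in_coset; rewrite -e; apply/in_coset; rewrite subrr; exact: qlat0.
apply/seteqP; split=> w /in_coset hw; apply/in_coset.
  exact: (qlat_trans HL hw h).
by apply: (qlat_trans HL hw); rewrite -opprB; exact: qlatN.
Qed.

Lemma induced_coset (K : M -> M) u : linear K -> (forall v, L v -> L (K v)) ->
  induced L K (coset L u) = coset L (K u).
Proof.
move=> lK LK.
have KB v w : K (v - w) = K v - K w.
  by have := lK (-1) w v; rewrite !scaleN1r ![- _ + _]addrC.
have qK v : qlat Rq L v -> qlat Rq L (K v).
  case=> a La ->; exists (K a); first exact: LK.
  have K0 : K 0 = 0 by rewrite -[X in K X](subrr 0) KB subrr.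
  by have := lK (lr_q Rq) a 0; rewrite addr0 K0 addr0.
have E v : coset L u v -> coset L (K v) = coset L (K u).
  by move/in_coset=> h; apply/coset_eq; rewrite -KB; exact: qK.
apply/seteqP; split=> [w [v hv]|w hw]; first by rewrite (E v hv).
by exists u => //; apply/in_coset; rewrite subrr; exact: qlat0.
Qed.

End Cosets.

Section WeightPart.
Variables (F : fieldType) (T : choiceType) (W : zmodType) (wt : T -> W).
Local Notation M := {malg F[T]}.

Definition weight_part (la : W) : M -> M := lext (fun x => (wt x == la)%:R *: << x >>).

Lemma weight_partE la (v : M) y : (weight_part la v)@_y = if wt y == la then v@_y else 0.
Proof. by rewrite /weight_part lext_diag; case: eqP; rewrite ?mul1r ?mul0r. Qed.

Lemma weight_part_inW la v : inW wt la (weight_part la v).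
Proof. by move=> y; rewrite weight_partE; case: (eqVneq (wt y) la) => // _; rewrite eqxx. Qed.

Lemma weight_part_U la x : wt x = la -> weight_part la << x >> = << x >>.
Proof. by move=> e; rewrite /weight_part lextU e eqxx scale1r. Qed.

Lemma weight_partZ la c v : weight_part la (c *: v) = c *: weight_part la v.
Proof. exact: linearZ. Qed.

Lemma weight_partB la u v : weight_part la (u - v) = weight_part la u - weight_part la v.
Proof. exact: linearB. Qed.

Lemma weight_part0 la : weight_part la 0 = 0.
Proof. exact: linear0. Qed.

Lemma weight_part_qlat (R : local_ring F) la v :
  qlat R (lattice R T) v -> qlat R (lattice R T) (weight_part la v).
Proof.
apply: lext_qlattice => x; apply: (latZ (@lattice_sub _ R _)); last exact: lattice_U.
by case: eqP => _; rewrite ?rpred1 ?rpred0.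
Qed.

(** The projections to weight spaces are used to make vectors homogeneous
    after they have been constructed. *)
Lemma weight_part_shift (f : {linear M -> M}) (al la : W) v :
  (forall x, inW wt (wt x + al) (f << x >>)) -> f (weight_part la v) = weight_part (la + al) (f v).
Proof.
move=> hf; pose h1 x : M := (wt x == la)%:R *: << x >>.
pose h2 x : M := (wt x == la + al)%:R *: << x >>.
transitivity (lext (fun x => f (h1 x)) v).
  have -> : f (weight_part la v) = (f \o lext h1) v by [].
  by apply: lext_uniq => x _ /=; rewrite lextU.
have -> : weight_part (la + al) (f v) = (lext h2 \o f) v by [].
apply/esym/lext_uniq => x _ /=; rewrite /h1 linearZ /=; apply/malgP => y.
rewrite mcoeffZ -[lext h2 _]/(weight_part _ _) weight_partE -(inj_eq (addIr al) (wt x)).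
case: (eqVneq (f << x >>)@_y 0) => [->|/hf ->]; first by rewrite mulr0 if_same.
by case: ifP; rewrite ?mul1r ?mul0r.
Qed.

End WeightPart.

Section Packaging.
Variable T : choiceType.
Local Notation M := ({malg Kq[T]} : lmodType Kq).
Variables (wt : T -> weight) (rho : Uq_rep M).
Local Notation L := (lattice Rq T).
Local Notation qlat := (qlat Rq).
Variables (eps phi : I -> T -> nat) (et ft : I -> T -> option T) (sv : I -> T -> M).

Definition zbasis : set (set M) := [set b | exists x, b = coset L << x >>].

Section Weights.
Hypothesis Hq : forall h x, rep_q rho h << x >> = q ^ pairing h (wt x) *: << x >>.

Lemma weight_spaceP la v : wspace rho la v <-> inW wt la v.
Proof.
have E h : rep_q rho h v = lext (fun x => q ^ pairing h (wt x) *: << x >>) v.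
  by apply: lext_uniq => x _; exact: Hq.
split=> [hv y vy|hv h].
  apply: pairing_sep => h; apply: q_inj; apply: (mulIf vy).
  by have := congr1 (mcoeff y) (hv h); rewrite E lext_diag mcoeffZ.
rewrite E; apply/malgP => y; rewrite lext_diag mcoeffZ.
by case: (eqVneq v@_y 0) => [->|/hv ->] //; rewrite !mulr0.
Qed.

Lemma U_inW x : inW wt (wt x) (<< x >> : M).
Proof. by move=> y; rewrite coefU; case: (eqVneq x y) => [->//|_]; rewrite eqxx. Qed.

Lemma rep_q_shift (g : {linear M -> M}) (c : coweight -> int) h x :
  (forall v, rep_q rho h (g (rep_q rho (- h) v)) = q ^ c h *: g v) ->
  rep_q rho h (g << x >>) = q ^ (pairing h (wt x) + c h) *: g << x >>.
Proof.
move=> hg; have := hg << x >>; rewrite Hq !linearZ /= => e.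
have pN : pairing (- h) (wt x) = - pairing h (wt x).
  by rewrite /pairing opprD -sumrN -mulNr; congr (_ + _); apply: eq_bigr => j _; rewrite ffunE mulNr.
move: e; rewrite pN; apply: scale_shift; exact: (qX_neq0 1).
Qed.

Lemma rep_e_weight i x : inW wt (wt x + alpha i) (rep_e rho i << x >>).
Proof.
apply/weight_spaceP => h; rewrite (@rep_q_shift _ (fun h => pairing h (alpha i))) ?pairingD // => v.
exact: rep_qe.
Qed.

Lemma rep_f_weight i x : inW wt (wt x - alpha i) (rep_f rho i << x >>).
Proof.
apply/weight_spaceP => h; rewrite (@rep_q_shift _ (fun h => - pairing h (alpha i))) => [|v].
  by rewrite pairingD pairingN.
exact: rep_qf.
Qed.

End Weights.

(** The data from which a crystal basis is obtained: a basis of weight vectors,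
    with the combinatorial structure of a crystal, that is congruent modulo q
    for each i to a family of exact strings of f. *)
Record string_basis : Prop := StringBasis {
  sb_q : forall h x, rep_q rho h << x >> = q ^ pairing h (wt x) *: << x >>;
  sb_fin : forall la, exists s : seq T, forall x, wt x = la -> x \in s;
  sb_nil : forall i x, exists n, forall y, wt y <> wt x + alpha i *+ n;
  sb_phi : forall i x, (wt x).1 i = (phi i x)%:Z - (eps i x)%:Z;
  sb_inv : forall i x y, ft i x = Some y <-> et i y = Some x;
  sb_ft : forall i x y, ft i x = Some y ->
    [/\ eps i y = (eps i x).+1, phi i x = (phi i y).+1 & wt y = wt x - alpha i];
  sb_ft0 : forall i x, ft i x = None -> phi i x = 0%N;
  sb_et0 : forall i x, et i x = None -> eps i x = 0%N;
  sb_cong : forall i x, qlat L (sv i x - << x >>);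
  sb_wt : forall i x, inW wt (wt x) (sv i x);
  sb_f : forall i x, rep_f rho i (sv i x) = br (qi i) (eps i x).+1 *: oapp (sv i) 0 (ft i x)
}.
Hypothesis H : string_basis.

Let wspaceP la v : wspace rho la v <-> inW wt la v.
Proof. exact: weight_spaceP (sb_q H) la v. Qed.
Let e_inW1 i x : inW wt (wt x + alpha i) (rep_e rho i << x >>).
Proof. exact: (rep_e_weight (sb_q H)). Qed.
Let f_inW1 i x : inW wt (wt x - alpha i) (rep_f rho i << x >>).
Proof. exact: (rep_f_weight (sb_q H)). Qed.

Lemma ef1 i x : rep_e rho i (rep_f rho i << x >>) - rep_f rho i (rep_e rho i << x >>) =
  br (qi i) ((wt x).1 i) *: << x >>.
Proof.
rewrite rep_ef eqxx !(sb_q H) qi_pairing qi_pairingN -scalerBl scalerA.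
by rewrite /br mulrC.
Qed.

Lemma alpha_step i (la : weight) : (la + alpha i).1 i = la.1 i + 2.
Proof. by rewrite ffunE cartan_diag. Qed.

Definition ops i := @kashiwara_operators _ Rq T (qi i) (qi_base i) (rep_e rho i) (rep_f rho i)
  weight wt (alpha i) (fun la : weight => la.1 i) (@e_inW1 i) (@f_inW1 i) (alpha_step i) (ef1 i)
  (sb_fin H) (sb_nil H i) (eps i) (phi i) (et i) (ft i) (sv i) (sb_phi H i) (sb_inv H i)
  (@sb_ft H i) (@sb_ft0 H i) (@sb_et0 H i) (sb_cong H i) (@sb_wt H i) (sb_f H i).

Lemma kash_ops i : exists kE kF : {linear M -> M},
  [/\ forall u, kash_e rho i u = kE u /\ kash_f rho i u = kF u,
      forall u, L u -> L (kE u) /\ L (kF u)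
    & forall x, qlat L (kE << x >> - U0 Kq (et i x)) /\ qlat L (kF << x >> - U0 Kq (ft i x))].
Proof.
have [kE [kF [h1 h2 h3 h4]]] := ops i; exists kE, kF; split=> // u.
have key (s : seq weight) (n : weight -> nat) (y : weight -> M) (x : weight -> nat -> M) :
    (forall la, la \in s -> wspace rho la (y la) /\ string_decomp rho i la (y la) (n la) (x la)) ->
    u = \sum_(la <- s) y la ->
    \sum_(la <- s) \sum_(1 <= k < n la) divpow (rep_f rho i) i k.-1 (x la k) = kE u /\
    \sum_(la <- s) \sum_(0 <= k < n la) divpow (rep_f rho i) i k.+1 (x la k) = kF u.
  move=> hs ->; rewrite !linear_sum; split; rewrite big_seq [RHS]big_seq.
    apply: eq_bigr => la /hs[_ [hx ->]]; rewrite linear_sum.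
    apply: (sum_pred (D := fun k' k => divpow (rep_f rho i) i k' (x la k))) => k.
    by move=> /hx[e1 /wspaceP e2 e3]; exact: (h1 k _ _ e1 e2 e3).1.
  apply: eq_bigr => la /hs[_ [hx ->]]; rewrite linear_sum big_nat [RHS]big_nat.
  apply: eq_bigr => k /andP[_ /hx[e1 /wspaceP e2 e3]].
  exact/esym/(h1 k _ _ e1 e2 e3).2.
have [s [n [y [x [us hs eu]]]]] := h2 u.
have hs' la : la \in s -> wspace rho la (y la) /\ string_decomp rho i la (y la) (n la) (x la).
  move=> /hs[g1 g2 g3]; split; first exact/wspaceP.
  by split=> // k /g2[? /wspaceP ? ?].
have [k1 k2] := key s n y x hs' eu.
split; rewrite /kash_e /kash_f; apply: xget_unique.
- by exists s, n, y, x.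
- by move=> w [s' [n' [y' [x' [_ hs1 eu1 ->]]]]]; have [k3 _] := key _ _ _ _ hs1 eu1; exact: k3.
- by exists s, n, y, x.
- by move=> w [s' [n' [y' [x' [_ hs1 eu1 ->]]]]]; have [_ k3] := key _ _ _ _ hs1 eu1; exact: k3.
Qed.
Let LA : submodule_over [set x | x \in lr_A Rq] L := lattice_sub Rq T.

Let lc (o : option T) : set M := coset L (U0 Kq o).

Lemma lc_inj o o' : lc o = lc o' -> o = o'.
Proof.
have h x o1 : lc (Some x) = lc o1 -> Some x = o1.
  move=> /(coset_eq LA)/qlatticeP/(_ x); rewrite mcoeffB coefU eqxx.
  case: o1 => [y|] /=; last by rewrite mcoeff0 subr0 => /qA_1.
  rewrite coefU; case: (eqVneq y x) => [->//|_]; by rewrite subr0 => /qA_1.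
by case: o => [x|]; [exact: h | case: o' => [x /esym/h|]].
Qed.

Lemma zbasis_lc o : zbasis (lc o) <-> o <> None.
Proof.
split=> [[x /(@lc_inj _ (Some x)) ->] //|]; case: o => // x _; by exists x.
Qed.

Lemma induced_e i o : induced L (kash_e rho i) (lc o) = lc (obind (et i) o).
Proof.
have [kE [kF [h1 h2 h3]]] := kash_ops i.
have -> : kash_e rho i = kE :> (M -> M) by apply/funext => u; exact: (h1 u).1.
rewrite /lc induced_coset //; [|exact: linearP|by move=> v /h2[]].
case: o => [x|]; last by rewrite /U0 /= linear0.
by apply/(coset_eq LA); exact: (h3 x).1.
Qed.

Lemma induced_f i o : induced L (kash_f rho i) (lc o) = lc (obind (ft i) o).
Proof.
have [kE [kF [h1 h2 h3]]] := kash_ops i.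
have -> : kash_f rho i = kF :> (M -> M) by apply/funext => u; exact: (h1 u).2.
rewrite /lc induced_coset //; [|exact: linearP|by move=> v /h2[]].
case: o => [x|]; last by rewrite /U0 /= linear0.
by apply/(coset_eq LA); exact: (h3 x).2.
Qed.

Lemma coset_weightP la x : coset_weight rho L la (lc (Some x)) <-> la = wt x.
Proof.
split=> [[v [Lv /wspaceP hv /(coset_eq LA)/qlatticeP/(_ x)]]|->]; last first.
  by exists << x >>; split; [exact: lattice_U | apply/wspaceP; exact: U_inW |].
rewrite mcoeffB coefU eqxx; case: (eqVneq v@_x 0) => [->|/hv <-//].
by rewrite subr0 => /qA_1.
Qed.

Lemma U_basis (C : set Kq) : C = setT \/ C = A0 ->
  is_basis C [set v : M | forall x, C v@_x] (fun x => << x >> : M).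
Proof.
move=> hC; have C1 n : C n%:R.
  by case: hC => -> //; rewrite A0_set /= rpred_nat.
split=> [x y|v Cv|s c us _ e x xs].
- by rewrite coefU; exact: C1.
- exists (msupp v), (fun x => v@_x); split; [exact: fset_uniq | by move=> x _; exact: Cv |].
  exact: malg_sum.
- by have := congr1 (mcoeff x) e; rewrite sum_coef // mcoeff0.
Qed.

(** All conditions are read on the basis: the Kashiwara operators are linear,
    preserve the lattice and are congruent to et and ft on its basis. *)
Lemma string_crystal_basis : crystal_basis rho L zbasis.
Proof.
split.
- rewrite A0_set; split=> //; exists T, (fun x => << x >> : M); split.
    by have := U_basis (or_intror erefl); rewrite A0_set.
  suff <- : [set v : M | forall x, setT v@_x] = setT by exact: U_basis (or_introl erefl).
  by apply/seteqP; split.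
- split=> [b [x ->]|v Lv|n u c hu hinj e j].
  + by exists << x >>; [exact: lattice_U|].
  + have hc x : exists c : rat, qA Rq (v@_x - ratr c) by apply: A_residue; exact: Lv.
    have [c hc'] := choice hc.
    exists (size (msupp v)), (fun j => << tnth (in_tuple (msupp v)) j >>),
      (fun j => c (tnth (in_tuple (msupp v)) j)); split.
      by move=> j; split; [exact: lattice_U | exists (tnth (in_tuple (msupp v)) j)].
    apply/(coset_eq LA).
    rewrite -(big_tnth _ _ (msupp v) xpredT (fun x => ratr (c x) *: << x >>)) {1}[v]malg_sum -sumrB.
    apply: (qlat_sum LA) => x _ _; rewrite -scalerBl.
    by apply: (qlatqZ LA); [exact: hc' | exact: lattice_U].
  + have hx k : exists x, coset L (u k) = lc (Some x) by have [_ [x]] := hu k; exists x.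
    have [f hf] := choice hx.
    have fi : injective f by move=> k l ekl; apply: hinj; rewrite !hf ekl.
    move/(coset_eq LA): e; rewrite subr0 => e.
    apply: ratr_qA; have : qlat L (\sum_(k < n) ratr (c k) *: << f k >> : M).
      rewrite -[X in qlat L X](subrK (\sum_(k < n) ratr (c k) *: u k)).
      apply: (qlatD LA) => //; rewrite -sumrB; apply: (qlat_sum LA) => k _ _.
      rewrite -scalerBr; apply: (qlatZ LA); first exact: ratr_A.
      by apply/(coset_eq LA); rewrite hf.
    by move/qlatticeP/(_ (f j)); rewrite (sum_coef_ord _ _ fi).
- have inWsum (s : seq weight) (x : weight -> M) : uniq s ->
      (forall la, la \in s -> inW wt la (x la)) -> forall la y, la \in s -> wt y = la ->
      (\sum_(la <- s) x la)@_y = (x la)@_y.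
    move=> us hx la y las wy; rewrite raddf_sum (bigD1_seq la) //= big_seq_cond.
    rewrite big1 ?addr0 // => mu /andP[mus nmu]; apply/eqP; apply: contraNT nmu => /(hx _ mus).
    by rewrite wy => ->.
  split=> [la v [] //|v Lv|s x us hx e la las].
  + pose y la : M := \sum_(x <- msupp v | wt x == la) v@_x *: << x >>.
    exists (undup [seq wt x | x <- msupp v]), y; split; first exact: undup_uniq.
    * move=> la _; split; first by apply: (lat_sum LA) => x _ _; apply: (latZ LA); [exact: Lv | exact: lattice_U].
      apply/wspaceP => z; apply: contraNeq => nz; rewrite raddf_sum big1 // => x /eqP wx /=.
      rewrite mcoeffZ coefU; case: (eqVneq x z) => [xz|_]; last exact: mulr0.
      by move: nz; rewrite -xz wx eqxx.
    * rewrite {1}[v]malg_sum (exchange_big_dep predT) //=.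
      rewrite big_seq [RHS]big_seq; apply: eq_bigr => t tS.
      rewrite big_mkcond (bigD1_seq (wt t)) /= ?undup_uniq ?mem_undup ?map_f //.
      by rewrite eqxx big1 ?addr0 // => la; rewrite eq_sym => /negPf ->.
  + apply/malgP => y; rewrite mcoeff0.
    have hx' mu : mu \in s -> inW wt mu (x mu) by move=> /hx[_ /wspaceP].
    case: (eqVneq (wt y) la) => wy; last first.
      by apply/eqP; apply: contraNT wy => /(hx' _ las) ->.
    by rewrite -(inWsum s x us hx' la y las wy) e mcoeff0.
- move=> b [x ->]; exists (wt x); split; first exact/coset_weightP.
  by move=> la /coset_weightP.
- move=> i v Lv; have [kE [kF [h1 h2 h3]]] := kash_ops i.
  by rewrite (h1 v).1; exact: (h2 v Lv).1.
- move=> i v Lv; have [kE [kF [h1 h2 h3]]] := kash_ops i.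
  by rewrite (h1 v).2; exact: (h2 v Lv).2.
- move=> i b [x ->]; rewrite (induced_e i (Some x)) /=.
  by case: (et i x) => [y|]; [left; exists y | right].
- move=> i b [x ->]; rewrite (induced_f i (Some x)) /=.
  by case: (ft i x) => [y|]; [left; exists y | right].
- move=> i b b' [x ->] [y ->].
  have kf : _ = lc (ft i x) := induced_f i (Some x).
  have ke : _ = lc (et i y) := induced_e i (Some y).
  split=> e.
    have /lc_inj/(sb_inv H) h : lc (ft i x) = lc (Some y) by exact: etrans (esym kf) e.
    by apply: (etrans _ (esym ke)); rewrite h.
  have /lc_inj/esym/(sb_inv H) h : lc (Some x) = lc (et i y) by exact: etrans e ke.
  by apply: (etrans kf); rewrite h.
Qed.

(** The length of the string of an element is computed by following the
    partial map until it stops, since eps and phi decrease by one at each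
    step. *)
Lemma string_lengthP (K : set M -> set M) (o : T -> option T) (n : T -> nat) b x :
  (forall o1, K (lc o1) = lc (obind o o1)) ->
  (forall y, o y = None -> n y = 0%N) -> (forall y z, o y = Some z -> n y = (n z).+1) ->
  sval b = lc (Some x) -> string_length (B := zbasis) K b = n x.
Proof.
move=> hK h0 h1 eb; rewrite /string_length eb.
have E k : iter k K (lc (Some x)) = lc (iter k (obind o) (Some x)).
  by elim: k => //= k ->; rewrite hK.
have key k : zbasis (iter k K (lc (Some x))) <-> (k <= n x)%N.
  rewrite E zbasis_lc; elim: k x {eb E} => [|k IH] x; first by split.
  rewrite iterSr /=; case ox : (o x) => [z|]; first by rewrite IH (h1 _ _ ox).
  rewrite (h0 _ ox) (_ : iter k _ None = None); first by split.
  by elim: k {IH} => //= k ->.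
apply: xget_unique; first by split; [exact/key | move=> l /key].
move=> k [/key kn /(_ (n x))]; rewrite key leqnn => /(_ isT) nk.
by apply/eqP; rewrite eqn_leq kn nk.
Qed.

Definition string_crystal : crystal := {|
  csort := T;
  cwt := wt;
  ceps i x := Some (eps i x)%:Z;
  cphi i x := Some (phi i x)%:Z;
  ce := et;
  cf := ft
|}.

Lemma string_crystal_isomorphic :
  crystal_isomorphic (crystal_of rho L zbasis) string_crystal.
Proof.
have hx (b : cosets_in zbasis) : exists x, sval b = lc (Some x).
  by case: b => b hb; exact: hb.
have [th hth] := choice hx.
have cosets_inj (b1 b2 : cosets_in zbasis) : sval b1 = sval b2 -> b1 = b2.
  case: b1 b2 => b1 p1 [b2 p2] /= e; move: p2; rewrite -e => p2.
  by congr exist; exact: Prop_irrelevance.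
have zb x : zbasis (lc (Some x)) by exists x.
exists th; split.
  exists (fun x => exist _ (lc (Some x)) (zb x)) => [b|x].
    by apply: cosets_inj; rewrite /= -hth.
  by have := hth (exist _ (lc (Some x)) (zb x)); move=> /(@lc_inj _ (Some _)) [].
have to_cosets o : omap th (to_cosets_in zbasis (lc o)) = o.
  rewrite /to_cosets_in; case: pselect => [Bb|nB] /=.
    by have /lc_inj e := hth (exist _ _ Bb); exact: esym e.
  by case: o nB => // x /(_ (zb x)).
move=> b; split.
  rewrite /= hth; apply/esym/xget_unique; first exact/coset_weightP.
  by move=> la /coset_weightP.
move=> i; split=> /=.
- congr (Some (Posz _)); apply/esym/(@string_lengthP _ (et i)); last exact: hth.
  + by move=> o; exact: induced_e.
  + exact: (sb_et0 H).
  + by move=> y z /(sb_inv H)/(sb_ft H)[].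
- congr (Some (Posz _)); apply/esym/(@string_lengthP _ (ft i)); last exact: hth.
  + by move=> o; exact: induced_f.
  + exact: (sb_ft0 H).
  + by move=> y z /(sb_ft H)[].
- by rewrite hth induced_e to_cosets.
- by rewrite hth induced_f to_cosets.
Qed.

Lemma string_affine_crystal : affine_crystal string_crystal.
Proof.
split=> [i b|i b b'|i b b'|i b b'|//].
- by rewrite /= pairing_hcheck (sb_phi H) addrC subrK.
- move=> /(sb_inv H)/(sb_ft H)[h1 h2 h3] /=; rewrite h1 h2 h3 subrK; split=> //; congr Some; lia.
- move=> /(sb_ft H)[h1 h2 h3] /=; rewrite h1 h2 h3; split=> //; congr Some; lia.
- exact: (sb_inv H).
Qed.

End Packaging.

Local Close Scope classical_set_scope.

(** * Configurations of the two rows at one level *)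
Local Open Scope nat_scope.

(** The lengths of the two rows at a level form a pair, with the lower or back
    half first; the second argument is the half. *)
Definition rlen (x : nat * nat) (g : bool) : nat := if g then x.2 else x.1.
Definition put (x : nat * nat) (g : bool) (y : nat) : nat * nat :=
  if g then (x.1, y) else (y, x.2).
Definition inc x g := put x g (rlen x g).+1.
Definition dec x g := put x g (rlen x g).-1.

Lemma put_rlen x g : put x g (rlen x g) = x. Proof. by case: x g => ? ? []. Qed.
Lemma rlen_put x g y : rlen (put x g y) g = y. Proof. by case: g. Qed.
Lemma rlen_putN x g y : rlen (put x g y) (~~ g) = rlen x (~~ g). Proof. by case: g. Qed.

(** * Rows close to their bounds *)

Lemma near_succ n m : n <= m <= n.+1 -> m = n \/ m = n.+1.
Proof. lia. Qed.

Lemma near_pred n m : m <= n <= m.+1 -> m = n.-1 \/ m = n.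
Proof. lia. Qed.

Lemma rows_cases a b y w :
  (maxn y w <= b <= (maxn y w).+1) && (a <= minn y w <= a.+1) ->
  (y = a \/ y = a.+1) /\ (w = b.-1 \/ w = b) \/ (w = a \/ w = a.+1) /\ (y = b.-1 \/ y = b).
Proof.
have [yw|wy] := leqP y w => /andP[]; first by move=> /near_pred h1 /near_succ h2; left.
by move=> /near_pred h1 /near_succ h2; right.
Qed.

(** When b - a is odd, one of the rows carries the letter: its length exceeds
    the shortest length with the parity of a by 0 or 1. That length is a or
    b-1. *)
Lemma odd_rows a b y w : odd (b - a) ->
  (maxn y w <= b <= (maxn y w).+1) && (a <= minn y w <= a.+1) ->
  let lo := (y - (odd y != odd a)) in
  lo = a /\ (w = b.-1 \/ w = b) \/ (a.+2 < b) /\ lo = b.-1 /\ (w = a \/ w = a.+1).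
Proof.
move=> oN /rows_cases h lo; have ab : a < b by rewrite -subn_gt0; case: (b - a) oN.
have ob : odd b = ~~ odd a by move: oN; rewrite oddB ?(ltnW ab) //; case: (odd a); case: (odd b).
case: b ab ob {oN} h => //= c ac ob; have oc : odd c = odd a by apply: negb_inj.
have loE : y = a \/ y = a.+1 -> lo = a.
  by rewrite /lo => -[->|->] /=; rewrite ?eqxx ?subn0 //; case: (odd a); rewrite subn1.
have loE' : y = c \/ y = c.+1 -> lo = c.
  by rewrite /lo => -[->|->] /=; rewrite ?oc ?eqxx ?subn0 //; case: (odd a); rewrite subn1.
case=> [[/loE e hw]|[hw /loE' e]]; first by left.
have [ca|ca] := eqVneq c a; first by left; rewrite e ca; case: hw => ->; split; auto.
right; split=> //; rewrite ltnS ltn_neqAle.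
have ac1 : a < c by rewrite ltn_neqAle eq_sym ca.
by rewrite ac1 andbT; apply: contraNneq ca => e2; move: oc; rewrite -e2 /=; case: (odd a).
Qed.

(** A letter moves its row by one cell, between the two lengths listed in
    [odd_rows]. *)
Lemma odd_rows_move a b y w (u : bool) : odd (b - a) ->
  (maxn y w <= b <= (maxn y w).+1) && (a <= minn y w <= a.+1) ->
  let y' := y - (odd y != odd a) + ~~ u in
  (maxn y' w <= b <= (maxn y' w).+1) && (a <= minn y' w <= a.+1).
Proof.
move=> oN v /=; have /= := odd_rows oN v.
have ab : a < b by move: oN; rewrite -subn_gt0; case: (b - a).
move: (y - _) => lo {v oN} [[-> [->|->]]|[_ [-> [->|->]]]]; case: u;
  rewrite /= ?addn0 ?addn1 /=; lia.
Qed.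

(** * The letters of a configuration *)

(** The letters of a configuration: none, one letter on the given row, or two
    letters, of which the second one is on the given row. *)
Inductive kind := K0 | K1 of bool | K2 of bool.

Section Local.
Variables t c z : bool.

(** The conditions that a proper wall imposes on the two rows at one level,
    with a the longest row above it and b the shortest row below it. The upper
    bounds by a successor hold because two full columns have different
    heights. The parameter t says that the cubes are of type I and z that the
    level is 0, where the first row consists of ground state blocks; c is the
    parity that distinguishes the two colors of a type II cube. *)
Definition valid a b (x : nat * nat) : bool :=
  if z then a <= x.2 <= a.+1
  else [&& maxn x.1 x.2 <= b <= (maxn x.1 x.2).+1,
           a <= minn x.1 x.2 <= a.+1 & t ==> (x.2 <= x.1)].

Definition colored g k : bool := t || (odd k (+) g == c).
Definition adm a b x g k : bool :=
  [&& ~~ (z && ~~ g), colored g k, rlen x g == k & valid a b (inc x g)].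
Definition rem a b x g k : bool :=
  [&& ~~ (z && ~~ g), colored g k, rlen x g == k.+1 & valid a b (dec x g)].

Definition kindof a b (x : nat * nat) : kind :=
  if t then if z then K1 true else if a < b then K2 true else K0
  else let s := odd a (+) c in
    if z then if s then K1 true else K0
    else if odd (b - a) then K1 s
    else if (a < b) && (rlen x s <= rlen x (~~ s)) then K2 s else K0.

(** The signature of the level, each sign with the row it is attached to. At a
    type II level the row s is the one whose cells with index congruent to a
    have the given color. *)
Definition lets a b x : seq (bool * bool) :=
  match kindof a b x with
  | K0 => [::]
  | K1 g => [:: (odd (rlen x g) == odd a, g)]
  | K2 g => [:: (rlen x (~~ g) != b, ~~ g); (rlen x g == a, g)]
  end.

Definition pure a b x (u : seq bool) : nat * nat :=
  match kindof a b x, u with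
  | K1 g, [:: u0] => put x g ((rlen x g - (odd (rlen x g) != odd a)) + ~~ u0)
  | K2 g, [:: u0; u1] => put (put x (~~ g) (b - u0)) g (a + ~~ u1)
  | _, _ => x
  end.

Definition word a b x := [seq y.1 | y <- lets a b x].
Definition lcol x (y : bool * bool) : nat := if y.1 then rlen x y.2 else (rlen x y.2).-1.

(** In these two configurations both letters are attached to the same column
    and have the same sign. Only one of the two blocks can be added or removed,
    the one that the signature rule selects first. *)
Definition blocked_adm a b x g := [&& t, ~~ z, b == a.+1, x == (a, a) & g].
Definition blocked_rem a b x g := [&& t, ~~ z, b == a.+1, x == (b, b) & ~~ g].

Lemma adm_lets a b x g k : valid a b x ->
  adm a b x g k = [&& (true, g) \in lets a b x, rlen x g == k & ~~ blocked_adm a b x g].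
Proof.
case: x => x1 x2; rewrite /adm /colored /lets /kindof /blocked_adm xpair_eqE.
case: (eqVneq (rlen _ g) k) => [<-|nk]; last by move=> _; rewrite /= !andbF.
rewrite /= /valid /inc /put /rlen.
case: t; case: z; case: g => //=.
- by rewrite ?inE ?xpair_eqE /=; lia.
- by rewrite ?inE ?xpair_eqE /=; lia.
- by case: (ltnP a b) => /=; rewrite ?inE ?xpair_eqE /=; lia.
- by case: (ltnP a b) => /=; rewrite ?inE ?xpair_eqE /=; lia.
- by case: (boolP (odd a (+) c)) => /=; rewrite ?inE ?xpair_eqE /=; lia.
- by case: (boolP (odd a (+) c)) => /=; rewrite ?inE ?xpair_eqE /=; lia.
- by case: (boolP (odd a (+) c)) => ?; case: ifP => /= ?; try case: ifP => /= ?; rewrite ?inE ?xpair_eqE /=; lia.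
- by case: (boolP (odd a (+) c)) => ?; case: ifP => /= ?; try case: ifP => /= ?; rewrite ?inE ?xpair_eqE /=; lia.
Qed.

Lemma rem_lets a b x g k : valid a b x ->
  rem a b x g k = [&& (false, g) \in lets a b x, rlen x g == k.+1 & ~~ blocked_rem a b x g].
Proof.
case: x => x1 x2; rewrite /rem /colored /lets /kindof /blocked_rem xpair_eqE.
case: (eqVneq (rlen _ g) k.+1) => [ek|nk]; last by move=> _; rewrite /= !andbF.
case: g ek => /= ->; rewrite /valid /dec /put /rlen; case: t; case: z => //=.
- by rewrite ?inE ?xpair_eqE /=; lia.
- by case: (ltnP a b) => /=; rewrite ?inE ?xpair_eqE /=; lia.
- by case: (boolP (odd a (+) c)) => /=; rewrite ?inE ?xpair_eqE /=; lia.
- by case: (boolP (odd a (+) c)) => ?; case: ifP => /= ?; try case: ifP => /= ?; rewrite ?inE ?xpair_eqE /=; lia.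
- by rewrite ?inE ?xpair_eqE /=; lia.
- by case: (ltnP a b) => /=; rewrite ?inE ?xpair_eqE /=; lia.
- by case: (boolP (odd a (+) c)) => /=; rewrite ?inE ?xpair_eqE /=; lia.
- by case: (boolP (odd a (+) c)) => ?; case: ifP => /= ?; try case: ifP => /= ?; rewrite ?inE ?xpair_eqE /=; lia.
Qed.

Definition adms a b x k : bool := adm a b x false k || adm a b x true k.
Definition rems a b x k : bool := rem a b x false k || rem a b x true k.
Definition adms2 a b x k : bool :=
  (adm a b x false k && adms a b (inc x false) k)
  || (adm a b x true k && adms a b (inc x true) k).
Definition rems2 a b x k : bool :=
  (rem a b x false k && rems a b (dec x false) k)
  || (rem a b x true k && rems a b (dec x true) k).

Definition column_sign (r2 a2 r1 a1 : bool) : seq bool :=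
  if r2 then [:: false; false] else if a2 then [:: true; true]
  else if r1 && a1 then [:: false; true] else if r1 then [:: false]
  else if a1 then [:: true] else [::].

(** Two blocks of the same color fit into one column only if they are the two
    halves of a type I cube. *)
Lemma adms2P a b x k : adms2 a b x k ->
  [/\ t, ~~ z & exists g, adm a b x g k && adm a b (inc x g) (~~ g) k].
Proof.
have h g g' : adm a b x g k -> adm a b (inc x g) g' k ->
    [/\ t, ~~ z & exists g, adm a b x g k && adm a b (inc x g) (~~ g) k].
  move=> h1 h2; have [eg|ng] := eqVneq g' g.
    case/and4P: h1 => _ _ /eqP e _; move: h2; rewrite eg => /and4P[_ _].
    by rewrite /inc rlen_put e gtn_eqF.
  have eg : g' = ~~ g by case: (g) (g') ng => [] [].
  rewrite eg in h2; split; last by exists g; rewrite h1.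
    case/and4P: h1 => _ h1 _ _; case/and4P: h2 => _ h2 _ _; move: h1 h2; rewrite /colored.
    by case: t => //=; case: (odd k); case: (g); case: (c).
  case/and4P: h1 => h1 _ _ _; case/and4P: h2 => h2 _ _ _; move: h1 h2.
  by case: z; case: (g).
by case/orP=> /andP[h1 /orP[]h2]; apply: h h1 h2.
Qed.

Lemma rems2P a b x k : rems2 a b x k ->
  [/\ t, ~~ z & exists g, rem a b x g k && rem a b (dec x g) (~~ g) k].
Proof.
have h g g' : rem a b x g k -> rem a b (dec x g) g' k ->
    [/\ t, ~~ z & exists g, rem a b x g k && rem a b (dec x g) (~~ g) k].
  move=> h1 h2; have [eg|ng] := eqVneq g' g.
    case/and4P: h1 => _ _ /eqP e _; move: h2; rewrite eg => /and4P[_ _].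
    by rewrite /dec rlen_put e ltn_eqF.
  have eg : g' = ~~ g by case: (g) (g') ng => [] [].
  rewrite eg in h2; split; last by exists g; rewrite h1.
    case/and4P: h1 => _ h1 _ _; case/and4P: h2 => _ h2 _ _; move: h1 h2; rewrite /colored.
    by case: t => //=; case: (odd k); case: (g); case: (c).
  case/and4P: h1 => h1 _ _ _; case/and4P: h2 => h2 _ _ _; move: h1 h2.
  by case: z; case: (g).
by case/orP=> /andP[h1 /orP[]h2]; apply: h h1 h2.
Qed.

Lemma adms2E a b x k : valid a b x ->
  adms2 a b x k = [&& t, ~~ z, b == a.+1, x == (a, a) & k == a].
Proof.
case: x => x1 x2 vx; apply/idP/idP => [/adms2P[ht hz [g]]|/and5P[ht hz]].
  move: vx; rewrite /adm /colored /valid ht (negPf hz) /inc /put /rlen xpair_eqE.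
  by case: g => /=; lia.
move/eqP=> -> /eqP[-> ->] /eqP ->; rewrite /adms2 /adms /adm /colored /valid ht (negPf hz) /inc /put /rlen /=.
by lia.
Qed.

Lemma rems2E a b x k : valid a b x ->
  rems2 a b x k = [&& t, ~~ z, b == a.+1, x == (b, b) & k == a].
Proof.
case: x => x1 x2 vx; apply/idP/idP => [/rems2P[ht hz [g]]|/and5P[ht hz]].
  move: vx; rewrite /rem /colored /valid ht (negPf hz) /dec /put /rlen xpair_eqE.
  by case: g => /=; lia.
move/eqP=> -> /eqP[-> ->] /eqP ->; rewrite /rems2 /rems /rem /colored /valid ht (negPf hz) /dec /put /rlen /=.
by lia.
Qed.

Lemma K1P a b x g : valid a b x -> kindof a b x = K1 g ->
  [/\ t ==> z, z ==> g, a <= rlen x g & t || (odd a (+) g == c)].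
Proof.
case: x => x1 x2; rewrite /valid /kindof.
case: t; case: z => //=; [|by case: ifP| |]; first by move=> ? [] <-; split=> //=; lia.
- by case: ifP => // h ? [] <-; split=> //=; lia.
- case: ifP => [h1 v [] <-|]; last by case: ifP.
  by split=> //; [case: (odd a (+) c) => /=; lia | rewrite addKb].
Qed.

Lemma K2P a b x g : valid a b x -> kindof a b x = K2 g ->
  [/\ ~~ z, a < b, b.-1 <= rlen x (~~ g) <= b, a <= rlen x g <= a.+1
    & if t then g && (rlen x g <= rlen x (~~ g))
      else [&& a.+1 < b, ~~ odd (b - a) & odd a (+) g == c]].
Proof.
case: x => x1 x2; rewrite /valid /kindof.
case: t; case: z => //=; [|by case: ifP|].
- by case: ifP => // h v [] <-; split=> //=; lia.
- case: ifP => // h1; case: ifP => // h2 v [] <-; move: h2; rewrite /rlen; case e: (odd a (+) c) => /= h2.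
    by split=> //; lia.
  by split=> //; lia.
Qed.

(** The column signatures are pieces of the word of the level; the signatures
    of two equal signs come from the two blocked configurations. *)
Lemma column_lets a b x k : valid a b x ->
  column_sign (rems2 a b x k) (adms2 a b x k) (rems a b x k) (adms a b x k) =
  [seq y.1 | y <- lets a b x & lcol x y == k].
Proof.
move=> vx; rewrite adms2E // rems2E // /rems /adms !adm_lets // !rem_lets // /lcol /lets.
rewrite /blocked_adm /blocked_rem.
case E: kindof => [|g|g] /=.
- have -> : [&& t, ~~ z, b == a.+1, x == (b, b) & k == a] = false.
    apply/negP=> /and5P[ht hz /eqP eb _ _]; move: E.
    by rewrite /kindof ht (negPf hz) eb ltnSn.
  have -> : [&& t, ~~ z, b == a.+1, x == (a, a) & k == a] = false.
    apply/negP=> /and5P[ht hz /eqP eb _ _]; move: E.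
    by rewrite /kindof ht (negPf hz) eb ltnSn.
  by [].
- have [tz zg ra co] := K1P vx E.
  have tz0 : t && ~~ z = false by case: (t) (z) tz => [] [].
  rewrite !andbA tz0 /= !inE !xpair_eqE /=.
  by case: (g) ra {E co zg} => /= ra; case: (odd _ =P odd a) => e /=; rewrite ?orbF ?andbT /column_sign; do ?case: ifP => //= ?; lia.
- have [hz ab r1 r2 ht] := K2P vx E.
  have er1 : rlen x (~~ g) = (b - (rlen x (~~ g) != b))%N by lia.
  have er2 : rlen x g = (a + (rlen x g != a))%N by lia.
  rewrite hz /= !inE !xpair_eqE /=.
  move: r1 r2 ht er1 er2 {vx E}; case: x => x1 x2; rewrite xpair_eqE.
  case: g => /= r1 r2 ht; case: eqP => e1 er1; case: eqP => e2 er2 /=;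
    rewrite ?er1 ?er2 ?addn0 ?addn1 ?subn0 ?subn1 /=.
  all: move: ht {r1 r2}; case: (t) => //= ht.
  all: case: (eqVneq k a) => [ek|nk]; case: (eqVneq k b.-1) => [?|nkb].
  all: rewrite ?xpair_eqE /column_sign; do ?case: ifP => //= ?; by [|lia].
Qed.

(** * Replacing the letters of a configuration *)

Lemma K1_kind a b x y g : kindof a b x = K1 g -> kindof a b y = K1 g.
Proof. by rewrite /kindof; case: t => //; case: z => //; case: ifP => // _; case: ifP. Qed.

(** The kind depends on the letters only through the row they belong to, so it
    does not change when the letters do. *)
Lemma pureE a b x u : valid a b x -> size u = size (lets a b x) ->
  kindof a b (pure a b x u) = kindof a b x /\
  lets a b (pure a b x u) = zip u [seq y.2 | y <- lets a b x].
Proof.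
move=> vx; rewrite /pure /lets; case E: kindof => [|g|g] /=.
- by rewrite E; case: u.
- case: u => [//|u0 [|//]] _; have [tz zg ra co] := K1P vx E.
  have -> : kindof a b (put x g (rlen x g - (odd (rlen x g) != odd a) + ~~ u0)) = K1 g.
    exact: K1_kind E.
  by rewrite rlen_put; split=> //; congr [:: (_, _)]; case: u0 => /=; lia.
- case: u => [//|u0 [//|u1 [|//]]] _; have [hz ab r1 r2 ht] := K2P vx E.
  have -> : kindof a b (put (put x (~~ g) (b - u0)) g (a + ~~ u1)) = K2 g.
    rewrite -E /kindof (negPf hz); case: (t) ht => //= /and3P[h1 h2 h3].
    have -> : odd a (+) c = g by rewrite -(eqP h3) addKb.
    rewrite (negPf h2) ab rlen_put rlen_putN rlen_put /=.
    by do 2 case: ifP => //; move: E; rewrite /kindof; lia.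
  rewrite rlen_put rlen_putN rlen_put; split=> //.
  by congr [:: (_, _); (_, _)]; case: u0; case: u1 => /=; lia.
Qed.

Lemma pureK a b x u v : valid a b x -> size u = size (lets a b x) -> size v = size u ->
  pure a b (pure a b x u) v = pure a b x v.
Proof.
move=> vx su sv; rewrite {1}/pure (pureE vx su).1.
move: su sv; rewrite /pure /lets; case E: kindof => [|g|g] //=.
- by case: u => [//|u0 [|//]] _; case: v => [//|v0 [|//]] _; have [_ _ ra _] := K1P vx E; rewrite rlen_put /put; case: (g) ra => /= ra; congr (_, _); case: u0 => /=; lia.
- by case: u => [//|u0 [//|u1 [|//]]] _; case: v => [//|v0 [//|v1 [|//]]] _; rewrite /put; case: g {E}.
Qed.

Lemma pure_word a b x : valid a b x -> pure a b x (word a b x) = x.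
Proof.
move=> vx; rewrite /pure /word /lets; case E: kindof => [|g|g] //=.
  rewrite -[RHS](put_rlen x g); congr put; have [_ _ ra _] := K1P vx E; lia.
have [hz ab r1 r2 ht] := K2P vx E.
have -> : b - (rlen x (~~ g) != b) = rlen x (~~ g) by lia.
have -> : a + ~~ (rlen x g == a) = rlen x g by lia.
by case: (x) (g) => x1 x2 [].
Qed.

(** A type I level with a single free cube has no configuration with the
    letters plus, minus: the upper half would be present without the lower
    half. *)
Definition illegal a b (u : seq bool) := [&& t, ~~ z, b == a.+1 & u == [:: true; false]].

Lemma valid_pure a b x u : valid a b x -> size u = size (lets a b x) ->
  ~~ illegal a b u -> valid a b (pure a b x u).
Proof.
move=> vx; rewrite /illegal /pure /lets; case E: kindof => [|g|g] //=.
  case: u => [//|u0 [|//]] _ _.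
  case: x vx E => x1 x2; rewrite /valid /kindof /put /rlen.
  case: t; case: z => //=.
  - by move=> ? [] <-; case: u0 => /=; lia.
  - by case: ifP.
  - by case: ifP => // h v [] <-; case: u0 => /=; lia.
  - case oN: (odd (b - a)); last by case: ifP.
    rewrite andbT => v [] <-; case: (odd a (+) c); rewrite /= andbT.
      by rewrite maxnC minnC; apply: odd_rows_move; rewrite // maxnC minnC.
    exact: odd_rows_move.
case: u => [//|u0 [//|u1 [|//]]] _; have [hz ab r1 r2 ht] := K2P vx E.
rewrite !eqseq_cons andbT hz /= => hl; rewrite /valid (negPf hz) in vx *.
rewrite /put; case: g r1 r2 ht {E} => /= r1 r2; case: (t) hl => //= hl ht.
all: by clear -ab ht hl; case: u0 hl; case: u1 => /= hl; rewrite ?subn0 ?subn1 ?addn0 ?addn1; lia.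
Qed.

End Local.

Local Open Scope ring_scope.

(** * The action of f at one level *)

Lemma wwt0 : wwt [::] = 0. Proof. by rewrite /wwt big_nil. Qed.
Lemma wwt1 e : wwt [:: e] = sgn e. Proof. by rewrite /wwt big_seq1. Qed.
Lemma wwt2 e e' : wwt [:: e; e'] = sgn e + sgn e'.
Proof. by rewrite /wwt big_cons big_seq1. Qed.

(** The pair of row lengths with length y on the row s. The two rows of a type
    II level play the same role, up to the parity s. *)
Definition two (s : bool) (y z : nat) : nat * nat := if s then (z, y) else (y, z).
Lemma two_eq s y z y' z' : (two s y z == two s y' z') = (y == y') && (z == z').
Proof. by case: s; rewrite /two xpair_eqE // andbC. Qed.
Lemma rlen_two s y z : rlen (two s y z) s = y. Proof. by case: s. Qed.
Lemma rlen_twoN s y z : rlen (two s y z) (~~ s) = z. Proof. by case: s. Qed.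
Lemma two_rlen s x : two s (rlen x s) (rlen x (~~ s)) = x.
Proof. by case: s x => [] []. Qed.

Section LocalVectors.
Variables (t c z : bool) (F : fieldType) (p : F).
Local Notation valid := (valid t z).
Local Notation adm := (adm t c z).
Local Notation word := (word t c z).
Local Notation lets := (lets t c z).
Local Notation pure := (pure t c z).
Local Notation kindof := (kindof t c z).

Definition config_weight a b x : int := wwt (word a b x).
(** In the part of a wall that consists of the columns with index at least s,
    a row of length at most s is empty. *)
Definition clip s (x : nat * nat) : nat * nat := (maxn s x.1, maxn s x.2).
Definition clipped_weight s a b x : int := config_weight (maxn s a) (maxn s b) (clip s x).
(** The coefficient of the definition of f_1 for a run of l+1 equal columns. *)
Definition coef (l : nat) : F := p^-1 * (1 - (- p ^+ 2) ^+ l.+1).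

(** The coefficient of an admissible slot, up to the weight of the levels
    below, which is added later. The exponent is the weight of the part of the
    same level that lies to the left of the slot. *)
Definition add_coef a b x g : F :=
  if t then if z || ~~ g then 1 else p ^ clipped_weight x.1 a b x * coef (x.1 - a.+1)
  else p ^ clipped_weight (rlen x g).+1 a b x.

(** The virtually admissible slot: the two rows exchange their lengths and the
    shorter one grows by one block. *)
Definition virtual_add a b x : seq (F * (nat * nat)) :=
  let M := maxn x.1 x.2 in let mu := minn x.1 x.2 in let h := (x.1 < x.2)%N in
  let x' := two h mu.+1 M in
  if [&& ~~ t, ~~ z, (mu.+1 < M)%N, odd M (+) h == c & valid a b x']
  then [:: ((- p) ^+ (M - mu.+1) * p ^ clipped_weight M a b x, x')] else [::].

Definition f_terms a b x : seq (F * (nat * nat)) :=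
  [seq (add_coef a b x g, inc x g) | g <- [:: false; true] & adm a b x g (rlen x g)] ++ virtual_add a b x.

(** The vector of the tensor whose letters are those of x. It is x plus at
    most one correction, with a coefficient divisible by q. The exception is a
    type I level with b = a+1: there only the three-dimensional summand of V
    tensor V is present, so that the tensors with the letters plus, minus and
    minus, plus are proportional to the same wall. At level 0 there is at most
    one letter and nothing to correct. *)
Definition pure_vector a b x : seq (F * (nat * nat)) :=
  if z then [:: (1, x)] else
  if t then
    if b == a.+1 then
      if x == (a, b) then [:: (p / (1 + p ^+ 2), (b, a))]
      else if x == (b, a) then [:: ((1 + p ^+ 2)^-1, (b, a))] else [:: (1, x)]
    else if (a < b)%N && (x == (b, a))
    then [:: (1, x); (- p * (- p ^+ 2) ^+ (b - a.+1), (b.-1, a.+1))] else [:: (1, x)]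
  else let s := odd a (+) c in
    if odd (b - a) then
      if (a.+2 < b)%N && (x == two s b a)
      then [:: (1, x); (- (- p) ^+ (b - a.+1), two s a.+1 b.-1)]
      else if (a.+2 < b)%N && (x == two s a.+1 b)
      then [:: (1, x); ((- p) ^+ (b - a.+1), two s b a.+1)]
      else [:: (1, x)]
    else
      if (a.+3 < b)%N && (x == two s a.+1 b.-1)
      then [:: (1, x); ((- p) ^+ (b - a.+2), two s b.-1 a.+1)]
      else if (a < b)%N && (x == two s b a)
      then [:: (1, x); ((- p) ^+ (b - a), two s a b)]
      else [:: (1, x)].

(** The vector of the tensor with letters u, at a level with the kind of x. *)
Definition tensor_vector a b x u := pure_vector a b (pure a b x u).

Section Equivariance.
Variables (M : lmodType F) (H : nat * nat -> M).
Local Notation comb w := (\sum_(y <- w) y.1 *: H y.2).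

Lemma comb_f_terms a b x : comb (f_terms a b x) =
  (if adm a b x false x.1 then add_coef a b x false *: H (inc x false) else 0) +
  (if adm a b x true x.2 then add_coef a b x true *: H (inc x true) else 0) + comb (virtual_add a b x).
Proof.
rewrite /f_terms big_cat /=; congr (_ + _).
case: ifP => _; case: ifP => _; rewrite ?map_cons ?big_cons ?big_nil ?addr0 ?add0r //=.
Qed.

(** The weight seen with another lower bound a' of the same rows, as needed
    for the parts of a wall: a change of the parity of a' exchanges the rows. *)
Lemma config_weight_two s a b y w : ~~ t -> ~~ z -> odd a (+) s = c -> forall a',
  config_weight a' b (two s y w) =
  let e := odd a' == odd a in
  let y' := if e then y else w in let w' := if e then w else y in
  if odd (b - a') then sgn (odd y' == odd a')
  else if (a' < b)%N && (y' <= w')%N then sgn (w' != b) + sgn (y' == a') else 0.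
Proof.
move=> ht hz co a'; rewrite /config_weight /word /lets /kindof (negPf ht) (negPf hz) /=.
have -> : odd a' (+) c = if odd a' == odd a then s else ~~ s.
  by rewrite -co; case: (odd a'); case: (odd a); case: (s).
case: ifP => e; do ?case: ifP => /=; rewrite ?rlen_two ?rlen_twoN ?negbK ?rlen_two ?wwt1 ?wwt2 ?wwt0 //.
all: by move=> h1 _ h2; rewrite h2 in h1.
Qed.

Section TypeII.
Variables (a b : nat) (s : bool).
Hypotheses (ht : ~~ t) (hz : ~~ z) (co : odd a (+) s = c).

Lemma valid_two y w : valid a b (two s y w) =
  (maxn y w <= b <= (maxn y w).+1)%N && (a <= minn y w <= a.+1)%N.
Proof.
rewrite /valid (negPf hz) (negPf ht) andbT /two.
by case: s => //=; rewrite maxnC minnC.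
Qed.

Lemma clip_two r y w : clip r (two s y w) = two s (maxn r y) (maxn r w).
Proof. by rewrite /clip /two; case: s. Qed.

(** The four terms are the two admissible and the two virtually admissible
    slots. *)
Lemma comb_two y w : comb (f_terms a b (two s y w)) =
  (if (odd y == odd a) && valid a b (two s y.+1 w)
   then p ^ clipped_weight y.+1 a b (two s y w) *: H (two s y.+1 w) else 0) +
  (if (odd w != odd a) && valid a b (two s y w.+1)
   then p ^ clipped_weight w.+1 a b (two s y w) *: H (two s y w.+1) else 0) +
  (if [&& y.+1 < w, odd w != odd a & valid a b (two s w y.+1)]%N
   then ((- p) ^+ (w - y.+1) * p ^ clipped_weight w a b (two s y w)) *: H (two s w y.+1) else 0) +
  (if [&& w.+1 < y, odd y == odd a & valid a b (two s w.+1 y)]%N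
   then ((- p) ^+ (y - w.+1) * p ^ clipped_weight y a b (two s y w)) *: H (two s w.+1 y) else 0).
Proof.
rewrite comb_f_terms -[RHS]addrA; congr (_ + _).
  rewrite /add_coef /adm /colored /inc /put (negPf ht) (negPf hz) -co /two.
  by case: (s) => /=; rewrite !eqxx ?addbT ?addbF /=; [rewrite addrC|]; congr (_ + _);
    congr (if _ && _ then _ else _); case: (odd _); case: (odd _).
rewrite /virtual_add ht hz /=; case: (ltngtP y w) => h.
- have -> : maxn (two s y w).1 (two s y w).2 = w by rewrite /two; case: (s) => /=; lia.
  have -> : minn (two s y w).1 (two s y w).2 = y by rewrite /two; case: (s) => /=; lia.
  have -> : ((two s y w).1 < (two s y w).2)%N = ~~ s by rewrite /two; case: (s) => /=; lia.
  have -> : two (~~ s) y.+1 w = two s w y.+1 by rewrite /two; case: (s).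
  have -> : (odd w (+) ~~ s == c) = (odd w != odd a) by rewrite -co; case: (odd w); case: (odd a); case: (s).
  have -> : (w.+1 < y)%N = false by lia.
  by rewrite addr0; case: ifP => _; rewrite ?big_seq1 ?big_nil.
- have -> : maxn (two s y w).1 (two s y w).2 = y by rewrite /two; case: (s) => /=; lia.
  have -> : minn (two s y w).1 (two s y w).2 = w by rewrite /two; case: (s) => /=; lia.
  have -> : ((two s y w).1 < (two s y w).2)%N = s by rewrite /two; case: (s) => /=; lia.
  have -> : (odd y (+) s == c) = (odd y == odd a) by rewrite -co; case: (odd y); case: (odd a); case: (s).
  have -> : (y.+1 < w)%N = false by lia.
  by rewrite add0r; case: ifP => _; rewrite ?big_seq1 ?big_nil.
- have -> : ((minn (two s y w).1 (two s y w).2).+1 < maxn (two s y w).1 (two s y w).2)%N = false.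
    by rewrite h /two; case: (s) => /=; lia.
  by rewrite h (_ : w.+1 < w = false)%N /= ?big_nil ?addr0 //; lia.
Qed.

Lemma clipped_weight_two r y w : clipped_weight r a b (two s y w) =
  let a' := maxn r a in let b' := maxn r b in
  let e := odd a' == odd a in
  let y' := if e then maxn r y else maxn r w in let w' := if e then maxn r w else maxn r y in
  if odd (b' - a') then sgn (odd y' == odd a')
  else if (a' < b')%N && (y' <= w')%N then sgn (w' != b') + sgn (y' == a') else 0.
Proof. by rewrite /clipped_weight clip_two (config_weight_two _ _ _ ht hz co). Qed.

Lemma clipped_weight_top r y w : (b <= r)%N -> (a <= r)%N -> (y <= r)%N -> (w <= r)%N -> clipped_weight r a b (two s y w) = 0.
Proof.
move=> h1 h2 h3 h4; rewrite clipped_weight_two /= (maxn_idPl h1) (maxn_idPl h2) subnn ltnn.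
by [].
Qed.

Local Ltac ifs := repeat (case: ifP => [?|?]; try (exfalso; lia)).
Local Ltac iff := case: ifP; let h := fresh in intro h; try (exfalso; lia); clear h.
Local Ltac outer := rewrite comb_two !valid_two; iff; iff; iff; iff; rewrite ?add0r ?addr0.
Local Ltac lcl n := match goal with |- context [clipped_weight ?r ?a ?b ?x] =>
   let e := fresh in have e : clipped_weight r a b x = n; [first [apply: clipped_weight_top; lia | rewrite clipped_weight_two /=; ifs; rewrite /sgn; ifs; lia] | rewrite e; clear e] end.
Local Ltac fin := rewrite ?expr0z ?mulr1 ?scale1r ?expr1z.

Section Odd.
Hypotheses (oN : odd (b - a)).

Lemma odd_low_max : (a.+1 < b)%N -> comb (f_terms a b (two s a b)) =
   H (two s a.+1 b) + (- p) ^+ (b - a.+1) *: H (two s b a.+1).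
Proof. by move=> h; outer; lcl constr:(0:int); lcl constr:(0:int); fin. Qed.

Lemma odd_low_pre : (a.+1 < b)%N -> comb (f_terms a b (two s a b.-1)) = H (two s a.+1 b.-1).
Proof. by move=> h; outer; lcl constr:(0:int); fin. Qed.

Lemma odd_minus w : ((w == b.-1) || (w == b))%N -> (a.+1 < b)%N ->
   comb (f_terms a b (two s a.+1 w)) = 0.
Proof. by move=> h h'; outer. Qed.

Lemma odd_high_a : (a.+2 < b)%N -> comb (f_terms a b (two s b.-1 a)) =
   H (two s b a) + ((- p) ^+ (b - a.+2) * p) *: H (two s a.+1 b.-1).
Proof.
move=> h; outer; lcl constr:(0:int); lcl constr:(1:int); fin.
by rewrite prednK ?(leq_ltn_trans _ h) // (_ : b.-1 - a.+1 = b - a.+2)%N //; lia.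
Qed.

Lemma odd_high_a1 : (a.+2 < b)%N -> comb (f_terms a b (two s b.-1 a.+1)) = H (two s b a.+1).
Proof.
move=> h; outer; lcl constr:(0:int); fin.
by rewrite prednK ?(leq_ltn_trans _ h).
Qed.

Lemma odd_high_minus y : ((y == a) || (y == a.+1))%N -> (a.+1 < b)%N ->
   comb (f_terms a b (two s b y)) = 0.
Proof. by move=> h h'; outer. Qed.

Lemma odd_one_plus w : b = a.+1 -> ((w == a) || (w == a.+1))%N ->
   comb (f_terms a b (two s a w)) = H (two s a.+1 w).
Proof. by move=> h hw; outer; lcl constr:(0:int); fin. Qed.

Lemma odd_one_minus w : b = a.+1 -> ((w == a) || (w == a.+1))%N ->
   comb (f_terms a b (two s a.+1 w)) = 0.
Proof. by move=> h hw; outer. Qed.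

End Odd.

Section Even.
Hypotheses (oN : ~~ odd (b - a)).

Lemma even_pp : (a.+3 < b)%N -> comb (f_terms a b (two s a b.-1)) =
  H (two s a b) + p *: H (two s a.+1 b.-1) + ((- p) ^+ (b - a.+2) * p) *: H (two s b.-1 a.+1).
Proof.
move=> h; outer; lcl constr:(1:int); lcl constr:(0:int); lcl constr:(1:int); fin.
rewrite prednK ?(leq_ltn_trans _ h) // (_ : b.-1 - a.+1 = b - a.+2)%N; last by lia.
by congr (_ + _); rewrite addrC.
Qed.

Lemma even_pp2 : b = a.+2 -> comb (f_terms a b (two s a b.-1)) =
  H (two s a b) + p *: H (two s a.+1 b.-1).
Proof.
move=> h; outer; lcl constr:(1:int); lcl constr:(0:int); fin.
by rewrite prednK ?h // addrC.
Qed.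

Lemma even_mp : (a.+1 < b)%N -> comb (f_terms a b (two s a b)) = p ^ (-1) *: H (two s a.+1 b).
Proof. by move=> h; outer; lcl constr:(-1:int); fin. Qed.

Lemma even_pm : (a.+1 < b)%N -> comb (f_terms a b (two s a.+1 b.-1)) = H (two s a.+1 b).
Proof.
move=> h; outer; lcl constr:(0:int); fin.
by rewrite prednK ?(leq_ltn_trans _ h).
Qed.

Lemma even_0 y w : [|| (y == b.-1) && (w == a.+1) && (a.+3 < b), (y == b.-1) && (w == a) && (a.+1 < b),
   (y == a.+1) && (w == b) && (a.+1 < b), (y == b) && (w == a.+1) && (a.+1 < b)
   | (y == a) && (w == a) && (a == b)]%N ->
  comb (f_terms a b (two s y w)) = 0.
Proof. by move=> h; outer. Qed.

Lemma even_ba : (a.+1 < b)%N -> comb (f_terms a b (two s b a)) = (- p) ^+ (b - a.+1) *: H (two s a.+1 b).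
Proof. by move=> h; outer; lcl constr:(0:int); fin. Qed.

End Even.

End TypeII.

End Equivariance.
End LocalVectors.

(** * Vectors of pure tensors at one level *)

Local Arguments pure_vector : simpl never.
Local Arguments f_terms : simpl never.
Local Arguments valid : simpl never.

Section Equivariance.
Variables (t c z : bool) (F : fieldType) (p : F).
Hypothesis p0 : p != 0.
Hypothesis p2 : 1 + p ^+ 2 != 0.
Local Notation valid := (valid t z).
Local Notation word := (word t c z).
Local Notation lets := (lets t c z).
Local Notation pure := (pure t c z).
Local Notation kindof := (kindof t c z).
Local Notation f_terms := (f_terms t c z p).
Local Notation pure_vector := (pure_vector t c z p).
Local Notation tensor_vector := (tensor_vector t c z p).
Local Notation fw := (fw p).

Variables (M : lmodType F) (H : nat * nat -> M).
Local Notation comb w := (\sum_(y <- w) y.1 *: H y.2).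

(** The passage from words to vectors intertwines the coproduct action of f
    with its action on the walls, at one level; H is the rest of the wall. *)
Definition equivariant a b x u : Prop :=
  \sum_(y <- tensor_vector a b x u) y.1 *: comb (f_terms a b y.2) =
  \sum_(w <- fw u) w.1 *: comb (tensor_vector a b x w.2).

Lemma fw1 e (G : seq bool -> M) :
  \sum_(w <- fw [:: e]) w.1 *: G w.2 = if e then G [:: false] else 0.
Proof. by case: e; rewrite /= ?big_seq1 ?big_nil ?scale1r. Qed.

Lemma fw2 e e' (G : seq bool -> M) :
  \sum_(w <- fw [:: e; e']) w.1 *: G w.2 =
  (if e then G [:: false; e'] else 0) + (if e' then p ^ sgn e *: G [:: e; false] else 0).
Proof.
by case: e; case: e'; rewrite /= ?big_cons ?big_nil ?scale1r ?addr0 ?add0r ?mulr1.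
Qed.

Section TypeII.
Variables (a b : nat) (s : bool).
Hypotheses (ht : ~~ t) (hz : ~~ z) (co : odd a (+) s = c).

Lemma sE : odd a (+) c = s. Proof. by rewrite -co addKb. Qed.

Lemma put_two y w y' : put (two s y w) s y' = two s y' w.
Proof. by rewrite /put /two; case: s. Qed.
Lemma put_twoN y w y' : put (two s y w) (~~ s) y' = two s y y'.
Proof. by rewrite /put /two; case: s. Qed.

Lemma pure_vector_odd y w : odd (b - a) -> pure_vector a b (two s y w) =
  if [&& a.+2 < b, y == b & w == a]%N
  then [:: (1, two s b a); (- (- p) ^+ (b - a.+1), two s a.+1 b.-1)]
  else if [&& a.+2 < b, y == a.+1 & w == b]%N
  then [:: (1, two s a.+1 b); ((- p) ^+ (b - a.+1), two s b a.+1)]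
  else [:: (1, two s y w)].
Proof.
move=> oN; rewrite /pure_vector (negPf ht) (negPf hz) /= sE oN !two_eq.
by case: ifP => [/and3P[_ /eqP -> /eqP ->] //|_]; case: ifP => [/and3P[_ /eqP -> /eqP ->]|].
Qed.

Lemma pure_vector_even y w : ~~ odd (b - a) -> pure_vector a b (two s y w) =
  if [&& a.+3 < b, y == a.+1 & w == b.-1]%N
  then [:: (1, two s a.+1 b.-1); ((- p) ^+ (b - a.+2), two s b.-1 a.+1)]
  else if [&& a < b, y == b & w == a]%N
  then [:: (1, two s b a); ((- p) ^+ (b - a), two s a b)]
  else [:: (1, two s y w)].
Proof.
move=> oN; rewrite /pure_vector (negPf ht) (negPf hz) /= sE (negPf oN) !two_eq.
by case: ifP => [/and3P[_ /eqP -> /eqP ->] //|_]; case: ifP => [/and3P[_ /eqP -> /eqP ->]|].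
Qed.

Local Ltac iff := case: ifP; let h := fresh in intro h; try (exfalso; lia); clear h.
Local Ltac cv := rewrite pure_vector_odd //; do 2?iff; rewrite ?big_cons ?big_nil /= ?scale1r ?addr0.
Local Ltac cve := rewrite pure_vector_even //; do 2?iff; rewrite ?big_cons ?big_nil /= ?scale1r ?addr0.

(** One letter, on the row s. The corrections exchange the two rows; their
    images under f and the virtual slots cancel. *)
Lemma equiv_odd y w u0 : odd (b - a) -> valid a b (two s y w) ->
  equivariant a b (two s y w) [:: u0].
Proof.
move=> oN; rewrite valid_two // => v.
have kE : kindof a b (two s y w) = K1 s by rewrite /kindof (negPf ht) (negPf hz) oN sE.
rewrite /equivariant (fw1 _ (fun v => comb (tensor_vector a b (two s y w) v))) /tensor_vector /pure kE rlen_two !put_two /=.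
have /= := odd_rows oN v; move: (y - (odd y != odd a))%N => lo hw {kE v}.
have [N1|N3] : b = a.+1 \/ (a.+2 < b)%N by clear -oN; lia.
  have {}hw : lo = a /\ ((w == a) || (w == a.+1)).
    case: hw => [[-> [->|->]]|[h _]]; [by rewrite N1 eqxx | by rewrite N1 eqxx orbT |].
    by move: h; rewrite N1 !ltnS ltnNge leqnSn.
  case: hw => -> hw; case: u0 => /=; rewrite ?addn0 ?addn1.
    by cv; cv; rewrite odd_one_plus.
  by cv; rewrite odd_one_minus.
case: hw => [[-> hw]|[_ [-> hw]]]; case: u0 => /=; rewrite ?addn0 ?addn1.
- case: hw => ->; first by cv; cv; rewrite odd_low_pre //; lia.
  by cv; cv; rewrite odd_low_max //; lia.
- case: hw => ->; first by cv; rewrite odd_minus ?eqxx //; lia.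
  by cv; rewrite odd_minus ?eqxx ?orbT 1?odd_high_minus ?eqxx ?orbT ?scaler0 ?addr0 //; lia.
- rewrite prednK; last by lia.
  case: hw => ->; last by cv; cv; rewrite odd_high_a1 //; lia.
  cv; cv; rewrite odd_high_a //; congr (_ + _ *: _).
  have -> : (b - a.+1 = (b - a.+2).+1)%N by lia.
  by rewrite exprS; ring.
- rewrite prednK; last by lia.
  case: hw => ->; last by cv; rewrite odd_high_minus ?eqxx ?orbT //; lia.
  by cv; rewrite odd_high_minus ?eqxx ?orbT 1?odd_minus ?eqxx ?orbT ?scaler0 ?addr0 //; lia.
Qed.

(** At most two letters. The corrections are chosen such that the virtual
    slots and the missing powers of p add up to the action on V tensor V. *)
Lemma equiv_even y w u : ~~ odd (b - a) -> valid a b (two s y w) ->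
  size u = size (lets a b (two s y w)) -> equivariant a b (two s y w) u.
Proof.
move=> oN; rewrite valid_two // => v.
have kE : kindof a b (two s y w) = if (a < b)%N && (y <= w)%N then K2 s else K0.
  by rewrite /kindof (negPf ht) (negPf hz) (negPf oN) sE rlen_two rlen_twoN.
rewrite /lets kE; case: ifP kE => h kE.
  case: u => [//|u0 [//|u1 [|//]]] _.
  have h2 : (a.+1 < b)%N by lia.
  rewrite /equivariant (fw2 _ _ (fun v => comb (tensor_vector a b (two s y w) v))) /tensor_vector /pure kE !put_twoN !put_two /= {v h kE}.
  case: u0; case: u1 => /=; rewrite ?addn0 ?addn1 ?subn0 ?subn1 ?addr0 ?add0r.
  - have [N2|N4] : b = a.+2 \/ (a.+3 < b)%N by lia.
      by do 3!cve; rewrite even_pp2 // N2 /= eqxx.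
    do 3!cve; rewrite even_pp // expr1z scalerDr scalerA -addrA; congr (_ + (_ + _ *: _)).
    by rewrite mulrC.
  - have [N2|N4] : b = a.+2 \/ (a.+3 < b)%N by lia.
      by do 2!cve; rewrite even_pm //; lia.
    by do 2!cve; rewrite even_pm // even_0 ?scaler0 ?addr0 //; lia.
  - by do 2!cve; rewrite even_mp.
  - by cve; rewrite even_0 //; lia.
case: u => // _; rewrite /equivariant /= big_nil /tensor_vector /pure kE.
have [N0|N2] : a = b \/ (a.+1 < b)%N by lia.
  by cve; rewrite even_0 //; lia.
have : [|| (y == b) && (w == a), (y == b.-1) && (w == a.+1) && (a.+3 < b), (y == b.-1) && (w == a) | (y == b) && (w == a.+1)]%N by lia.
case/or4P=> [/andP[/eqP -> /eqP ->]|/andP[/andP[/eqP -> /eqP ->] h4]|/andP[/eqP -> /eqP ->]|/andP[/eqP -> /eqP ->]].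
- cve; rewrite even_ba // even_mp // scalerA -scalerDl.
  have -> : (b - a = (b - a.+1).+1)%N by lia.
  rewrite exprSr -mulrA mulNr -[p ^ (-1)]/(p ^- 1) expr1 mulfV // mulrN1 subrr.
  exact: scale0r.
- by cve; rewrite even_0 //; lia.
- by cve; rewrite even_0 //; lia.
- by cve; rewrite even_0 //; lia.
Qed.

End TypeII.
End Equivariance.

Section TypeI.
Variables (c : bool) (F : fieldType) (p : F).
Hypothesis p0 : p != 0.
Hypothesis p2 : 1 + p ^+ 2 != 0.
Variables (M : lmodType F) (H : nat * nat -> M) (a b : nat).
Local Notation comb w := (\sum_(y <- w) y.1 *: H y.2).
Local Notation f_terms := (f_terms true c false p a b).
Local Notation tensor_vector := (tensor_vector true c false p a b).
Local Notation valid := (valid true false a b).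

Lemma valid_I x1 x2 : valid (x1, x2) =
  [&& x1 <= b <= x1.+1, a <= x2 <= a.+1 & x2 <= x1]%N.
Proof. rewrite /valid /=; lia. Qed.

Lemma comb_I x1 x2 : valid (x1, x2) -> comb (f_terms (x1, x2)) =
  (if x1.+1 == b then H (x1.+1, x2) else 0) +
  (if (x2 == a) && (x2 < x1)%N
   then (p ^ (if x1.+1 == b then 2 else 0) * coef p (x1 - a.+1)) *: H (x1, x2.+1) else 0).
Proof.
move=> v; move: (v); rewrite valid_I => v1.
rewrite comb_f_terms /virtual_add /= big_nil addr0; congr (_ + _).
  have -> : adm true c false a b (x1, x2) false x1 = (x1.+1 == b).
    rewrite /adm /colored eqxx /inc /put /= valid_I; lia.
  by case: ifP => // _; rewrite /add_coef /= scale1r.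
have -> : adm true c false a b (x1, x2) true x2 = (x2 == a) && (x2 < x1)%N.
  rewrite /adm /colored eqxx /inc /put /= valid_I; lia.
case: ifP => // h; rewrite /add_coef /=; congr ((p ^ _ * _) *: _).
rewrite /clipped_weight /config_weight /word /lets /kindof /=.
case: ifP => e; case: ifP => e'; rewrite /= ?wwt0 ?wwt2 //.
- have -> : (maxn x1 x1 != maxn x1 b)%N by lia.
  by have -> : (maxn x1 x2 == maxn x1 a)%N by lia.
- by exfalso; lia.
- by exfalso; lia.
Qed.

Lemma pure_vector_I y : pure_vector true c false p a b y = if b == a.+1 then
      if y == (a, b) then [:: (p / (1 + p ^+ 2), (b, a))]
      else if y == (b, a) then [:: ((1 + p ^+ 2)^-1, (b, a))] else [:: (1, y)]
    else if (a < b)%N && (y == (b, a))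
    then [:: (1, y); (- p * (- p ^+ 2) ^+ (b - a.+1), (b.-1, a.+1))] else [:: (1, y)].
Proof. by []. Qed.

Local Ltac iff := case: ifP; let h := fresh in intro h; try (exfalso; lia); clear h.
Local Ltac cv := rewrite pure_vector_I !xpair_eqE; do 3?iff; rewrite ?big_cons ?big_nil /= ?scale1r ?addr0.
Local Ltac fl := rewrite comb_I ?valid_I; [do 2 iff | lia]; rewrite ?add0r ?addr0.

(** The coefficient of the upper slot is a difference of two terms, one of
    which is compensated by the correction term of the tensor with letters
    minus, plus. *)
Lemma equiv_I x u : valid x -> size u = size (lets true c false a b x) ->
  equivariant true c false p H a b x u.
Proof.
case: x => x1 x2 v; move: (v); rewrite valid_I => v1.
rewrite /lets /kindof /=.
case: ifP => ab; last first.
  case: u => // _; rewrite /equivariant /= big_nil /tensor_vector /pure /kindof /= ab.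
  by cv; fl.
case: u => [//|u0 [//|u1 [|//]]] _.
rewrite /equivariant (fw2 _ _ _ (fun v => comb (tensor_vector (x1, x2) v))) /tensor_vector /pure.
rewrite /kindof /= ab /put /= {v v1}.
have [N1|N2] : b = a.+1 \/ (a.+1 < b)%N by lia.
  case: u0; case: u1; rewrite /= ?subn0 ?subn1 ?addn0 ?addn1 ?addr0 ?add0r.
  - do 3!cv; fl; rewrite scalerA -scalerDl N1 expr1z -[LHS]scale1r; congr (_ *: _).
    by field; rewrite p2.
  - do 2!cv; fl; rewrite scalerA N1 subnn expr0z mul1r /coef expr1 opprK -[RHS]scale1r; congr (_ *: _).
    by field; rewrite p0 p2.
  - do 2!cv; fl; rewrite scalerA N1 subnn expr0z mul1r /coef expr1 opprK -[p ^ -1]/(p ^- 1) expr1; congr (_ *: _).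
    by field; rewrite p0 p2.
  - by cv; fl.
case: u0; case: u1; rewrite /= ?subn0 ?subn1 ?addn0 ?addn1 ?addr0 ?add0r.
- do 3!cv; fl; rewrite !prednK ?(leq_ltn_trans _ N2) //.
  rewrite expr1z -addrA -scalerDl; congr (_ + _ *: _).
  rewrite /coef (_ : (b.-1 - a.+1).+1 = b - a.+1)%N; last by lia.
  by rewrite -exprnP expr2; field; rewrite p0.
- by do 2!cv; fl; rewrite prednK // (leq_ltn_trans _ N2).
- do 2!cv; rewrite comb_I ?valid_I; [do 2 iff | lia]; fl; rewrite prednK ?(leq_ltn_trans _ N2) // -scalerDl.
  congr (_ *: _); rewrite /coef expr0z mul1r -[p ^ -1]/(p ^- 1) expr1 exprS.
  by field; rewrite p0.
- by cv; fl.
Qed.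
End TypeI.

Section LevelZero.
Variables (t c : bool) (F : fieldType) (p : F) (M : lmodType F) (H : nat * nat -> M) (a b : nat).
Local Notation comb w := (\sum_(y <- w) y.1 *: H y.2).

Lemma equiv_0 x u : valid t true a b x -> size u = size (lets t c true a b x) ->
  equivariant t c true p H a b x u.
Proof.
case: x => x1 x2 v; have {v} v : (a <= x2 <= a.+1)%N by [].
have fl y2 : (a <= y2 <= a.+1)%N -> comb (f_terms t c true p a b (x1, y2)) =
    if (y2 == a) && (t || (odd a (+) c)) then H (x1, y2.+1) else 0.
  move=> v2; rewrite comb_f_terms /virtual_add andbF big_nil addr0 /adm /= add0r.
  have -> : [&& colored t c true y2, y2 == y2 & valid t true a b (inc (x1, y2) true)] = (y2 == a) && (t || (odd a (+) c)).
    rewrite /colored /valid /inc /put /= eqxx; case: (t) => /=; lia.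
  case: ifP => // /andP[/eqP -> h]; rewrite /add_coef; case: (t) h => /= h; first by rewrite scale1r.
  rewrite /clipped_weight /config_weight /word /lets /kindof /= (_ : odd (maxn a.+1 a) (+) c = false); first by rewrite wwt0 expr0z scale1r.
  by rewrite (maxn_idPl (leqnSn a)) /=; move: h; case: (odd a); case: (c).
rewrite /equivariant /tensor_vector /lets /pure /pure_vector /kindof.
case: (boolP (t || (odd a (+) c))) => h.
  have -> : (if t then K1 true else if odd a (+) c then K1 true else K0) = K1 true.
    by case: (t) h => //= ->.
  case: u => [//|u0 [|//]] _; rewrite /= big_seq1 scale1r /put /=.
  rewrite fl; last by lia.
  rewrite h andbT; case: u0 => /=; rewrite ?big_seq1 ?big_nil ?scale1r /=; case: ifP => h'; try (exfalso; lia); last by [].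
  by congr (H (_, _)); lia.
have -> : (if t then K1 true else if odd a (+) c then K1 true else K0) = K0.
  by move: h; case: (t) => //= /negPf ->.
case: u => // _; rewrite /= big_nil big_seq1 scale1r fl //.
by rewrite (negPf h) andbF.
Qed.

End LevelZero.

Lemma equiv_all t c z (F : fieldType) (p : F) (p0 : p != 0) (p2 : 1 + p ^+ 2 != 0)
  (M : lmodType F) (H : nat * nat -> M) a b x u :
  valid t z a b x -> size u = size (lets t c z a b x) -> equivariant t c z p H a b x u.
Proof.
case: z => [|]; first exact: equiv_0.
case: t => v su; first exact: equiv_I.
rewrite -[x](two_rlen (odd a (+) c)) in v su *.
have co : odd a (+) (odd a (+) c) = c by rewrite addKb.
case: (boolP (odd (b - a))) => oN; last exact: equiv_even.
move: su; rewrite /lets /kindof oN /=; case: u => [//|u0 [|//]] _.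
exact: equiv_odd.
Qed.

Lemma pure_vector_zero (t c z : bool) (F : fieldType) (p : F) a b x : z -> pure_vector t c z p a b x = [:: (1, x)].
Proof. by rewrite /pure_vector => ->. Qed.

Lemma pure_vector_typeI (t c z : bool) (F : fieldType) (p : F) a b x : ~~ z -> t -> pure_vector t c z p a b x =
  if b == a.+1 then
    if x == (a, b) then [:: (p / (1 + p ^+ 2), (b, a))]
    else if x == (b, a) then [:: ((1 + p ^+ 2)^-1, (b, a))] else [:: (1, x)]
  else if (a < b)%N && (x == (b, a))
  then [:: (1, x); (- p * (- p ^+ 2) ^+ (b - a.+1), (b.-1, a.+1))] else [:: (1, x)].
Proof. by rewrite /pure_vector => /negPf -> ->. Qed.

Lemma pure_vector_typeII (t c z : bool) (F : fieldType) (p : F) a b x : ~~ z -> ~~ t -> pure_vector t c z p a b x =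
  let s := odd a (+) c in
  if odd (b - a) then
    if (a.+2 < b)%N && (x == two s b a)
    then [:: (1, x); (- (- p) ^+ (b - a.+1), two s a.+1 b.-1)]
    else if (a.+2 < b)%N && (x == two s a.+1 b)
    then [:: (1, x); ((- p) ^+ (b - a.+1), two s b a.+1)]
    else [:: (1, x)]
  else
    if (a.+3 < b)%N && (x == two s a.+1 b.-1)
    then [:: (1, x); ((- p) ^+ (b - a.+2), two s b.-1 a.+1)]
    else if (a < b)%N && (x == two s b a)
    then [:: (1, x); ((- p) ^+ (b - a), two s a b)]
    else [:: (1, x)].
Proof. by rewrite /pure_vector => /negPf -> /negPf ->. Qed.

(** In the degenerate case the tensor with letters plus, minus is a multiple
    of this configuration, which has the same weight. *)
Lemma valid_illegal c a : valid true false a a.+1 (a.+1, a) &&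
  (config_weight true c false a a.+1 (a.+1, a) == wwt [:: true; false]).
Proof.
rewrite /valid /config_weight /word /lets /kindof ltnSn /=.
by rewrite !eqxx !wwt2; apply/andP; split; [lia|].
Qed.

Section Members.
Variables (t c z : bool) (F : fieldType) (p : F) (a b : nat).
Local Notation valid := (valid t z a b).
Local Notation word := (word t c z a b).
Local Notation lets := (lets t c z a b).
Local Notation pure := (pure t c z a b).
Local Notation pure_vector := (pure_vector t c z p a b).
Local Notation tensor_vector := (tensor_vector t c z p a b).
Local Notation config_weight := (config_weight t c z a b).

Lemma word_pure x u : valid x -> size u = size (lets x) -> word (pure x u) = u.
Proof.
move=> vx su; rewrite /word (pureE vx su).2 -/(unzip1 _) unzip1_zip ?size_map //.
by rewrite su.
Qed.

Lemma pure_vector_valid x y : valid x -> y \in pure_vector x -> valid y.2 && (config_weight y.2 == config_weight x).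
Proof.
move=> v; case/orP: (orbN z) => hz.
  by rewrite pure_vector_zero // inE => /eqP -> /=; rewrite v eqxx.
case/orP: (orbN t) => ht; last first.
  rewrite pure_vector_typeII //=.
  have co : odd a (+) (odd a (+) c) = c by rewrite addKb.
  move: (odd a (+) c) co => s co; rewrite -(two_rlen s x) in v *.
  move: (rlen x s) (rlen x (~~ s)) v => y1 y2; rewrite valid_two // !two_eq => v.
  by case: ifP => oN; do 2?case: ifP => ?; rewrite !inE ?orbF; (try (case/orP)); move/eqP=> -> /=;
    rewrite ?eqxx ?andbT ?valid_two ?v //=; (apply/andP; split; [lia|apply/eqP]);
    rewrite !(config_weight_two _ _ _ _ _ co) //= eqxx oN //=; do ?case: ifP => ? //; rewrite /sgn; do ?case: ifP => ?; lia.
rewrite pure_vector_typeI //.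
  have lE x1 x2 : config_weight (x1, x2) = if (a < b)%N then sgn (x1 != b) + sgn (x2 == a) else 0.
    by rewrite /config_weight /word /lets /kindof ht (negPf hz) /=; case: ifP; rewrite /= ?wwt2 ?wwt0.
  have vE x1 x2 : valid (x1, x2) = [&& maxn x1 x2 <= b <= (maxn x1 x2).+1, a <= minn x1 x2 <= a.+1 & x2 <= x1]%N.
    by rewrite /valid (negPf hz) ht.
  case: x v => x1 x2; rewrite vE => v; rewrite !xpair_eqE.
  do 3?case: ifP => ?; rewrite !inE ?orbF.
  all: (try (case/orP)); move/eqP=> -> /=; rewrite !lE vE ?v ?eqxx //=.
  all: apply/andP; split; [lia|].
  all: do ?case: ifP => ? //; apply/eqP; rewrite /sgn; do ?case: ifP => ?; lia.
Qed.

Lemma tensor_vector_valid x u y : valid x -> size u = size (lets x) -> y \in tensor_vector x u ->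
  valid y.2 && (config_weight y.2 == wwt u).
Proof.
move=> vx su; case/orP: (orbN (illegal t z a b u)) => [/and4P[ht hz /eqP eb /eqP eu]|li].
  rewrite /tensor_vector pure_vector_typeI // /pure /kindof ht (negPf hz) eb ltnSn eqxx eu /put /=.
  by rewrite subn1 addn1 eqxx inE => /eqP -> /=; exact: valid_illegal.
have vp := valid_pure vx su li.
by move=> /(pure_vector_valid vp); rewrite {2}/config_weight word_pure.
Qed.

End Members.

Section Integrality.
Variables (t c z : bool) (F : fieldType) (R : local_ring F) (p : F).
Hypothesis bp : base R p.
Variables a b : nat.
Local Notation pure_vector := (pure_vector t c z p a b).

Let A := lr_A R.
Let pA n : p ^+ n \in A. Proof. by rewrite rpredX ?(base_A bp). Qed.
Let NpA n : (- p) ^+ n \in A. Proof. by rewrite rpredX ?rpredN ?(base_A bp). Qed.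

Lemma pure_vector_A x y : y \in pure_vector x -> y.1 \in A.
Proof.
have u2 : (1 + p ^+ 2)^-1 \in A.
  by apply/unit1_A/(unit1_inv _).2/unit1_1D/(base_qA bp).
have h2 n : - p * (- p ^+ 2) ^+ n \in A by rewrite rpredM ?rpredN ?(base_A bp) ?rpredX ?rpredN.
have hp : p \in A by exact: base_A bp.
rewrite /pure_vector; do ?case: ifP => _; rewrite !inE; (try (case/orP)); move/eqP=> -> /=;
  rewrite ?h2 ?rpred1 ?rpredN ?NpA //.
by rewrite rpredM.
Qed.

(** Congruence modulo q to the wall with the same letters. *)
Lemma pure_vector_head x : valid t z a b x -> exists c0 r, [/\ pure_vector x = (c0, x) :: r, unit1 R c0
  & forall y, y \in r -> qA R y.1].
Proof.
have u2 : unit1 R (1 + p ^+ 2)^-1 by apply: (unit1_inv _).2; apply/unit1_1D/(base_qA bp).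
have h2 n : qA R (- p * (- p ^+ 2) ^+ n).
  rewrite mulNr; apply/qAN/qAMr; first by rewrite -(expr1 p); exact: base_qA.
  by rewrite rpredX ?rpredN.
have h3 n : (0 < n)%N -> qA R ((- p) ^+ n).
  case: n => // n _; rewrite exprS mulNr; apply/qAN/qAMr => //.
  by rewrite -(expr1 p); exact: base_qA.
move=> v; have one : exists c0 r, [/\ [:: (1, x)] = (c0, x) :: r, unit1 R c0
  & forall y, y \in r -> qA R y.1] by exists 1, [::]; split=> //; exact: unit1_1.
have two y : qA R y.1 -> exists c0 r, [/\ [:: (1, x); y] = (c0, x) :: r, unit1 R c0
  & forall y, y \in r -> qA R y.1].
  by move=> hy; exists 1, [:: y]; split=> // [|w]; [exact: unit1_1 | rewrite inE => /eqP ->].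
case/orP: (orbN z) => hz; first by rewrite pure_vector_zero.
case/orP: (orbN t) => ht; last first.
  rewrite pure_vector_typeII //=; case: ifP => oN; (case: ifP => [/andP[? _]|_]; [|case: ifP => [/andP[? _]|//]]);
    apply: (two (_, _)); rewrite /=; try (apply: qAN); apply: h3; lia.
rewrite pure_vector_typeI //.
case: ifP => [/eqP eb|_]; last by case: ifP => // _; exact/two/h2.
case: ifP => [/eqP ex|_].
  by move: v; rewrite ex /valid (negPf hz) ht eb /=; lia.
by case: ifP => [/eqP ex|//]; rewrite ex; exists (1 + p ^+ 2)^-1, [::]; split.
Qed.

End Integrality.

(** * Walls as nested rows *)
Local Open Scope nat_scope.

Section Profiles.
Variable lam : I.
Local Notation typeI := (typeI lam).

(** The lengths of the rows at each level. The ground state blocks are not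
    counted. *)
Definition profile : Type := nat -> nat * nat.
Implicit Types (R : profile) (A : {fset block}).

Definition hi R l : nat := maxn (R l).1 (R l).2.
(** The row of ground state blocks is infinite, so that at level 0 only the
    other row counts. *)
Definition lo R l : nat := if l == 0 then (R l).2 else minn (R l).1 (R l).2.

(** The wall, from the column s on, consists of rows that start in column s. *)
Definition shape s A R : Prop := forall k l g,
  ((k, l, g) \in A) = [&& s <= k, k < rlen (R l) g & ~~ ground (k, l, g)].
Definition above s R : Prop := forall l g, s <= rlen (R l) g.

(** Each cube stands on a complete cube and an upper half on a lower half. *)
Definition nested R l : bool :=
  (hi R l.+1 <= lo R l) && ((0 < l) && typeI l ==> ((R l).2 <= (R l).1)).
(** The full columns with topmost cube at level l are those with index between
    the longest row above and the shortest row at this level; there is at most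
    one of them. *)
Definition okR R : Prop := forall l, nested R l && (lo R l <= (hi R l.+1).+1).

Lemma groundE k l g : ground (k, l, g) = (l == 0) && ~~ g. Proof. by []. Qed.

Lemma rlen_hi R l g : rlen (R l) g <= hi R l.
Proof. by rewrite /hi /rlen; case: g; lia. Qed.

Lemma lo_rlen R l g : (l != 0) || g -> lo R l <= rlen (R l) g.
Proof. by rewrite /lo /rlen; case: eqP; case: g => //=; lia. Qed.

Lemma lo_ge R l m : (forall g, (l != 0) || g -> m <= rlen (R l) g) -> m <= lo R l.
Proof.
rewrite /lo /rlen; case: eqP => [_ h|_ h]; first exact: (h true).
by have := h true isT; have := h false isT; rewrite /=; lia.
Qed.

Lemma hi_le R l m : (forall g, rlen (R l) g <= m) -> hi R l <= m.
Proof. by move=> h; have := h true; have := h false; rewrite /hi /rlen; lia. Qed.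

Lemma lo_hi R l : lo R l <= hi R l.
Proof. by rewrite /lo /hi; case: ifP; lia. Qed.

Section Shape.
Variables (s : nat) (A : {fset block}) (R : profile).
Hypotheses (sA : shape s A R) (aR : above s R).

Lemma shape_occ k l g : s <= k -> occupied A (k, l, g) = ground (k, l, g) || (k < rlen (R l) g).
Proof. by move=> sk; rewrite /occupied sA sk /=; case: ground; rewrite ?andbT. Qed.

Lemma shape_young : young_wall lam (s, None) A <-> forall l, nested R l.
Proof.
split=> [/allP yw l|nR].
  have occ k j g : (k, j, g) \in A -> s <= k by rewrite sA => /andP[].
  apply/andP; split.
    apply: hi_le => g; apply: lo_ge => h hl.
    case E: (rlen (R l.+1) g) (aR l.+1 g) => [|r] sr //.
    have [{}sr|->] : s <= r \/ r.+1 = s by lia.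
      have /yw : (r, l.+1, g) \in A by rewrite sA sr E ltnSn.
      case/and5P=> _ _ _ /= /andP[o1 o2] _.
      by case: h hl o1 o2 => hl; rewrite !shape_occ // !groundE; case: (l) hl => //=; rewrite ?andbT ?andbF /=; lia.
    exact: aR.
  apply/implyP=> /andP[l0 tl]; have := aR l true; have := aR l false; rewrite /rlen => h1.
  case E: (R l).2 => [|r] sr //; have [{}sr|<-//] : s <= r \/ s = r.+1 by lia.
  have /yw : (r, l, true) \in A by rewrite sA sr /= E ltnSn groundE andbF.
  case/and5P=> _ _ + _ _; rewrite tl /= shape_occ // groundE; case: (l) l0 => //.
apply/allP=> -[[k l] g]; rewrite sA => /and3P[sk kr ng].
apply/and5P; split.
- by rewrite /in_range /= sk.
- exact: ng.
- apply/implyP=> /andP[tl gt]; rewrite shape_occ // groundE.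
  case: l tl kr ng => [//|l] tl kr _ /=; move: (nR l.+1); rewrite /nested tl /= => /andP[_ h].
  by apply: leq_trans kr _; rewrite gt.
- apply/implyP; case: l kr ng => // l kr _ _; rewrite !shape_occ // !groundE.
  have h : k < lo R l.
    case/andP: (nR l) => h _; apply: leq_trans h; apply: leq_trans kr _; exact: rlen_hi.
  by case: (l) h => [|l'] h; rewrite /= ?andbF /=; rewrite /rlen; move: h; rewrite /lo /=; lia.
- apply/implyP=> /= k0; have sk' : s <= k.-1 by lia.
  by rewrite shape_occ //; apply/orP; right; lia.
Qed.

Lemma shape_added k (t : seq block) : s <= k -> uniq t ->
  (forall b, b \in t = (col b == k) && occupied A b) -> has ground t -> size t = (added A k).+1.
Proof.
move=> sk ut ht hg; rewrite /added -size_filter -[RHS]/(size ((k, 0, false) :: [seq b <- A | col b == k])).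
apply/perm_size/uniq_perm => //=.
  by rewrite mem_filter sA groundE !andbF /=; apply: filter_uniq; exact: fset_uniq.
move=> [[j l] g]; rewrite ht inE mem_filter /col /=; case: eqP => [->|nj] /=.
  rewrite /occupied groundE !xpair_eqE eqxx /=; case: g => //=; rewrite ?andbF ?andbT //.
by rewrite !xpair_eqE (introF eqP nj).
Qed.

Hypothesis nR : forall l, nested R l.

Lemma nest l : hi R l.+1 <= lo R l. Proof. by case/andP: (nR l). Qed.

Lemma lo_anti l m : l <= m -> lo R m <= lo R l.
Proof.
move=> /subnK <-; elim: (m - l) => // n IH; apply: leq_trans IH.
by rewrite addSn; apply: leq_trans (nest _); exact: lo_hi.
Qed.

Lemma hi_lo l m : l < m -> hi R m <= lo R l.
Proof. by case: m => // m lm; apply: leq_trans (nest m) _; apply: lo_anti. Qed.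

Definition cube (k l : nat) : seq block := [seq (k, j, g) | j <- iota 0 l, g <- [:: false; true]].

Lemma mem_cube k l k' l' g : ((k', l', g) \in cube k l) = (k' == k) && (l' < l).
Proof.
apply/allpairsP/andP => [[[j h] [/= hj _ [-> -> _]]]|[/eqP -> lt]].
  by rewrite eqxx; move: hj; rewrite mem_iota.
by exists (l', g); split; rewrite ?mem_iota //=; case: g.
Qed.

Lemma uniq_cube k l : uniq (cube k l).
Proof. by apply: allpairs_uniq; rewrite ?iota_uniq // => -[? ?] [? ?] _ _ [-> ->]. Qed.

Lemma size_cube k l : size (cube k l) = l.*2.
Proof. by rewrite size_allpairs size_iota muln2. Qed.

Lemma added_full k l : s <= k -> hi R l.+1 <= k < lo R l -> added A k = l.*2.+1.
Proof.
move=> sk /andP[h1 h2]; apply: succn_inj; rewrite -doubleS -(size_cube k l.+1); apply/esym.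
apply: shape_added => //; first exact: uniq_cube.
  move=> [[j m] g]; rewrite mem_cube /col /=; case: eqP => //= ->.
  rewrite shape_occ // groundE ltnS; apply/idP/orP => [ml|[/andP[/eqP -> _] //|kr]].
    case: (boolP ((m != 0) || g)) => [h|]; last by rewrite negb_or negbK; left.
    right; apply: leq_trans (lo_rlen R h); apply: leq_trans h2 (lo_anti ml).
  rewrite leqNgt; apply/negP=> lm; have := rlen_hi R m g; have := lo_hi R l.+1.
  have : hi R m <= hi R l.+1.
    case: (ltngtP l.+1 m) lm => // [h _|-> //]; apply: leq_trans (hi_lo h) _; exact: lo_hi.
  by lia.
Qed.

Lemma added_half k l g : s <= k -> (l = 0 \/ k < lo R l.-1) -> hi R l.+1 <= k ->
  occupied A (k, l, g) -> ~~ occupied A (k, l, ~~ g) -> added A k = l.*2.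
Proof.
move=> sk h1 h2 o1 o2; apply: succn_inj; rewrite -(size_cube k l).
rewrite -[RHS]/(size ((k, l, g) :: cube k l)); apply/esym.
have mE b : (b \in (k, l, g) :: cube k l) = (col b == k) && occupied A b.
  case: b => [[j m] h]; rewrite inE mem_cube !xpair_eqE /col /=; case: eqP => //= ->.
  case: (ltngtP m l) => lm /=.
  - apply/esym; rewrite shape_occ // groundE.
    case: (boolP ((m != 0) || h)) => [hh|]; last by rewrite negb_or negbK => ->.
    apply/orP; right; apply: leq_trans (lo_rlen R hh).
    case: h1 lm => [->//|h1] lm; apply: leq_trans h1 _; apply: lo_anti; lia.
  - apply/esym/negbTE; rewrite shape_occ // groundE negb_or; apply/andP; split; first by lia.
    rewrite -leqNgt; apply: leq_trans (rlen_hi R m h) _; apply: leq_trans h2.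
    case: (ltngtP l.+1 m) lm => // [hh _|-> //]; apply: leq_trans (hi_lo hh) _; exact: lo_hi.
  - rewrite lm orbF; case: eqP => [->//|nh]; apply/esym/negbTE; suff -> : h = ~~ g by [].
    by case: (h) (g) nh => [] [].
apply: shape_added => //.
  by rewrite /= uniq_cube mem_cube ltnn andbF.
have : (k, 0, false) \in (k, l, g) :: cube k l by rewrite mE /col eqxx /= /occupied groundE.
by move=> h; apply/hasP; exists (k, 0, false).
Qed.

Lemma column_cases k : s <= k ->
  (exists l, hi R l.+1 <= k < lo R l) \/
  exists l g, [/\ l = 0 \/ k < lo R l.-1, hi R l.+1 <= k, occupied A (k, l, g)
    & ~~ occupied A (k, l, ~~ g)].
Proof.
move=> sk; have [n hn] : exists n, forall m g, (k, m, g) \in A -> m < n.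
  exists (\max_(b <- A) level b).+1 => m g h; rewrite ltnS.
  by rewrite -[m]/(level (k, m, g)); apply: leq_bigmax_seq.
have big m : n <= m -> hi R m.+1 <= k.
  move=> nm; apply: hi_le => g; rewrite leqNgt; apply/negP=> h.
  have /hn : (k, m.+1, g) \in A by rewrite sA sk h.
  by lia.
case: (boolP (lo R 0 <= k)) => [l0k|]; last first.
  rewrite -ltnNge => l0k; pose P m := k < lo R m.
  have exP : exists m, P m by exists 0.
  have ubP m : P m -> m <= n.+1.
    rewrite /P leqNgt => h1; apply/negP=> h2; have := big m.-1; rewrite prednK; last by lia.
    by move=> /(_ ltac:(lia)); have := lo_hi R m; lia.
  case: (ex_maxnP exP ubP) => m Pm mx.
  have np : lo R m.+1 <= k by rewrite leqNgt; apply/negP=> /mx; rewrite ltnn.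
  have kl : k < lo R m by [].
  case: (leqP (hi R m.+1) k) => hm; first by left; exists m; rewrite hm.
  have [g [h1 h2]] : exists g, rlen (R m.+1) g > k /\ rlen (R m.+1) (~~ g) <= k.
    move: hm np; rewrite /hi /lo /= => h1 h2.
    have [h|h] : (R m.+1).2 <= k \/ (R m.+1).1 <= k by lia.
      by exists false; rewrite /=; lia.
    by exists true; rewrite /=; lia.
  right; exists m.+1, g; split.
  - by right.
  - by apply: leq_trans (np); apply: nest.
  - by rewrite shape_occ // h1 orbT.
  - by rewrite shape_occ // groundE /= -leqNgt.
right; exists 0, false; split.
- by left.
- by apply: leq_trans (l0k); apply: nest.
- by rewrite shape_occ.
- by rewrite shape_occ // groundE /= -leqNgt; move: l0k; rewrite /lo.
Qed.

End Shape.

(** Together with [okR], this turns properness, which compares all columns,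
    into conditions on neighbouring levels. *)
Lemma shape_proper s A R : shape s A R -> above s R -> proper lam (s, None) A <-> okR R.
Proof.
move=> sA aR; split=> [/andP[/(shape_young sA aR) nR /allP pr] l|ok].
  rewrite nR /=; case: (leqP (lo R l) (hi R l.+1).+1) => // lt.
  have h g : s <= rlen (R l.+1) g by exact: aR.
  have sk : s <= hi R l.+1 by apply: leq_trans (h true) (rlen_hi _ _ _).
  have inA k : s <= k -> k < lo R l -> (k, l, true) \in A.
    move=> sk' kl; rewrite sA sk' groundE andbF andbT /=.
    by apply: leq_trans kl (lo_rlen R (orbT _)).
  have /pr/allP/(_ (hi R l.+1, l, true)) : ((hi R l.+1).+1, l, true) \in A by apply: inA; lia.
  have /[swap]/[apply] : (hi R l.+1, l, true) \in A by apply: inA; lia.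
  rewrite /full /col /= !(added_full sA nR (l := l)) //; try lia.
have nR l : nested R l by case/andP: (ok l).
apply/andP; split; first exact/(shape_young sA aR).
apply/allP=> -[[k l] g] /=; rewrite sA => /and3P[sk _ _].
apply/allP=> -[[k' l'] g']; rewrite sA => /and3P[sk' _ _].
apply/implyP=> /and3P[nk f1 f2]; rewrite /col /= in nk f1 f2 *.
have find k0 : s <= k0 -> full A k0 -> exists l0, hi R l0.+1 <= k0 < lo R l0.
  move=> sk0; rewrite /full; case: (column_cases sA nR sk0) => [[l0 h] _|[l0 [g0 [h1 h2 h3 h4]]]]; first by exists l0.
  by rewrite (added_half sA nR sk0 h1 h2 h3 h4) /= odd_double.
have [l1 i1] := find _ sk f1; have [l2 i2] := find _ sk' f2.
rewrite (added_full sA nR sk i1) (added_full sA nR sk' i2).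
apply: contraNneq nk => -[] /double_inj e12; move: i2; rewrite -e12.
by case/andP: (ok l1); lia.
Qed.

End Profiles.

Local Open Scope ring_scope.

(** * Slots and removable blocks, level by level *)
Local Open Scope nat_scope.

Lemma let_between t c z a b x y : valid t z a b x -> y \in lets t c z a b x ->
  [/\ a <= lcol x y, z || (lcol x y < b), ~~ (z && ~~ y.2) & y.1 || (0 < rlen x y.2)].
Proof.
move=> vx; rewrite /lets; case E: kindof => [|g|g] //.
  have [tz zg ra co] := K1P vx E; rewrite inE => /eqP -> /=; rewrite /lcol /=.
  have z2 : z && ~~ g = false by case: (z) (g) zg => [] [].
  rewrite z2; split=> //; [case: ifP; lia | | lia].
  case zE: z => //=; have oN : odd (b - a).
    move: E tz; rewrite zE implybF /kindof => E /negPf tF; move: E; rewrite tF.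
    by case: (odd _) => //; case: ifP.
  move: vx; rewrite /valid zE => /andP[vb _]; have : rlen x g <= b by rewrite /rlen; case: (g); lia.
  by case: ifP; lia.
have [hz ab r1 r2 ht] := K2P vx E; rewrite !inE /lcol => /orP[] /eqP -> /=; rewrite (negPf hz).
  by split=> //; try (case: ifP); lia.
by split=> //; try (case: ifP); lia.
Qed.

Section Relevant.
Variables (lam i : I).
Local Notation typeI := (typeI lam).
Implicit Types (R : profile) (A : {fset block}).

(** The blocks of color i are halves of type I cubes if i = 1 and of type II
    cubes otherwise. *)
Definition tI : bool := i == i1.
(** A block of color 0 or 2 at column k and half g has color i if k and g have
    this parity. *)
Definition cI : bool := (i == i0) (+) (lam == i2).
(** The level l consists of cubes that contain blocks of color i. *)
Definition tinted l : bool := typeI l == tI.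
(** The longest row above and the shortest row below the level l. They belong
    to levels without blocks of color i. *)
Definition lower R l : nat := hi R l.+1.
Definition upper R l : nat := if l == 0 then 0 else lo R l.-1.
Definition validl R l x : bool := valid tI (l == 0) (lower R l) (upper R l) x.
Definition letsl R l : seq (bool * bool) := lets tI cI (l == 0) (lower R l) (upper R l) (R l).
Definition upd R l x : profile := fun j => if j == l then x else R j.

Lemma relS l : tinted l.+1 = ~~ tinted l.
Proof. by rewrite /tinted /tI /Defs.typeI oddS; case: (odd l); case: (lam == i1); case: (i == i1). Qed.

Lemma color_rel k l g : (color lam (k, l, g) == i) = tinted l && colored tI cI g k.
Proof.
rewrite /color /tinted /colored /tI /cI /level /half /col /=.
case: typeI; case: (lam == i2); case: (odd k); case: g; by case: i => -[|[|[|]]].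
Qed.

Lemma upd_same R l x : upd R l x l = x. Proof. by rewrite /upd eqxx. Qed.
Lemma upd_other R l x j : j != l -> upd R l x j = R j. Proof. by rewrite /upd => /negPf ->. Qed.

Definition agree R R' : Prop := forall l, ~~ tinted l -> R' l = R l.

Lemma agree_upd R l x : tinted l -> agree R (upd R l x).
Proof. by move=> rl j nj; apply: upd_other; apply: contraNneq nj => ->. Qed.

Lemma agree_lower R R' l : agree R R' -> tinted l -> lower R' l = lower R l.
Proof. by move=> e rl; rewrite /lower /hi e // relS rl. Qed.

Lemma agree_upper R R' l : agree R R' -> tinted l -> upper R' l = upper R l.
Proof.
move=> e rl; rewrite /upper; case: l rl => //= l; rewrite relS => nl.
by rewrite /lo e.
Qed.

Lemma okR_valid R l : okR lam R -> tinted l -> validl R l (R l).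
Proof.
move=> ok rl; have /andP[/andP[h1 h2] h3] := ok l; rewrite /validl /valid.
move: h1 h2 h3; rewrite /lower /upper /lo.
case: l rl => [|l] rl h1 h2 h3 /=; first by move: h1 h3 => /=; lia.
have /andP[/andP[k1 k2] k3] := ok l; rewrite {1 2}/hi in k1 k3.
have et : tI ==> typeI l.+1 by move: rl; rewrite /tinted => /eqP ->; case: tI.
by rewrite /lo /hi in h1 h2 h3 k1 k3 *; move: h1 h2 h3 k1 k3 et; rewrite /=; case: tI; case: (typeI l.+1) => /=; lia.
Qed.

Lemma valid_okR R R' : okR lam R -> agree R R' ->
  (forall l, tinted l -> validl R l (R' l)) -> okR lam R'.
Proof.
move=> ok e v l; case rl: (tinted l).
  have := v _ rl; rewrite /validl -(agree_lower e rl) -(agree_upper e rl) /valid.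
  rewrite /nested /lower /upper /lo; case: (l =P 0) => [->|/eqP l0]; first by rewrite /=; lia.
  have et : typeI l ==> tI by move: rl; rewrite /tinted => /eqP ->; case: tI.
  rewrite (_ : 0 < l); last by rewrite lt0n.
  by move: et; case: tI; case: typeI => //=; lia.
have rl1 : tinted l.+1 by rewrite relS rl.
have := v _ rl1; rewrite /validl -(agree_lower e rl1) -(agree_upper e rl1) /valid /upper /=.
have eR : R' l = R l by apply: e; rewrite rl.
have elo : lo R' l = lo R l by rewrite /lo eR.
have /andP[/andP[_ h2] _] := ok l; rewrite /nested elo eR h2 andbT.
by move/and3P=> [h _ _]; rewrite /hi; lia.
Qed.

(** Changing the rows at a level with blocks of color i only affects the
    conditions at this level, because the neighbouring levels do not contain
    such blocks. *)
Lemma upd_okR R l x : okR lam R -> tinted l -> okR lam (upd R l x) <-> validl R l x.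
Proof.
move=> ok rl; have e := agree_upd R x rl; split=> [ok'|v].
  have := okR_valid ok' rl; rewrite /validl (agree_lower e rl) (agree_upper e rl).
  by rewrite upd_same.
apply: (valid_okR ok e) => j rj; case: (eqVneq j l) => [->|nj]; first by rewrite upd_same.
by rewrite upd_other //; exact: okR_valid.
Qed.

Section Part.
Variables (s : nat) (A : {fset block}) (R : profile).
Hypotheses (sA : shape s A R) (aR : above s R) (ok : okR lam R).
Local Notation p := (s, None).

Lemma shape_add l g k : s <= k -> rlen (R l) g = k -> ~~ ground (k, l, g) ->
  shape s ((k, l, g) |` A)%fset (upd R l (inc (R l) g)).
Proof.
move=> sk ek ng k' l' g'; rewrite in_fset1U sA !xpair_eqE /upd.
case: (eqVneq l' l) => [->|nl]; last by rewrite andbF.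
case: (eqVneq g' g) => [->|ng']; last first.
  rewrite andbF /=; suff -> : rlen (inc (R l) g) g' = rlen (R l) g' by [].
  by rewrite /inc /put /rlen; case: (g) (g') ng' => [] [].
rewrite /inc rlen_put ek ltnS !andbT; case: (eqVneq k' k) => [->|nk] /=.
  by rewrite sk leqnn.
by rewrite [k' <= k]leq_eqVlt (negPf nk).
Qed.

Lemma shape_rem l g k : s <= k -> rlen (R l) g = k.+1 -> ~~ ground (k, l, g) ->
  shape s (A `\ (k, l, g))%fset (upd R l (dec (R l) g)).
Proof.
move=> sk ek ng k' l' g'; rewrite in_fsetD1 sA !xpair_eqE /upd.
case: (eqVneq l' l) => [->|nl]; last by rewrite andbF.
case: (eqVneq g' g) => [->|ng']; last first.
  rewrite andbF /=; suff -> : rlen (dec (R l) g) g' = rlen (R l) g' by [].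
  by rewrite /dec /put /rlen; case: (g) (g') ng' => [] [].
rewrite /dec rlen_put ek ltnS !andbT /=; case: (eqVneq k' k) => [->|nk] /=.
  by rewrite ltnn andbF.
by rewrite [in RHS]ltn_neqAle nk.
Qed.

Lemma above_upd l x : (forall g, s <= rlen x g) -> above s (upd R l x).
Proof. by move=> h j g; rewrite /upd; case: ifP. Qed.

Lemma lower_above l : s <= lower R l.
Proof. exact: leq_trans (aR _ true) (rlen_hi _ _ _). Qed.

Definition adml l g k : bool := adm tI cI (l == 0) (lower R l) (upper R l) (R l) g k.
Definition reml l g k : bool := rem tI cI (l == 0) (lower R l) (upper R l) (R l) g k.

(** A slot lies at the end of its row, and properness of the enlarged wall is
    the validity of the new rows at its level. *)
Lemma mem_admissible k' l g k :
  ((k', l, g) \in admissible lam i p A k) = [&& k' == k, tinted l & adml l g k].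
Proof.
rewrite mem_filter color_rel.
have -> : ((k', l, g) \in [seq (k, l0, h) | l0 <- iota 0 (added A k).+2, h <- [:: false; true]])
    = (k' == k) && (l < (added A k).+2) by rewrite -/(cube k _) mem_cube.
case: (eqVneq k' k) => [->|]; last by rewrite !andbF.
case rl: (tinted l); last by rewrite /= andbF.
rewrite /adml /adm -(groundE k) /=; case ng: (ground (k, l, g)) => /=.
  by rewrite /occupied ng.
case co: (colored _ _ _ _); last by rewrite andbF.
apply/idP/idP => [/andP[/andP[no /andP[_ pr]] _]|/and3P[_ /eqP ek v]].
  have sk : s <= k.
    case/andP: pr => /allP/(_ (k, l, g)) + _; rewrite in_fset1U eqxx => /(_ isT).
    by case/and5P; rewrite /in_range andbT.
  have ek : rlen (R l) g = k.
    move: no; rewrite (shape_occ sA) // ng /= -leqNgt => h.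
    case/andP: pr => /allP/(_ (k, l, g)) + _; rewrite in_fset1U eqxx => /(_ isT).
    case/and5P=> _ _ _ _ /implyP /=; case: (ltngtP s k) sk => // [sk _|es _ _]; last first.
      by apply/eqP; rewrite eqn_leq h -{1}es aR.
    move=> /(_ isT); rewrite /occupied in_fset1U sA !xpair_eqE; move: ng; rewrite !groundE => ->.
    by rewrite (_ : (k.-1 == k) = false) /=; lia.
  have sU := shape_add sk ek (negbT ng).
  have aU : above s (upd R l (inc (R l) g)).
    apply: above_upd => g'; rewrite /inc; have := aR l g'; rewrite /put /rlen.
    by case: (g); case: (g') => /=; lia.
  by rewrite ek eqxx /=; apply/(upd_okR _ ok rl); exact/(shape_proper lam sU aU).
have sk : s <= k by rewrite -ek; exact: aR.
have aU : above s (upd R l (inc (R l) g)).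
  apply: above_upd => g'; rewrite /inc; have := aR l g'; rewrite /put /rlen.
  by case: (g); case: (g') => /=; lia.
have okU : okR lam (upd R l (inc (R l) g)) by apply/upd_okR.
have sU := shape_add sk ek (negbT ng).
apply/andP; split; first apply/andP; first split.
- by rewrite (shape_occ sA) // ng ek ltnn.
- exact/(shape_proper lam sU aU).
- rewrite ltnW // ltnS; case: (posnP l) => [->//|l0].
  have h : k < lo R l.-1.
    have := okU l.-1; rewrite /nested prednK // => /andP[/andP[h _] _].
    have e1 : lo (upd R l (inc (R l) g)) l.-1 = lo R l.-1 by rewrite /lo upd_other //; lia.
    have k1 : k < hi (upd R l (inc (R l) g)) l.
      by apply: leq_trans (rlen_hi _ _ g); rewrite upd_same /inc rlen_put ek.
    by rewrite e1 in h; exact: leq_trans k1 h.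
  rewrite -[l](size_iota 0) -(size_map (fun j => (k, j, true))) /added -size_filter.
  apply: uniq_leq_size; first by rewrite map_inj_uniq ?iota_uniq // => ? ? [].
  move=> b /mapP[j]; rewrite mem_iota /= add0n => jl ->.
  rewrite mem_filter /col /= eqxx /= sA sk groundE andbF andbT /=.
  apply: leq_trans (lo_rlen R (orbT _)); apply: leq_trans h _.
  by apply: (lo_anti (lam := lam)) => [m|]; [case/andP: (ok m) | lia].
Qed.

Lemma mem_removable k' l g k :
  ((k', l, g) \in removable lam i p A k) = [&& k' == k, tinted l & reml l g k].
Proof.
rewrite mem_filter color_rel /col /=.
case: (eqVneq k' k) => [->|] //=; case rl: (tinted l) => //=.
rewrite /reml /rem -(groundE k); case co: (colored _ _ _ _); last by rewrite andbF.
apply/idP/idP => [/andP[/andP[_ pr]]|/and4P[ng _ /eqP ek v]].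
  rewrite sA => /and3P[sk kr ng]; rewrite ng /=.
  have ek : rlen (R l) g = k.+1.
    apply/eqP; rewrite eqn_leq kr andbT leqNgt; apply/negP=> kr2.
    have ng2 : ~~ ground (k.+1, l, g) by [].
    case/andP: pr => /allP/(_ (k.+1, l, g)) + _; rewrite in_fsetD1 sA !xpair_eqE.
    rewrite (_ : (k.+1 == k) = false) ?(leqW sk) ?kr2 ?ng2 /=; last by lia.
    move=> /(_ isT)/and4P[_ _ _]; rewrite ltnS sk /= /occupied in_fsetD1 eqxx orbF.
    by rewrite (negPf ng).
  have sU := shape_rem sk ek ng.
  have aU : above s (upd R l (dec (R l) g)).
    apply: above_upd => g'; rewrite /dec; have := aR l g'; move: ek; rewrite /put /rlen.
    by case: (g); case: (g') => /=; lia.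
  by rewrite ek eqxx /=; apply/(upd_okR _ ok rl); exact/(shape_proper lam sU aU).
have sk : s <= k.
  apply: leq_trans (lower_above l) _; move: v ng; rewrite groundE /valid /dec /put; move: ek; rewrite /rlen.
  by case: (l == 0); case: (g) => /=; lia.
have aU : above s (upd R l (dec (R l) g)).
  apply: above_upd => g'; rewrite /dec; have := aR l g'; move: ek; rewrite /put /rlen.
  by case: (g); case: (g') => /=; lia.
have okU : okR lam (upd R l (dec (R l) g)) by apply/upd_okR.
have sU := shape_rem sk ek ng.
apply/andP; split; first exact/(shape_proper lam sU aU).
by rewrite sA sk ek ltnSn ng.
Qed.

End Part.
End Relevant.

Local Open Scope ring_scope.

(** * The signature, level by level *)
Local Open Scope nat_scope.

Section Signature.
Variables (lam i : I).
Local Notation typeI := (typeI lam).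
Local Notation tinted := (tinted lam i).
Local Notation tI := (tI i).
Local Notation cI := (cI lam i).
Local Notation agree := (agree lam i).
Implicit Types (R : profile) (A : {fset block}).

(** The columns in which blocks of color i can be added or removed at the
    level l. These intervals are disjoint for different levels, so that the
    signature of a column comes from a single level. *)
Definition at_level R l k : bool := (lower R l <= k) && ((l == 0) || (k < upper R l)).

Lemma at_let R l y : okR lam R -> tinted l -> y \in letsl lam i R l -> at_level R l (lcol (R l) y).
Proof.
by move=> ok rl /(let_between (okR_valid ok rl))[h1 h2 _ _]; rewrite /at_level h1.
Qed.

Lemma adm_at R l g k : okR lam R -> tinted l -> adml lam i R l g k -> at_level R l k.
Proof.
move=> ok rl; rewrite /adml adm_lets; last exact: okR_valid.
case/and3P=> h /eqP <- _.
exact: (at_let ok rl h).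
Qed.

Lemma rem_at R l g k : okR lam R -> tinted l -> reml lam i R l g k -> at_level R l k.
Proof.
move=> ok rl; rewrite /reml rem_lets; last exact: okR_valid.
case/and3P=> h /eqP e _.
by have := at_let ok rl h; rewrite /lcol /= e.
Qed.

Lemma ok_nested R : okR lam R -> forall l, nested lam R l.
Proof. by move=> ok l; case/andP: (ok l). Qed.

Lemma at_lt R l m k k' : okR lam R -> tinted l -> tinted m -> l < m ->
  at_level R l k -> at_level R m k' -> k' < k.
Proof.
move=> ok rl rm lm /andP[h1 _] /andP[_]; rewrite /upper gtn_eqF /= => [h2|]; last by lia.
have lm2 : l.+1 <= m.-1.
  case: (ltngtP l.+1 m) lm => [||e] //; first by lia.
  by move: rm; rewrite -e relS rl.
apply: leq_trans h2 _; apply: leq_trans h1; apply: leq_trans (lo_hi R l.+1).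
exact: (lo_anti (ok_nested ok)).
Qed.

Lemma at_uniq R l m k : okR lam R -> tinted l -> tinted m -> at_level R l k -> at_level R m k -> l = m.
Proof.
move=> ok rl rm h1 h2; case: (ltngtP l m) => // h.
  by have := at_lt ok rl rm h h1 h2; rewrite ltnn.
by have := at_lt ok rm rl h h2 h1; rewrite ltnn.
Qed.

Section Column.
Variable s : nat.
Local Notation p := (s, None).

Lemma has_adm A R l k (P : pred block) : shape s A R -> above s R -> okR lam R ->
  tinted l -> at_level R l k -> has P (admissible lam i p A k) =
  (adml lam i R l false k && P (k, l, false)) || (adml lam i R l true k && P (k, l, true)).
Proof.
move=> sA aR ok rl al; apply/hasP/idP => [[[[k' l'] g]]|].
  rewrite (mem_admissible i sA aR ok) => /and3P[/eqP -> rl' h].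
  have -> := at_uniq ok rl rl' al (adm_at ok rl' h) => Pb.
  by case: g h Pb => -> ->; rewrite ?orbT.
by case/orP=> /andP[h Pb]; eexists; try exact: Pb; rewrite (mem_admissible i sA aR ok) eqxx rl.
Qed.

Lemma has_rem A R l k (P : pred block) : shape s A R -> above s R -> okR lam R ->
  tinted l -> at_level R l k -> has P (removable lam i p A k) =
  (reml lam i R l false k && P (k, l, false)) || (reml lam i R l true k && P (k, l, true)).
Proof.
move=> sA aR ok rl al; apply/hasP/idP => [[[[k' l'] g]]|].
  rewrite (mem_removable i sA aR ok) => /and3P[/eqP -> rl' h].
  have -> := at_uniq ok rl rl' al (rem_at ok rl' h) => Pb.
  by case: g h Pb => -> ->; rewrite ?orbT.
by case/orP=> /andP[h Pb]; eexists; try exact: Pb; rewrite (mem_removable i sA aR ok) eqxx rl.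
Qed.

Lemma neq_nil (T : eqType) (w : seq T) : (w != [::]) = has predT w.
Proof. by case: w. Qed.

Lemma is_admE A R l k : shape s A R -> above s R -> okR lam R -> tinted l -> at_level R l k ->
  is_admissible lam i p A k = adms tI cI (l == 0) (lower R l) (upper R l) (R l) k.
Proof. by move=> *; rewrite /is_admissible neq_nil (has_adm (R := R) (l := l)) //= !andbT. Qed.

Lemma is_remE A R l k : shape s A R -> above s R -> okR lam R -> tinted l -> at_level R l k ->
  is_removable lam i p A k = rems tI cI (l == 0) (lower R l) (upper R l) (R l) k.
Proof. by move=> *; rewrite /is_removable neq_nil (has_rem (R := R) (l := l)) //= !andbT. Qed.

Lemma upd_at R l x k : tinted l -> at_level (upd R l x) l k = at_level R l k.
Proof. by move=> rl; have e := agree_upd R x rl; rewrite /at_level (agree_lower e rl) (agree_upper e rl). Qed.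

Variables (A : {fset block}) (R : profile).
Hypotheses (sA : shape s A R) (aR : above s R) (ok : okR lam R).

Lemma add_shape l g k : tinted l -> adml lam i R l g k ->
  [/\ shape s ((k, l, g) |` A)%fset (upd R l (inc (R l) g)), above s (upd R l (inc (R l) g))
    & okR lam (upd R l (inc (R l) g))].
Proof.
move=> rl /and4P[ng _ /eqP ek v]; split.
- by apply: shape_add => //; rewrite -ek; exact: aR.
- apply: above_upd => // g'; rewrite /inc; have := aR l g'; rewrite /put /rlen.
  by case: (g); case: (g') => /=; lia.
- exact/(upd_okR _ ok rl).
Qed.

Lemma rem_shape l g k : tinted l -> reml lam i R l g k ->
  [/\ shape s (A `\ (k, l, g))%fset (upd R l (dec (R l) g)), above s (upd R l (dec (R l) g))
    & okR lam (upd R l (dec (R l) g))].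
Proof.
move=> rl h; move: (h) => /and4P[ng _ /eqP ek v].
have sk : s <= k by have /andP[h1 _] := rem_at ok rl h; apply: leq_trans h1; exact: lower_above.
split.
- exact: shape_rem.
- apply: above_upd => // g'; rewrite /dec; have := aR l g'; move: ek; rewrite /put /rlen.
  by case: (g); case: (g') => /=; lia.
- exact/(upd_okR _ ok rl).
Qed.

Lemma column_at l k : tinted l -> at_level R l k ->
  column_signature lam i p A k = [seq y.1 | y <- letsl lam i R l & lcol (R l) y == k].
Proof.
move=> rl al; rewrite -column_lets; last exact: okR_valid.
rewrite /column_signature /column_sign (is_admE sA aR ok rl al) (is_remE sA aR ok rl al).
have -> : twice_admissible lam i p A k = adms2 tI cI (l == 0) (lower R l) (upper R l) (R l) k.
  rewrite /twice_admissible (has_adm _ sA aR ok rl al) /adms2.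
  have e g : adml lam i R l g k && is_admissible lam i p ((k, l, g) |` A)%fset k =
      adml lam i R l g k && adms tI cI (l == 0) (lower R l) (upper R l) (inc (R l) g) k.
    case h: adml => //=; have [h1 h2 h3] := add_shape rl h.
    have ag := agree_upd R (inc (R l) g) rl.
    by rewrite (is_admE h1 h2 h3 rl) ?upd_at // (agree_lower ag rl) (agree_upper ag rl) upd_same.
  by rewrite !e.
have -> // : twice_removable lam i p A k = rems2 tI cI (l == 0) (lower R l) (upper R l) (R l) k.
rewrite /twice_removable (has_rem _ sA aR ok rl al) /rems2.
have e g : reml lam i R l g k && is_removable lam i p (A `\ (k, l, g))%fset k =
    reml lam i R l g k && rems tI cI (l == 0) (lower R l) (upper R l) (dec (R l) g) k.
  case h: reml => //=; have [h1 h2 h3] := rem_shape rl h.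
  have ag := agree_upd R (dec (R l) g) rl.
  by rewrite (is_remE h1 h2 h3 rl) ?upd_at // (agree_lower ag rl) (agree_upper ag rl) upd_same.
by rewrite !e.
Qed.

Lemma column_none k : (forall l, tinted l -> ~~ at_level R l k) ->
  column_signature lam i p A k = [::].
Proof.
move=> h; have hA (P : pred block) : has P (admissible lam i p A k) = false.
  apply/negbTE/hasPn=> -[[k' l'] g]; rewrite (mem_admissible i sA aR ok) => /and3P[_ rl' h'].
  by have := h _ rl'; rewrite (adm_at ok rl' h').
have hR (P : pred block) : has P (removable lam i p A k) = false.
  apply/negbTE/hasPn=> -[[k' l'] g]; rewrite (mem_removable i sA aR ok) => /and3P[_ rl' h'].
  by have := h _ rl'; rewrite (rem_at ok rl' h').
by rewrite /column_signature /twice_removable /twice_admissible /is_removable /is_admissible !neq_nil !hA !hR.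
Qed.

(** Columns are read from left to right, that is, with decreasing index, which
    is the order of increasing levels. *)
Definition letters (ls : seq nat) : seq (bool * nat) :=
  flatten [seq [seq (y.1, lcol (R l) y) | y <- letsl lam i R l] | l <- ls].

Variable D : nat.
Hypothesis hD : forall l, tinted l -> D <= l -> letsl lam i R l = [::].
Definition levels : seq nat := [seq l <- iota 0 D | tinted l].

Lemma column_letters k : column_signature lam i p A k = [seq y.1 | y <- letters levels & y.2 == k].
Proof.
have lE l : [seq y.1 | y <- [seq (y.1, lcol (R l) y) | y <- letsl lam i R l] & y.2 == k] =
   [seq y.1 | y <- letsl lam i R l & lcol (R l) y == k].
  by rewrite filter_map -map_comp.
have fl (ls : seq nat) : [seq y.1 | y <- letters ls & y.2 == k] =
    flatten [seq [seq y.1 | y <- letsl lam i R l & lcol (R l) y == k] | l <- ls].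
  elim: ls => //= l ls IH; rewrite /letters /= filter_cat map_cat -/(letters _) IH.
  by rewrite lE.
have nil l : tinted l -> ~~ at_level R l k -> [seq y.1 | y <- letsl lam i R l & lcol (R l) y == k] = [::].
  move=> rl nl; apply/eqP; rewrite -size_eq0 size_map -all_pred0 all_filter.
  apply/allP => y hy /=; apply/implyP=> /eqP e; move: nl; rewrite -e.
  by rewrite (at_let ok rl hy).
have nils ls : (forall l, l \in ls -> tinted l /\ ~~ at_level R l k) ->
    flatten [seq [seq y.1 | y <- letsl lam i R l & lcol (R l) y == k] | l <- ls] = [::].
  elim: ls => //= l ls IH h; rewrite nil ?IH //; first by move=> m hm; apply: h; rewrite inE hm orbT.
    by have [] := h l (mem_head _ _).
  by have [] := h l (mem_head _ _).
rewrite fl; have [[l rl al]|no] := pselect (exists2 l, tinted l & at_level R l k); last first.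
  have h l : tinted l -> ~~ at_level R l k by move=> rl; apply/negP=> al; apply: no; exists l.
  rewrite column_none // nils // => l; rewrite mem_filter => /andP[rl _]; split=> //; exact: h.
rewrite (column_at rl al).
have other m : tinted m -> m != l -> ~~ at_level R m k.
  by move=> rm; apply: contraNN => am; rewrite (at_uniq ok rm rl am al).
case: (ltnP l D) => lD; last first.
  rewrite hD //= nils // => m; rewrite mem_filter mem_iota add0n => /and3P[rm _ mD].
  by split=> //; apply: other => //; rewrite ltn_eqF // (leq_trans mD).
have : l \in levels by rewrite mem_filter rl mem_iota.
have : uniq levels by rewrite filter_uniq // iota_uniq.
have : forall m, m \in levels -> tinted m by move=> m; rewrite mem_filter => /andP[].
elim: levels => //= m ls IH hr /andP[ml ul]; rewrite inE.
case: (eqVneq l m) => [e _|nlm /= hl].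
  rewrite -e nils ?cats0 // => m' hm'; have rm' : tinted m' by apply: hr; rewrite inE hm' orbT.
  by split=> //; apply: other => //; apply: contraNneq ml => e'; rewrite -e -e'.
have rm : tinted m by apply: hr; rewrite mem_head.
rewrite (nil m) //=; last by apply: other; rewrite // eq_sym.
by apply: IH => // m' hm'; apply: hr; rewrite inE hm' orbT.
Qed.

Lemma letters_pairwise : pairwise (fun y y' : bool * nat => y'.2 <= y.2) (letters levels).
Proof.
have : pairwise ltn levels.
  by rewrite -(sorted_pairwise ltn_trans) sorted_filter ?iota_ltn_sorted //; exact: ltn_trans.
have : forall m, m \in levels -> tinted m by move=> m; rewrite mem_filter => /andP[].
elim: levels => //= l ls IH hr /andP[/allP lt pw]; have rl : tinted l by apply: hr; rewrite mem_head.
rewrite /letters /= -/(letters ls) pairwise_cat IH //; last first.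
  by move=> m hm; apply: hr; rewrite inE hm orbT.
rewrite andbT; apply/andP; split.
  apply/allrelP => y y' /mapP[w hw ->] /flattenP[_ /mapP[m hm ->] /mapP[w' hw' ->]] /=.
  have rm : tinted m by apply: hr; rewrite inE hm orbT.
  apply: ltnW; exact: (at_lt ok rl rm (lt _ hm) (at_let ok rl hw) (at_let ok rm hw')).
have vl := okR_valid ok rl; rewrite /letsl /lets; case E: kindof => [|g|g] //=.
have [hz ab r1 r2 _] := K2P vl E; rewrite !andbT /lcol /=.
by do 2?case: ifP; lia.
Qed.

(** A word with decreasing columns is recovered from its pieces in each
    column. *)
Lemma regroup (w : seq (bool * nat)) a n : pairwise (fun y y' : bool * nat => y'.2 <= y.2) w ->
  (forall y, y \in w -> a <= y.2 < a + n) ->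
  [seq (x, k) | k <- rev (iota a n), x <- [seq y.1 | y <- w & y.2 == k]] = w.
Proof.
have fil (v : seq (bool * nat)) k : [seq (x, k) | x <- [seq y.1 | y <- v & y.2 == k]] = [seq y <- v | y.2 == k].
  by elim: v => //= -[x k'] v IH /=; case: eqP => [->|] //=; rewrite IH.
elim: n w => [|n IH] w pw hw.
  by case: w pw hw => // y w _ /(_ y (mem_head _ _)); lia.
rewrite -addn1 iotaD rev_cat /= fil.
have -> : w = [seq y <- w | y.2 == a + n] ++ [seq y <- w | y.2 < a + n].
  elim: w pw hw {IH} => //= y w IH /andP[/allP hy pw] hw.
  have hyn := hw y (mem_head _ _).
  have hw' y' : y' \in w -> a <= y'.2 < a + n.+1 by move=> h; apply: hw; rewrite inE h orbT.
  case: eqP => [->|ne]; first by rewrite ltnn {1}IH.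
  have lt : y.2 < a + n by lia.
  rewrite lt /= (eq_in_filter (a2 := pred0)); last by move=> y' /hy /=; lia.
  rewrite filter_pred0 /=; congr cons; rewrite (eq_in_filter (a2 := predT)) ?filter_predT //.
  by move=> y' /hy /=; lia.
set w1 := [seq y <- w | y.2 == _]; set w2 := [seq y <- w | _ < _].
have f2 : [seq y <- w2 | y.2 == a + n] = [::].
  by rewrite -filter_predI (eq_filter (a2 := pred0)) ?filter_pred0 // => y /=; lia.
have f1 : [seq y <- w1 | y.2 == a + n] = w1.
  by rewrite -filter_predI; apply: eq_filter => y /=; rewrite andbb.
rewrite filter_cat f1 f2 cats0; congr cat.
have e k : k \in rev (iota a n) -> [seq (x, k) | x <- [seq y.1 | y <- w1 ++ w2 & y.2 == k]] =
    [seq (x, k) | x <- [seq y.1 | y <- w2 & y.2 == k]].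
  rewrite mem_rev mem_iota => hk; rewrite filter_cat.
  suff -> : [seq y <- w1 | y.2 == k] = [::] by [].
  by rewrite -filter_predI (eq_filter (a2 := pred0)) ?filter_pred0 // => y /=; lia.
transitivity [seq (x, k) | k <- rev (iota a n), x <- [seq y.1 | y <- w2 & y.2 == k]].
  by congr flatten; exact/eq_in_map.
apply: IH => [|y]; first exact: pairwise_filter.
by rewrite mem_filter /= => /andP[h /hw /andP[-> _]].
Qed.

(** The word of a wall is the concatenation of the words of its levels, and
    [at_lt] orders the levels in the same way as the columns. *)
Lemma signs_letters : signs lam i p A = letters levels.
Proof.
rewrite /signs; have -> : columns p A = rev (iota s ((maxn s (ncols A)).+1 - s)) by [].
rewrite (_ : flatten _ = [seq (x, k) | k <- rev (iota s ((maxn s (ncols A)).+1 - s)),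
   x <- [seq y.1 | y <- letters levels & y.2 == k]]); last first.
  by congr flatten; apply: eq_map => k; rewrite column_letters.
apply: regroup => [|y]; first exact: letters_pairwise.
case/flattenP=> v /mapP[l]; rewrite mem_filter => /andP[rl _] -> /mapP[w hw ->] /=.
have [h1 _ h3 h4] := let_between (okR_valid ok rl) hw.
have sm := leq_trans (lower_above aR l) h1.
suff : lcol (R l) w <= maxn s (ncols A) by lia.
have [le|gt] := leqP (lcol (R l) w) s; first by rewrite (leq_trans le) ?leq_maxl.
have inA : ((lcol (R l) w).-1, l, w.2) \in A.
  rewrite sA groundE h3 andbT; apply/andP; split; first by lia.
  by move: gt; rewrite /lcol; move: (rlen (R l) w.2) => r; case: (w.1); lia.
rewrite leq_max; apply/orP; right.
apply: leq_trans (_ : (col ((lcol (R l) w).-1, l, w.2)).+1 <= _).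
  by rewrite /col /= prednK // (leq_trans _ gt).
exact: (leq_bigmax_seq _ inA isT).
Qed.

End Column.

(** * Parts of a wall *)

Definition clipR s R : profile := fun l => clip s (R l).

Lemma clipR0 R : clipR 0 R = R.
Proof. by apply: funext => l; rewrite /clipR /clip !max0n; case: (R l). Qed.

Lemma rlen_clip s R l g : rlen (clipR s R l) g = maxn s (rlen (R l) g).
Proof. by case: g. Qed.

Lemma clip_above s R : above s (clipR s R).
Proof. by move=> l g; rewrite rlen_clip leq_maxl. Qed.

Lemma clip_hi s R l : hi (clipR s R) l = maxn s (hi R l).
Proof. rewrite /hi /=; lia. Qed.

Lemma clip_lo s R l : lo (clipR s R) l = maxn s (lo R l).
Proof. rewrite /lo /=; case: ifP => _; lia. Qed.

Lemma clip_okR s R : okR lam R -> okR lam (clipR s R).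
Proof.
move=> ok l; have := ok l; rewrite /nested clip_hi clip_lo /=.
by case: (_ && typeI l); lia.
Qed.

Lemma clip_lower s R l : lower (clipR s R) l = maxn s (lower R l).
Proof. exact: clip_hi. Qed.

Lemma clip_upper s R l : l != 0 -> upper (clipR s R) l = maxn s (upper R l).
Proof. by rewrite /upper => /negPf ->; exact: clip_lo. Qed.

Lemma shape_part s A R : shape 0 A R -> shape s (part (s, None) A) (clipR s R).
Proof.
move=> sA k l g; rewrite /part !inE /= sA /in_range /= andbT rlen_clip leq_max.
by case: (leqP s k) => sk /=; rewrite ?andbT ?andbF // ltnNge sk.
Qed.

(** Cancellation removes pairs of opposite signs and does not change the
    weight. *)
Lemma cancel_signs_wt w ms ps :
  ((size (cancel_signs w ms ps).2)%:Z - (size (cancel_signs w ms ps).1)%:Z =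
  (size ps)%:Z - (size ms)%:Z + wwt [seq y.1 | y <- w])%R.
Proof.
elim: w ms ps => [|[[] k] w IH] ms ps /=.
- by rewrite !size_rev wwt0 GRing.addr0.
- by rewrite IH /wwt /= big_cons /=; lia.
- case: ps => [|k' ps]; rewrite IH /wwt /= big_cons /=; lia.
Qed.

Section Truncated.
Variables (A : {fset block}) (R : profile) (D : nat).
Hypotheses (sA : shape 0 A R) (ok : okR lam R).
Hypotheses (rD : ~~ tinted D) (hD : forall l, D <= l -> R l = (0, 0)).

Lemma no_lets s l : tinted l -> D <= l -> letsl lam i (clipR s R) l = [::].
Proof.
move=> rl Dl; have Dl' : D < l by rewrite ltn_neqAle Dl andbT; apply: contraNneq rD => ->.
have l0 : l != 0 by lia.
have eg : lower (clipR s R) l = s by rewrite clip_lower /lower /hi hD ?maxn0 // leqW.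
have eb : upper (clipR s R) l = s.
  rewrite clip_upper // /upper (negPf l0) /lo hD ?maxn0 //=; last by lia.
  by case: ifP; rewrite maxn0.
rewrite /letsl eg eb (negPf l0) /lets /kindof ltnn subnn.
by case: tI.
Qed.

Lemma signs_part s : signs lam i (s, None) (part (s, None) A) = letters (clipR s R) (levels D).
Proof.
apply: signs_letters; [exact: shape_part | exact: clip_above | exact: clip_okR |].
by move=> l rl Dl; exact: no_lets.
Qed.

Lemma phi_epsE s : phi_eps lam i (s, None) A =
  (\sum_(l <- levels D) wwt [seq y.1 | y <- letsl lam i (clipR s R) l])%R.
Proof.
rewrite /phi_eps /phi /eps /signature signs_part cancel_signs_wt /= GRing.subr0 GRing.add0r.
rewrite /letters; elim: (levels D) => [|l ls IH] /=; first by rewrite big_nil wwt0.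
rewrite big_cons map_cat {1}/wwt big_cat /= -[X in (_ + X)%R]/(wwt _) IH.
by rewrite -map_comp.
Qed.

End Truncated.
End Signature.

Local Open Scope ring_scope.

(** * Runs of columns of the same height *)
Local Open Scope nat_scope.

Lemma count_between a b m n : m <= a -> b <= m + n -> count (fun k => a <= k < b) (iota m n) = b - a.
Proof.
elim: n m a => [|n IH] m a ma bm /=; first by lia.
case: (ltnP m a) => h /=; first by rewrite add0n IH //; lia.
have -> : a = m by lia.
case: (ltnP m b) => hb; last first.
  rewrite (eq_in_count (a2 := pred0)) ?count_pred0; first by lia.
  by move=> k; rewrite mem_iota /=; lia.
rewrite (eq_in_count (a2 := fun k => m.+1 <= k < b)) ?IH //; [lia|lia|].
by move=> k; rewrite mem_iota; lia.
Qed.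

Section Counts.
Variables (lam : I) (A : {fset block}) (R : profile).
Hypotheses (sA : shape 0 A R) (ok : okR lam R).
Let nR := ok_nested ok.

(** The columns with a half-filled topmost cube at level l are those between
    its two rows, and the columns of the same height are counted by the
    difference of the lengths. *)
Lemma added_eq_half k l : l != 0 -> (added A k == l.*2) = (lo R l <= k < hi R l).
Proof.
move=> l0; apply/idP/idP => [/eqP e|/andP[h1 h2]].
  have [[m h]|[m [g [h1 h2 h3 h4]]]] := column_cases sA nR (leq0n k).
    by move: e; rewrite (added_full sA nR (leq0n k) h); lia.
  move: e; rewrite (added_half sA nR (leq0n k) h1 h2 h3 h4) => /double_inj e.
  move: h3 h4; rewrite e !(shape_occ sA) // !groundE (negPf l0) /= /lo /hi (negPf l0) /rlen.
  by case: (g) => /=; lia.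
have h3 : l = 0 \/ k < lo R l.-1.
  by right; apply: leq_trans h2 _; have := nest nR l.-1; rewrite prednK // lt0n.
have h4 : hi R l.+1 <= k by apply: leq_trans (nest nR l) h1.
have [g [o1 o2]] : exists g, k < rlen (R l) g /\ ~~ (k < rlen (R l) (~~ g)).
  move: h1 h2; rewrite /lo /hi (negPf l0) /rlen => h1 h2.
  have [h|h] : (R l).2 <= k \/ (R l).1 <= k by lia.
    by exists false; rewrite /=; lia.
  by exists true; rewrite /=; lia.
by rewrite (added_half sA nR (leq0n k) h3 h4 (g := g)) // (shape_occ sA) // ?o1 ?orbT // groundE (negPf l0).
Qed.

Lemma added_eq_full k l : (added A k == l.*2.+1) = (hi R l.+1 <= k < lo R l).
Proof.
apply/idP/idP => [/eqP e|h]; last by rewrite (added_full sA nR (leq0n k) h).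
have [[m h]|[m [g [h1 h2 h3 h4]]]] := column_cases sA nR (leq0n k).
  by move: e; rewrite (added_full sA nR (leq0n k) h) => /succn_inj/double_inj <-.
by move: e; rewrite (added_half sA nR (leq0n k) h1 h2 h3 h4); lia.
Qed.

Lemma added_eq0 k : (added A k == 0) = (lo R 0 <= k).
Proof.
apply/idP/idP => [/eqP e|h].
  rewrite leqNgt; apply/negP=> h; have : (k, 0, true) \in A by rewrite sA groundE andbF andbT; move: h; rewrite /lo.
  move=> inA; have : 0 < added A k by rewrite -has_count; apply/hasP; exists (k, 0, true); rewrite ?eqxx.
  by rewrite e.
rewrite (added_half sA nR (leq0n k) (l := 0) (g := false)) //.
- by left.
- by apply: leq_trans (nest nR 0) h.
- by rewrite (shape_occ sA) // groundE /= -leqNgt; move: h; rewrite /lo.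
Qed.

Lemma hi_ncols l : l != 0 -> hi R l <= ncols A.
Proof.
move=> l0; apply: hi_le => g; case E: (rlen _ _) => [//|r].
have inA : (r, l, g) \in A by rewrite sA E ltnSn groundE (negPf l0).
rewrite -[r]/(col (r, l, g)); exact: (leq_bigmax_seq _ inA isT).
Qed.

Lemma lo_ncols l : lo R l <= ncols A.
Proof.
case: (eqVneq l 0) => [->|l0]; last by apply: leq_trans (lo_hi R l) (hi_ncols l0).
rewrite /lo /=; case E: (R 0).2 => [//|r].
have inA : (r, 0, true) \in A by rewrite sA groundE andbT /= E ltnSn.
rewrite -[r]/(col (r, 0, true)); exact: (leq_bigmax_seq _ inA isT).
Qed.

Lemma nleft_half k l : l != 0 -> lo R l <= k < hi R l -> nleft A k = hi R l - k.+1.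
Proof.
move=> l0 h; have /eqP e : added A k == l.*2 by rewrite added_eq_half.
rewrite /nleft e (eq_count (a2 := fun k => lo R l <= k < hi R l)); last by move=> j; exact: added_eq_half.
rewrite (eq_in_count (a2 := fun j => k.+1 <= j < hi R l)); last by move=> j; rewrite mem_iota; lia.
by rewrite count_between // subnKC ?hi_ncols //; have := hi_ncols l0; lia.
Qed.

Lemma nright_half k l : l != 0 -> lo R l <= k < hi R l -> nright A k = k - lo R l.
Proof.
move=> l0 h; have /eqP e : added A k == l.*2 by rewrite added_eq_half.
rewrite /nright e (eq_count (a2 := fun k => lo R l <= k < hi R l)); last by move=> j; exact: added_eq_half.
rewrite (eq_in_count (a2 := fun j => lo R l <= j < k)); last by move=> j; rewrite mem_iota; lia.
by rewrite count_between.
Qed.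

Lemma nleft_full k l : hi R l.+1 <= k < lo R l -> nleft A k = lo R l - k.+1.
Proof.
move=> h; have /eqP e : added A k == l.*2.+1 by rewrite added_eq_full.
rewrite /nleft e (eq_count (a2 := fun k => hi R l.+1 <= k < lo R l)); last by move=> j; exact: added_eq_full.
rewrite (eq_in_count (a2 := fun j => k.+1 <= j < lo R l)); last by move=> j; rewrite mem_iota; lia.
by rewrite count_between // subnKC ?lo_ncols //; have := lo_ncols l; lia.
Qed.

Lemma half_topE k : half_top lam A k =
  if (odd (added A k)) || typeI lam (added A k)./2 then None
  else Some ((added A k)./2, occupied A (k, (added A k)./2, true)).
Proof.
rewrite /half_top /=; case o: (odd (added A k)) => //=.
have -> : uphalf (added A k) = (added A k)./2 by rewrite uphalf_half o.
by case: typeI.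
Qed.

End Counts.

(** * The exponents in the action of f *)

Section Prefix.
Variables (lam i : I) (A : {fset block}) (R : profile) (D : nat).
Hypotheses (sA : shape 0 A R) (ok : okR lam R).
Hypotheses (rD : ~~ tinted lam i D) (hD : forall l, D <= l -> R l = (0, 0)).
Local Notation tinted := (tinted lam i).
Local Notation tI := (tI i).
Local Notation cI := (cI lam i).
Let nR := ok_nested ok.

Definition level_weight R l : int := config_weight tI cI (l == 0) (lower R l) (upper R l) (R l).

Lemma lets_z t c a b b' x : lets t c true a b x = lets t c true a b' x.
Proof. by rewrite /lets /kindof; case: t => //=; case: (_ (+) _). Qed.

(** The part of a wall to the left of a column at level l contains the lower
    levels without change, it is empty at the higher levels, and it cuts the
    level l. *)
Lemma clip_prefix l s m : tinted l -> tinted m -> lower R l <= s -> (l == 0) || (s <= upper R l) ->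
  level_weight (clipR s R) m =
  if m < l then level_weight R m else
  if m == l then clipped_weight tI cI (l == 0) s (lower R l) (upper R l) (R l) else 0.
Proof.
move=> rl rm h1 h2; case: (ltngtP m l) => ml.
- have l0 : (l == 0) = false by lia.
  rewrite l0 /upper l0 /= in h2.
  have m2 : m.+1 <= l.-1.
    case: (ltngtP m.+1 l) ml => [||e] //; first by lia.
    by move: rl; rewrite -e relS rm.
  have g1 : s <= lo R m.+1 by apply: leq_trans h2 (lo_anti nR m2).
  have g2 : s <= lo R m by apply: leq_trans g1 (lo_anti nR (leqnSn m)).
  have ega : lower (clipR s R) m = lower R m.
    by rewrite clip_lower; apply/maxn_idPr; rewrite /lower; apply: leq_trans g1 (lo_hi _ _).
  rewrite /level_weight /config_weight /word ega /clipR; case: (eqVneq m 0) => [m0|m0].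
    have e2 : maxn s (R m).2 = (R m).2 by apply/maxn_idPr; move: g2; rewrite /lo m0.
    rewrite (lets_z _ _ _ _ (upper R m)) /lets /kindof /=; case: tI => /=; rewrite ?e2 //.
    by case: (_ (+) _) => //=; rewrite e2.
  rewrite clip_upper // (maxn_idPr _); last first.
    rewrite /upper (negPf m0); apply: leq_trans g2 (lo_anti nR (leq_pred m)).
  rewrite /clip; move: g2; rewrite /lo (negPf m0) => g2.
  have -> : maxn s (R m).1 = (R m).1 by lia.
  have -> : maxn s (R m).2 = (R m).2 by lia.
  by case: (R m).
- have m0 : m != 0 by lia.
  have m2 : l.+1 <= m.-1.
    case: (ltngtP l.+1 m) ml => [||e] //; first by lia.
    by move: rm; rewrite -e relS rl.
  have g1 : lo R m.-1 <= s.
    by apply: leq_trans (lo_anti nR m2) _; apply: leq_trans (lo_hi R l.+1) h1.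
  have g2 : hi R m <= s by apply: leq_trans g1; have := nest nR m.-1; rewrite prednK // lt0n.
  have g3 : hi R m.+1 <= s by apply: leq_trans (nest nR m) _; apply: leq_trans (lo_hi R m) g2.
  rewrite /level_weight /config_weight clip_lower clip_upper // /lower /upper (negPf m0).
  by rewrite (maxn_idPl g1) (maxn_idPl g3) /word /lets /kindof ltnn subnn; case: tI; rewrite /= wwt0.
- rewrite ml /level_weight /clipped_weight /config_weight clip_lower /clipR; case: (eqVneq l 0) => [l0|l0].
    by rewrite /word (lets_z _ _ _ _ (maxn s (upper R l))).
  by rewrite clip_upper.
Qed.

(** This computes the exponents in the definition of the action of f. *)
Lemma phi_eps_prefix l s : tinted l -> l < D -> lower R l <= s -> (l == 0) || (s <= upper R l) ->
  phi_eps lam i (s, None) A =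
  (\sum_(m <- levels lam i D | (m < l)%N) level_weight R m + clipped_weight tI cI (l == 0) s (lower R l) (upper R l) (R l))%R.
Proof.
move=> rl lD h1 h2; rewrite (phi_epsE sA ok rD hD).
have lL : l \in levels lam i D by rewrite mem_filter rl mem_iota.
have uL : uniq (levels lam i D) by rewrite filter_uniq // iota_uniq.
rewrite (bigID (fun m => m < l)%N) /=; congr (_ + _)%R.
  rewrite big_seq_cond [RHS]big_seq_cond; apply: eq_bigr => m /andP[].
  rewrite mem_filter => /andP[rm _] ml.
  by have := clip_prefix rl rm h1 h2; rewrite ml.
rewrite big_mkcond (bigD1_seq l) //= ltnn.
rewrite -[X in (X + _)%R]/(level_weight (clipR s R) l) (clip_prefix rl rl h1 h2) ltnn eqxx.
rewrite big_seq_cond big1 ?GRing.addr0 // => m /andP[]; rewrite mem_filter => /andP[rm _] nml.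
case: ifP => // ml; rewrite -[LHS]/(level_weight (clipR s R) m) (clip_prefix rl rm h1 h2).
by rewrite (negPf ml) (negPf nml).
Qed.

End Prefix.

Local Open Scope ring_scope.

(** * The action of f on a wall as a sum over the levels *)

(** The bound D on the levels makes this a finite set. *)
Definition wall (D : nat) (R : profile) : {fset block} :=
  [fset b in [seq b <- [seq (x, g) | x <- [seq (k, l) | k <- iota 0 (\max_(l < D) hi R l), l <- iota 0 D],
                                   g <- [:: false; true]]
     | (col b < rlen (R (level b)) (half b))%N && ~~ ground b]]%fset.

Lemma mem_wall D R k l g :
  ((k, l, g) \in wall D R) = [&& (l < D)%N, (k < rlen (R l) g)%N & ~~ ground (k, l, g)].
Proof.
rewrite /wall inE mem_filter -[col _]/k -[level _]/l -[half _]/g andbC.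
case kr: (k < _)%N; last by rewrite !andbF.
case: (ground _); rewrite ?andbF // !andbT.
apply/allpairsP/idP => [[[[k' l'] g'] [/= /allpairsP[[a b] [/= _ hb [_ ->]]] _ [_ -> _]]]|lD].
  by move: hb; rewrite mem_iota.
exists ((k, l), g); split=> //; last by case: g {kr}.
apply/allpairsP; exists (k, l); split=> //; rewrite mem_iota add0n //=.
 apply: leq_trans kr _; apply: leq_trans (rlen_hi R l g) _.
exact: (leq_bigmax (Ordinal lD)).
Qed.

Lemma wall_shape D R : (forall l, (D <= l)%N -> R l = (0, 0)%N) -> shape 0 (wall D R) R.
Proof.
move=> hD k l g; rewrite mem_wall /=; case: (ltnP l D) => //= /hD ->.
by case: g.
Qed.

Lemma shape_wall D A R : shape 0 A R -> (forall l, (D <= l)%N -> R l = (0, 0)%N) -> A = wall D R.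
Proof.
by move=> sA hD; apply/fsetP => -[[k l] g]; rewrite sA (wall_shape hD).
Qed.

Definition wvec lam D R : fock lam := vec_of lam (wall D R).

Lemma wvec_bad lam D R : (forall l, (D <= l)%N -> R l = (0, 0)%N) -> ~ okR lam R -> wvec lam D R = 0.
Proof.
move=> hD nok; rewrite /wvec /vec_of insubN //; apply/negP=> h; apply: nok.
exact/(shape_proper lam (wall_shape hD) (fun _ _ => leq0n _)).
Qed.

Lemma pow_split (F : fieldType) (p : F) (W L : int) (c : F) : p != 0 ->
  p ^ (W + L) * c = p ^ W * (p ^ L * c).
Proof. by move=> p0; rewrite expfzDr // mulrA. Qed.

Lemma pow_split1 (F : fieldType) (p : F) (W L : int) : p != 0 ->
  p ^ (W + L) = p ^ W * p ^ L.
Proof. by move=> p0; rewrite expfzDr. Qed.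

Lemma pow_split2 (F : fieldType) (p : F) (W L : int) (c : F) : p != 0 ->
  p ^ (W + L) * c = p ^ W * (c * p ^ L).
Proof. by move=> p0; rewrite expfzDr // -mulrA [c * _]mulrC. Qed.

Section Slots.
Variables (lam i : I) (A : {fset block}) (R : profile) (D : nat).
Hypotheses (sA : shape 0 A R) (ok : okR lam R).
Hypotheses (rD : ~~ tinted lam i D) (hD : forall l, (D <= l)%N -> R l = (0, 0)%N).
Local Notation tinted := (tinted lam i).
Local Notation tI := (tI i).
Local Notation cI := (cI lam i).
Local Notation levels := (levels lam i D).
Let nR := ok_nested ok.
Let aR : above 0 R := fun _ _ => leq0n _.

Lemma upd_hD l x : tinted l -> (l < D)%N -> forall m, (D <= m)%N -> upd R l x m = (0, 0)%N.
Proof. by move=> rl lD m Dm; rewrite upd_other ?hD // gtn_eqF // (leq_trans lD). Qed.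

Lemma rel_lt l g k : tinted l -> adml lam i R l g k -> (l < D)%N.
Proof.
move=> rl h; rewrite ltnNge; apply/negP=> Dl.
have := no_lets rD hD 0 rl Dl; rewrite clipR0 => e.
move: h; rewrite /adml adm_lets; last exact: okR_valid.
by rewrite -/(letsl lam i R l) e.
Qed.

Lemma adml_len l g k : adml lam i R l g k = (k == rlen (R l) g) && adml lam i R l g (rlen (R l) g).
Proof.
rewrite /adml /adm [k == _]eq_sym eqxx; case: (eqVneq (rlen (R l) g) k) => [->|_] //=.
by rewrite !andbF.
Qed.

Lemma rlen_ncols l g : adml lam i R l g (rlen (R l) g) -> (rlen (R l) g <= ncols A)%N.
Proof.
move=> /and4P[ng _ _ _]; case E: (rlen _ _) => [//|r].
have inA : (r, l, g) \in A by rewrite sA E ltnSn groundE.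
rewrite -[r]/(col (r, l, g)); exact: (leq_bigmax_seq _ inA isT).
Qed.

(** Every admissible slot is the end of a row at a unique level. *)
Lemma sum_admissible (V : zmodType) (G : nat -> block -> V) :
  \sum_(0 <= k < (ncols A).+1) \sum_(b <- admissible lam i whole A k) G k b =
  \sum_(l <- levels) \sum_(g <- [:: false; true] | adml lam i R l g (rlen (R l) g))
     G (rlen (R l) g) (rlen (R l) g, l, g).
Proof.
have key k : \sum_(b <- admissible lam i whole A k) G k b =
    \sum_(l <- levels) \sum_(g <- [:: false; true] | adml lam i R l g k) G k (k, l, g).
  pose bx : seq block := [seq (k, l, g) | l <- levels, g <- [:: false; true]].
  pose P (b : block) := adml lam i R (level b) (half b) k.
  have -> : \sum_(l <- levels) \sum_(g <- [:: false; true] | adml lam i R l g k) G k (k, l, g) =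
      \sum_(b <- [seq b <- bx | P b]) G k b.
    by rewrite [RHS]big_filter [RHS]big_mkcond [RHS]big_allpairs_dep /=; apply: eq_bigr => l _; rewrite big_mkcond.
  have u1 : uniq (admissible lam i whole A k).
    by rewrite filter_uniq // allpairs_uniq ?iota_uniq // => -[? ?] [? ?] _ _ [-> ->].
  have u2 : uniq bx.
    rewrite allpairs_uniq //; first by rewrite filter_uniq // iota_uniq.
    by move=> [? ?] [? ?] _ _ [-> ->].
  apply/perm_big/uniq_perm; [exact: u1 | exact: filter_uniq |].
  move=> [[k' l] g]; rewrite (mem_admissible i sA aR ok) mem_filter /P /level /half /=.
  apply/and3P/andP => [[/eqP -> rl h]|[h /allpairsP[[l' g'] [/= hl _ [-> el _]]]]].
    split=> //; apply/allpairsP; exists (l, g); split=> //; last by case: (g).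
    by rewrite mem_filter rl mem_iota add0n (rel_lt rl h).
  by split=> //; rewrite el; move: hl; rewrite mem_filter => /andP[].
under eq_bigr => k _ do rewrite key.
rewrite exchange_big; apply: eq_bigr => l _ /=.
under eq_bigr => k _ do rewrite big_mkcond.
rewrite exchange_big [RHS]big_mkcond; apply: eq_bigr => g _ /=.
case: ifP => h; last by rewrite big1 // => k _; rewrite adml_len h andbF.
have hk : rlen (R l) g \in index_iota 0 (ncols A).+1.
  by rewrite mem_index_iota ltnS rlen_ncols.
rewrite (bigD1_seq _ hk (iota_uniq _ _)) /=.
rewrite h big1 ?addr0 // => k /negPf nk; by rewrite adml_len nk.
Qed.

Lemma sum_levels (V : zmodType) (G G' : nat -> bool -> V) :
  (forall l g, tinted l -> adml lam i R l g (rlen (R l) g) -> G l g = G' l g) ->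
  \sum_(l <- levels) \sum_(g <- [:: false; true] | adml lam i R l g (rlen (R l) g)) G l g =
  \sum_(l <- levels) \sum_(g <- [:: false; true] | adml lam i R l g (rlen (R l) g)) G' l g.
Proof.
move=> e; apply: eq_big_seq => l; rewrite mem_filter => /andP[rl _].
by apply: eq_bigr => g h; exact: e.
Qed.

Lemma add_wall l g : tinted l -> adml lam i R l g (rlen (R l) g) ->
  ((rlen (R l) g, l, g) |` A)%fset = wall D (upd R l (inc (R l) g)).
Proof.
move=> rl h; apply: shape_wall; last by apply: upd_hD => //; exact: rel_lt h.
by apply: shape_add => //; case/and4P: h.
Qed.

Local Notation p := (qi i).
Definition f_termsl l := f_terms tI cI (l == 0)%N p (lower R l) (upper R l) (R l).
Definition pre l : int := \sum_(m <- levels | (m < l)%N) level_weight lam i R m.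
(** The action of f_i written as a sum over the levels, with the coproduct
    exponents. *)
Definition action : fock lam :=
  \sum_(l <- levels) \sum_(y <- f_termsl l) (p ^ pre l * y.1) *: wvec lam D (upd R l y.2).

Let p0 : p != 0 := base_neq0 (qi_base i).

Lemma action_split : action =
  \sum_(l <- levels) \sum_(g <- [:: false; true] | adml lam i R l g (rlen (R l) g))
     (p ^ pre l * add_coef tI cI (l == 0)%N p (lower R l) (upper R l) (R l) g) *: wvec lam D (upd R l (inc (R l) g)) +
  \sum_(l <- levels) \sum_(y <- virtual_add tI cI (l == 0)%N p (lower R l) (upper R l) (R l))
     (p ^ pre l * y.1) *: wvec lam D (upd R l y.2).
Proof.
rewrite -big_split; apply: eq_bigr => l _ /=.
by rewrite /f_termsl /f_terms big_cat big_map big_filter.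
Qed.

Lemma adml_at l g : tinted l -> adml lam i R l g (rlen (R l) g) ->
  (lower R l <= rlen (R l) g)%N && ((l == 0%N) || (rlen (R l) g < upper R l)%N).
Proof. by move=> rl h; exact: (adm_at ok rl h). Qed.

Lemma phi_pre l s : tinted l -> (l < D)%N -> (lower R l <= s)%N -> (l == 0%N) || (s <= upper R l)%N ->
  phi_eps lam i (s, None) A = pre l + clipped_weight tI cI (l == 0%N) s (lower R l) (upper R l) (R l).
Proof. by move=> *; apply: phi_eps_prefix. Qed.

(** For a type I level, the factor that depends on the run of equal columns
    occurs for the upper slot only, and the length of the run is the distance
    from the rows above. *)
Lemma coef_1 l g : tI -> tinted l -> adml lam i R l g (rlen (R l) g) ->
  let k := rlen (R l) g in let n := nleft A k in
  let sg := column_signature lam i whole A k in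
  forall (F : fieldType) (x : F), x != 0 ->
  (if added A k == 0%N then 1 else
   x ^ phi_eps lam i ((k + n).+1, None) A *
   (if (sg == [:: true; true]) || (sg == [:: true]) && ~~ g then 1 else coef x n)) =
  x ^ pre l * add_coef tI cI (l == 0%N) x (lower R l) (upper R l) (R l) g.
Proof.
move=> et rl h k n sg F x x0.
have v := okR_valid ok rl; have lD := rel_lt rl h.
have al := adml_at rl h.
have sgE : sg = [seq y.1 | y <- letsl lam i R l & lcol (R l) y == k].
  by rewrite /sg /whole (column_at sA aR ok rl al).
move: v h al; rewrite /validl /adml /add_coef et /=.
case: (eqVneq l 0%N) => [l0|l0] v /and4P[ng _ _ v'] al.
  have gt : g by case: (g) ng.
  have -> : (added A k == 0%N) = true by rewrite (added_eq0 sA ok) /lo /= /k gt l0 /= leqnn.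
  by rewrite /pre big1 ?expr0z ?mulr1 // => m; rewrite l0.
have b0 : upper R l = lo R l.-1 by rewrite /upper (negPf l0).
have hl : hi R l.-1.+1 = hi R l by rewrite prednK // lt0n.
move: v v'; rewrite /valid /= => v v'.
have lE : lo R l = (R l).2 by rewrite /lo (negPf l0); lia.
have hE : hi R l = (R l).1 by rewrite /hi; lia.
move: sgE; rewrite /letsl et (negPf l0) /lets /kindof.
have ab : (lower R l < upper R l)%N by move: al; rewrite /=; lia.
rewrite ab /= => sgE.
have ek : k = rlen (R l) g by [].
have en : n = nleft A k by [].
move: ek en; case: g k n sg sgE v' al {ng} => /= k n sg sgE v' al ek en.
- have hk : (lo R l <= k < hi R l)%N by rewrite lE hE ek; lia.
  have -> : (added A k == 0%N) = false.
    by apply/negP=> e; have := added_eq_half sA ok k l0; rewrite hk (eqP e) -[0%N]/(0.*2); lia.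
  have nE : n = (hi R l - k.+1)%N by rewrite en (nleft_half sA ok l0 hk).
  have -> : (k + n).+1 = (R l).1 by rewrite nE hE; lia.
  rewrite andbF orbF; have -> : (sg == [:: true; true]) = false.
    apply/negP=> /eqP e; move: sgE; rewrite e /lcol /=.
    case: ifP => [c1|_]; case: ifP => [c2|_] // -[] // e1 e2.
    by move: c1; rewrite -e1 /=; lia.
  rewrite (phi_pre rl lD); [|lia|by rewrite (negPf l0) /=; lia].
  by rewrite (pow_split _ _ _ x0) nE hE et (negPf l0); congr (_ * (_ * coef x _)); lia.
- have hk : (hi R l.-1.+1 <= k < lo R l.-1)%N by rewrite hl hE ek -b0; lia.
  have -> : (added A k == 0%N) = false.
    by apply/negP=> e; have := added_eq_full sA ok k l.-1; rewrite hk (eqP e).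
  have nE : n = 0%N by rewrite en (nleft_full sA ok hk) -b0 ek; lia.
  have -> : (k + n).+1 = upper R l by rewrite nE ek; lia.
  have -> : (sg == [:: true; true]) || (sg == [:: true]) && ~~ false.
    rewrite sgE /lcol /= ek (_ : ((R l).1 != upper R l) = true) ?eqxx; last by lia.
    by case e2: ((R l).2 == lower R l) => /=; case: ifP => //= c2; lia.
  rewrite (phi_pre rl lD); [|lia|by rewrite leqnn orbT].
  rewrite (_ : clipped_weight _ _ _ _ _ _ _ = 0) ?addr0 // /clipped_weight /config_weight /word /lets /kindof et (negPf l0).
  have -> : (maxn (upper R l) (lower R l) < maxn (upper R l) (upper R l))%N = false by lia.
  by rewrite /= wwt0.
Qed.

Lemma action_1 : i = i1 -> fock_f1 lam A = action.
Proof.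
move=> ei; have et : tI by rewrite /tI ei.
have eq1 : p = q by rewrite ei /qi /di eqxx expr1z.
rewrite action_split [X in _ + X]big1 ?addr0; last by move=> l _; rewrite /virtual_add et big_nil.
rewrite /fock_f1 -{1}ei.
rewrite (sum_admissible (fun k b => (if added A k == 0%N then 1 else
   q ^ phi_eps lam i1 ((k + nleft A k).+1, None) A *
   (if (column_signature lam i1 whole A k == [:: true; true]) || (column_signature lam i1 whole A k == [:: true]) && ~~ half b
    then 1 else coef1 (nleft A k))) *: vec_of lam (b |` A)%fset)).
apply: sum_levels => l g rl h; rewrite (add_wall rl h).
by rewrite -(coef_1 et rl h p0) eq1 ei.
Qed.

(** * Virtual slots *)

Definition vcond l : bool :=
  [&& l != 0%N, (minn (R l).1 (R l).2).+1 < maxn (R l).1 (R l).2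
    & odd (maxn (R l).1 (R l).2) (+) ((R l).1 < (R l).2) == cI]%N.
Definition vnew l : nat * nat :=
  two ((R l).1 < (R l).2)%N (minn (R l).1 (R l).2).+1 (maxn (R l).1 (R l).2).

Lemma vcond_hi l : l != 0%N -> maxn (R l).1 (R l).2 = hi R l /\ minn (R l).1 (R l).2 = lo R l.
Proof. by move=> l0; rewrite /lo (negPf l0). Qed.

Lemma vcond_added l k : vcond l && (k == (hi R l).-1) -> l != 0%N /\ added A k = l.*2.
Proof.
case/andP=> /and3P[l0 h1 h2] /eqP ek; split=> //; apply/eqP.
rewrite (added_eq_half sA ok) // ek; have [e1 e2] := vcond_hi l0; rewrite -e1 -e2; lia.
Qed.

(** Replacing the top blocks of a run of equal columns by the other halves and
    completing the right-most cube exchanges the two rows, up to one block. *)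
Lemma virtual_wall l (h : bool) (k m : nat) : tinted l -> (l < D)%N -> vcond l -> k = (hi R l).-1 ->
  h = ((R l).1 < (R l).2)%N -> m = (hi R l - (lo R l).+1)%N ->
  ((A `\` [fset ((j, l, h) : block) | j in iota (k - m).+1 m])
        `|` [fset ((j, l, ~~ h) : block) | j in iota (k - m) m.+1])%fset = wall D (upd R l (vnew l)).
Proof.
move=> rl lD /and3P[l0 h1 h2] ek eh em; apply: shape_wall; last exact: upd_hD.
have [e1 e2] := vcond_hi l0; rewrite e1 e2 in h1.
have ekm : (k - m = lo R l)%N by lia.
move=> k' l' g.
have imE g0 a n : ((k', l', g) \in [fset ((j, l, g0) : block) | j in iota a n]%fset) =
    [&& l' == l, g == g0 & (a <= k' < a + n)%N].
  apply/imfsetP/and3P => /= [[j]|[/eqP -> /eqP -> hk']]; last by exists k'; rewrite ?mem_iota.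
  by rewrite mem_iota => hj [-> -> ->].
rewrite in_fsetU in_fsetD !imE sA leq0n ekm groundE /upd; case: (eqVneq l' l) => [->|_] /=; last by rewrite orbF.
rewrite (negPf l0) !andbT /vnew -eh e1 e2.
have er : rlen (R l) h = hi R l /\ rlen (R l) (~~ h) = lo R l.
  rewrite -e1 -e2 eh /rlen; case: ifP => /=; lia.
case: (eqVneq g h) => [->|ngh].
  rewrite rlen_two er.1 (_ : (h == ~~ h) = false) /= ?orbF; last by case: (h).
  by apply/idP/idP; lia.
have -> : g = ~~ h by case: (g) (h) ngh => [] [].
by rewrite rlen_twoN er.2 eqxx /=; apply/idP/idP; lia.
Qed.

Lemma wvec_invalid l x : tinted l -> (l < D)%N -> ~~ validl i R l x -> wvec lam D (upd R l x) = 0.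
Proof.
move=> rl lD nv; apply: wvec_bad; first exact: upd_hD.
by move/(upd_okR _ ok rl); apply/negP.
Qed.

(** The virtually admissible slots correspond to the levels whose rows differ
    by more than one block. *)
Lemma virtual_termE k : i != i1 -> virtual_term lam (virtual_f lam i A k) =
  \sum_(l <- levels | vcond l && (k == (hi R l).-1))
     (- q ^+ 2) ^+ (hi R l - (lo R l).+1) *: wvec lam D (upd R l (vnew l)).
Proof.
move=> ni; have tF : tI = false by rewrite /tI (negPf ni).
rewrite /virtual_f half_topE.
have none : ~ (exists2 l, l \in levels & vcond l && (k == (hi R l).-1)) ->
   \sum_(l <- levels | vcond l && (k == (hi R l).-1))
     (- q ^+ 2) ^+ (hi R l - (lo R l).+1) *: wvec lam D (upd R l (vnew l)) = 0.
  move=> no; rewrite big_seq_cond big_pred0 // => l; apply/negP=> /andP[h1 h2].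
  by apply: no; exists l.
have relT l : tinted l = ~~ typeI lam l by rewrite /tinted tF eqbF_neg.
case: ifP => [od|/negbT].
  rewrite none // => -[l hl /vcond_added[l0 ea]]; move: od hl; rewrite ea odd_double doubleK /=.
  by rewrite mem_filter relT => ->.
rewrite negb_or => /andP[ev]; set l := (added A k)./2 => rl; rewrite -relT in rl.
have ea : added A k = l.*2 by rewrite -[LHS]odd_double_half (negPf ev).
case: (posnP (added A k)) => [a0|apos].
  by rewrite none // => -[m _ /vcond_added[m0 em]]; move: a0 m0; rewrite em; case: (m).
have l0 : l != 0%N by apply: contraTneq apos; rewrite ea => ->.
have hk : (lo R l <= k < hi R l)%N by rewrite -(added_eq_half sA ok) // ea.
have lD : (l < D)%N.
  by rewrite ltnNge; apply/negP=> Dl; move: hk; rewrite /hi hD //= ltn0 andbF.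
rewrite (nleft_half sA ok l0 hk) (nright_half sA ok l0 hk).
have [e1 e2] := vcond_hi l0.
set h := occupied A (k, l, true).
have hE : k = (hi R l).-1 -> ((lo R l).+1 < hi R l)%N -> h = ((R l).1 < (R l).2)%N.
  move=> ek lt; rewrite /h (shape_occ sA) // groundE (negPf l0) /= ek; move: lt hk; rewrite -e1 -e2.
  by rewrite ek -e1; lia.
have condE : (((hi R l - k.+1)%N == 0%N) && ((0 < k - lo R l)%N && (color lam (k, l, ~~ h) == i))) =
   vcond l && (k == (hi R l).-1).
  rewrite color_rel rl /= /colored tF /= /vcond l0 e1 e2 /=.
  case: (eqVneq k (hi R l).-1) => ek; last by rewrite andbF; apply/negP; lia.
  rewrite andbT (_ : (hi R l - k.+1)%N == 0%N) /=; last by lia.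
  have -> : (0 < k - lo R l)%N = ((lo R l).+1 < hi R l)%N by lia.
  case lt: (_ < _)%N => //=; rewrite (hE ek lt).
  have -> : odd (hi R l) = ~~ odd k by rewrite ek; case: (hi R l) lt => //= n _; rewrite negbK.
  by case: (odd k); case: (_ < _)%N.
rewrite condE; case: ifP => [vc|/negbT nvc]; last first.
  rewrite none // => -[m _ vm]; have [m0 em] := vcond_added vm.
  by move: nvc; rewrite /= (_ : l = m) ?vm // -[m]doubleK -em.
have /and3P[_ vcl /eqP ek] := vc.
have mE : (k - lo R l = hi R l - (lo R l).+1)%N by lia.
have lt : ((lo R l).+1 < hi R l)%N by case/and3P: vcl => _; rewrite e1 e2.
rewrite /virtual_term (virtual_wall rl lD vcl ek (hE ek lt) mE).
have hl : l \in levels by rewrite mem_filter rl mem_iota.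
have ul : uniq levels by rewrite filter_uniq // iota_uniq.
rewrite big_mkcond (bigD1_seq l hl ul) big1 => [|m nm]; last first.
  case: ifP => // /vcond_added[m0 em]; move: nm; rewrite /l em doubleK eqxx.
  by [].
have -> : vcond l && (k == (hi R l).-1) by rewrite vcl ek eqxx.
rewrite mE; exact: (esym (addr0 _)).
Qed.

Lemma sum_virtual (V : zmodType) (G : nat -> nat -> V) :
  \sum_(0 <= k < (ncols A).+1) \sum_(l <- levels | vcond l && (k == (hi R l).-1)) G k l =
  \sum_(l <- levels | vcond l) G (hi R l).-1 l.
Proof.
under eq_bigr => k _ do rewrite big_mkcond.
rewrite exchange_big [RHS]big_mkcond; apply: eq_bigr => l _ /=.
case: ifP => vl; last by rewrite big1.
have hk : (hi R l).-1 \in index_iota 0 (ncols A).+1.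
  rewrite mem_index_iota ltnS; apply: leq_trans (leq_pred _) _; apply: (hi_ncols sA).
  by case/and3P: vl.
by rewrite (bigD1_seq _ hk (iota_uniq _ _)) /= eqxx big1 ?addr0 // => k /negPf ->.
Qed.

Lemma q2_scalars : i != i1 -> p = q ^+ 2 /\ forall n : int, q ^ (2 * n) = p ^ n.
Proof. by move=> ni; rewrite /qi /di (negPf ni); split=> // n; rewrite exprz_exp. Qed.

Lemma sum_virtual_valid (G : nat -> fock lam) : ~~ tI ->
  (forall l, tinted l -> (l < D)%N -> vcond l -> G l =
     (p ^ pre l * ((- p) ^+ (hi R l - (lo R l).+1) * p ^ clipped_weight tI cI (l == 0%N) (hi R l) (lower R l) (upper R l) (R l)))
       *: wvec lam D (upd R l (vnew l))) ->
  \sum_(l <- levels | vcond l) G l =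
  \sum_(l <- levels) \sum_(y <- virtual_add tI cI (l == 0)%N p (lower R l) (upper R l) (R l))
     (p ^ pre l * y.1) *: wvec lam D (upd R l y.2).
Proof.
move=> nt hG; rewrite big_mkcond; apply: eq_big_seq => l; rewrite mem_filter mem_iota add0n => /and3P[rl _ lD].
rewrite /virtual_add nt [X in if X then [:: _] else _](_ : _ = vcond l && validl i R l (vnew l)); last by rewrite /vcond -!andbA.
case: ifP => vl; last by rewrite big_nil.
rewrite hG //; have /and3P[l0 h1 h2] := vl.
have [e1 e2] := vcond_hi l0; rewrite e1 e2 /=.
case: ifP => v; first by rewrite big_seq1 /vnew e1 e2.
by rewrite big_nil (wvec_invalid rl lD) ?scaler0 // v.
Qed.

Lemma action_02 : i != i1 -> fock_f02 lam i A = action.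
Proof.
move=> ni; have nt : ~~ tI by rewrite /tI.
have [ep eq] := q2_scalars ni.
rewrite action_split /fock_f02.
under eq_bigr => k _ do rewrite scalerDr scaler_sumr eq virtual_termE // scaler_sumr.
rewrite big_split /=; congr (_ + _).
  rewrite (sum_admissible (fun k b => p ^ phi_eps lam i (k.+1, None) A *: vec_of lam (b |` A)%fset)).
  apply: sum_levels => l g rl h; rewrite (add_wall rl h).
  have al := adml_at rl h; rewrite (phi_pre rl (rel_lt rl h)); [|lia|lia].
  by rewrite (pow_split1 _ _ p0) /add_coef (negPf nt).
rewrite (sum_virtual (fun k l => p ^ phi_eps lam i (k.+1, None) A *:
   ((- q ^+ 2) ^+ (hi R l - (lo R l).+1) *: wvec lam D (upd R l (vnew l))))).
apply: (sum_virtual_valid nt) => l rl lD vl; have /and3P[l0 h1 h2] := vl.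
have [e1 e2] := vcond_hi l0; rewrite e1 e2 in h1.
have hh : (lower R l <= hi R l)%N by apply: leq_trans (nest nR l) (lo_hi R l).
have hg : (hi R l <= upper R l)%N.
  by rewrite /upper (negPf l0); have := nest nR l.-1; rewrite prednK // lt0n.
have eh : (hi R l).-1.+1 = hi R l by lia.
have hg' : (l == 0%N) || (hi R l <= upper R l)%N by rewrite hg orbT.
rewrite eh (phi_pre rl lD hh hg') scalerA (pow_split2 _ _ _ p0) -ep.
reflexivity.
Qed.

End Slots.

(** * Tensor products over the levels *)

Lemma updC R l m x y : l != m -> upd (upd R l x) m y = upd (upd R m y) l x.
Proof.
move=> lm; apply: funext => j; rewrite /upd; case: (eqVneq j m) => [->|//].
by rewrite eq_sym (negPf lm).
Qed.
Lemma upd_upd R l x y : upd (upd R l x) l y = upd R l y.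
Proof. by apply: funext => j; rewrite /upd; case: eqP. Qed.
Lemma upd_id R l : upd R l (R l) = R.
Proof. by apply: funext => j; rewrite /upd; case: eqP => [->|]. Qed.

Section Tensor.
Variables (F : fieldType) (M : lmodType F).
Variables (n : nat -> nat) (C : nat -> seq bool -> seq (F * (nat * nat))).
Implicit Types (ls : seq nat) (R : profile) (H : profile -> M).

(** The tensor product of the local vectors of the levels ls for the word w,
    which is cut into pieces of lengths n l. It is a sum over all choices of
    configurations at these levels, and H is the vector attached to the
    resulting profile. *)
Fixpoint tensor ls (w : seq bool) H R : M :=
  if ls is l :: ls' then
    \sum_(x <- C l (take (n l) w)) x.1 *: tensor ls' (drop (n l) w) H (upd R l x.2)
  else H R.

Definition letters_of ls : nat := \sum_(l <- ls) n l.

(** The profiles that occur in the sum [tensor]. *)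
Definition leaf ls R R' : Prop :=
  (forall l, l \notin ls -> R' l = R l) /\
  (forall l, l \in ls -> exists2 u, size u = n l & exists2 x, x \in C l u & R' l = x.2).

Lemma leaf_step l ls R R' u x : l \notin ls -> size u = n l -> x \in C l u ->
  leaf ls (upd R l x.2) R' -> leaf (l :: ls) R R' /\ R' l = x.2.
Proof.
move=> nl su hx [h1 h2]; have e : R' l = x.2 by rewrite h1 // upd_same.
split=> //; split=> m.
  by rewrite inE negb_or => /andP[nm nls]; rewrite h1 // upd_other.
by rewrite inE => /orP[/eqP ->|/h2 //]; exists u => //; exists x.
Qed.

Lemma size_parts l ls (w : seq bool) : size w = letters_of (l :: ls) ->
  size (take (n l) w) = n l /\ size (drop (n l) w) = letters_of ls.
Proof.
rewrite /letters_of big_cons => sw; rewrite size_drop size_take sw; split; last by lia.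
by case: ltnP => //; lia.
Qed.

Lemma tensor_ext ls w H H' R : uniq ls -> size w = letters_of ls ->
  (forall R', leaf ls R R' -> H R' = H' R') -> tensor ls w H R = tensor ls w H' R.
Proof.
elim: ls w R => [|l ls IH] w R /=; first by move=> _ _; apply.
case/andP=> nl ul /size_parts[s1 s2] h; apply: eq_big_seq => x hx; congr (_ *: _).
by apply: IH => // R' /(leaf_step nl s1 hx)[hl _]; exact: h.
Qed.

Lemma tensorD ls w H H' R :
  tensor ls w (fun R' => H R' + H' R') R = tensor ls w H R + tensor ls w H' R.
Proof.
elim: ls w R => //= l ls IH w R; rewrite -big_split; apply: eq_bigr => x _ /=.
by rewrite IH scalerDr.
Qed.

Lemma tensorZ ls w c H R : tensor ls w (fun R' => c *: H R') R = c *: tensor ls w H R.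
Proof.
elim: ls w R => //= l ls IH w R; rewrite scaler_sumr; apply: eq_bigr => x _ /=.
by rewrite IH !scalerA mulrC.
Qed.

Lemma tensor0 ls w R : tensor ls w (fun=> 0) R = 0.
Proof. by elim: ls w R => //= l ls IH w R; rewrite big1 // => x _; rewrite IH scaler0. Qed.

Lemma tensor_sum (J : Type) (s : seq J) (G : J -> profile -> M) ls w R :
  tensor ls w (fun R' => \sum_(j <- s) G j R') R = \sum_(j <- s) tensor ls w (G j) R.
Proof.
elim: s => [|j s IH].
  under [X in tensor _ _ X]eq_fun => R' do rewrite big_nil.
  by rewrite big_nil tensor0.
under [X in tensor _ _ X]eq_fun => R' do rewrite big_cons.
by rewrite tensorD IH big_cons.
Qed.

Lemma tensor_linear (f : {linear M -> M}) ls w H R :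
  f (tensor ls w H R) = tensor ls w (fun R' => f (H R')) R.
Proof.
elim: ls w R => //= l ls IH w R; rewrite linear_sum; apply: eq_bigr => x _.
by rewrite linearZ /= IH.
Qed.

Lemma tensor_shift ls w H R l y : l \notin ls ->
  tensor ls w (fun R' => H (upd R' l y)) R = tensor ls w H (upd R l y).
Proof.
elim: ls w R => //= m ls IH w R; rewrite inE negb_or => /andP[lm nl].
by apply: eq_bigr => x _; rewrite IH // updC // eq_sym.
Qed.

Lemma tensor_base ls w H R R' : (forall l, l \notin ls -> R l = R' l) ->
  tensor ls w H R = tensor ls w H R'.
Proof.
elim: ls w R R' => [|l ls IH] w R R' h /=.
  by congr H; apply: funext => l; exact: h.
apply: eq_bigr => x _; congr (_ *: _); apply: IH => m nm; rewrite /upd.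
by case: eqP => // /eqP ml; apply: h; rewrite inE negb_or ml.
Qed.

Variables (p : F) (p0 : p != 0).
Variables (wtl : nat -> nat * nat -> int) (fl : nat -> nat * nat -> seq (F * (nat * nat))).

(** The coproduct action of f on a profile: at the first level, or at the
    later levels with the weight of the first level as exponent. *)
Fixpoint act ls H R : M :=
  if ls is l :: ls' then
    \sum_(y <- fl l (R l)) y.1 *: H (upd R l y.2) + p ^ wtl l (R l) *: act ls' H R
  else 0.

Variable P : pred nat.
Hypothesis wtC : forall l u x, P l -> size u = n l -> x \in C l u -> wtl l x.2 = wwt u.
Hypothesis eqC : forall (H : nat * nat -> M) l u, P l -> size u = n l ->
  \sum_(x <- C l u) x.1 *: (\sum_(y <- fl l x.2) y.1 *: H y.2) =
  \sum_(v <- fw p u) v.1 *: (\sum_(x <- C l v.2) x.1 *: H x.2).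

(** By induction on the levels, from the equivariance at each level and
    [fw_cat]. *)
Lemma tensor_act ls w H R : uniq ls -> all P ls -> size w = letters_of ls ->
  tensor ls w (act ls H) R = \sum_(v <- fw p w) v.1 *: tensor ls v.2 H R.
Proof.
elim: ls w R => [|l ls IH] w R.
  by rewrite /letters_of big_nil => _ _ /size0nil ->; rewrite /= big_nil.
case/andP=> nl ul /andP[Pl Pls] /size_parts[]; rewrite -{3 4}(cat_take_drop (n l) w).
move: (take _ w) (drop _ w) => w1 w2 s1 s2.
have t1 : take (n l) (w1 ++ w2) = w1 by rewrite -s1 take_size_cat.
have t2 : drop (n l) (w1 ++ w2) = w2 by rewrite -s1 drop_size_cat.
have E x : x \in C l w1 -> tensor ls w2 (act (l :: ls) H) (upd R l x.2) =
    (\sum_(y <- fl l x.2) y.1 *: tensor ls w2 H (upd R l y.2)) +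
    p ^ wwt w1 *: tensor ls w2 (act ls H) (upd R l x.2).
  move=> hx; rewrite (@tensor_ext _ _ _ (fun R' => (\sum_(y <- fl l x.2) y.1 *: H (upd R' l y.2)) + p ^ wwt w1 *: act ls H R')) //; last first.
    by move=> R' /(leaf_step nl s1 hx)[_ e] /=; rewrite e (wtC Pl s1 hx).
  rewrite tensorD tensorZ tensor_sum; congr (_ + _); apply: eq_bigr => y _.
  by rewrite tensorZ tensor_shift // upd_upd.
transitivity (\sum_(x <- C l w1) x.1 *: ((\sum_(y <- fl l x.2) y.1 *: tensor ls w2 H (upd R l y.2)) +
    p ^ wwt w1 *: tensor ls w2 (act ls H) (upd R l x.2))).
  rewrite [LHS]/= t1 t2; apply: eq_big_seq => x hx; congr (_ *: _); exact: E.
under eq_bigr => x _ do rewrite scalerDr.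
rewrite big_split fw_cat // big_cat !big_map; congr (_ + _).
  rewrite (eqC (fun y => tensor ls w2 H (upd R l y)) Pl s1); apply: eq_big_seq => v hv /=.
  by rewrite -s1 -(size_fw hv) take_size_cat // drop_size_cat.
under eq_bigr => x _ do rewrite IH // !scaler_sumr.
rewrite exchange_big; apply: eq_bigr => v _ /=.
rewrite -s1 take_size_cat // drop_size_cat // scaler_sumr; apply: eq_bigr => x _.
by rewrite !scalerA -mulrA mulrC.
Qed.

(** The recursive form of the action, unfolded into a sum over the levels with
    the weight of the lower levels as exponent. *)
Lemma act_sum ls H R : sorted ltn ls -> act ls H R =
  \sum_(l <- ls) \sum_(y <- fl l (R l)) (p ^ (\sum_(m <- ls | (m < l)%N) wtl m (R m)) * y.1) *: H (upd R l y.2).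
Proof.
elim: ls => [|l ls IH] /=; first by rewrite big_nil.
rewrite (path_sortedE ltn_trans) => /andP[/allP lt so].
rewrite big_cons; congr (_ + _).
  have e0 : \sum_(m <- l :: ls | (m < l)%N) wtl m (R m) = 0.
    rewrite big_seq_cond big_pred0 // => m; rewrite inE; apply/negP=> /andP[/orP[/eqP ->|/lt]]; lia.
  by apply: eq_bigr => y _; rewrite e0 expr0z mul1r.
rewrite IH // scaler_sumr; apply: eq_big_seq => k hk; rewrite scaler_sumr; apply: eq_bigr => y _.
by rewrite big_cons (lt _ hk) scalerA expfzDr // mulrA.
Qed.

End Tensor.

Lemma tensor_eq (F : fieldType) (M : lmodType F) n n' (C C' : nat -> seq bool -> seq (F * (nat * nat)))
    ls w (H : profile -> M) R : size w = letters_of n ls ->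
  (forall l, l \in ls -> n' l = n l /\ forall u, size u = n l -> C' l u = C l u) ->
  tensor n' C' ls w H R = tensor n C ls w H R.
Proof.
elim: ls w R => //= l ls IH w R sw h; have [s1 s2] := size_parts sw; have [e1 e2] := h l (mem_head _ _).
rewrite e1 e2 //; apply: eq_bigr => x _; rewrite IH // => m hm; apply: h.
by rewrite inE hm orbT.
Qed.

(** * Congruence of tensors *)
Section TensorLattice.
Variables (F : fieldType) (A : local_ring F) (M : lmodType F) (L : set M).
Hypothesis HL : submodule_over [set x | x \in lr_A A]%classic L.
Variables (n : nat -> nat) (C : nat -> seq bool -> seq (F * (nat * nat))).
Variable H : profile -> M.
Hypothesis LH : forall R, L (H R).
Hypothesis AC : forall l u x, x \in C l u -> x.1 \in lr_A A.

Lemma tensor_lattice ls w R : L (tensor n C ls w H R).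
Proof.
elim: ls w R => //= l ls IH w R; apply: (lat_sum HL) => x hx _.
by apply: (latZ HL) => //; exact: AC hx.
Qed.

(** Each local vector is congruent to its leading configuration. *)
Lemma tensor_cong ls (wd : nat -> seq bool) R :
  (forall l, l \in ls -> size (wd l) = n l /\ exists c0 r, [/\ C l (wd l) = (c0, R l) :: r,
     unit1 A c0 & forall y, y \in r -> qA A y.1]) ->
  qlat A L (tensor n C ls (flatten [seq wd l | l <- ls]) H R - H R).
Proof.
elim: ls => [|l ls IH] h /=; first by rewrite subrr; exact: (qlat0 HL).
have [s1 [c0 [r [e1 e2 e3]]]] := h l (mem_head _ _).
rewrite -s1 take_size_cat // drop_size_cat // e1 big_cons /= upd_id addrAC.
apply: (qlatD HL); last first.
  apply: (qlat_sum HL) => x hx _; apply: (qlatqZ HL); [exact: e3 | exact: tensor_lattice].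
apply: (qlat_trans HL) (IH _); last by move=> m hm; apply: h; rewrite inE hm orbT.
rewrite -[X in _ - X]scale1r -scalerBl; apply: (qlatqZ HL) => //; exact: tensor_lattice.
Qed.

End TensorLattice.

(** * The signature rule on words *)
Local Open Scope nat_scope.

(** One step of [cancel_signs], as an operation on the two stacks, to be used
    as a right fold on the reversed word. *)
Definition sign_step (st : seq nat * seq nat) (y : bool * nat) : seq nat * seq nat :=
  if y.1 then (st.1, y.2 :: st.2)
  else if st.2 is _ :: ps then (st.1, ps) else (y.2 :: st.1, [::]).
Definition sign_stacks (V : seq (bool * nat)) := foldr (fun y st => sign_step st y) ([::], [::]) V.

Lemma cancel_signsE W : cancel_signs W [::] [::] =
  (rev (sign_stacks (rev W)).1, rev (sign_stacks (rev W)).2).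
Proof.
rewrite /sign_stacks -!foldl_rev revK.
have E st : cancel_signs W st.1 st.2 = (rev (foldl sign_step st W).1, rev (foldl sign_step st W).2).
  elim: W st => [|[[] k] W IH] [ms ps] //=; first by rewrite -IH.
  by case: ps => [|k' ps]; rewrite -IH.
exact: (E ([::], [::])).
Qed.

Lemma sign_stacks_size V : size (sign_stacks V).1 = weps (map fst V) /\
  size (sign_stacks V).2 = wphi (map fst V).
Proof.
elim: V => [|[[] k] V [IH1 IH2]] //=.
  by rewrite weps_true wphi_true /= IH1 IH2.
rewrite weps_false wphi_false -IH1 -IH2 /sign_step /=.
by case: (sign_stacks V) => ms [|k' ps] /=; rewrite ?addn1 ?addn0.
Qed.

(** The bottom of the stack of plus signs is the left-most uncancelled plus
    sign. It is the letter changed by [wft], and no uncancelled plus sign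
    precedes it. *)
Lemma plus_stack V s k : (sign_stacks V).2 = rcons s k -> exists V1 V2,
  [/\ V = V1 ++ (true, k) :: V2, wft (map fst V) = Some (map fst V1 ++ false :: map fst V2)
    & wphi (map fst V2) = 0].
Proof.
elim: V s => [|[b k'] V IH] s /=; first by case: s.
have [_ sz] := sign_stacks_size V.
rewrite /sign_step; case: b => /=.
  case: s => [|k0 s] /= [ek e].
    exists [::], V; rewrite -ek /= -sz e; split=> //.
  have [V1 [V2 [e1 e2 e3]]] := IH _ e; subst k0.
  exists ((true, k') :: V1), V2; rewrite {1}e1 e2 /=; split=> //.
  by rewrite -sz e size_rcons.
case E: (sign_stacks V).2 => [|k0 ps] /=; first by case: s.
move=> ep; have [V1 [V2 [e1 e2 e3]]] := IH (k0 :: s) (etrans E (congr1 (cons k0) ep)).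
exists ((false, k') :: V1), V2; rewrite {1}e1 e2 /=; split=> //.
by rewrite -sz E ep /= size_rcons.
Qed.

(** The top of the stack of minus signs is the right-most uncancelled minus
    sign. It is the letter changed by [wet]; a minus sign next to it on the
    right would be uncancelled too. *)
Lemma minus_stack V s k : (sign_stacks V).1 = k :: s -> exists V1 V2,
  [/\ V = V1 ++ (false, k) :: V2, wet (map fst V) = Some (map fst V1 ++ true :: map fst V2),
      last true (map fst V1) & V1 = [::] -> wphi (map fst V) = 0].
Proof.
elim: V => [|[b k'] V IH] //=.
have [_ sz] := sign_stacks_size V.
rewrite /sign_step; case: b => /=.
  move=> /IH[V1 [V2 [e1 e2 e3 e4]]]; exists ((true, k') :: V1), V2; rewrite {1}e1 e2 /=; split=> //.
case E: (sign_stacks V).2 => [|k0 ps] /=.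
  move=> [<- _]; exists [::], V; rewrite -sz E /=; split=> //.
  by rewrite wphi_false -sz E.
move=> /IH[V1 [V2 [e1 e2 e3 e4]]]; exists ((false, k') :: V1), V2; rewrite {1}e1 e2 /=; split=> //.
  by rewrite -sz E.
by case: (V1) e3 e4 => //= _ /(_ erefl); rewrite -sz E.
Qed.

Lemma cat_split (T : Type) (u v W1 W2 : seq T) x : u ++ v = W1 ++ x :: W2 ->
  (exists2 U, u = W1 ++ x :: U & W2 = U ++ v) \/ (exists2 U, W1 = u ++ U & v = U ++ x :: W2).
Proof.
elim: u W1 => [|y u IH] [|y1 W1] /=; [by right; exists [::] | by right; exists (y1 :: W1) | |].
  by case=> -> <-; left; exists u.
case=> -> /IH[[U -> ->]|[U -> ->]]; [by left; exists U | by right; exists U].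
Qed.

Lemma flatten_split (T : Type) (J : Type) (G : J -> seq T) ls W1 x W2 :
  flatten [seq G l | l <- ls] = W1 ++ x :: W2 -> exists ls1 l ls2 U1 U2,
  [/\ ls = ls1 ++ l :: ls2, G l = U1 ++ x :: U2, W1 = flatten [seq G l | l <- ls1] ++ U1
    & W2 = U2 ++ flatten [seq G l | l <- ls2]].
Proof.
elim: ls W1 => [|l ls IH] W1 /=; first by case: W1.
move=> e; case: (cat_split e) => [[U e1 e2]|[U -> /IH[ls1 [l' [ls2 [U1 [U2 [-> h1 -> ->]]]]]]]].
  by exists [::], l, ls, W1, U.
by exists (l :: ls1), l', ls2, U1, U2; rewrite /= catA.
Qed.

Section LocalMoves.
Variables (t c z : bool).

(** Adding the block of a plus letter turns it into a minus letter and leaves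
    the other letters unchanged. *)
Lemma inc_pure a b x g U1 U2 : valid t z a b x -> lets t c z a b x = U1 ++ (true, g) :: U2 ->
  inc x g = pure t c z a b x (map fst U1 ++ false :: map fst U2).
Proof.
move=> vx; rewrite /lets /pure; case E: kindof => [|h|h].
- by case: U1.
- case: U1 => [|? [|? ?]] //= [e1 <- <-] /=; have [_ _ ra _] := K1P vx E.
  by rewrite /inc; congr put; lia.
have [hz ab r1 r2 ht] := K2P vx E.
case: U1 => [|y1 [|y2 [|? ?]]] //=.
- case=> e1 <- <- /=; rewrite /inc; case: x {vx E} e1 r1 r2 ht => x1 x2.
  by rewrite /put /rlen; case: h => /= *; congr (_, _); lia.
- case=> <- e1 <- <- /=; rewrite /inc; case: x {vx E} e1 r1 r2 ht => x1 x2.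
  by rewrite /put /rlen; case: h => /= *; congr (_, _); lia.
Qed.

Lemma dec_pure a b x g U1 U2 : valid t z a b x -> lets t c z a b x = U1 ++ (false, g) :: U2 ->
  dec x g = pure t c z a b x (map fst U1 ++ true :: map fst U2).
Proof.
move=> vx; rewrite /lets /pure; case E: kindof => [|h|h].
- by case: U1.
- case: U1 => [|? [|? ?]] //= [e1 <- <-] /=; have [_ _ ra _] := K1P vx E.
  by rewrite /dec; congr put; lia.
have [hz ab r1 r2 ht] := K2P vx E.
case: U1 => [|y1 [|y2 [|? ?]]] //=.
- case=> e1 <- <- /=; rewrite /dec; case: x {vx E} e1 r1 r2 ht => x1 x2.
  by rewrite /put /rlen; case: h => /= *; congr (_, _); lia.
- case=> <- e1 <- <- /=; rewrite /dec; case: x {vx E} e1 r1 r2 ht => x1 x2.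
  by rewrite /put /rlen; case: h => /= *; congr (_, _); lia.
Qed.

Lemma adm_unique a b x g g' k : valid t z a b x ->
  adm t c z a b x g k -> adm t c z a b x g' k -> g = g'.
Proof.
move=> vx; case: x vx => x1 x2 vx.
rewrite /adm; move: vx; rewrite /valid /colored /inc /put /rlen.
by case: t; case: z; case: g; case: g' => //=; lia.
Qed.

Lemma rem_unique a b x g g' k : valid t z a b x ->
  rem t c z a b x g k -> rem t c z a b x g' k -> g = g'.
Proof.
move=> vx; case: x vx => x1 x2 vx.
rewrite /rem; move: vx; rewrite /valid /colored /dec /put /rlen.
by case: t; case: z; case: g; case: g' => //=; lia.
Qed.

(** In the blocked configuration the second plus letter is not admissible, but
    it is preceded by the first one, so it is never the left-most uncancelled
    plus sign. *)
Lemma leftmost_adm a b x g U1 U2 : valid t z a b x -> lets t c z a b x = U1 ++ (true, g) :: U2 ->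
  ~~ last false (map fst U1) -> adm t c z a b x g (rlen x g).
Proof.
move=> vx e nl; rewrite adm_lets // eqxx e mem_cat mem_head orbT /=.
apply/negP=> /and5P[ht hz /eqP eb /eqP ex hg]; move: e nl.
rewrite /lets /kindof ht (negPf hz) eb ltnSn ex /= eqxx (_ : (a != a.+1)) /=; last by lia.
by case: U1 => [|? [|? [|? ?]]] //=; [case; rewrite hg | case=> <-].
Qed.

(** In the blocked configuration the first minus letter is not removable, but
    it is followed by the second one, so it is never the right-most
    uncancelled minus sign. *)
Lemma rightmost_rem a b x g U1 U2 : valid t z a b x -> lets t c z a b x = U1 ++ (false, g) :: U2 ->
  head true (map fst U2) -> rem t c z a b x g (rlen x g).-1.
Proof.
move=> vx e nl; have hin : (false, g) \in lets t c z a b x by rewrite e mem_cat mem_head orbT.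
have [_ _ _ /= r0] := let_between vx hin.
rewrite rem_lets // hin prednK // eqxx /=.
apply/negP=> /and5P[ht hz /eqP eb /eqP ex hg]; move: e nl.
rewrite /lets /kindof ht (negPf hz) {1}eb ltnSn ex /= eqxx (_ : (b == a) = false) /=; last by lia.
case: U1 => [|? [|? [|? ?]]] //=; first by case=> _ <-.
by case=> _ eg; rewrite -eg in hg.
Qed.

End LocalMoves.

(** * Crystal operators on words *)

Section Moves.
Variables (lam i : I).
Local Notation tinted := (tinted lam i).
Local Notation tI := (tI i).
Local Notation cI := (cI lam i).
Local Notation levels := (levels lam i).
Implicit Types (R : profile) (A : {fset block}).

Definition wordl R l : seq bool := word tI cI (l == 0) (lower R l) (upper R l) (R l).
Definition purel R l (u : seq bool) : nat * nat := pure tI cI (l == 0) (lower R l) (upper R l) (R l) u.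
Definition gword R (ls : seq nat) : seq bool := flatten [seq wordl R l | l <- ls].

Lemma size_wordl R l : size (wordl R l) = size (letsl lam i R l).
Proof. exact: size_map. Qed.

Lemma letters_gword R ls : map fst (letters lam i R ls) = gword R ls.
Proof.
rewrite /letters /gword map_flatten -map_comp; congr flatten; apply: eq_map => l /=.
by rewrite -map_comp.
Qed.

Lemma mem_levels D l : (l \in levels D) = tinted l && (l < D).
Proof. by rewrite mem_filter mem_iota add0n. Qed.

Lemma uniq_levels D : uniq (levels D).
Proof. by rewrite filter_uniq ?iota_uniq. Qed.

Lemma wordl_upd_other R l m x : tinted l -> tinted m -> m != l -> wordl (upd R l x) m = wordl R m.
Proof.
move=> rl rm ml; have e := agree_upd R x rl.
by rewrite /wordl (agree_lower e rm) (agree_upper e rm) upd_other.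
Qed.

Lemma wordl_upd R l u : okR lam R -> tinted l -> size u = size (letsl lam i R l) ->
  wordl (upd R l (purel R l u)) l = u.
Proof.
move=> ok rl su; have e := agree_upd R (purel R l u) rl.
rewrite /wordl (agree_lower e rl) (agree_upper e rl) upd_same word_pure //.
exact: okR_valid.
Qed.

Lemma gword_upd R l u ls1 ls2 : okR lam R -> uniq (ls1 ++ l :: ls2) -> all tinted (ls1 ++ l :: ls2) ->
  size u = size (letsl lam i R l) ->
  gword (upd R l (purel R l u)) (ls1 ++ l :: ls2) = gword R ls1 ++ u ++ gword R ls2.
Proof.
rewrite cat_uniq all_cat /= negb_or => ok /and3P[_ /andP[n1 _] /andP[n2 _]] /and3P[r1 rl r2] su.
rewrite /gword map_cat flatten_cat /= wordl_upd //; congr (_ ++ (_ ++ _)).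
  congr flatten; apply/eq_in_map => m hm; apply: wordl_upd_other => //; first exact: (allP r1).
  by apply: contraNneq n1 => <-.
congr flatten; apply/eq_in_map => m hm; apply: wordl_upd_other => //; first exact: (allP r2).
by apply: contraNneq n2 => <-.
Qed.

Variables (A : {fset block}) (R : profile) (D : nat).
Hypotheses (sA : shape 0 A R) (ok : okR lam R).
Hypotheses (rD : ~~ tinted D) (hD : forall l, D <= l -> R l = (0, 0)).

Definition rword : seq bool := rev (gword R (levels D)).

Lemma signatureE : signature lam i whole A =
  (rev (sign_stacks (rev (letters lam i R (levels D)))).1,
   rev (sign_stacks (rev (letters lam i R (levels D)))).2).
Proof. by rewrite /signature (signs_part sA ok rD hD 0) clipR0 cancel_signsE. Qed.

Lemma eps_word : eps lam i whole A = weps rword.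
Proof.
by rewrite /eps signatureE size_rev (sign_stacks_size _).1 map_rev /rword -letters_gword.
Qed.

Lemma phi_word : phi lam i whole A = wphi rword.
Proof.
by rewrite /phi signatureE size_rev (sign_stacks_size _).2 map_rev /rword -letters_gword.
Qed.

Lemma all_levels : all tinted (levels D).
Proof. by apply/allP => l; rewrite mem_levels => /andP[]. Qed.

Lemma split_letters W1 b k W2 : letters lam i R (levels D) = W1 ++ (b, k) :: W2 ->
  exists ls1 l ls2 U1 U2 g, [/\ levels D = ls1 ++ l :: ls2,
     letsl lam i R l = U1 ++ (b, g) :: U2, k = lcol (R l) (b, g),
     map fst W1 = gword R ls1 ++ map fst U1 & map fst W2 = map fst U2 ++ gword R ls2].
Proof.
move=> e; have [ls1 [l [ls2 [V1 [V2 [e1 e2 e3 e4]]]]]] := flatten_split e.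
exists ls1, l, ls2; move: (letsl lam i R l) e2 => L e2.
have hs : size V1 < size L by rewrite -(size_map (fun y => (y.1, lcol (R l) y)) L) e2 size_cat /=; lia.
exists (take (size V1) L), (drop (size V1).+1 L), (nth (false, false) L (size V1)).2.
have en := congr1 (fun s => nth (false, 0) s (size V1)) e2.
move: en; rewrite (nth_map (false, false)) // nth_cat ltnn subnn /= => -[eb ek].
have eL : L = take (size V1) L ++ (b, (nth (false, false) L (size V1)).2) :: drop (size V1).+1 L.
  by rewrite -eb -surjective_pairing -drop_nth // cat_take_drop.
have t1 : map fst V1 = map fst (take (size V1) L).
  have := congr1 (fun s => map fst (take (size V1) s)) e2.
  by rewrite take_size_cat // -map_take -map_comp => <-.
have t2 : map fst V2 = map fst (drop (size V1).+1 L).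
  have := congr1 (fun s => map fst (drop (size V1).+1 s)) e2.
  by rewrite drop_cat ltnNge leqnSn /= subSn // subnn /= drop0 -map_drop -map_comp => <-.
split=> //.
- by rewrite -ek -eb -surjective_pairing.
- by rewrite e3 map_cat -letters_gword t1.
- by rewrite e4 map_cat -letters_gword t2.
Qed.

Lemma ohead_mem (T : eqType) (s : seq T) x : x \in s -> (forall y, y \in s -> y = x) -> ohead s = Some x.
Proof. by case: s => //= y s _ /(_ y (mem_head _ _)) ->. Qed.

(** The signature rule for walls is the tensor product rule for their words. *)
Lemma add_spec k : ohead (signature lam i whole A).2 = Some k -> exists l g,
  [/\ l \in levels D, adml lam i R l g k, ohead (admissible lam i whole A k) = Some (k, l, g)
    & wft rword = Some (rev (gword (upd R l (inc (R l) g)) (levels D)))].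
Proof.
rewrite signatureE /=; case/lastP: (sign_stacks _).2 (@plus_stack (rev (letters lam i R (levels D)))) => [|s k'] //.
move=> /(_ s k' erefl)[V1 [V2 [e1 e2 e3]]]; rewrite rev_rcons => -[ek]; subst k'.
have eW : letters lam i R (levels D) = rev V2 ++ (true, k) :: rev V1.
  by rewrite -[LHS]revK e1 rev_cat rev_cons cat_rcons.
have [ls1 [l [ls2 [U1 [U2 [g [h1 h2 h3 h4 h5]]]]]]] := split_letters eW.
have hl : l \in levels D by rewrite h1 mem_cat mem_head orbT.
have rl : tinted l by move: hl; rewrite mem_levels => /andP[].
have vx := okR_valid ok rl.
have ha : adml lam i R l g k.
  rewrite /adml h3; apply: (leftmost_adm vx h2).
  case/lastP: U1 h4 {h2} => [|U1 y] //; rewrite map_rcons last_rcons map_rev => /(congr1 rev).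
  rewrite revK rev_cat rev_rcons /= => e; apply/negP=> yt; move: e3.
  by rewrite e yt wphi_true.
exists l, g; split=> //.
  apply: ohead_mem; first by rewrite (mem_admissible i sA (fun _ _ => leq0n _) ok) eqxx rl.
  move=> [[k' l'] g']; rewrite (mem_admissible i sA (fun _ _ => leq0n _) ok) => /and3P[/eqP -> rl' ha'].
  have el : l' = l := at_uniq ok rl' rl (adm_at ok rl' ha') (adm_at ok rl ha).
  by rewrite el in ha' *; rewrite (adm_unique vx ha' ha).
have ei := inc_pure vx h2; rewrite ei -/(purel R l _) h1 gword_upd //.
- move: e2; rewrite map_rev letters_gword -/rword => ->; congr Some.
  rewrite -[LHS]revK; congr rev; rewrite rev_cat rev_cons -!map_rev h4 h5 cat_rcons.
  by rewrite -!catA.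
- by rewrite -h1 uniq_levels.
- by rewrite -h1 all_levels.
- by rewrite h2 !size_cat /= !size_map.
Qed.

Lemma rem_spec k : ohead (rev (signature lam i whole A).1) = Some k -> exists l g,
  [/\ l \in levels D, reml lam i R l g k, ohead (removable lam i whole A k) = Some (k, l, g)
    & wet rword = Some (rev (gword (upd R l (dec (R l) g)) (levels D)))].
Proof.
rewrite signatureE /= revK; case: (sign_stacks _).1 (@minus_stack (rev (letters lam i R (levels D)))) => [|k' s] //.
move=> /(_ s k' erefl)[V1 [V2 [e1 e2 e3 _]]] /= [ek]; subst k'.
have eW : letters lam i R (levels D) = rev V2 ++ (false, k) :: rev V1.
  by rewrite -[LHS]revK e1 rev_cat rev_cons cat_rcons.
have [ls1 [l [ls2 [U1 [U2 [g [h1 h2 h3 h4 h5]]]]]]] := split_letters eW.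
have hl : l \in levels D by rewrite h1 mem_cat mem_head orbT.
have rl : tinted l by move: hl; rewrite mem_levels => /andP[].
have vx := okR_valid ok rl.
have ha : reml lam i R l g k.
  rewrite /reml h3; apply: (rightmost_rem vx h2).
  case: U2 h5 {h2} => [|y U2] //=; rewrite map_rev => /(congr1 rev).
  by rewrite revK rev_cons => e; move: e3; rewrite e last_rcons.
exists l, g; split=> //.
  apply: ohead_mem; first by rewrite (mem_removable i sA (fun _ _ => leq0n _) ok) eqxx rl.
  move=> [[k' l'] g']; rewrite (mem_removable i sA (fun _ _ => leq0n _) ok) => /and3P[/eqP -> rl' ha'].
  have el : l' = l := at_uniq ok rl' rl (rem_at ok rl' ha') (rem_at ok rl ha).
  by rewrite el in ha' *; rewrite (rem_unique vx ha' ha).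
have ei := dec_pure vx h2; rewrite ei -/(purel R l _) h1 gword_upd //.
- move: e2; rewrite map_rev letters_gword -/rword => ->; congr Some.
  rewrite -[LHS]revK; congr rev; rewrite rev_cat rev_cons -!map_rev h4 h5 cat_rcons.
  by rewrite -!catA.
- by rewrite -h1 uniq_levels.
- by rewrite -h1 all_levels.
- by rewrite h2 !size_cat /= !size_map.
Qed.

Lemma add_none : ohead (signature lam i whole A).2 = None -> phi lam i whole A = 0.
Proof. by rewrite /phi; case: (signature lam i whole A).2. Qed.

Lemma rem_none : ohead (rev (signature lam i whole A).1) = None -> eps lam i whole A = 0.
Proof. by rewrite /eps -size_rev; case: (rev (signature lam i whole A).1). Qed.

End Moves.

Local Open Scope ring_scope.

Local Open Scope nat_scope.

(** * The profile of a wall *)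

(** For a proper wall this is the number of blocks of the row, see
    [prof_shape]. *)
Definition rowlen (A : {fset block}) l g : nat :=
  \max_(b <- A | (level b == l) && (half b == g)) (col b).+1.
Definition prof A : profile := fun l => (rowlen A l false, rowlen A l true).

Lemma rlen_prof A l g : rlen (prof A l) g = rowlen A l g. Proof. by case: g. Qed.

Lemma rowlen_gt A k l g : k < rowlen A l g -> exists2 k', (k <= k')%N & (k', l, g) \in A.
Proof.
move=> h; have [/hasP[[[k' l'] g'] bA /andP[/andP[/eqP h1 /eqP h2] h3]]|hn] :=
    boolP (has (fun b => (level b == l) && (half b == g) && (k <= col b)) A).
  by exists k' => //; rewrite /level /half /= in h1 h2; rewrite -h1 -h2.
move: h; rewrite ltnNge => /negP[]; apply/bigmax_leqP_seq => b bA hb.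
by move/hasPn: hn => /(_ b bA); rewrite hb /= -ltnNge.
Qed.

Lemma prof_shape lam A : proper lam whole A -> shape 0 A (prof A).
Proof.
case/andP=> /allP yw _ k l g; rewrite leq0n rlen_prof /=; apply/idP/andP => [h|[]].
  split; last by have /and5P[_ ? _ _ _] := yw _ h.
  exact: (@leq_bigmax_seq _ _ _ (fun b : block => (col b).+1) (k, l, g) h (introT andP (conj (eqxx _) (eqxx _)))).
move=> /rowlen_gt[k' kk' h] ng; move: h; rewrite -(subnKC kk'); elim: (k' - k) => [|n IH].
  by rewrite addn0.
rewrite addnS => h; apply: IH; have /and5P[_ _ _ _] := yw _ h.
by rewrite /= /occupied; move: ng; rewrite !groundE => /negPf ->.
Qed.

(** The row of ground state blocks has no added blocks, which is the
    convention that makes the profile unique. *)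
Lemma prof_unique A R : shape 0 A R -> (R 0).1 = 0 -> R = prof A.
Proof.
move=> sA R0; apply: funext => l; rewrite [LHS]surjective_pairing.
suff E g : rlen (R l) g = rowlen A l g by rewrite /prof -!E.
apply/eqP; rewrite eqn_leq; apply/andP; split.
  case E: (rlen (R l) g) => [|r] //; case ng: (ground (r, l, g)).
    by move: ng E; rewrite groundE => /andP[/eqP -> /negPf ->]; rewrite /rlen R0.
  have h : (r, l, g) \in A by rewrite sA E ltnSn ng.
  exact: (@leq_bigmax_seq _ _ _ (fun b : block => (col b).+1) (r, l, g) h (introT andP (conj (eqxx _) (eqxx _)))).
apply/bigmax_leqP_seq => -[[k l'] g'] /[swap] /andP[/eqP e1 /eqP e2].
by rewrite /level /half /= in e1 e2; rewrite e1 e2 sA => /and3P[].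
Qed.

Lemma prof0 lam A : proper lam whole A -> (prof A 0).1 = 0.
Proof.
case/andP=> /allP yw _; rewrite /prof /= /rowlen big_seq_cond big_pred0 // => -[[k l] g].
apply/negP=> /andP[h /andP[/eqP h1 /eqP h2]]; rewrite /level /half /= in h1 h2.
by have /and5P[_ ng _ _ _] := yw _ h; rewrite groundE h1 h2 in ng.
Qed.

Lemma prof_okR lam A : proper lam whole A -> okR lam (prof A).
Proof. by move=> h; apply/(shape_proper lam (prof_shape h) (fun _ _ => leq0n _)). Qed.

Section Bound.
Variables (lam i : I).
Local Notation tinted := (tinted lam i).
Implicit Types R : profile.

Lemma okR_zero R d : okR lam R -> R d = (0, 0) -> forall l, d <= l -> R l = (0, 0).
Proof.
move=> ok e l; rewrite leq_eqVlt => /orP[/eqP <- //|dl].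
have := hi_lo (ok_nested ok) dl; rewrite /lo e /= if_same /hi.
by case: (R l) => x1 x2 /=; case: x1 x2 => [|?] [|?] //=; lia.
Qed.

Lemma bound_ex A : exists l, ~~ tinted l && (prof A l == (0, 0)).
Proof.
pose m := (\max_(b <- A) level b).+1.
have z l : m <= l -> prof A l = (0, 0).
  move=> ml; suff e g : rowlen A l g = 0 by rewrite /prof !e.
  rewrite /rowlen big_seq_cond big_pred0 // => b; apply/negP=> /and3P[h /eqP el _].
  have := @leq_bigmax_seq _ _ predT (fun b : block => level b) b h isT; rewrite el.
  by move=> h2; move: (leq_trans ml h2); rewrite ltnn.
case rm: (tinted m); last by exists m; rewrite rm z ?eqxx.
by exists m.+1; rewrite relS rm z ?eqxx.
Qed.

(** The first level not of color i from which on all rows are empty; it is the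
    same for all walls that differ by blocks of color i only. *)
Definition bound A : nat := ex_minn (bound_ex A).

Lemma boundP A : proper lam whole A ->
  ~~ tinted (bound A) /\ forall l, bound A <= l -> prof A l = (0, 0).
Proof.
move=> pr; rewrite /bound; case: ex_minnP => d /andP[rd /eqP e] _; split=> //.
exact: okR_zero (prof_okR pr) e.
Qed.

Lemma bound_agree A B : agree lam i (prof A) (prof B) -> bound A = bound B.
Proof.
move=> e; apply: eq_ex_minn => l; case rl: (tinted l) => //=.
by rewrite e // rl.
Qed.

End Bound.

(** * Changes of letters *)
Section Moved.
Variables (lam i : I).
Local Notation tinted := (tinted lam i).
Implicit Types R : profile.

(** R' is obtained from R by a change of letters at the levels of color i.
    Along such changes the kinds of the levels are constant, so that the
    profiles belong to the same tensor product. *)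
Definition moved R R' : Prop := agree lam i R R' /\
  forall l, tinted l -> R' l = purel lam i R l (wordl lam i R' l) /\
    size (wordl lam i R' l) = size (wordl lam i R l).

Lemma moved_refl R : okR lam R -> moved R R.
Proof.
move=> ok; split=> // l rl; split=> //; rewrite /purel /wordl pure_word //.
exact: okR_valid.
Qed.

Lemma moved_size R R' l : moved R R' -> tinted l -> size (letsl lam i R' l) = size (letsl lam i R l).
Proof. by move=> [_ h] /h[_]; rewrite !size_wordl. Qed.

Lemma moved_pure R R' l u : okR lam R -> moved R R' -> tinted l -> size u = size (letsl lam i R l) ->
  purel lam i R' l u = purel lam i R l u.
Proof.
move=> ok mv rl su; have [e /(_ l rl)[e1 e2]] := mv.
rewrite /purel (agree_lower e rl) (agree_upper e rl) e1 pureK //; first exact: okR_valid.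
  by rewrite e2 size_wordl.
by rewrite su e2 size_wordl.
Qed.

Lemma moved_upd R R' l u : okR lam R -> okR lam R' -> moved R R' -> tinted l ->
  size u = size (letsl lam i R l) -> moved R (upd R' l (purel lam i R' l u)).
Proof.
move=> ok ok' mv rl su; have [e h] := mv; split.
  by move=> m nm; rewrite upd_other ?e //; apply: contraNneq nm => ->.
move=> m rm; case: (eqVneq m l) => [->|ml]; last by rewrite upd_other // wordl_upd_other //; exact: h.
rewrite wordl_upd ?(moved_size mv) // upd_same size_wordl su; split=> //.
exact: moved_pure.
Qed.

(** Within one tensor product the word determines the profile. *)
Lemma gword_inj R R' ls : okR lam R -> moved R R' -> all tinted ls ->
  gword lam i R' ls = gword lam i R ls -> forall l, l \in ls -> R' l = R l.
Proof.
move=> ok [e h] rls eg l hl; have rl := allP rls l hl; have [e1 _] := h l rl.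
have/eq_in_map/(_ l hl) ew : [seq wordl lam i R' l | l <- ls] = [seq wordl lam i R l | l <- ls].
  apply: eq_from_flatten_shape => //; rewrite /seq.shape -!map_comp; apply/eq_in_map => m hm /=.
  by have [_] := h m (allP rls m hm).
rewrite e1 ew /purel /wordl pure_word //; exact: okR_valid.
Qed.

End Moved.

Local Open Scope ring_scope.

(** * The tensor product inside the Fock space *)

Lemma strv_ext (F : fieldType) (p : F) (M : lmodType F) N (Th Th' : seq bool -> M) n r w :
  (forall w, size w = N -> Th w = Th' w) -> size r = n -> (n + size w)%N = N ->
  strv p Th n r w = strv p Th' n r w.
Proof.
move=> e; elim: n r w => [|n IH] [|b r] w //=; first by move=> _; exact: e.
move=> [sr] sw; have sw' b' : (n + size (b' :: w))%N = N by rewrite /=; lia.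
case: b.
  rewrite IH //; case E: (wet r) => [r1|] //=; rewrite IH //.
  by have [_ ->] := wet_some E.
case: ifP => _; first by rewrite IH.
rewrite IH //; case E: (wft r) => [r1|] //=; rewrite (IH r1) //.
by have [_ _ _ ->] := wft_some E.
Qed.

Section Strings.
Variables (lam : I) (rho : Uq_rep (fock lam)) (Hrho : is_fock_rep rho) (i : I).
Local Notation tinted := (tinted lam i).
Local Notation tI := (tI i).
Local Notation cI := (cI lam i).
Local Notation levels := (levels lam i).
Local Notation agree := (agree lam i).
Local Notation p := (qi i).
Implicit Types (R : profile).

Definition nlets R l : nat := size (letsl lam i R l).
Definition tensorl R l (u : seq bool) : seq (Kq * (nat * nat)) :=
  tensor_vector tI cI (l == 0)%N p (lower R l) (upper R l) (R l) u.
(** The vector of the Fock space for the tensor with the word w, in the tensor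
    product that contains the profile R. *)
Definition theta D R (w : seq bool) : fock lam :=
  tensor (nlets R) (tensorl R) (levels D) w (wvec lam D) R.

Let p0 : p != 0 := base_neq0 (qi_base i).
Let p2 : 1 + p ^+ 2 != 0 := base_1D (qi_base i) (ltn0Sn 1).

Lemma gword_size R D : size (gword lam i R (levels D)) = letters_of (nlets R) (levels D).
Proof.
rewrite /gword size_flatten /seq.shape -map_comp sumnE big_map /letters_of.
by apply: eq_bigr => l _ /=; rewrite size_wordl.
Qed.

Section Fixed.
Variables (R : profile) (D : nat).
Hypotheses (ok : okR lam R) (rD : ~~ tinted D) (hD : forall l, (D <= l)%N -> R l = (0, 0)%N).

(** The configurations that occur in the local vectors are valid, hence so are
    the walls composed of them. *)
Lemma leaf_ok R' : leaf (nlets R) (tensorl R) (levels D) R R' ->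
  [/\ agree R R', okR lam R' & forall l, (D <= l)%N -> R' l = (0, 0)%N].
Proof.
case=> h1 h2; have e : agree R R'.
  by move=> l nl; apply: h1; rewrite mem_levels (negPf nl).
split=> // [|l Dl]; last by rewrite h1 ?hD // mem_levels ltnNge Dl andbF.
apply: (valid_okR ok e) => l rl; case hl: (l \in levels D); last by rewrite h1 ?hl //; exact: okR_valid.
have [u su [x hx ->]] := h2 _ hl.
by have /andP[] := tensor_vector_valid (okR_valid ok rl) su hx.
Qed.

Lemma wvecE R' : okR lam R' -> (forall l, (D <= l)%N -> R' l = (0, 0)%N) ->
  exists2 Y : walls lam, val Y = wall D R' & wvec lam D R' = vec Y.
Proof.
move=> ok' hD'; have pr : proper lam whole (wall D R').
  exact/(shape_proper lam (wall_shape hD') (fun _ _ => leq0n _)).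
exists (Sub (wall D R') pr); first exact: SubK.
by rewrite /wvec /vec_of (insubT _ pr).
Qed.

Lemma f_wvec R' : okR lam R' -> (forall l, (D <= l)%N -> R' l = (0, 0)%N) ->
  rep_f rho i (wvec lam D R') = action lam i R' D.
Proof.
move=> ok' hD'; have [Y eY ->] := wvecE ok' hD'; have [_ _ ->] := Hrho Y.
rewrite /fock_f eY; case: eqP => ei.
  by rewrite (action_1 (wall_shape hD') ok' rD hD' ei).
by apply: (action_02 (wall_shape hD') ok' rD hD'); apply/eqP.
Qed.

Definition wtl l x : int := config_weight tI cI (l == 0)%N (lower R l) (upper R l) x.
Definition fl l x := f_terms tI cI (l == 0)%N p (lower R l) (upper R l) x.

Lemma action_act R' : agree R R' -> action lam i R' D = act p wtl fl (levels D) (wvec lam D) R'.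
Proof.
move=> e; have so : sorted ltn (levels D).
  by apply: sorted_filter; [exact: ltn_trans | exact: iota_ltn_sorted].
rewrite (act_sum p0 wtl fl (wvec lam D) R' so).
apply: eq_big_seq => l; rewrite mem_levels => /andP[rl _].
rewrite /f_termsl (agree_lower e rl) (agree_upper e rl); apply: eq_bigr => y _.
suff -> : pre lam i R' D l = \sum_(m <- levels D | (m < l)%N) wtl m (R' m) by reflexivity.
rewrite /pre big_seq_cond [RHS]big_seq_cond; apply: eq_bigr => m.
rewrite mem_levels => /andP[/andP[rm _] _]; rewrite /level_weight /wtl (agree_lower e rm) (agree_upper e rm) //.
Qed.

Lemma f_theta w : size w = size (gword lam i R (levels D)) ->
  rep_f rho i (theta D R w) = \sum_(v <- fw p w) v.1 *: theta D R v.2.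
Proof.
rewrite gword_size => sw; rewrite /theta tensor_linear.
rewrite (@tensor_ext _ _ _ _ _ _ _ (act p wtl fl (levels D) (wvec lam D))) ?uniq_levels //; last first.
  by move=> R' /leaf_ok[e ok' hD']; rewrite f_wvec // action_act.
apply: (tensor_act p0 (P := tinted)) => //.
- move=> l u x rl su hx; apply/eqP.
  by have /andP[] := tensor_vector_valid (okR_valid ok rl) su hx.
- move=> H l u rl su; exact: (equiv_all p0 p2 H (okR_valid ok rl) su).
- exact: uniq_levels.
- exact: all_levels.
Qed.

Lemma theta_lattice w : lattice Rq (walls lam) (theta D R w).
Proof.
apply: (tensor_lattice (@lattice_sub _ Rq _)) => [R'|l u x hx].
  rewrite /wvec /vec_of; case: insub => [Y|] /=; first exact: lattice_U.
  exact: (lat0 (@lattice_sub _ Rq _)).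
exact: (pure_vector_A (qi_base i) hx).
Qed.

Lemma theta_cong : qlat Rq (lattice Rq (walls lam))
  (theta D R (gword lam i R (levels D)) - wvec lam D R).
Proof.
apply: (tensor_cong (@lattice_sub _ Rq _)) => [R'|l u x hx|l hl].
- rewrite /wvec /vec_of; case: insub => [Y|] /=; first exact: lattice_U.
  exact: (lat0 (@lattice_sub _ Rq _)).
- exact: (pure_vector_A (qi_base i) hx).
split; first exact: size_wordl.
have rl : tinted l by move: hl; rewrite mem_levels => /andP[].
have vx := okR_valid ok rl; have [c0 [r [h1 h2 h3]]] := pure_vector_head cI (qi_base i) vx.
by exists c0, r; split=> //; rewrite /tensorl /tensor_vector pure_word.
Qed.

(** The tensors depend on the class of R only. *)
Lemma theta_moved R' w : moved lam i R R' -> size w = size (gword lam i R (levels D)) ->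
  (forall l, (D <= l)%N -> R' l = (0, 0)%N) -> theta D R' w = theta D R w.
Proof.
rewrite gword_size => mv sw hD'; rewrite /theta (tensor_eq (n := nlets R) (C := tensorl R)) //.
  apply: tensor_base => l nl; case: (ltnP l D) => lD; last by rewrite hD // hD'.
  by case: mv => e _; apply: e; move: nl; rewrite mem_levels lD andbT.
move=> l; rewrite mem_levels => /andP[rl _]; split=> [|u su].
  exact: moved_size.
have [e _] := mv; rewrite /tensorl /tensor_vector -!/(purel _ _ _ _ _) (agree_lower e rl) (agree_upper e rl).
rewrite -(moved_pure ok mv rl su) /purel (agree_lower e rl) (agree_upper e rl) //.
Qed.

End Fixed.
End Strings.

(** * Crystal operators and string vectors of walls *)

Lemma mem_split (T : eqType) (x : T) s : x \in s -> exists s1 s2, s = s1 ++ x :: s2.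
Proof. by case/splitPr=> s1 s2; exists s1, s2. Qed.

Section Operators.
Variables (lam i : I).
Local Notation tinted := (tinted lam i).
Local Notation levels := (levels lam i).
Implicit Types (R : profile) (Y : walls lam).

Definition wprof Y : profile := prof (val Y).
Definition wbound Y : nat := bound lam i (val Y).
Definition wword Y : seq bool := rword lam i (wprof Y) (wbound Y).

Lemma walls_proper Y : proper lam whole (val Y). Proof. exact: valP Y. Qed.
Lemma wprof_shape Y : shape 0 (val Y) (wprof Y). Proof. exact: prof_shape (walls_proper Y). Qed.
Lemma wprof_okR Y : okR lam (wprof Y). Proof. exact: prof_okR (walls_proper Y). Qed.
Lemma wbound_rel Y : ~~ tinted (wbound Y). Proof. by have [] := boundP i (walls_proper Y). Qed.
Lemma wbound_hD Y l : (wbound Y <= l)%N -> wprof Y l = (0, 0)%N.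
Proof. by have [_] := boundP i (walls_proper Y); apply. Qed.

Lemma wall_wprof Y : val Y = wall (wbound Y) (wprof Y).
Proof. by apply: shape_wall (wprof_shape Y) _ => l; exact: wbound_hD. Qed.

Lemma eps_wword Y : eps lam i whole (val Y) = weps (wword Y).
Proof. exact: eps_word (wprof_shape Y) (wprof_okR Y) (wbound_rel Y) (@wbound_hD Y). Qed.
Lemma phi_wword Y : phi lam i whole (val Y) = wphi (wword Y).
Proof. exact: phi_word (wprof_shape Y) (wprof_okR Y) (wbound_rel Y) (@wbound_hD Y). Qed.

(** The two walls differ by letters at one level, as they do after one crystal
    operator. *)
Definition near Y Y' : Prop := exists l u,
  [/\ tinted l, size u = size (letsl lam i (wprof Y) l)
    & wprof Y' = upd (wprof Y) l (purel lam i (wprof Y) l u)].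

Lemma near_moved Y Y' : near Y Y' -> moved lam i (wprof Y) (wprof Y').
Proof.
case=> l [u [rl su ->]]; apply: moved_upd => //; try exact: wprof_okR.
exact: moved_refl (wprof_okR Y).
Qed.

Lemma near_bound Y Y' : near Y Y' -> wbound Y' = wbound Y.
Proof.
by move=> /near_moved[e _]; apply/esym/bound_agree.
Qed.

(** Two moves that restore the word restore the wall. *)
Lemma near_back Y Y' Y'' : near Y Y' -> near Y' Y'' -> wword Y'' = wword Y -> Y'' = Y.
Proof.
move=> n1 n2; have mv := near_moved n1; have eb := near_bound n1.
have eb2 := near_bound n2.
have mv2 : moved lam i (wprof Y) (wprof Y'').
  case: n2 => l [u [rl su ->]]; apply: moved_upd => //; try exact: wprof_okR.
  by rewrite su; exact: moved_size.
rewrite /wword /rword eb2 eb => /(can_inj revK) ew.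
apply: val_inj; rewrite !wall_wprof eb2 eb; congr wall; apply: funext => l.
case: (ltnP l (wbound Y)) => lD; last by rewrite !wbound_hD // eb2 eb.
case rl: (tinted l); last by case: mv2 => e _; rewrite e // rl.
apply: (gword_inj (wprof_okR Y) mv2 (all_levels lam i _) ew).
by rewrite mem_levels rl.
Qed.

Lemma adml_pure R l g k : okR lam R -> tinted l -> adml lam i R l g k ->
  exists2 u, size u = size (letsl lam i R l) & inc (R l) g = purel lam i R l u.
Proof.
move=> ok rl; have vx := okR_valid ok rl; rewrite /adml adm_lets // => /andP[h _].
have [U1 [U2 E]] := mem_split h; exists (map fst U1 ++ false :: map fst U2).
  by rewrite /letsl E !size_cat /= !size_map.
exact: inc_pure vx E.
Qed.

Lemma reml_pure R l g k : okR lam R -> tinted l -> reml lam i R l g k ->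
  exists2 u, size u = size (letsl lam i R l) & dec (R l) g = purel lam i R l u.
Proof.
move=> ok rl; have vx := okR_valid ok rl; rewrite /reml rem_lets // => /andP[h _].
have [U1 [U2 E]] := mem_split h; exists (map fst U1 ++ true :: map fst U2).
  by rewrite /letsl E !size_cat /= !size_map.
exact: dec_pure vx E.
Qed.

Lemma Ftilde_none Y : Ftilde i Y = None -> phi lam i whole (val Y) = 0%N.
Proof.
rewrite /Ftilde; case E: (ohead _) => [k|] /=; last by move=> _; exact: add_none E.
have [l [g [hl ha -> _]]] := add_spec (wprof_shape Y) (wprof_okR Y) (wbound_rel Y) (@wbound_hD Y) E.
have rl : tinted l by move: hl; rewrite mem_levels => /andP[].
have := mem_admissible i (wprof_shape Y) (fun _ _ => leq0n _) (wprof_okR Y) k l g k.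
rewrite eqxx rl ha /= mem_filter => /andP[/and3P[_ _ pr] _].
by rewrite insubT.
Qed.

Lemma Etilde_none Y : Etilde i Y = None -> eps lam i whole (val Y) = 0%N.
Proof.
rewrite /Etilde; case E: (ohead _) => [k|] /=; last by move=> _; exact: rem_none E.
have [l [g [hl ha -> _]]] := rem_spec (wprof_shape Y) (wprof_okR Y) (wbound_rel Y) (@wbound_hD Y) E.
have rl : tinted l by move: hl; rewrite mem_levels => /andP[].
have := mem_removable i (wprof_shape Y) (fun _ _ => leq0n _) (wprof_okR Y) k l g k.
rewrite eqxx rl ha /= mem_filter => /andP[/and3P[_ _ pr] _].
by rewrite insubT.
Qed.

Lemma Ftilde_some Y Y' : Ftilde i Y = Some Y' ->
  [/\ near Y Y', wft (wword Y) = Some (wword Y')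
    & exists b, [/\ color lam b = i, b \notin val Y & val Y' = (b |` val Y)%fset]].
Proof.
rewrite /Ftilde; case E: (ohead _) => [k|] //=.
have [l [g [hl ha -> ew]]] := add_spec (wprof_shape Y) (wprof_okR Y) (wbound_rel Y) (@wbound_hD Y) E.
have rl : tinted l by move: hl; rewrite mem_levels => /andP[].
have := mem_admissible i (wprof_shape Y) (fun _ _ => leq0n _) (wprof_okR Y) k l g k.
rewrite eqxx rl ha /= mem_filter => /andP[/and3P[no /eqP co pr] _].
rewrite insubT => -[eY].
have vY : val Y' = ((k, l, g) |` val Y)%fset by rewrite -eY SubK.
have [sU _ okU] := add_shape (wprof_shape Y) (fun _ _ => leq0n _) (wprof_okR Y) rl ha.
have [u su eu] := adml_pure (wprof_okR Y) rl ha.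
have eP : wprof Y' = upd (wprof Y) l (inc (wprof Y l) g).
  rewrite /wprof vY; apply/esym/prof_unique => //.
  case/and4P: ha => z _ _ _; rewrite /upd; case: eqP => [e0|_]; last exact: prof0 (walls_proper Y).
  move: z; rewrite -e0 eqxx /= negbK => gt; rewrite gt /inc /put /=.
  exact: prof0 (walls_proper Y).
have n : near Y Y' by exists l, u; rewrite eP eu.
split=> //; last first.
  exists (k, l, g); split=> //; by move: no; rewrite /occupied negb_or => /andP[].
by rewrite /wword (near_bound n) eP -ew.
Qed.

Lemma Etilde_some Y Y' : Etilde i Y = Some Y' -> near Y Y' /\ wet (wword Y) = Some (wword Y').
Proof.
rewrite /Etilde; case E: (ohead _) => [k|] //=.
have [l [g [hl ha -> ew]]] := rem_spec (wprof_shape Y) (wprof_okR Y) (wbound_rel Y) (@wbound_hD Y) E.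
have rl : tinted l by move: hl; rewrite mem_levels => /andP[].
have := mem_removable i (wprof_shape Y) (fun _ _ => leq0n _) (wprof_okR Y) k l g k.
rewrite eqxx rl ha /= mem_filter => /andP[/and3P[_ _ pr] _].
rewrite insubT => -[eY].
have vY : val Y' = (val Y `\ (k, l, g))%fset by rewrite -eY SubK.
have [sU _ okU] := rem_shape (wprof_shape Y) (fun _ _ => leq0n _) (wprof_okR Y) rl ha.
have [u su eu] := reml_pure (wprof_okR Y) rl ha.
have eP : wprof Y' = upd (wprof Y) l (dec (wprof Y l) g).
  rewrite /wprof vY; apply/esym/prof_unique => //.
  case/and4P: ha => z _ _ _; rewrite /upd; case: eqP => [e0|_]; last exact: prof0 (walls_proper Y).
  move: z; rewrite -e0 eqxx /= negbK => gt; rewrite gt /dec /put /=.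
  exact: prof0 (walls_proper Y).
have n : near Y Y' by exists l, u; rewrite eP eu.
by split=> //; rewrite /wword (near_bound n) eP -ew.
Qed.

(** Both operators act on the words by mutually inverse rules, and the word
    determines the wall within one tensor product. *)
Lemma Ftilde_Etilde Y Y' : Ftilde i Y = Some Y' <-> Etilde i Y' = Some Y.
Proof.
split=> h.
  have [n1 e1 _] := Ftilde_some h; have [_ _ e2 _] := wft_some e1.
  case E: (Etilde i Y') => [Y''|]; last first.
    by move: (Etilde_none E); rewrite eps_wword => /eqP; rewrite -wet_none e2.
  have [n2] := Etilde_some E; rewrite e2 => -[e3].
  by rewrite (near_back n1 n2 (esym e3)).
have [n1 e1] := Etilde_some h; have [e2 _] := wet_some e1.
case E: (Ftilde i Y) => [Y''|]; last first.
  by move: (Ftilde_none E); rewrite phi_wword => /eqP; rewrite -wft_none e2.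
have [n2] := Ftilde_some E; rewrite e2 => -[e3] _.
by rewrite (near_back n1 n2 (esym e3)).
Qed.

End Operators.

Section StringVectors.
Variables (lam : I) (rho : Uq_rep (fock lam)) (Hrho : is_fock_rep rho) (i : I).
Implicit Types Y : walls lam.
Local Notation p := (qi i).
Local Notation wword := (wword i).

(** The string vector of a wall: the whole word is the prefix, and no pure
    tensor is left. *)
Definition raw_string Y : fock lam :=
  strv p (theta lam i (wbound i Y) (wprof Y)) (size (wword Y)) (wword Y) [::].

(** String vectors along one string are built in the same tensor product. *)
Lemma near_strings Y Y' : near i Y Y' -> size (wword Y') = size (wword Y) ->
  strv p (theta lam i (wbound i Y) (wprof Y)) (size (wword Y)) (wword Y') [::] = raw_string Y'.
Proof.
move=> n sw; rewrite /raw_string (near_bound n) sw.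
apply: (@strv_ext _ _ _ (size (wword Y))) => [w hw| |]; rewrite ?addn0 //.
apply/esym/theta_moved.
- exact: wprof_okR.
- exact: wbound_hD.
- exact: near_moved.
- by rewrite hw size_rev.
- by move=> l h; apply: (@wbound_hD lam i); rewrite (near_bound n).
Qed.

Lemma raw_string_f Y : rep_f rho i (raw_string Y) =
  br p (eps lam i whole (val Y)).+1 *: oapp raw_string 0 (Ftilde i Y).
Proof.
rewrite /raw_string (f_strv (N := size (wword Y)) (base_neq0 (qi_base i)) (fun n => base_1B (qi_base i) (n := n))) //.
- rewrite [X in _ + _ *: X](_ : _ = 0); last by rewrite /= big_nil.
  rewrite scaler0 addr0 -eps_wword; congr (_ *: _).
  case E: (Ftilde i Y) => [Y'|] /=.
    have [n -> _] := Ftilde_some E; rewrite /=; apply: near_strings => //.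
    by have [_ e _] := Ftilde_some E; have [_ _ _ ->] := wft_some e.
  by move: (Ftilde_none E); rewrite phi_wword => /eqP; rewrite -wft_none => /eqP ->.
- move=> w hw; apply: f_theta => //.
  + exact: wprof_okR.
  + exact: wbound_rel.
  + exact: wbound_hD.
  + by rewrite hw size_rev.
- by rewrite addn0.
Qed.

Lemma raw_string_cong Y : qlat Rq (lattice Rq (walls lam)) (raw_string Y - << Y >>).
Proof.
apply: (qlat_trans (@lattice_sub _ Rq _)).
  apply: (strv_cong (@lattice_sub _ Rq _) (qi_base i) (N := size (wword Y))) => //; last by rewrite addn0.
  by move=> w hw; exact: theta_lattice.
rewrite catrevE cats0 /wword /rword revK.
have -> : << Y >> = wvec lam (wbound i Y) (wprof Y).
  by rewrite /wvec /vec_of -wall_wprof valK.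
apply: theta_cong; exact: wprof_okR.
Qed.

End StringVectors.

(** * Weights of walls *)
Section Cells.
Local Open Scope nat_scope.
Definition cells (t c : bool) (r : nat) (g : bool) : nat :=
  if t then r else if c (+) g then r./2 else uphalf r.

Lemma count_colored t c g r : count (colored t c g) (iota 0 r) = cells t c r g.
Proof.
elim: r => [|r IH]; first by rewrite /cells /=; do !case: ifP.
rewrite -addn1 iotaD count_cat IH /= add0n addn0 /cells /colored.
by clear IH; case: t; case: c; case: g => /=; lia.
Qed.

Lemma cells_II c r g : cells false c r g + cells false (~~ c) r g = r.
Proof. by rewrite /cells; case: c; case: g => /=; lia. Qed.
End Cells.

(** A new cell turns a plus letter into a minus letter, so the weight is an
    affine function of the number of cells with slope -2. The constant term
    comes from the neighbouring rows, and at level 0 also from the row of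
    ground state blocks. *)
Lemma config_weight_cells t c z a b x : valid t z a b x -> (z -> b = 0%N) -> (z -> x.1 = 0%N) ->
  config_weight t c z a b x = (1 + t%:R) * (a%:Z + b%:Z)
    - 2 * ((cells t c x.1 false)%:Z + (cells t c x.2 true)%:Z) + (z && (t || c))%:R.
Proof.
case: x => x1 x2; rewrite /config_weight /word /lets /kindof /valid /cells /=.
case: z => /= v hb hx.
  rewrite hb // hx //.
  case: t v => /= v; first by rewrite wwt1 /sgn; case: ifP; lia.
  case: (boolP (odd a (+) c)) => h; rewrite /= ?wwt0 ?wwt1 /sgn; try case: ifP; case: (c) h => /=; lia.
case: t v => /= v.
  by case: ifP => /= h; rewrite ?wwt0 ?wwt2 /sgn; do ?case: ifP; lia.
case: c => /=; case e: (odd a) => /=; case: ifP => h1 /=; do ?[case: ifP => h2 /=]; rewrite ?wwt0 ?wwt1 ?wwt2 /sgn; do ?case: ifP; lia.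
Qed.

Section Weights.
Variable lam : I.
Implicit Types (A B : {fset block}) (R : profile).

Definition cnt A (i : I) : nat := count (fun b => color lam b == i) A.

Lemma cnt_rows A R D i : shape 0 A R -> (R 0%N).1 = 0%N -> (forall l, (D <= l)%N -> R l = (0, 0)%N) ->
  cnt A i = (\sum_(l <- levels lam i D)
    (cells (tI i) (cI lam i) (R l).1 false + cells (tI i) (cI lam i) (R l).2 true))%N.
Proof.
move=> sA R0 hD.
pose row l g := [seq k <- iota 0 (rlen (R l) g) | colored (tI i) (cI lam i) g k].
pose L := [seq ((y.2, l, y.1) : block) | l <- levels lam i D,
    y <- [seq (false, k) | k <- row l false] ++ [seq (true, k) | k <- row l true]].
have -> : cnt A i = size L.
  rewrite /cnt -size_filter; apply/perm_size/uniq_perm.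
  - by rewrite filter_uniq ?fset_uniq.
  - apply: allpairs_uniq_dep.
    + by rewrite filter_uniq ?iota_uniq.
    + move=> l _; rewrite cat_uniq !map_inj_uniq ?filter_uniq ?iota_uniq //= ?andbT.
      * by apply/hasPn => y /mapP[k _ ->]; apply/mapP => -[].
      * by move=> ? ? [].
      * by move=> ? ? [].
    + by move=> [l [g k]] [l' [g' k']] _ _ /= [-> -> ->].
  move=> [[k l] g]; rewrite mem_filter sA /= color_rel.
  have hL : ((k, l, g) \in L) = (l \in levels lam i D) && (k \in row l g).
    apply/allpairsPdep/andP => [[l' [[g' k'] [/= hl hk [-> -> ->]]]]|[hl hk]].
      split=> //; move: hk; rewrite mem_cat => /orP[] /mapP[k0 h0 [-> ->]] //.
    exists l, (g, k); split=> //; rewrite mem_cat; case: (g) hk => hk.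
      by rewrite (map_f (fun k => (true, k)) hk) orbT.
    by rewrite (map_f (fun k => (false, k)) hk).
  rewrite hL !mem_filter !mem_iota !add0n /=.
  case rl: (tinted _ _ _) => //=; case co: (colored _ _ _ _) => //=; last by rewrite andbF.
  case: (ltnP l D) => lD /=; last by rewrite hD //; case: (g).
  case kr: (k < _)%N => //=; apply/negP; rewrite groundE => /andP[/eqP l0 /negPf gF].
  by move: kr; rewrite l0 gF /= R0.
rewrite /L size_allpairs_dep sumnE big_map; apply: eq_bigr => l _.
by rewrite size_cat !size_map /row !size_filter !count_colored.
Qed.

Lemma sum_I (V : nmodType) (G : I -> V) : \sum_i G i = G i0 + G i1 + G i2.
Proof.
rewrite !big_ord_recl big_ord0 addr0 addrA.
by congr (_ + _ + _); congr G; exact: val_inj.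
Qed.

Lemma alpha_mulrn i n : (forall j, (alpha i *+ n).1 j = cartan j i * n%:Z) /\
  (alpha i *+ n).2 = (i == i0)%:R * n%:Z.
Proof.
elim: n => [|n [IH1 IH2]]; first by rewrite mulr0n; split=> [j|] /=; rewrite ?ffunE mulr0.
rewrite mulrS; split=> [j|]; rewrite /= ?ffunE ?IH1 ?IH2 ?ffunE; lia.
Qed.

Lemma weight_coord A j : (wall_wt lam A).1 j = (j == lam)%:R
   - (cartan j i0 * (cnt A i0)%:Z + cartan j i1 * (cnt A i1)%:Z + cartan j i2 * (cnt A i2)%:Z).
Proof.
rewrite /wall_wt sum_I; have h i := (alpha_mulrn i (cnt A i)).1 j.
transitivity ((Lambda lam).1 j - ((alpha i0 *+ cnt A i0).1 j + (alpha i1 *+ cnt A i1).1 j + (alpha i2 *+ cnt A i2).1 j)).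
  by rewrite /= !ffunE.
by rewrite !h /= ffunE.
Qed.

Lemma weight_delta A : (wall_wt lam A).2 = - (cnt A i0)%:Z.
Proof.
rewrite /wall_wt sum_I; have h i := (alpha_mulrn i (cnt A i)).2.
transitivity (0 - ((alpha i0 *+ cnt A i0).2 + (alpha i1 *+ cnt A i1).2 + (alpha i2 *+ cnt A i2).2)) => //.
by rewrite !h eqxx mul1r !mul0r !addr0 sub0r.
Qed.

Lemma I3 (j : I) : [\/ j = i0, j = i1 | j = i2].
Proof.
by case: j => -[|[|[|]]] // h; [apply: Or31 | apply: Or32 | apply: Or33]; exact: val_inj.
Qed.

(** The coordinates of the weights determine the numbers of blocks of each
    color, since the simple roots are linearly independent. *)
Lemma weight_shift A B i n : wall_wt lam A = wall_wt lam B + alpha i *+ n ->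
  forall j, (cnt A j + n * (j == i))%N = cnt B j.
Proof.
move=> e; have e2 := congr1 (fun la : weight => la.2) e.
have e0 := congr1 (fun la : weight => la.1 i0) e; have e1 := congr1 (fun la : weight => la.1 i1) e.
have hD (la : weight) : (la + alpha i *+ n).2 = la.2 + (i == i0)%:R * n%:Z.
  by rewrite -(alpha_mulrn i n).2.
have hC (la : weight) j : (la + alpha i *+ n).1 j = la.1 j + cartan j i * n%:Z.
  by rewrite -(alpha_mulrn i n).1 /= ffunE.
move: e0 e1 e2; rewrite hD !hC !weight_coord !weight_delta => e0 e1 e2 j; move: e0 e1 e2.
move: (i0 == lam) (i1 == lam) => r0 r1.
by case: (I3 i) => ->; case: (I3 j) => ->; rewrite /cartan /=; lia.
Qed.

Lemma cnt_add A b j : b \notin A -> cnt (b |` A)%fset j = (cnt A j + (color lam b == j))%N.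
Proof.
move=> nb; rewrite addnC; apply: (seq.permP (s2 := b :: A) _ (fun b => color lam b == j)).
apply: uniq_perm; rewrite ?fset_uniq //= ?nb ?fset_uniq // => b'.
by rewrite in_fset1U inE.
Qed.

Lemma weight_add A b : b \notin A -> wall_wt lam (b |` A)%fset = wall_wt lam A - alpha (color lam b).
Proof.
move=> nb; rewrite /wall_wt -addrA -opprD; congr (_ - _).
rewrite [in RHS](bigD1 (color lam b)) //= [in LHS](bigD1 (color lam b)) //= addrAC -/(cnt _ _) -/(cnt _ _).
congr (_ + _); first by rewrite -/(cnt _ _) cnt_add // eqxx addn1 mulrSr.
by apply: eq_bigr => j /negPf nj; rewrite -/(cnt _ _) cnt_add // eq_sym nj addn0.
Qed.

(** * The weight and the signature *)

Section Balance.
Variables (i : I) (A : {fset block}) (R : profile) (D : nat).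
Hypotheses (sA : shape 0 A R) (ok : okR lam R) (R0 : (R 0%N).1 = 0%N).
Hypotheses (rD : ~~ tinted lam i D) (hD : forall l, (D <= l)%N -> R l = (0, 0)%N).

Lemma sum_levels_nat (G : nat -> nat) j :
  (\sum_(l <- levels lam j D) G l = \sum_(0 <= l < D | tinted lam j l) G l)%N.
Proof. by rewrite big_filter /index_iota subn0. Qed.

Lemma sum_lower n : (\sum_(0 <= l < n | tinted lam i l) lower R l =
  \sum_(0 <= m < n.+1 | ~~ tinted lam i m) if m == 0 then 0 else hi R m)%N.
Proof.
elim: n => [|n IH]; first by rewrite big_geq // big_mkcond big_nat1 if_same.
by rewrite big_mkcond big_nat_recr // -big_mkcond IH [RHS]big_mkcond big_nat_recr // -big_mkcond relS negbK.
Qed.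

Lemma sum_upper n : (\sum_(0 <= l < n | tinted lam i l) upper R l = \sum_(0 <= m < n.-1 | ~~ tinted lam i m) lo R m)%N.
Proof.
elim: n => [|n IH]; first by rewrite !big_geq.
rewrite big_mkcond big_nat_recr // -big_mkcond IH; case: n {IH} => [|n] /=.
  by rewrite !big_geq // /upper /= if_same.
by rewrite [RHS]big_mkcond big_nat_recr // -big_mkcond relS.
Qed.

(** Every level without blocks of color i is the upper neighbour of one level
    and the lower neighbour of another one, so its two rows are counted once
    each. *)
Lemma sum_neighbours : (\sum_(l <- levels lam i D) (lower R l + upper R l) =
  \sum_(0 <= m < D | ~~ tinted lam i m) ((R m).1 + (R m).2))%N.
Proof.
rewrite sum_levels_nat big_split /= sum_lower sum_upper.
have -> : (\sum_(0 <= m < D.-1 | ~~ tinted lam i m) lo R m = \sum_(0 <= m < D | ~~ tinted lam i m) lo R m)%N.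
  case: D rD => [|d]; first by rewrite !big_geq.
  by rewrite relS negbK => rd; rewrite [RHS]big_mkcond big_nat_recr // -big_mkcond rd /= addn0.
rewrite big_mkcond big_nat_recr //= -big_mkcond /hi hD // if_same if_same addn0 -big_split /=.
apply: eq_bigr => m _; case: eqP => [->|/eqP m0]; first by rewrite /lo eqxx R0.
by rewrite /lo (negPf m0); lia.
Qed.

Lemma sum_level_weight : \sum_(l <- levels lam i D) level_weight lam i R l = (1 + (tI i)%:R) * (\sum_(0 <= m < D | ~~ tinted lam i m) ((R m).1 + (R m).2))%N%:Z
  - 2 * (cnt A i)%:Z + (i == lam)%:R.
Proof.
rewrite -sum_neighbours (cnt_rows i sA R0 hD).
have -> : (i == lam)%:R = \sum_(l <- levels lam i D) ((l == 0)%N && (tI i || cI lam i))%:R :> int.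
  case d0: D rD => [|d].
    rewrite big_nil; rewrite /tinted /tI /typeI /=.
    by case: (I3 i) => ->; case: (I3 lam) => ->.
  rewrite big_filter /index_iota /= big_mkcond big_cons /= big_seq_cond big1 => [|l]; last first.
    by rewrite andbT mem_iota => /andP[l1 _]; rewrite gtn_eqF // if_same.
  move=> _; rewrite addr0 /tinted /tI /cI /typeI /=.
  by case: (I3 i) => ->; case: (I3 lam) => ->.
rewrite -!natz !natr_sum !mulr_sumr -sumrB -big_split; apply: eq_big_seq => l.
rewrite mem_levels => /andP[rl _]; rewrite /level_weight config_weight_cells.
- by rewrite !natrD !natz.
- exact: okR_valid.
- by move=> z; rewrite /upper z.
- by move/eqP=> ->.
Qed.

(** The Cartan matrix: the weight of the word is the number of blocks of the
    neighbouring colors, with multiplicity 2 for i = 1, minus twice the number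
    of blocks of color i, plus the contribution of the ground state. *)
Lemma weight_phi_eps : (wall_wt lam A).1 i = (phi lam i whole A)%:Z - (eps lam i whole A)%:Z.
Proof.
have -> : (phi lam i whole A)%:Z - (eps lam i whole A)%:Z = \sum_(l <- levels lam i D) level_weight lam i R l.
  have := phi_epsE sA ok rD hD 0; rewrite /phi_eps clipR0 => h.
  rewrite /level_weight /config_weight /word -h /phi /eps /signature; do 3 f_equal.
rewrite sum_level_weight weight_coord.
have cE j : cnt A j = (\sum_(0 <= l < D | tinted lam j l)
    (cells (tI j) (cI lam j) (R l).1 false + cells (tI j) (cI lam j) (R l).2 true))%N.
  by rewrite (cnt_rows j sA R0 hD) sum_levels_nat.
have two : (cnt A i0 + cnt A i2 = \sum_(0 <= m < D | ~~ tinted lam i1 m) ((R m).1 + (R m).2))%N.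
  rewrite !cE (eq_bigl (fun m => ~~ tinted lam i1 m)); last by move=> m; rewrite /tinted /=; case: typeI.
  rewrite [X in (_ + X)%N](eq_bigl (fun m => ~~ tinted lam i1 m)); last by move=> m; rewrite /tinted /=; case: typeI.
  rewrite -big_split /=; apply: eq_bigr => m _.
  have -> : cI lam i2 = ~~ cI lam i0 by rewrite /cI /=; case: (lam == i2).
  by rewrite /tI /= addnACA !cells_II.
have one j : j != i1 -> cnt A i1 = (\sum_(0 <= m < D | ~~ tinted lam j m) ((R m).1 + (R m).2))%N.
  by move=> nj; rewrite cE; apply: eq_big => m; rewrite /tinted /tI ?(negPf nj) /=; case: typeI.
have [ei|ei] := eqVneq i i1.
  have -> : (\sum_(0 <= m < D | ~~ tinted lam i m) ((R m).1 + (R m).2) = cnt A i0 + cnt A i2)%N by rewrite two ei.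
  by rewrite ei /cartan /tI eqxx /=; move: (i1 == lam); lia.
rewrite -(one i ei) /tI (negPf ei); move: (i == lam) ei => e.
clear; by case: (I3 i) => -> //= _; rewrite /cartan /=; lia.
Qed.

End Balance.

(** * Finiteness of the weight spaces *)

Lemma cnt_size A : (cnt A i0 + cnt A i1 + cnt A i2 = size A)%N.
Proof.
rewrite /cnt; elim: (enum_fset A) => //= b s IH; rewrite -IH.
by case: (I3 (color lam b)) => -> /=; lia.
Qed.

(** A block far to the left or far up forces many others. *)
Lemma wall_box A : proper lam whole A -> forall k l g, (k, l, g) \in A -> (k < size A)%N /\ (l <= size A)%N.
Proof.
move=> pr k l g; have sA := prof_shape pr; have ok := prof_okR pr; rewrite sA => /and3P[_ kr ng]; split.
  rewrite -[k.+1](size_iota 0) -(size_map (fun j => ((j, l, g) : block))); apply: uniq_leq_size.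
    by rewrite map_inj_uniq ?iota_uniq // => ? ? [].
  move=> b /mapP[j]; rewrite mem_iota add0n ltnS => /andP[_ jk] ->.
  by rewrite sA ng andbT; apply: leq_ltn_trans jk kr.
rewrite -{1}[l](size_iota 0) -(size_map (fun j => ((k, j, true) : block))); apply: uniq_leq_size.
  by rewrite map_inj_uniq ?iota_uniq // => ? ? [].
move=> b /mapP[j]; rewrite mem_iota add0n => /andP[_ jl] ->.
rewrite sA groundE andbF andbT /=; apply: leq_trans (lo_rlen (prof A) (orbT (j != 0%N))).
apply: leq_trans (hi_lo (ok_nested ok) jl); exact: leq_trans kr (rlen_hi _ _ _).
Qed.

Lemma finite_weight (la : weight) : exists s : seq (walls lam),
  forall Y, wall_wt lam (val Y) = la -> Y \in s.
Proof.
have [[X eX]|no] := pselect (exists Y : walls lam, wall_wt lam (val Y) = la); last first.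
  by exists [::] => Y e; case: no; exists Y.
pose N := size (val X).
pose box := [fset b in [seq (x, g) | x <- [seq (k, l) | k <- iota 0 N, l <- iota 0 N.+1], g <- [:: false; true]]]%fset.
exists (pmap insub (fpowerset box)) => Y e; rewrite mem_pmap_sub fpowersetE.
have eN : size (val Y) = N.
  rewrite /N -!cnt_size; have h := @weight_shift (val Y) (val X) i0 0.
  by rewrite mulr0n addr0 e eX in h; rewrite -!(h erefl) !addn0.
apply/fsubsetP => -[[k l] g] hb; have [h1 h2] := wall_box (valP Y) hb.
rewrite inE; apply/allpairsP; exists ((k, l), g); split=> //; last by case: (g).
by apply/allpairsP; exists (k, l); rewrite !mem_iota add0n -eN.
Qed.

End Weights.

(** * The crystal basis of the Fock space *)

Section Final.
Variables (lam : I) (rho : Uq_rep (fock lam)) (Hrho : is_fock_rep rho).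
Local Notation wt := (fun Y : walls lam => wall_wt lam (val Y)).

(** Taking the component in the weight space of the wall makes the vector
    homogeneous; this does not affect the action of f. *)
Definition string_vector i (Y : walls lam) : fock lam := weight_part wt (wt Y) (raw_string i Y).

Lemma walls_string_basis : string_basis wt rho
  (fun i Y => eps lam i whole (val Y)) (fun i Y => phi lam i whole (val Y))
  (@Etilde lam) (@Ftilde lam) string_vector.
Proof.
have ftw i Y Y' : Ftilde i Y = Some Y' -> wt Y' = wt Y - alpha i.
  by move=> /Ftilde_some[_ _ [b [cb nb vY]]]; rewrite vY weight_add // cb.
have Hq h (Y : walls lam) : rep_q rho h << Y >> = q ^ pairing h (wt Y) *: << Y >>.
  by have [] := Hrho Y.
split.
- exact: Hq.
- exact: finite_weight.
- move=> i X; exists (cnt lam (val X) i).+1 => Y /weight_shift/(_ i); rewrite eqxx; lia.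
- move=> i Y; exact: (weight_phi_eps (wprof_shape Y) (wprof_okR Y) (prof0 (walls_proper Y)) (wbound_rel i Y) (@wbound_hD lam i Y)).
- exact: Ftilde_Etilde.
- move=> i Y Y' E; have [_ e _] := Ftilde_some E; have [e1 e2 _ _] := wft_some e.
  by rewrite !eps_wword !phi_wword e1 e2 (ftw _ _ _ E).
- exact: Ftilde_none.
- exact: Etilde_none.
- move=> i Y; have eY : << Y >> = weight_part wt (wt Y) (<< Y >> : fock lam) by rewrite weight_part_U.
  rewrite /string_vector [X in _ - X]eY -weight_partB.
  exact: weight_part_qlat (raw_string_cong i Y).
- by move=> i Y; exact: weight_part_inW.
move=> i Y; rewrite /string_vector (weight_part_shift (al := - alpha i)); last first.
  by move=> x; exact: (rep_f_weight Hq).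
rewrite (raw_string_f Hrho) weight_partZ; congr (_ *: _).
case E: (Ftilde i Y) => [Y'|]; last exact: weight_part0.
exact: (congr1 (fun la => weight_part wt la (raw_string i Y')) (esym (ftw _ _ _ E))).
Qed.

Lemma fock_lattice_string : fock_lattice lam = lattice Rq (walls lam).
Proof. by apply/seteqP; split=> v h Y; apply/RqP; exact: h. Qed.

End Final.

Theorem theorem5p3 (lam : 'I_3) (rho : Uq_rep (fock lam))
    (Hrho : is_fock_rep rho) (Hint : integrable rho) :
  crystal_basis rho (fock_lattice lam) (fock_basis lam) /\
  affine_crystal (wall_crystal lam) /\
  crystal_isomorphic (crystal_of rho (fock_lattice lam) (fock_basis lam))
    (wall_crystal lam).
Proof.
have H := walls_string_basis Hrho.
have eB : fock_basis lam = @zbasis (walls lam) by rewrite /fock_basis fock_lattice_string.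
rewrite eB fock_lattice_string; split; first exact: string_crystal_basis H.
split; first exact: string_affine_crystal H.
exact: string_crystal_isomorphic H.
Qed.
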